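(* Let $M$ be a compact complex manifold with vanishing Kobayashi pseudometric. Then the Kobayashi pseudometric vanishes for all ergodic complex structures in the same deformation class, i.e. if $I$ is an ergodic complex structure on the underlying smooth manifold in the deformation class of $M$, then $d_{(M,I)}\equiv 0$.
   Context: For a compact complex manifold $M$, let $\mathrm{Comp}$ be the space of complex structures on $M$ (with its Fréchet manifold structure), $\mathrm{Diff}_0(M)$ the connected component of the diffeomorphism group (the group of isotopies), and $\mathrm{Teich}:=\mathrm{Comp}/\mathrm{Diff}_0(M)$ the Teichmüller space with the quotient topology. The mapping class group $\Gamma:=\mathrm{Diff}(M)/\mathrm{Diff}_0(M)$ (orientable diffeomorphisms) acts on $\mathrm{Teich}$. A complex structure $I$ is ergodic if its orbit $\Gamma\cdot I=\{I'\in\mathrm{Teich}: (M,I')\text{ biholomorphic to }(M,I)\}$ is dense in $\mathrm{Teich}$. For hyperkähler $M$, only complex structures of hyperkähler type are considered. Two complex structures are in the same deformation class if they are represented in the same connected component of $\mathrm{Teich}$. Kobayashi pseudometric: let $(\mathbb{D},\rho)$ be the unit disk with the Poincaré metric. $d_M$ is the supremum of all pseudometrics $d$ on $M$ such that $d(f(x),f(y))\le\rho(x,y)$ for all holomorphic $f:\mathbb{D}\to M$ and all $x,y\in\mathbb{D}$ (a pseudometric satisfies all axioms of a metric except possibly nondegeneracy). It vanishes if $d_M(p,q)=0$ for all $p,q$. *)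

(* Defs.v *)
From HB Require Import structures.
From mathcomp Require Import all_boot all_order all_algebra.
From mathcomp Require Import all_classical all_reals all_analysis.
From mathcomp.real_closed Require Import complex.

Set Implicit Arguments.
Unset Strict Implicit.
Unset Printing Implicit Defensive.

Import Order.TTheory GRing.Theory Num.Theory.
Import numFieldNormedType.Exports.

Local Open Scope classical_set_scope.
Local Open Scope ring_scope.

(* Tangent vectors are row vectors: 'J f x is the matrix of v |-> v *m 'J f x,
   so the matrix of a composite is the product in the reverse order. *)

Definition iter_partial (R : realType) (m : nat) (V : normedModType R)
    (s : seq 'I_m) (f : 'rV[R]_m -> V) : 'rV[R]_m -> V :=
  foldr (fun i g x => 'D_(delta_mx 0 i) g x) f s.

(* Class C^oo when U is open: all iterated partial derivatives exist and are
   continuous at the points of U. *)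
Definition smooth_on (R : realType) (m : nat) (V : normedModType R)
    (U : set 'rV[R]_m) (f : 'rV[R]_m -> V) : Prop :=
  forall (s : seq 'I_m) (x : 'rV[R]_m), U x ->
    {for x, continuous (iter_partial s f)} /\
    forall i, derivable (iter_partial s f) x (delta_mx 0 i).

(* [coord] is only meaningful on [chart_dom], and [param] on [chart_codom]. *)
Record chart (R : realType) (T : Type) (m : nat) := Chart {
  chart_dom : set T;
  coord : T -> 'rV[R]_m;
  param : 'rV[R]_m -> T
}.

Definition chart_codom (R : realType) (T : Type) (m : nat) (c : chart R T m) :
  set 'rV[R]_m := coord c @` chart_dom c.

Definition is_chart (R : realType) (T : topologicalType) (m : nat)
    (c : chart R T m) : Prop :=
  [/\ open (chart_dom c), open (chart_codom c),
      {in chart_dom c, cancel (coord c) (param c)},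
      {within chart_dom c, continuous (coord c)} &
      {within chart_codom c, continuous (param c)}].

(* The expression of f : S -> T in the charts c and c', and its domain. *)
Definition rep (R : realType) (S T : Type) (k m : nat)
    (c : chart R S k) (f : S -> T) (c' : chart R T m) : 'rV[R]_k -> 'rV[R]_m :=
  fun x => coord c' (f (param c x)).

Definition rep_dom (R : realType) (S T : Type) (k m : nat)
    (c : chart R S k) (f : S -> T) (c' : chart R T m) : set 'rV[R]_k :=
  coord c @` (chart_dom c `&` f @^-1` chart_dom c').

Definition oriented_compat (R : realType) (T : Type) (m : nat)
    (c c' : chart R T m) : Prop :=
  smooth_on (rep_dom c id c') (rep c id c') /\
  forall x, rep_dom c id c' x -> 0 < \det ('J (rep c id c') x).

(* A compact smooth oriented manifold of real dimension n + n, with its maximal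
   oriented smooth atlas. *)
Record manifold (R : realType) (n : nat) := Manifold {
  carrier :> topologicalType;
  atlas : set (chart R carrier (n + n));
  manifold_compact : compact [set: carrier];
  manifold_hausdorff : hausdorff_space carrier;
  atlas_is_chart : forall c, atlas c -> is_chart c;
  atlas_cover : forall p : carrier, exists2 c, atlas c & chart_dom c p;
  atlas_compat : forall c c', atlas c -> atlas c' -> oriented_compat c c';
  atlas_maximal : forall c, is_chart c ->
    (forall c', atlas c' -> oriented_compat c c' /\ oriented_compat c' c) ->
    atlas c
}.

Section Diffeomorphisms.
Variables (R : realType) (n : nat) (M : manifold R n).

Definition smooth_map (f : M -> M) : Prop :=
  continuous f /\
  forall c c' : chart R M (n + n), atlas c -> atlas c' ->
    smooth_on (rep_dom c f c') (rep c f c').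

Definition orientation_preserving (f : M -> M) : Prop :=
  forall c c' : chart R M (n + n), atlas c -> atlas c' ->
    forall x, rep_dom c f c' x -> 0 < \det ('J (rep c f c') x).

Definition is_diffeo (f : M -> M) : Prop :=
  [/\ smooth_map f,
      exists g, [/\ cancel f g, cancel g f & smooth_map g] &
      orientation_preserving f].

Definition diffeo : Type := {f : M -> M | is_diffeo f}.

HB.instance Definition _ := gen_eqMixin diffeo.
HB.instance Definition _ := gen_choiceMixin diffeo.

(* The C^oo topology: uniform convergence, on the compact subsets of charts, of
   all partial derivatives of the local expressions. *)
Definition diffeo_subbase : set (set diffeo) :=
  [set U | exists (f : diffeo) (c c' : chart R M (n + n))
             (K : set 'rV[R]_(n + n)) (s : seq 'I_(n + n)) (e : R),
     [/\ atlas c /\ atlas c', compact K, K `<=` rep_dom c (sval f) c', 0 < e &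
         U = [set g : diffeo | K `<=` rep_dom c (sval g) c' /\
           forall x, K x ->
             `|iter_partial s (rep c (sval g) c') x
               - iter_partial s (rep c (sval f) c') x| < e]]].

HB.instance Definition _ :=
  @isSubBaseTopological.Build diffeo (set diffeo) diffeo_subbase id.

Lemma is_diffeo_id : is_diffeo id.
Proof.
have smooth_id : smooth_map id.
  split; first by move=> x.
  by move=> c c' Ac Ac'; have [] := atlas_compat Ac Ac'.
split=> //; first by exists id; split.
by move=> c c' Ac Ac'; have [] := atlas_compat Ac Ac'.
Qed.

Definition diffeo_id : diffeo := exist _ id is_diffeo_id.

Definition Diff0 : set diffeo := connected_component [set: diffeo] diffeo_id.

End Diffeomorphisms.

(* Multiplication by i on R^(n + n) = C^n, where (x, y) stands for x + iy. *)
Definition std_J (R : realType) (n : nat) : 'M[R]_(n + n) :=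
  block_mx 0 1%:M (- 1%:M) 0.

Section ComplexStructures.
Variables (R : realType) (n : nat) (M : manifold R n).

(* A field of matrices given by its expression in every chart: [t c x] is the
   value at the point of coordinates x in the chart c. *)
Definition chart_field : Type :=
  chart R M (n + n) -> 'rV[R]_(n + n) -> 'M[R]_(n + n).

Definition smooth_field (t : chart_field) : Prop :=
  forall c, atlas c -> smooth_on (chart_codom c) (t c).

(* df \o I = I' \o df, in all charts. With f := id, this is the transformation
   rule of an endomorphism of the tangent bundle. *)
Definition intertwines (f : M -> M) (I I' : chart_field) : Prop :=
  forall c c' : chart R M (n + n), atlas c -> atlas c' ->
    forall x, rep_dom c f c' x ->
      I c x *m 'J (rep c f c') x = 'J (rep c f c') x *m I' c' (rep c f c' x).

(* A complex structure is given by its smooth endomorphism field I of TM with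
   I^2 = -1, which is integrable: M is covered by holomorphic charts, that is,
   charts taking I to the multiplication by i. As the charts are oriented, I
   induces the orientation of M. The first clause makes the encoding of the
   endomorphism field unique. *)
Record is_complex_structure (I : chart_field) : Prop := IsComplexStructure {
  cs_support : forall c x, ~ (atlas c /\ chart_codom c x) -> I c x = 0;
  cs_tensor : intertwines id I I;
  cs_smooth : smooth_field I;
  cs_square : forall c x, atlas c -> chart_codom c x -> I c x *m I c x = - 1%:M;
  cs_integrable : forall p : M, exists c,
    [/\ atlas c, chart_dom c p & forall x, chart_codom c x -> I c x = std_J R n]
}.

Definition complex_structure : Type := {I : chart_field | is_complex_structure I}.

HB.instance Definition _ := gen_eqMixin complex_structure.
HB.instance Definition _ := gen_choiceMixin complex_structure.

(* The (Frechet) C^oo topology: uniform convergence, on the compact subsets of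
   charts, of all partial derivatives of the endomorphism fields. *)
Definition complex_structure_subbase : set (set complex_structure) :=
  [set U | exists (I : complex_structure) (c : chart R M (n + n))
             (K : set 'rV[R]_(n + n)) (s : seq 'I_(n + n)) (e : R),
     [/\ atlas c, compact K, K `<=` chart_codom c, 0 < e &
         U = [set I' : complex_structure | forall x, K x ->
           `|iter_partial s (sval I' c) x - iter_partial s (sval I c) x| < e]]].

HB.instance Definition _ :=
  @isSubBaseTopological.Build complex_structure (set complex_structure)
    complex_structure_subbase id.

(* [w c x] is the matrix of a bilinear form: w(u, v) = u *m w c x *m v^T. *)
Definition closed_two_form (w : chart_field) : Prop :=
  [/\ smooth_field w,
      forall c c' : chart R M (n + n), atlas c -> atlas c' ->
        forall x, rep_dom c id c' x ->
          w c x = 'J (rep c id c') x *m w c' (rep c id c' x)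
                    *m ('J (rep c id c') x)^T,
      forall c x, atlas c -> chart_codom c x -> (w c x)^T = - w c x &
      forall c x, atlas c -> chart_codom c x -> forall i j k : 'I_(n + n),
        iter_partial [:: i] (w c) x j k + iter_partial [:: j] (w c) x k i
          + iter_partial [:: k] (w c) x i j = 0].

(* w(Iu, Iv) = w(u, v), and w(u, Iu) > 0 for u <> 0. *)
Definition kahler_form (I w : chart_field) : Prop :=
  closed_two_form w /\
  forall c x, atlas c -> chart_codom c x ->
    I c x *m w c x *m (I c x)^T = w c x /\
    forall u : 'rV[R]_(n + n), u != 0 ->
      0 < (u *m w c x *m (u *m I c x)^T) 0 0.

(* The form W = a + ib is closed, of type (2,0), i.e. W(Iu, v) = i W(u, v), and
   nondegenerate; a closed (2,0)-form is holomorphic. *)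
Definition holomorphic_symplectic_form (I a b : chart_field) : Prop :=
  [/\ closed_two_form a, closed_two_form b &
      forall c x, atlas c -> chart_codom c x ->
        [/\ I c x *m a c x = - b c x, I c x *m b c x = a c x &
            forall u : 'rV[R]_(n + n),
              u *m a c x = 0 -> u *m b c x = 0 -> u = 0]].

Definition hyperkahler_type (I : complex_structure) : Prop :=
  (exists w, kahler_form (sval I) w) /\
  (exists a b, holomorphic_symplectic_form (sval I) a b).

End ComplexStructures.

Section Teichmuller.
Variables (R : realType) (n : nat) (M : manifold R n).
Variable (I0 : complex_structure M).

(* If (M, I0) is hyperkaehler, only the complex structures of hyperkaehler type
   are considered. [Comp] used as a type carries the subspace topology. *)
Definition Comp : set (complex_structure M) :=
  [set I | hyperkahler_type I0 -> hyperkahler_type I].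

Lemma Comp_base : I0 \in Comp.
Proof. by rewrite inE. Qed.

Definition base : Comp := exist _ I0 Comp_base.

Definition structure (I : Comp) : chart_field M := sval (set_val I).

(* [moved_to f I I']: the diffeomorphism f takes I to I', i.e. f is a
   biholomorphism from (M, I) to (M, I'). *)
Definition moved_to (f : diffeo M) (I I' : Comp) : Prop :=
  intertwines (sval f) (structure I) (structure I').

Definition Diff0_orbit (I : Comp) : set Comp :=
  [set I' | exists2 f, Diff0 f & moved_to f I I'].

Definition Teich : Type := {A : set Comp | exists I, A = Diff0_orbit I}.

Definition to_Teich (I : Comp) : Teich :=
  exist _ (Diff0_orbit I) (ex_intro _ I erefl).

HB.instance Definition _ := gen_eqMixin Teich.
HB.instance Definition _ := gen_choiceMixin Teich.

Definition Teich_open : set (set Teich) :=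
  [set U | open (to_Teich @^-1` U)].

Lemma Teich_openT : Teich_open setT.
Proof. by rewrite /Teich_open /= preimage_setT; exact: openT. Qed.

Lemma Teich_openI : setI_closed Teich_open.
Proof. by move=> U V oU oV; rewrite /Teich_open /= preimage_setI; exact: openI. Qed.

Lemma Teich_open_bigU (J : Type) (F : J -> set Teich) :
  (forall j, Teich_open (F j)) -> Teich_open (\bigcup_j F j).
Proof.
move=> oF; rewrite /Teich_open /= preimage_bigcup.
by apply: bigcup_open => j _; exact: oF.
Qed.

HB.instance Definition _ :=
  isOpenTopological.Build Teich Teich_openT Teich_openI Teich_open_bigU.

(* The orbit of I in Teich under the mapping class group Diff / Diff0. *)
Definition mapping_class_orbit (I : Comp) : set Teich :=
  to_Teich @` [set I' | exists f, moved_to f I I'].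

Definition ergodic (I : Comp) : Prop := dense (mapping_class_orbit I).

Definition same_deformation_class (I I' : Comp) : Prop :=
  connected_component [set: Teich] (to_Teich I) (to_Teich I').

End Teichmuller.

Definition to_complex (R : realType) (v : 'rV[R]_(1 + 1)) : R[i] :=
  (v 0 (lshift 1 0) +i* v 0 (rshift 1 0))%C.

Definition unit_disk (R : realType) : set 'rV[R]_(1 + 1) :=
  [set v | ComplexField.Normc.normc (to_complex v) < 1].

Arguments unit_disk : clear implicits.

(* The Poincare distance, for the metric 4 |dz|^2 / (1 - |z|^2)^2. *)
Definition poincare (R : realType) (v w : 'rV[R]_(1 + 1)) : R :=
  let z := to_complex v in
  let z' := to_complex w in
  let t := ComplexField.Normc.normc ((z - z') / (1 - (z^*)%C * z')) in
  ln ((1 + t) / (1 - t)).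

Section Kobayashi.
Variables (R : realType) (n : nat) (M : manifold R n).
Variable (I : complex_structure M).

(* Holomorphic maps from the unit disk to (M, I): smooth maps f such that
   df \o i = I \o df. The values of f outside the disk are irrelevant. *)
Definition holomorphic_disk (f : 'rV[R]_(1 + 1) -> M) : Prop :=
  {within unit_disk R, continuous f} /\
  forall c : chart R M (n + n), atlas c ->
    let U := unit_disk R `&` f @^-1` chart_dom c in
    smooth_on U (coord c \o f) /\
    forall z, U z ->
      std_J R 1 *m 'J (coord c \o f) z
        = 'J (coord c \o f) z *m sval I c (coord c (f z)).

Record pseudometric (d : M -> M -> R) : Prop := Pseudometric {
  pm_ge0 : forall x y, 0 <= d x y;
  pm_refl : forall x, d x x = 0;
  pm_sym : forall x y, d x y = d y x;
  pm_triangle : forall x y z, d x z <= d x y + d y z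
}.

Definition disk_decreasing (d : M -> M -> R) : Prop :=
  forall f, holomorphic_disk f ->
    forall z w, unit_disk R z -> unit_disk R w ->
      d (f z) (f w) <= poincare z w.

Definition kobayashi (p q : M) : \bar R :=
  ereal_sup [set (d p q)%:E | d in
    [set d : M -> M -> R | pseudometric d /\ disk_decreasing d]].

Definition kobayashi_vanishes : Prop := forall p q : M, kobayashi p q = 0%E.

End Kobayashi.

(* Main.v *)
From Pilot Require Import Defs.
From HB Require Import structures.
From mathcomp Require Import all_boot all_order all_algebra.
From mathcomp Require Import all_classical all_reals all_analysis.
From mathcomp.real_closed Require Import complex.
From mathcomp Require Import ring lra zify.

Set Implicit Arguments.
Unset Strict Implicit.
Unset Printing Implicit Defensive.

Import Order.TTheory GRing.Theory Num.Theory.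
Import numFieldNormedType.Exports.

Local Open Scope classical_set_scope.
Local Open Scope ring_scope.

Local Notation Re := complex.Re.
Local Notation Im := complex.Im.
Local Notation coord := Pilot.Defs.coord.

(** The vanishing of the Kobayashi pseudometric splits into conditions that are open in the complex
    structure and invariant under diffeomorphisms; a dense orbit meets every nonempty open set, so
    it inherits each of them. Call J short at e when any two points are joined by a chain of
    J-holomorphic disks of total Poincaré length less than e ([short]). The pseudometric of J
    vanishes exactly when J is short at every e > 0 ([kobayashi_short], [short_kobayashi]).
    Shortness at e is carried along by biholomorphisms ([short_map]) and is open in J
    ([short_near]). So the structures short at e form an open saturated set containing I0; its image
    in the Teichmüller space is open and nonempty, the orbit of I meets it, and invariance brings
    shortness back to I.

    Openness is the analytic core. By compactness of M x M and induction along a chain it is enough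
    that one disk persists with prescribed ends: if f is J-holomorphic and z, w are distinct, then
    for J' near J and for all p near f(z) and q near f(w) some J'-holomorphic disk passes through p
    and q, at points whose Poincaré distance hardly exceeds that of z and w ([disk_extends_nbhs]).

    To find this disk, f is read through an affine map and embedded in a spray Phi(x, y, v): the
    disk is moved successively, in charts holomorphic for J, by cut-off multiples of the parameter
    v. Then u(x, y) = Phi(x, y, S(x, y)) is J'-holomorphic once S solves a quasilinear system S_x +
    i S_y + a(x, y, S) + S_y b(x, y, S) = 0 ([spray_cr]). For J' = J the coefficients a and b vanish
    at S = 0, hence they are small there for J' near J.

    The system is solved by iteration ([pde_solution]). Putting S = exp(s^2 x^2 / 2) w turns the
    Cauchy-Riemann operator into w_x + i w_y + s^2 x w. Fourier series in y reduce it to ordinary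
    differential equations, whose bounded solutions give an inverse of norm O(1 / s) on absolutely
    convergent Fourier series. A large s beats the Lipschitz constant of a; the smallness of S
    controls the term with b; two explicit homogeneous solutions adjust the values at two points.
    Only finitely many modes are kept at each step, and their range doubles, so the iterates are
    trigonometric polynomials that converge geometrically to a C^1 solution. Cauchy's formula in
    charts holomorphic for J' then makes the disk smooth ([cr_smooth], [holomorphic_diskP]). *)

(** * Primitives and integrals of continuous functions on the line *)

Section Primitive.
Variable R : realType.
Implicit Types (f F : R -> R).

(** The fundamental theorem of calculus gives a primitive to the right of a fixed lower end. Here
    the lower end moves with x, and subtracting the value at 0 makes the result independent of it,
    so that near each point it agrees with a primitive of fixed lower end. *)
Lemma primitive_exists f : continuous f ->
  exists F, forall x : R, is_derive x 1 F (f x).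
Proof.
move=> cf; set mu := @lebesgue_measure R.
have fint a b : mu.-integrable `[a, b] (EFin \o f).
  apply: continuous_compact_integrable; first exact: segment_compact.
  exact: continuous_subspaceT.
pose G (a x : R) := (\int[mu]_(t in `[a, x]) f t)%R.
have dG (a x : R) : a < x -> is_derive x 1 (G a) (f x).
  move=> ax.
  have xx1 : x < x + 1 by rewrite ltrDl.
  have [d1 d2] := @continuous_FTC1_closed R f a x _ xx1 (fint _ _) ax (cf x).
  by move: d2; rewrite derive1E; exact: DeriveDef.
have GB (a b x : R) : a <= b -> b <= x -> G a x - G a b =
    (\int[mu]_(t in `]b, x]) f t)%R.
  by move=> ab bx; rewrite Rintegral_itvB // ?bnd_simp.
have GG (a b x : R) : a <= b -> b <= x -> b <= 0 -> G a x - G a 0 = G b x - G b 0.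
  move=> ab bx b0.
  have h1 := GB a b x ab bx; have h2 := GB a b 0 ab b0.
  have h3 := GB b b x (lexx _) bx; have h4 := GB b b 0 (lexx _) b0.
  have : (G a x - G a b) - (G a 0 - G a b) = (G b x - G b b) - (G b 0 - G b b).
    by rewrite h1 h2 h3 h4.
  by rewrite !opprB !addrA !subrK.
pose A (x : R) := - (`|x| + 2).
exists (fun x : R => G (A x) x - G (A x) 0) => x0.
pose a := - (`|x0| + 4).
have ax0 : a < x0 by rewrite /a; have := ler_norm (- x0); rewrite normrN; lra.
have : is_derive x0 1 (fun x : R => G a x - G a 0) (f x0).
  have h := dG a x0 ax0.
  have := @is_deriveB R R R (G a) (cst (G a 0)) x0 1 _ _ h (is_derive_cst _ _ _).
  by rewrite subr0.
apply: near_eq_is_derive.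
near=> x.
have xx0 : `|x - x0| < 1.
  have : ball x0 1 x by near: x; exact: nbhsx_ballx.
  by rewrite /ball /= distrC.
apply: GG.
- rewrite /a /A; have : `|x| <= `|x - x0| + `|x0|.
    by rewrite -{1}(subrK x0 x) ler_normD.
  lra.
- by rewrite /A; have := ler_norm (- x); rewrite normrN; lra.
- by rewrite /A; have := normr_ge0 x; lra.
Unshelve. all: end_near. Qed.

Definition primitive f : R -> R :=
  xget (fun=> 0) [set F | forall x : R, is_derive x 1 F (f x)].

Lemma primitiveP f : continuous f -> forall x : R, is_derive x 1 (primitive f) (f x).
Proof.
move=> /primitive_exists[F hF]; rewrite /primitive.
by case: xgetP => [_ -> //|/(_ F)].
Qed.

(** Defined through a primitive, the integral is additive in its ends whatever their order. *)
Definition integ f a b := primitive f b - primitive f a.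

Lemma is_derive_continuous F (f : R -> R) :
  (forall x : R, is_derive x 1 F (f x)) -> continuous F.
Proof.
move=> dF x; apply: differentiable_continuous; apply/derivable1_diffP.
exact: ex_derive.
Qed.

Lemma MVTR F f a b : a <= b -> (forall x : R, is_derive x 1 F (f x)) ->
  exists2 c, a <= c <= b & F b - F a = f c * (b - a).
Proof.
move=> ab dF; have [|c] := @MVT_segment R F f a b ab (fun x _ => dF x).
  exact/continuous_subspaceT/(is_derive_continuous dF).
by rewrite in_itv => cab E; exists c.
Qed.

Lemma is_derive_eqB F G f a b : (forall x : R, is_derive x 1 F (f x)) ->
  (forall x : R, is_derive x 1 G (f x)) -> F b - F a = G b - G a.
Proof.
move=> dF dG.
have : (F - G) a = (F - G) b.
  apply: is_derive_0_is_cst => x.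
  by have := is_deriveB (dF x) (dG x); rewrite subrr.
rewrite /= -[(F - G) a]/(F a - G a) -[(F - G) b]/(F b - G b); lra.
Qed.

Lemma integE F f a b : (forall x : R, is_derive x 1 F (f x)) ->
  integ f a b = F b - F a.
Proof.
move=> dF; apply: (is_derive_eqB (f := f)) => //; rewrite /primitive.
by case: xgetP => [_ -> //|/(_ F)].
Qed.

Lemma integ_ext f g a b : f =1 g -> integ f a b = integ g a b.
Proof. by move=> /funext ->. Qed.

Lemma integD f g a b : continuous f -> continuous g ->
  integ (fun x => f x + g x) a b = integ f a b + integ g a b.
Proof.
move=> cf cg.
have H (x : R) := is_deriveD (primitiveP cf x) (primitiveP cg x).
rewrite (integE a b H) -![(primitive f + primitive g) _]/(primitive f _ + primitive g _).
by rewrite /integ opprD addrACA.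
Qed.

Lemma integZ f k a b : continuous f ->
  integ (fun x => k * f x) a b = k * integ f a b.
Proof.
move=> cf; have H (x : R) := is_deriveZ k (primitiveP cf x).
by rewrite (integE a b H) /= /integ mulrBr.
Qed.

Lemma integB f g a b : continuous f -> continuous g ->
  integ (fun x => f x - g x) a b = integ f a b - integ g a b.
Proof.
move=> cf cg.
have H (x : R) := is_deriveB (primitiveP cf x) (primitiveP cg x).
rewrite (integE a b H) -![(primitive f - primitive g) _]/(primitive f _ - primitive g _).
rewrite /integ.
move: (primitive f a) (primitive f b) (primitive g a) (primitive g b) => *; ring.
Qed.

Lemma integ_cst k a b : integ (fun=> k) a b = k * (b - a).
Proof.
have H (x : R) : is_derive x 1 (fun y : R => k * y) k.
  have := @is_deriveZ R R R id k x 1 1 (is_derive_id _ _).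
  by rewrite /GRing.scale /= mulr1.
by rewrite (integE a b H) mulrBr.
Qed.

Lemma integ_le f g a b : a <= b -> continuous f -> continuous g ->
  (forall x : R, a <= x <= b -> f x <= g x) -> integ f a b <= integ g a b.
Proof.
move=> ab cf cg fg; rewrite -subr_ge0 -integB //.
have H (x : R) := is_deriveB (primitiveP cg x) (primitiveP cf x).
have [c cab] := MVTR ab H.
rewrite -(integE a b H) => ->.
by rewrite mulr_ge0 ?subr_ge0 ?fg.
Qed.

Lemma integ_cat f a b c : integ f a b + integ f b c = integ f a c.
Proof. by rewrite /integ; ring. Qed.

Lemma integ_rev f a b : integ f a b = - integ f b a.
Proof. by rewrite /integ; ring. Qed.

End Primitive.
Arguments integ : simpl never.

(** * Integrals depending on a parameter *)

Section ParametricIntegral.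
Variable R : realType.

Lemma is_derive1_epsP (f : R -> R) (x d : R) :
  is_derive x 1 f d <->
  (forall e, 0 < e -> exists2 del, 0 < del & forall t, `|t| < del ->
     `|f (x + t) - f x - d * t| <= e * `|t|).
Proof.
split=> [[df dv] e e0|H].
  have : h^-1 *: (f (h *: 1 + x) - f x) @[h --> 0^'] --> d by rewrite -dv; exact: df.
  move=> /cvgrPdist_le /(_ e e0)[del /= del0 hdel].
  exists del => // t tdel; have [->|t0] := eqVneq t 0.
    by rewrite addr0 subrr mulr0 subr0 normr0 mulr0.
  have := hdel t; rewrite /ball_ /= sub0r normrN => /(_ tdel t0).
  rewrite /GRing.scale /= mulr1 (addrC t) => h.
  have -> : f (x + t) - f x - d * t = - (d - t^-1 * (f (x + t) - f x)) * t.
    by field.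
  by rewrite normrM normrN ler_wpM2r.
have c : h^-1 *: (f (h *: 1 + x) - f x) @[h --> 0^'] --> d.
  apply/cvgrPdist_le => e e0; have [del del0 hd] := H e e0.
  exists del => //= t; rewrite /ball_ /= sub0r normrN => tdel t0.
  rewrite /GRing.scale /= mulr1 (addrC t).
  have -> : d - t^-1 * (f (x + t) - f x) = - t^-1 * (f (x + t) - f x - d * t).
    by field.
  rewrite normrM normrN normfV ler_pdivrMl ?normr_gt0 // [leRHS]mulrC.
  exact: hd.
have cc : cvg (h^-1 *: (f (h *: 1 + x) - f x) @[h --> 0^']) by apply/cvg_ex; exists d.
apply: DeriveDef; first exact: cc.
exact: cvg_lim c.
Qed.

Lemma integ_norm_le (f : R -> R) a b M : a <= b -> continuous f ->
  (forall x : R, a <= x <= b -> `|f x| <= M) -> `|integ f a b| <= M * (b - a).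
Proof.
move=> ab cf fM; rewrite ler_norml -mulNr -!integ_cst; apply/andP; split.
  by apply: integ_le => // [x|x /fM]; [exact: cvg_cst|rewrite ler_norml => /andP[]].
by apply: integ_le => // [x|x /fM]; [exact: cvg_cst|rewrite ler_norml => /andP[]].
Qed.

(** Tube lemma: compactness of the segment turns neighbourhoods in the product into one
    neighbourhood of the parameter. *)
Lemma segment_near (T : topologicalType) (t0 : T) (P : T -> R -> Prop) a b :
  (forall y, a <= y <= b -> \forall p \near (t0, y), P p.1 p.2) ->
  \forall t \near t0, forall y, a <= y <= b -> P t y.
Proof.
move=> H; have /compact_near_coveringP C := @segment_compact R a b.
have := C T (nbhs t0) (fun t y => P t y) _.
move=> /(_ _) K; have {K} : \forall t \near t0, `[a, b]%classic `<=` P t.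
  apply: K => y; rewrite /= in_itv /= => /H.
  move=> [[A B] /= [nA nB] AB]; exists (B, A) => //= -[u v] [/= Bu Av].
  exact: (AB (v, u)).
by apply: filterS => t h y yab; apply: h; rewrite /= in_itv.
Qed.

Lemma segment_unif_near (T : topologicalType) (h : T -> R -> R) (t0 : T) a b e :
  0 < e -> continuous (fun p : T * R => h p.1 p.2) ->
  \forall t \near t0, forall y, a <= y <= b -> `|h t y - h t0 y| < e.
Proof.
move=> e0 ch; apply: segment_near => y _.
have c1 := ch (t0, y).
have c2 : h t0 p.2 @[p --> (t0, y)] --> h t0 y.
  apply: (cvg_comp (fun p : T * R => (t0, p.2)) (fun p => h p.1 p.2) _ (ch (t0, y))).
  exact: cvg_pair (cvg_cst _) cvg_snd.
have : (h p.1 p.2 - h t0 p.2) @[p --> (t0, y)] --> (0 : R).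
  by rewrite -(subrr (h t0 y)); exact: cvgB c1 c2.
by move=> /cvgrPdist_lt /(_ e e0); apply: filterS => p /=; rewrite sub0r normrN.
Qed.

Lemma continuous_slice (T : topologicalType) (h : T -> R -> R) t :
  continuous (fun p : T * R => h p.1 p.2) -> continuous (h t).
Proof.
move=> ch y.
apply: (cvg_comp (fun y => (t, y)) (fun p => h p.1 p.2) _ (ch (t, y))).
exact: cvg_pair (cvg_cst _) cvg_id.
Qed.

Lemma continuous_integ (T : topologicalType) (h : T -> R -> R) a b : a <= b ->
  continuous (fun p : T * R => h p.1 p.2) ->
  continuous (fun t => integ (h t) a b).
Proof.
move=> ab ch t0; apply/cvgrPdist_le => e e0.
(* Adding 1 keeps the divisor positive when a = b. *)
pose e' := e / (b - a + 1).
have ba0 : 0 < b - a + 1 by lra.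
have e'0 : 0 < e' by rewrite divr_gt0.
have := @segment_unif_near T h t0 a b e' e'0 ch; apply: filterS => t ht.
rewrite distrC -integB; try exact: continuous_slice.
apply: (le_trans (integ_norm_le (M := e') ab _ _)).
- by move=> y; apply: cvgB; exact: continuous_slice.
- by move=> y yab; exact/ltW/ht.
by rewrite /e' mulrAC ler_pdivrMr // ler_pM2l //; lra.
Qed.

(** By the mean value theorem the increment of the integrand is [hx] at an intermediate parameter
    times t, and [hx] there is uniformly close to its value at x0 along the segment. *)
Lemma is_derive_integ (h hx : R -> R -> R) (x0 a b : R) : a <= b ->
  (forall x, continuous (h x)) ->
  (forall x y : R, is_derive x 1 (h^~ y) (hx x y)) ->
  continuous (fun p : R * R => hx p.1 p.2) ->
  is_derive x0 1 (fun x => integ (h x) a b) (integ (hx x0) a b).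
Proof.
move=> ab ch dh chx; apply/is_derive1_epsP => e e0.
pose e' := e / (b - a + 1).
have ba0 : 0 < b - a + 1 by lra.
have e'0 : 0 < e' by rewrite divr_gt0.
have [del /= del0 hd] := @segment_unif_near _ hx x0 a b e' e'0 chx.
exists del => // t tdel.
have cx0 := @continuous_slice R hx x0 chx.
have cz : continuous (fun y => hx x0 y * t).
  by move=> y; apply: cvgM; [exact: cx0|exact: cvg_cst].
have cB : continuous (fun y => h (x0 + t) y - h x0 y).
  by move=> y; apply: cvgB; exact: ch.
have -> : integ (h (x0 + t)) a b - integ (h x0) a b - integ (hx x0) a b * t =
   integ (fun y => h (x0 + t) y - h x0 y - hx x0 y * t) a b.
  rewrite integB // integB //; congr (_ - _).
  by rewrite mulrC -integZ //; apply: integ_ext => y; rewrite mulrC.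
apply: (le_trans (integ_norm_le (M := e' * `|t|) ab _ _)).
- by move=> y; apply: cvgB; [exact: cB|exact: cz].
- move=> y yab.
  have [c cI ->] : exists2 c, `|c - x0| <= `|t| &
      h (x0 + t) y - h x0 y = hx c y * t.
    have [t0|t0] := leP 0 t.
      have [|c cI E] := @MVTR R (h^~ y) (hx^~ y) x0 (x0 + t) _ (fun x => dh x y).
        by lra.
      exists c; last by rewrite E; congr (_ * _); ring.
      by rewrite !ger0_norm //; lra.
    have [|c cI E] := @MVTR R (h^~ y) (hx^~ y) (x0 + t) x0 _ (fun x => dh x y).
      by lra.
    exists c; first by rewrite (ltr0_norm t0) ler0_norm; lra.
    by rewrite -opprB E; ring.
  rewrite -mulrBl normrM ler_wpM2r //; apply/ltW/hd => //.
  by rewrite /ball_ /= distrC (le_lt_trans cI).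
rewrite mulrAC ler_wpM2r //.
by rewrite /e' mulrAC ler_pdivrMr // ler_pM2l //; lra.
Qed.

End ParametricIntegral.

(** * Differentiation rules for real functions *)

Section RealDerivative.
Variable R : realType.
Implicit Types f g : R -> R.

Lemma derivD f g (x a b : R) : is_derive x 1 f a -> is_derive x 1 g b ->
  is_derive x 1 (fun t => f t + g t) (a + b).
Proof. by move=> df dg; exact: is_deriveD. Qed.

Lemma derivN f (x a : R) : is_derive x 1 f a ->
  is_derive x 1 (fun t => - f t) (- a).
Proof. by move=> df; exact: is_deriveN. Qed.

Lemma derivB f g (x a b : R) : is_derive x 1 f a -> is_derive x 1 g b ->
  is_derive x 1 (fun t => f t - g t) (a - b).
Proof. by move=> df dg; exact: is_deriveB. Qed.

Lemma derivM f g (x a b : R) : is_derive x 1 f a -> is_derive x 1 g b ->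
  is_derive x 1 (fun t => f t * g t) (a * g x + f x * b).
Proof.
move=> df dg; have := is_deriveM df dg; rewrite /GRing.scale /= addrC.
by rewrite (mulrC (g x)).
Qed.

Lemma deriv_comp f g (x a b : R) : is_derive x 1 g b ->
  is_derive (g x) 1 f a -> is_derive x 1 (fun t => f (g t)) (a * b).
Proof. by move=> dg df; exact: (@is_derive1_comp R f g x a b df dg). Qed.

Lemma deriv_cst (c x : R) : is_derive x 1 (fun _ : R => c) 0.
Proof. exact: is_derive_cst. Qed.

Lemma deriv_id (x : R) : is_derive x 1 (fun t : R => t) 1.
Proof. exact: is_derive_id. Qed.

Lemma deriv_ext f g (x a : R) : f =1 g -> is_derive x 1 f a -> is_derive x 1 g a.
Proof. by move=> /funext ->. Qed.

Lemma deriv_eq f (x a b : R) : is_derive x 1 f a -> a = b -> is_derive x 1 f b.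
Proof. by move=> df <-. Qed.

Lemma deriv_lin (c x : R) : is_derive x 1 (fun t : R => c * t) c.
Proof.
apply: (deriv_eq (derivM (deriv_cst c x) (deriv_id x))).
by rewrite mul0r add0r mulr1.
Qed.

End RealDerivative.

(** * Complex-valued functions: continuity, derivatives, integrals *)

Section ComplexFunctions.
Variable R : realType.
Notation C := (R[i]).

Lemma ReD (z w : C) : Re (z + w) = Re z + Re w. Proof. by case: z => a b; case: w => c d. Qed.
Lemma ImD (z w : C) : Im (z + w) = Im z + Im w. Proof. by case: z => a b; case: w => c d. Qed.
Lemma ReN (z : C) : Re (- z) = - Re z. Proof. by case: z => a b. Qed.
Lemma ImN (z : C) : Im (- z) = - Im z. Proof. by case: z => a b. Qed.
Lemma ReM (z w : C) : Re (z * w) = Re z * Re w - Im z * Im w.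
Proof. by case: z => a b; case: w => c d. Qed.
Lemma ImM (z w : C) : Im (z * w) = Re z * Im w + Im z * Re w.
Proof. by case: z => a b; case: w => c d. Qed.
Lemma Re0 : Re (0 : C) = 0. Proof. by []. Qed.
Lemma Im0 : Im (0 : C) = 0. Proof. by []. Qed.
Lemma ReRC (x : R) : Re (x%:C)%C = x. Proof. by []. Qed.
Lemma ImRC (x : R) : Im (x%:C)%C = 0. Proof. by []. Qed.
Lemma ReCJ (z : C) : Re (z^*)%C = Re z. Proof. by case: z => a b. Qed.
Lemma ImCJ (z : C) : Im (z^*)%C = - Im z. Proof. by case: z => a b. Qed.

Definition ReImE := (ReD, ImD, ReN, ImN, ReM, ImM, ReRC, ImRC, ReCJ, ImCJ, Re0, Im0).

Lemma ceqP (z w : C) : Re z = Re w -> Im z = Im w -> z = w.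
Proof. by case: z => a b; case: w => c d /= -> ->. Qed.

Lemma Re_sum (I : Type) (s : seq I) (P : pred I) (F : I -> C) :
  Re (\sum_(i <- s | P i) F i) = \sum_(i <- s | P i) Re (F i).
Proof. exact: (big_morph (@complex.Re R) ReD Re0). Qed.

(* The l^1 norm on C = R^2: submultiplicative, and it commutes with integration
   up to the triangle inequality without square roots. *)
Definition cnorm (z : C) : R := `|Re z| + `|Im z|.

Lemma cnorm_ge0 z : 0 <= cnorm z. Proof. by rewrite addr_ge0. Qed.
Hint Resolve cnorm_ge0 : core.
Lemma cnorm0 : cnorm 0 = 0. Proof. by rewrite /cnorm /= normr0 addr0. Qed.
Lemma cnorm0_eq z : cnorm z = 0 -> z = 0.
Proof.
rewrite /cnorm => /eqP; rewrite paddr_eq0 // !normr_eq0 => /andP[/eqP a /eqP b].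
exact: ceqP.
Qed.
Lemma cnormN z : cnorm (- z) = cnorm z.
Proof. by rewrite /cnorm !ReImE !normrN. Qed.
Lemma cnormD z w : cnorm (z + w) <= cnorm z + cnorm w.
Proof.
rewrite /cnorm !ReImE addrACA; apply: lerD; exact: ler_normD.
Qed.
Lemma cnormB z w : cnorm (z - w) <= cnorm z + cnorm w.
Proof. by rewrite -(cnormN w) cnormD. Qed.
Lemma cnormM z w : cnorm (z * w) <= cnorm z * cnorm w.
Proof.
rewrite /cnorm !ReImE mulrDl !mulrDr -!normrM.
have := ler_normB (Re z * Re w) (Im z * Im w).
have := ler_normD (Re z * Im w) (Im z * Re w).
by move=> h1 h2; apply: le_trans (lerD h2 h1) _; lra.
Qed.
Lemma cnormRC x : cnorm (x%:C)%C = `|x|.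
Proof. by rewrite /cnorm /= normr0 addr0. Qed.
Lemma cnormMRC x z : cnorm ((x%:C)%C * z) = `|x| * cnorm z.
Proof. by rewrite /cnorm !ReImE !mul0r subr0 addr0 !normrM mulrDr. Qed.
Lemma cnorm_sum (I : Type) (s : seq I) (P : pred I) (F : I -> C) :
  cnorm (\sum_(i <- s | P i) F i) <= \sum_(i <- s | P i) cnorm (F i).
Proof.
elim/big_rec2: _ => [|i y x _ h]; first by rewrite cnorm0.
by apply: le_trans (cnormD _ _) _; rewrite lerD2l.
Qed.
Lemma cnormJ z : cnorm (z^*)%C = cnorm z.
Proof. by rewrite /cnorm !ReImE normrN. Qed.
Lemma cnorm_Re z : `|Re z| <= cnorm z. Proof. by rewrite lerDl. Qed.
Lemma cnorm_Im z : `|Im z| <= cnorm z. Proof. by rewrite lerDr. Qed.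

Definition ccont (T : topologicalType) (f : T -> C) : Prop :=
  continuous (fun t => Re (f t)) /\ continuous (fun t => Im (f t)).

Definition cderiv (f : R -> C) (x : R) (d : C) : Prop :=
  is_derive x 1 (fun t => Re (f t)) (Re d) /\
  is_derive x 1 (fun t => Im (f t)) (Im d).

Section Continuity.
Variable T : topologicalType.
Implicit Types f g : T -> C.

Lemma ccont_ext f g : f =1 g -> ccont f -> ccont g.
Proof. by move=> /funext ->. Qed.

Lemma ccont_cst (c : C) : ccont (fun _ : T => c).
Proof. by split=> t; exact: cvg_cst. Qed.

Lemma ccontD f g : ccont f -> ccont g -> ccont (fun t => f t + g t).
Proof.
move=> [f1 f2] [g1 g2]; split=> t.
  rewrite (_ : (fun t => Re (f t + g t)) = (fun t => Re (f t) + Re (g t))).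
    by apply: cvgD; [exact: f1|exact: g1].
  by apply/funext => u; rewrite ReImE.
rewrite (_ : (fun t => Im (f t + g t)) = (fun t => Im (f t) + Im (g t))).
  by apply: cvgD; [exact: f2|exact: g2].
by apply/funext => u; rewrite ReImE.
Qed.

Lemma ccontM f g : ccont f -> ccont g -> ccont (fun t => f t * g t).
Proof.
move=> [f1 f2] [g1 g2]; split=> t.
  rewrite (_ : (fun t => Re (f t * g t)) =
      (fun t => Re (f t) * Re (g t) - Im (f t) * Im (g t))).
    by apply: cvgB; apply: cvgM;
      [exact: f1|exact: g1|exact: f2|exact: g2].
  by apply/funext => u; rewrite ReImE.
rewrite (_ : (fun t => Im (f t * g t)) =
    (fun t => Re (f t) * Im (g t) + Im (f t) * Re (g t))).
  by apply: cvgD; apply: cvgM;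
    [exact: f1|exact: g2|exact: f2|exact: g1].
by apply/funext => u; rewrite ReImE.
Qed.

Lemma ccontN f : ccont f -> ccont (fun t => - f t).
Proof.
move=> cf; apply: (ccont_ext _ (ccontM (ccont_cst (-1)) cf)) => t.
by rewrite mulN1r.
Qed.

Lemma ccontB f g : ccont f -> ccont g -> ccont (fun t => f t - g t).
Proof. by move=> cf cg; apply: ccontD => //; exact: ccontN. Qed.

Lemma ccontRC (f : T -> R) : continuous f -> ccont (fun t => (f t)%:C%C).
Proof. by move=> cf; split=> //= t; exact: cvg_cst. Qed.

Lemma ccont_sum (I : Type) (s : seq I) (P : pred I) (F : I -> T -> C) :
  (forall i, P i -> ccont (F i)) -> ccont (fun t => \sum_(i <- s | P i) F i t).
Proof.
move=> cF; elim: s => [|a s IH].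
  by apply: ccont_ext (ccont_cst 0) => t; rewrite big_nil.
case Pa: (P a); last by apply: ccont_ext IH => t; rewrite big_cons Pa.
by apply: ccont_ext (ccontD (cF a Pa) IH) => t; rewrite big_cons Pa.
Qed.

Lemma ccont_comp (S : topologicalType) (h : S -> T) f :
  continuous h -> ccont f -> ccont (fun s => f (h s)).
Proof.
move=> ch [f1 f2]; split=> s.
  by apply: (cvg_comp h (fun t => Re (f t)) (ch s)); exact: f1.
by apply: (cvg_comp h (fun t => Im (f t)) (ch s)); exact: f2.
Qed.

End Continuity.

Section Derivative.
Implicit Types (f g : R -> C) (x : R).

Lemma cderiv_ext f g x d : f =1 g -> cderiv f x d -> cderiv g x d.
Proof. by move=> /funext ->. Qed.

Lemma cderiv_eq f x d d' : cderiv f x d -> d = d' -> cderiv f x d'.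
Proof. by move=> h <-. Qed.

Lemma cderiv_cst (c : C) x : cderiv (fun=> c) x 0.
Proof. by split; exact: deriv_cst. Qed.

Lemma cderivD f g x a b : cderiv f x a -> cderiv g x b ->
  cderiv (fun t => f t + g t) x (a + b).
Proof.
move=> [f1 f2] [g1 g2]; split; rewrite ReImE.
  by apply: deriv_ext (derivD f1 g1) => t; rewrite ReImE.
by apply: deriv_ext (derivD f2 g2) => t; rewrite ReImE.
Qed.

Lemma cderivM f g x a b : cderiv f x a -> cderiv g x b ->
  cderiv (fun t => f t * g t) x (a * g x + f x * b).
Proof.
move=> [f1 f2] [g1 g2]; split; rewrite !ReImE.
  apply: (@deriv_eq _ (fun t => Re (f t * g t)) x _ _
     (deriv_ext _ (derivB (derivM f1 g1) (derivM f2 g2)))).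
    by move=> t; rewrite ReImE.
  by ring.
apply: (@deriv_eq _ (fun t => Im (f t * g t)) x _ _
   (deriv_ext _ (derivD (derivM f1 g2) (derivM f2 g1)))).
  by move=> t; rewrite ReImE.
by ring.
Qed.

Lemma cderivZ f x (c a : C) : cderiv f x a -> cderiv (fun t => c * f t) x (c * a).
Proof.
move=> df; apply: cderiv_eq (cderivM (cderiv_cst c x) df) _.
by rewrite mul0r add0r.
Qed.

Lemma cderivN f x a : cderiv f x a -> cderiv (fun t => - f t) x (- a).
Proof.
move=> df; apply: cderiv_eq (cderiv_ext _ (cderivZ (-1) df)) _.
  by move=> t; rewrite mulN1r.
by rewrite mulN1r.
Qed.

Lemma cderivB f g x a b : cderiv f x a -> cderiv g x b ->
  cderiv (fun t => f t - g t) x (a - b).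
Proof. by move=> df dg; apply: cderivD => //; exact: cderivN. Qed.

Lemma cderivRC (f : R -> R) x (a : R) : is_derive x 1 f a ->
  cderiv (fun t => (f t)%:C%C) x a%:C%C.
Proof. by move=> df; split => //=; exact: deriv_cst. Qed.

Lemma cderiv_sum (I : Type) (s : seq I) (P : pred I) (F : I -> R -> C) x
    (d : I -> C) : (forall i, P i -> cderiv (F i) x (d i)) ->
  cderiv (fun t => \sum_(i <- s | P i) F i t) x (\sum_(i <- s | P i) d i).
Proof.
move=> dF; elim: s => [|a s IH].
  by rewrite big_nil; apply: cderiv_ext (cderiv_cst 0 x) => t; rewrite big_nil.
rewrite big_cons; case Pa: (P a).
  by apply: cderiv_ext (cderivD (dF a Pa) IH) => t; rewrite big_cons Pa.
by apply: cderiv_ext IH => t; rewrite big_cons Pa.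
Qed.

Lemma cderiv_comp f (g : R -> R) x (a : C) (b : R) : is_derive x 1 g b ->
  cderiv f (g x) a -> cderiv (fun t => f (g t)) x (b%:C%C * a).
Proof.
move=> dg [f1 f2]; split; rewrite !ReImE mul0r.
  by rewrite subr0 mulrC; exact: (deriv_comp dg f1).
by rewrite addr0 mulrC; exact: (deriv_comp dg f2).
Qed.

Lemma cderiv_ccont f (d : R -> C) : (forall x, cderiv f x (d x)) -> ccont f.
Proof.
move=> df; split.
  by apply: is_derive_continuous => x; case: (df x) => h _; exact: h.
by apply: is_derive_continuous => x; case: (df x) => _ h; exact: h.
Qed.

Lemma cderiv_unique f x a b : cderiv f x a -> cderiv f x b -> a = b.
Proof.
move=> [f1 f2] [g1 g2]; apply: ceqP.
  by rewrite -(@derive_val _ _ _ _ _ _ _ f1) (@derive_val _ _ _ _ _ _ _ g1).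
by rewrite -(@derive_val _ _ _ _ _ _ _ f2) (@derive_val _ _ _ _ _ _ _ g2).
Qed.

End Derivative.

Section Integral.
Implicit Types (f g : R -> C) (a b : R).

Definition cinteg f a b : C :=
  (integ (fun t => Re (f t)) a b +i* integ (fun t => Im (f t)) a b)%C.

Lemma cinteg_ext f g a b : f =1 g -> cinteg f a b = cinteg g a b.
Proof. by move=> /funext ->. Qed.

Lemma cintegE f (F : R -> C) a b : (forall x, cderiv F x (f x)) ->
  cinteg f a b = F b - F a.
Proof.
move=> dF; apply: ceqP; rewrite [RHS]ReImE ?ReN ?ImN.
  by apply: (@integE _ (fun t => Re (F t))) => x; case: (dF x).
by apply: (@integE _ (fun t => Im (F t))) => x; case: (dF x).
Qed.

Lemma cderiv_cinteg f a x : ccont f -> cderiv (fun t => cinteg f a t) x (f x).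
Proof.
move=> [f1 f2]; split=> /=; rewrite /integ.
  by apply: (deriv_eq (derivB (primitiveP f1 x) (deriv_cst _ x))); rewrite subr0.
by apply: (deriv_eq (derivB (primitiveP f2 x) (deriv_cst _ x))); rewrite subr0.
Qed.

Lemma cinteg_refl f a : cinteg f a a = 0.
Proof. by rewrite /cinteg /integ !subrr. Qed.

Lemma cintegD f g a b : ccont f -> ccont g ->
  cinteg (fun t => f t + g t) a b = cinteg f a b + cinteg g a b.
Proof.
move=> cf cg; rewrite (@cintegE _ (fun t => cinteg f a t + cinteg g a t)).
  by rewrite !cinteg_refl addr0 subr0.
by move=> x; apply: cderivD; exact: cderiv_cinteg.
Qed.

Lemma cintegZ f c a b : ccont f ->
  cinteg (fun t => c * f t) a b = c * cinteg f a b.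
Proof.
move=> cf; rewrite (@cintegE _ (fun t => c * cinteg f a t)).
  by rewrite cinteg_refl mulr0 subr0.
by move=> x; apply: cderivZ; exact: cderiv_cinteg.
Qed.

Lemma cintegB f g a b : ccont f -> ccont g ->
  cinteg (fun t => f t - g t) a b = cinteg f a b - cinteg g a b.
Proof.
move=> cf cg; rewrite (@cintegE _ (fun t => cinteg f a t - cinteg g a t)).
  by rewrite !cinteg_refl !subr0.
by move=> x; apply: cderivB; exact: cderiv_cinteg.
Qed.

Lemma cinteg0 a b : cinteg (fun=> 0) a b = 0.
Proof.
by rewrite (@cintegE _ (fun=> 0)) ?subrr // => x; exact: cderiv_cst.
Qed.

Lemma cinteg_sum (I : Type) (s : seq I) (P : pred I) (F : I -> R -> C) a b :
  (forall i, P i -> ccont (F i)) ->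
  cinteg (fun t => \sum_(i <- s | P i) F i t) a b =
  \sum_(i <- s | P i) cinteg (F i) a b.
Proof.
move=> cF; elim: s => [|i s IH].
  rewrite big_nil -[RHS](cinteg0 a b); apply: cinteg_ext => t.
  by rewrite big_nil.
rewrite big_cons; case Pi: (P i).
  rewrite -IH -cintegD; last 2 first.
  - exact: cF.
  - exact: ccont_sum.
  by apply: cinteg_ext => t; rewrite big_cons Pi.
by rewrite -IH; apply: cinteg_ext => t; rewrite big_cons Pi.
Qed.

(** The l^1 norm is the maximum of the four real forms s Re + t Im with s and t equal to 1 or -1,
    and each of them commutes with the integral. *)
Lemma cinteg_norm_le f (k : R -> R) a b : a <= b -> ccont f -> continuous k ->
  (forall x, a <= x <= b -> cnorm (f x) <= k x) ->
  cnorm (cinteg f a b) <= integ k a b.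
Proof.
move=> ab [f1 f2] ck fk.
have key (s t : R) : (s = 1 \/ s = -1) -> (t = 1 \/ t = -1) ->
   s * integ (fun t => Re (f t)) a b + t * integ (fun t => Im (f t)) a b
     <= integ k a b.
  move=> hs ht.
  have cs : continuous (fun x => s * Re (f x)).
    by move=> x; apply: cvgM; [exact: cvg_cst|exact: f1].
  have ct : continuous (fun x => t * Im (f x)).
    by move=> x; apply: cvgM; [exact: cvg_cst|exact: f2].
  rewrite -!integZ // -integD //; apply: integ_le => //.
    by move=> x; apply: cvgD; [exact: cs|exact: ct].
  move=> x /fk; apply: le_trans; rewrite /cnorm.
  have := ler_norm (Re (f x)); have := ler_norm (- Re (f x)).
  have := ler_norm (Im (f x)); have := ler_norm (- Im (f x)).
  by rewrite !normrN; case: hs => ->; case: ht => ->; lra.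
rewrite /cnorm /cinteg /=.
have k1 := key 1 1 (or_introl erefl) (or_introl erefl).
have k2 := key 1 (-1) (or_introl erefl) (or_intror erefl).
have k3 := key (-1) 1 (or_intror erefl) (or_introl erefl).
have k4 := key (-1) (-1) (or_intror erefl) (or_intror erefl).
move: k1 k2 k3 k4; move: (integ k a b) (integ _ a b) (integ _ a b) => u v w k1 k2 k3 k4.
have [v0|/ltW v0] := leP 0 v; have [w0|/ltW w0] := leP 0 w;
  rewrite ?(ger0_norm v0) ?(ler0_norm v0) ?(ger0_norm w0) ?(ler0_norm w0); lra.
Qed.

Lemma cinteg_norm_leM f (M : R) a b : a <= b -> ccont f ->
  (forall x, a <= x <= b -> cnorm (f x) <= M) ->
  cnorm (cinteg f a b) <= M * (b - a).
Proof.
move=> ab cf fM; rewrite -integ_cst; apply: cinteg_norm_le => // x.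
exact: cvg_cst.
Qed.

Lemma cinteg_rev f a b : cinteg f a b = - cinteg f b a.
Proof.
by apply: ceqP; rewrite [RHS]ReImE; exact: integ_rev.
Qed.

Lemma cinteg_by_parts (u v du dv : R -> C) a b :
  (forall x, cderiv u x (du x)) -> (forall x, cderiv v x (dv x)) ->
  ccont du -> ccont dv ->
  cinteg (fun x => u x * dv x) a b =
  u b * v b - u a * v a - cinteg (fun x => du x * v x) a b.
Proof.
move=> hu hv cu cv.
have D (x : R) := cderivM (hu x) (hv x).
have cuu := cderiv_ccont hu; have cvv := cderiv_ccont hv.
rewrite -(cintegE a b D) cintegD; last 2 first.
- exact: ccontM.
- exact: ccontM.
by rewrite addrAC subrr add0r.
Qed.

Lemma ccont_cinteg (T : topologicalType) (h : T -> R -> C) a b : a <= b ->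
  ccont (fun p : T * R => h p.1 p.2) -> ccont (fun t => cinteg (h t) a b).
Proof.
move=> ab [h1 h2]; split=> /=.
  exact: (@continuous_integ _ T (fun t y => Re (h t y))).
exact: (@continuous_integ _ T (fun t y => Im (h t y))).
Qed.

Lemma cderiv_integ (h hx : R -> R -> C) (x0 a b : R) : a <= b ->
  (forall x, ccont (h x)) -> (forall x y, cderiv (h^~ y) x (hx x y)) ->
  ccont (fun p : R * R => hx p.1 p.2) ->
  cderiv (fun x => cinteg (h x) a b) x0 (cinteg (hx x0) a b).
Proof.
move=> ab ch dh [chx1 chx2]; split=> /=.
  apply: (@is_derive_integ _ (fun x y => Re (h x y)) (fun x y => Re (hx x y))) => //.
  - by move=> x; case: (ch x).
  - by move=> x y; case: (dh x y).
apply: (@is_derive_integ _ (fun x y => Im (h x y)) (fun x y => Im (hx x y))) => //.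
- by move=> x; case: (ch x).
- by move=> x y; case: (dh x y).
Qed.

(** The factor 2 is the price of separate intermediate points for the real and imaginary parts. *)
Lemma cMVT f (df : R -> C) a b (M : R) : a <= b ->
  (forall x, cderiv f x (df x)) -> (forall x, a <= x <= b -> cnorm (df x) <= M) ->
  cnorm (f b - f a) <= 2 * M * (b - a).
Proof.
move=> ab dF dM; rewrite /cnorm !ReImE.
have [c cab ->] := @MVTR _ (fun t => Re (f t)) _ _ _ ab (fun x => (dF x).1).
have [d dab ->] := @MVTR _ (fun t => Im (f t)) _ _ _ ab (fun x => (dF x).2).
rewrite !normrM -mulrDl (ger0_norm (x := b - a)) ?subr_ge0 // ler_wpM2r ?subr_ge0 //.
have := le_trans (cnorm_Re _) (dM c cab); have := le_trans (cnorm_Im _) (dM d dab).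
lra.
Qed.

End Integral.

End ComplexFunctions.
#[export] Hint Resolve cnorm_ge0 : core.

(** * The exponentials exp(2 pi i k y) and Fourier coefficients on [0, 1] *)

Section Exponentials.
Variable R : realType.
Notation C := (R[i]).

Definition freq (k : int) : R := 2 * pi * k%:~R.

Lemma freqD k l : freq (k + l) = freq k + freq l.
Proof. by rewrite /freq intrD mulrDr. Qed.
Lemma freqN k : freq (- k) = - freq k.
Proof. by rewrite /freq mulrNz mulrN. Qed.
Lemma freq0 : freq 0 = 0. Proof. by rewrite /freq mulr0. Qed.

Definition E (k : int) (y : R) : C := (cos (freq k * y) +i* sin (freq k * y))%C.

Lemma ED k l y : E (k + l) y = E k y * E l y.
Proof.
by apply: ceqP; rewrite !ReImE /= freqD mulrDl ?cosD ?sinD // addrC.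
Qed.

Lemma E0 y : E 0 y = 1.
Proof. by rewrite /E freq0 mul0r cos0 sin0. Qed.

Lemma Ey0 k : E k 0 = 1.
Proof. by rewrite /E mulr0 cos0 sin0. Qed.

Lemma Enat1 (n : nat) : E n 1 = 1.
Proof.
elim: n => [|n IH]; first exact: E0.
rewrite -addn1 PoszD ED IH mul1r /E /freq !mulr1.
by rewrite mulrC mulr_natr cos2pi sin2pi.
Qed.

Lemma EN k y : E (- k) y = (E k y)^*%C.
Proof. by apply: ceqP; rewrite !ReImE /= freqN mulNr ?cosN ?sinN. Qed.

Lemma Ey1 k : E k 1 = 1.
Proof.
case: k => n; first exact: Enat1.
by rewrite NegzE EN Enat1 conjc1.
Qed.

Lemma EyD k y z : E k (y + z) = E k y * E k z.
Proof.
by apply: ceqP; rewrite !ReImE /= mulrDr ?cosD ?sinD // addrC.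
Qed.

Lemma cderiv_E k y : cderiv (E k) y (Complex 0 (freq k) * E k y).
Proof.
have dk := deriv_lin (freq k) y.
split; rewrite ReImE /= mul0r.
  apply: (deriv_eq (deriv_comp dk (is_derive_cos _))).
  by rewrite sub0r mulNr mulrC.
apply: (deriv_eq (deriv_comp dk (is_derive_sin _))).
by rewrite add0r mulrC.
Qed.

Lemma ccont_E k : ccont (E k).
Proof. exact: cderiv_ccont (cderiv_E k). Qed.

Lemma cnorm_E k y : cnorm (E k y) <= 2.
Proof.
rewrite /cnorm /=; have := cos_max (freq k * y); have := sin_max (freq k * y).
lra.
Qed.

Definition fc (h : R -> C) (k : int) : C :=
  cinteg (fun y => h y * E (- k) y) 0 1.

Lemma fc_ext (f g : R -> C) k : f =1 g -> fc f k = fc g k.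
Proof. by move=> /funext ->. Qed.

Lemma fcD (f g : R -> C) k : ccont f -> ccont g -> fc (fun y => f y + g y) k = fc f k + fc g k.
Proof.
move=> cf cg; rewrite /fc -cintegD; try by apply: ccontM => //; exact: ccont_E.
by apply: cinteg_ext => y; rewrite mulrDl.
Qed.

Lemma fcB (f g : R -> C) k : ccont f -> ccont g -> fc (fun y => f y - g y) k = fc f k - fc g k.
Proof.
move=> cf cg; rewrite /fc -cintegB; try by apply: ccontM => //; exact: ccont_E.
by apply: cinteg_ext => y; rewrite mulrBl.
Qed.

Lemma fcZ (f : R -> C) c k : ccont f -> fc (fun y => c * f y) k = c * fc f k.
Proof.
move=> cf; rewrite /fc -cintegZ; last by apply: ccontM => //; exact: ccont_E.
by apply: cinteg_ext => y; rewrite mulrA.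
Qed.

Lemma fc_sum (I : Type) (s : seq I) (P : pred I) (F : I -> R -> C) k :
  (forall i, P i -> ccont (F i)) ->
  fc (fun y => \sum_(i <- s | P i) F i y) k = \sum_(i <- s | P i) fc (F i) k.
Proof.
move=> cF; rewrite /fc -cinteg_sum; last first.
  by move=> i Pi; apply: ccontM; [exact: cF|exact: ccont_E].
by apply: cinteg_ext => y; rewrite mulr_suml.
Qed.

Lemma fcE (f : R -> C) j k : fc (fun y => f y * E j y) k = fc f (k - j).
Proof. by apply: cinteg_ext => y; rewrite -mulrA -ED opprB. Qed.

Lemma fc_norm_le (f : R -> C) k (M : R) : ccont f ->
  (forall y, 0 <= y <= 1 -> cnorm (f y) <= M) -> cnorm (fc f k) <= 2 * M.
Proof.
move=> cf fM; apply: le_trans (cinteg_norm_leM (M := 2 * M) ler01 _ _) _.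
- by apply: ccontM => //; exact: ccont_E.
- move=> y /fM h; apply: le_trans (cnormM _ _) _.
  by rewrite [leLHS]mulrC; apply: ler_pM; rewrite ?cnorm_ge0 ?cnorm_E.
by rewrite subr0 mulr1.
Qed.

Lemma fc_deriv (f df : R -> C) k : (forall y : R, cderiv f y (df y)) -> ccont df ->
  f 0 = f 1 -> fc df k = Complex 0 (freq k) * fc f k.
Proof.
move=> hf cdf f01.
have cf := cderiv_ccont hf.
rewrite /fc; under cinteg_ext do rewrite mulrC.
rewrite (cinteg_by_parts (u := E (- k)) (dv := df) (v := f)
  (du := fun y => Complex 0 (freq (- k)) * E (- k) y)) //; last 2 first.
- exact: cderiv_E.
- by apply: ccontM; [exact: ccont_cst|exact: ccont_E].
rewrite Ey0 Ey1 f01 subrr sub0r -cintegZ; last first.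
  by apply: ccontM => //; exact: ccont_E.
rewrite -mulN1r -cintegZ; last first.
  apply: ccontM => //; apply: ccontM; [exact: ccont_cst|exact: ccont_E].
apply: cinteg_ext => y; rewrite freqN.
have -> : Complex 0 (- freq k) = - Complex 0 (freq k).
  by apply: ceqP; rewrite !ReImE /= ?oppr0.
by ring.
Qed.

Definition bern (k : int) : R := (1 + (k%:~R) ^+ 2)^-1.

Lemma bern_ge0 k : 0 <= bern k.
Proof. by rewrite invr_ge0 addr_ge0 // sqr_ge0. Qed.

Lemma cnorm_freq k (z : C) : cnorm (Complex 0 (freq k) * z) = `|freq k| * cnorm z.
Proof.
rewrite /cnorm !ReImE /= !mul0r sub0r add0r normrN !normrM -mulrDr.
by rewrite (addrC (`|Im z|)).
Qed.

(** Two integrations by parts multiply the coefficient by (2 pi k)^2 up to sign, and this is at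
    least 1 + k^2 for k nonzero; for k = 0 the supremum bound is enough. *)
Lemma fc_bern (f df ddf : R -> C) k (M : R) :
  (forall y : R, cderiv f y (df y)) -> (forall y : R, cderiv df y (ddf y)) ->
  ccont ddf -> f 0 = f 1 -> df 0 = df 1 ->
  (forall y, 0 <= y <= 1 -> cnorm (f y) <= M) ->
  (forall y, 0 <= y <= 1 -> cnorm (ddf y) <= M) ->
  cnorm (fc f k) <= 2 * M * bern k.
Proof.
move=> hf hdf cddf f01 df01 fM ddfM.
have cdf := cderiv_ccont hdf; have cf := cderiv_ccont hf.
have [->|k0] := eqVneq k 0.
  rewrite /bern expr0n /= addr0 invr1 mulr1.
  exact: fc_norm_le.
have : cnorm (fc ddf k) <= 2 * M by exact: fc_norm_le.
rewrite (fc_deriv k hdf) // (fc_deriv k hf) // !cnorm_freq mulrA -normrM -expr2.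
rewrite ger0_norm ?sqr_ge0 // /bern ler_pdivlMr; last first.
  by rewrite ltr_pwDl // sqr_ge0.
apply: le_trans; rewrite [leLHS]mulrC; apply: ler_wpM2r; first exact: cnorm_ge0.
rewrite /freq !exprMn.
have k1 : 1 <= (k%:~R : R) ^+ 2.
  have : (1 <= k ^+ 2)%R by move: k0; clear; case: k => [[|n]|n] // _; nia.
  by rewrite -(ler_int R) rmorphXn /=.
have := @pi_ge2 R; move: k1; move: (_ ^+ 2) => q q1 p2.
have : 4 <= (pi : R) ^+ 2 by nra.
by move: (pi ^+ 2) => p; nra.
Qed.

Lemma sum_uniq_nat (t : seq nat) (f : nat -> R) N :
  uniq t -> (forall j, 0 <= f j) -> (forall j, j \in t -> (j < N)%N) ->
  \sum_(j <- t) f j <= \sum_(0 <= j < N) f j.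
Proof.
move=> ut f0 tN.
have -> : \sum_(0 <= j < N) f j =
    \sum_(0 <= j < N | j \in t) f j + \sum_(0 <= j < N | j \notin t) f j.
  by rewrite (bigID (mem t)).
suff -> : \sum_(j <- t) f j = \sum_(0 <= j < N | j \in t) f j.
  by rewrite lerDl sumr_ge0.
rewrite -[RHS]big_filter; apply: perm_big; apply: uniq_perm => //.
  by rewrite filter_uniq // iota_uniq.
move=> j; rewrite mem_filter mem_index_iota.
by case: (boolP (j \in t)) => // /tN ->.
Qed.

(** The nonnegative and the negative integers contribute at most 3 each, by the telescoping
    comparison of 1 / (1 + (n + 1)^2) with 2 / (n + 1) - 2 / (n + 2). *)
Lemma sum_bern (s : seq int) : uniq s -> \sum_(k <- s) bern k <= 6.
Proof.
move=> us.
pose f (n : nat) : R := (1 + n%:R ^+ 2)^-1.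
have bf k : bern k = f `|k|%N.
  rewrite /bern /f; congr (_ + _)^-1.
  by case: k => n //=; rewrite NegzE mulrNz sqrrN.
have f0 n : 0 <= f n by rewrite invr_ge0 addr_ge0 // sqr_ge0.
have sf N : \sum_(0 <= j < N) f j <= 3.
  have h : \sum_(0 <= j < N.+1) f j <= 3 - 2 / N.+1%:R.
    elim: N => [|N IH].
      by rewrite big_nat1 /f expr0n /= addr0 invr1; lra.
    rewrite big_nat_recr //=; apply: le_trans (lerD IH (lexx _)) _.
    rewrite /f; have n0 : (0 : R) <= N%:R by [].
    rewrite -!natr1; move: (N%:R) n0 => n n0.
    have e1 : (1 + (n + 1) ^+ 2)^-1 <= 2 / (n + 1) - 2 / (n + 1 + 1).
      have -> : 2 / (n + 1) - 2 / (n + 1 + 1) = 2 / ((n + 1) * (n + 1 + 1)).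
        by field; apply/andP; split; lra.
      have n1 : 0 < (n + 1) * (n + 1 + 1) by rewrite mulr_gt0; lra.
      have n2 : 0 < 1 + (n + 1) ^+ 2 by rewrite ltr_pwDl // sqr_ge0.
      rewrite -[leLHS]mul1r ler_pdivrMr // mulrAC ler_pdivlMr // mul1r.
      have := sqr_ge0 n; rewrite expr2 => nn; nra.
    lra.
  apply: le_trans (_ : \sum_(0 <= j < N.+1) f j <= _).
    by rewrite big_nat_recr //= lerDl.
  by apply: le_trans h _; rewrite gerBl divr_ge0.
pose N := (\max_(k <- s) `|k|%N).+1.
have sN k : k \in s -> (`|k| < N)%N.
  rewrite ltnS; elim: (s) => // a s' IH; rewrite inE big_cons.
  move=> /predU1P[->|/IH h]; first exact: leq_maxl.
  by apply: leq_trans h _; rewrite leq_maxr.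
rewrite (bigID (fun k : int => 0 <= k)) /=.
have half (P : pred int) : {in [pred k | P k] &, injective absz} ->
   \sum_(k <- s | P k) bern k <= 3.
  move=> inj.
  apply: le_trans (sf N).
  under eq_bigr do rewrite bf.
  rewrite -big_filter -(big_map absz predT f); apply: sum_uniq_nat => //.
    rewrite map_inj_in_uniq ?filter_uniq // => x y.
    by rewrite !mem_filter => /andP[Px _] /andP[Py _]; exact: inj.
  by move=> j /mapP[k]; rewrite mem_filter => /andP[_ ks] ->; exact: sN.
have -> : (6 : R) = 3 + 3 by lra.
by apply: lerD; apply: half => x y; rewrite !inE; lia.
Qed.

End Exponentials.

(** * The ordinary differential equation of one Fourier mode *)

Section ModeSolution.
Variable R : realType.
Notation C := (R[i]).
Implicit Types (lam s x a b M : R) (f : R) (g h : R -> C).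

Lemma deriv_expR (f : R -> R) (x a : R) : is_derive x 1 f a ->
  is_derive x 1 (fun t => expR (f t)) (expR (f x) * a).
Proof. by move=> df; apply: deriv_comp df (is_derive_expR _). Qed.

Lemma deriv_sq (x : R) : is_derive x 1 (fun t : R => t ^+ 2) (2 * x).
Proof.
apply: deriv_eq (deriv_ext _ (derivM (deriv_id x) (deriv_id x))) _.
  by move=> t; rewrite expr2.
by rewrite mul1r mulr1; ring.
Qed.

(** A primitive of lam x - f; for lam > 0 its minimum is at f / lam. *)
Definition phase (lam f x : R) : R := lam / 2 * x ^+ 2 - f * x.

Lemma deriv_phase lam f x : is_derive x 1 (phase lam f) (lam * x - f).
Proof.
have h1 := derivM (deriv_cst (lam / 2) x) (deriv_sq x).
apply: deriv_eq (derivB h1 (deriv_lin f x)) _.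
by field.
Qed.

(** Variation of constants for u' + (lam x - f) u = g, started at the minimum f / lam of the phase.
    Between that point and x the exponential factor is at most 1 and decays away from x, so a
    bounded g gives a bounded u on the whole line. *)
Definition modesol (lam f : R) (g : R -> C) (x : R) : C :=
  (expR (- phase lam f x))%:C%C *
  cinteg (fun t => (expR (phase lam f t))%:C%C * g t) (f / lam) x.

Lemma ccont_phase lam f : ccont (fun t => (expR (phase lam f t))%:C%C).
Proof.
apply: (@cderiv_ccont R _ (fun x => (expR (phase lam f x) * (lam * x - f))%:C%C)).
by move=> x; apply: cderivRC; apply: deriv_expR; exact: deriv_phase.
Qed.

Lemma cderiv_modesol lam f g x : ccont g ->
  cderiv (modesol lam f g) x
    (g x - (lam * x - f)%:C%C * modesol lam f g x).
Proof.
move=> cg.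
have h1 := cderivRC (deriv_expR (derivN (deriv_phase lam f x))).
have h2 := cderiv_cinteg (f / lam) x (ccontM (ccont_phase lam f) cg).
apply: cderiv_eq (cderivM h1 h2) _; rewrite /modesol.
set I := cinteg _ _ _; set e := (expR (- phase lam f x)).
have ee : (e * expR (phase lam f x) = 1).
  by rewrite /e expRN mulVf // gt_eqF // expR_gt0.
rewrite mulrA.
have -> : (e%:C * (expR (phase lam f x))%:C)%C = 1.
  by rewrite -[RHS]/(1%:C)%C -ee; apply: ceqP; rewrite !ReImE; ring.
rewrite mul1r addrC mulrN.
have -> : (- (e * (lam * x - f)))%:C%C = - (e%:C%C * (lam * x - f)%:C%C).
  by apply: ceqP; rewrite !ReImE; ring.
by ring.
Qed.

Lemma ccont_modesol lam f g : ccont g -> ccont (modesol lam f g).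
Proof. by move=> cg; apply: cderiv_ccont => x; exact: cderiv_modesol. Qed.

Lemma modesolE lam f g x : ccont g -> modesol lam f g x =
  cinteg (fun t => (expR (phase lam f t - phase lam f x))%:C%C * g t) (f / lam) x.
Proof.
move=> cg; rewrite /modesol -cintegZ; last first.
  by apply: ccontM => //; exact: ccont_phase.
apply: cinteg_ext => t; rewrite mulrA; congr (_ * _).
by rewrite expRD; apply: ceqP; rewrite !ReImE; ring.
Qed.

Lemma cinteg_reflect (h : R -> C) a b : ccont h ->
  cinteg (fun t => h (- t)) (- a) (- b) = - cinteg h a b.
Proof.
move=> ch.
have dN (x : R) : is_derive x 1 (fun t : R => - t) (-1).
  exact: derivN (deriv_id x).
have D (x : R) : cderiv (fun t => - cinteg h a (- t)) x (h (- x)).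
  have := cderivN (cderiv_comp (dN x) (cderiv_cinteg a (- x) ch)).
  move=> H; apply: cderiv_eq H _.
  by apply: ceqP; rewrite !ReImE; ring.
by rewrite (cintegE _ _ D) !opprK cinteg_refl addr0.
Qed.

(** The symmetry x -> -x, f -> -f reduces the estimates to the half-line x <= f / lam. *)
Lemma modesol_reflect lam f g x : ccont g ->
  modesol lam f g x = - modesol lam (- f) (fun t => g (- t)) (- x).
Proof.
move=> cg.
have cgN : ccont (fun t => g (- t)).
  by apply: (ccont_comp (h := -%R)) cg; exact: opp_continuous.
rewrite !modesolE // mulNr -cinteg_reflect; last first.
  apply: ccontM => //.
  have := ccontM (ccont_phase lam (- f)) (ccont_cst _ (expR (- phase lam (- f) (- x)))%:C%C).
  apply: ccont_ext => t; rewrite expRD.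
  by apply: ceqP; rewrite !ReImE; ring.
rewrite !opprK; apply: cinteg_ext => t; rewrite opprK.
congr ((expR _)%:C%C * _).
by rewrite /phase; ring.
Qed.

Lemma cinteg_exp_le (h : R -> C) (a b s M : R) : a <= b -> 0 < s -> 0 <= M ->
  ccont h ->
  (forall t : R, a <= t <= b -> cnorm (h t) <= M * expR (- (s * (t - a)))) ->
  cnorm (cinteg h a b) <= M / s.
Proof.
move=> ab s0 M0 ch hM.
have dF (t : R) : is_derive t 1 (fun t : R => - (M / s) * expR (- (s * (t - a))))
    (M * expR (- (s * (t - a)))).
  have h1 := derivN (derivM (deriv_cst s t) (derivB (deriv_id t) (deriv_cst a t))).
  apply: deriv_eq (derivM (deriv_cst (- (M / s)) t) (deriv_expR h1)) _.
  by field; rewrite gt_eqF.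
have ck : continuous (fun t => M * expR (- (s * (t - a)))).
  have h1 (t : R) :=
    derivN (derivM (deriv_cst s t) (derivB (deriv_id t) (deriv_cst a t))).
  have h2 (t : R) := derivM (deriv_cst M t) (deriv_expR (h1 t)).
  exact: is_derive_continuous h2.
apply: le_trans (cinteg_norm_le ab ch ck hM) _.
rewrite (integE _ _ dF) subrr mulr0 oppr0 expR0 mulr1 opprK mulNr.
by rewrite gerDr oppr_le0 mulr_ge0 ?expR_ge0 // divr_ge0 // ltW.
Qed.

Definition modeK : R := expR 2^-1.

Lemma modeK_gt0 : 0 < modeK. Proof. exact: expR_gt0. Qed.

Lemma ccont_modeint lam f g x : ccont g ->
  ccont (fun t => (expR (phase lam f t - phase lam f x))%:C%C * g t).
Proof.
move=> cg; apply: ccontM => //.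
have := ccontM (ccont_phase lam f) (ccont_cst _ (expR (- phase lam f x))%:C%C).
apply: ccont_ext => t; rewrite expRD.
by apply: ceqP; rewrite !ReImE; ring.
Qed.

Lemma modesol_le_half s f g x (M : R) : 0 < s -> ccont g -> 0 <= M ->
  (forall t : R, cnorm (g t) <= M) -> x <= f / s ^+ 2 ->
  cnorm (modesol (s ^+ 2) f g x) <= modeK / s * M.
Proof.
move=> s0 cg M0 gM xf.
rewrite modesolE // cinteg_rev cnormN mulrAC.
apply: cinteg_exp_le => //.
- by rewrite mulr_ge0 // ltW // modeK_gt0.
- exact: ccont_modeint.
move=> t /andP[xt tf]; rewrite cnormMRC ger0_norm ?expR_ge0 // mulrAC.
apply: ler_pM; rewrite ?expR_ge0 ?cnorm_ge0 //.
rewrite /modeK -expRD ler_expR /phase.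
have s20 : 0 < s ^+ 2 by rewrite exprn_gt0.
have := sqr_ge0 (s * (t - x) - 1).
move: tf; rewrite ler_pdivlMr // => tf.
have : 0 <= (t - x) * (f - t * s ^+ 2) by rewrite mulr_ge0; lra.
move: tf s20; rewrite !expr2 => tf s20 h1 h2.
nra.
Qed.

Lemma modesol_le s f g x (M : R) : 0 < s -> ccont g ->
  (forall t : R, cnorm (g t) <= M) ->
  cnorm (modesol (s ^+ 2) f g x) <= modeK / s * M.
Proof.
move=> s0 cg gM.
have M0 : 0 <= M by apply: le_trans (gM 0); exact: cnorm_ge0.
have [xf|/ltW xf] := leP x (f / s ^+ 2); first exact: modesol_le_half.
rewrite modesol_reflect // cnormN; apply: modesol_le_half => //.
  by apply: (ccont_comp (h := -%R)) cg; exact: opp_continuous.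
by rewrite mulNr lerN2.
Qed.

Lemma modesolZ lam f g c x : ccont g ->
  modesol lam f (fun t => c * g t) x = c * modesol lam f g x.
Proof.
move=> cg; rewrite !modesolE //; last by apply: ccontM => //; exact: ccont_cst.
rewrite -cintegZ; last exact: ccont_modeint.
by apply: cinteg_ext => t; rewrite mulrCA.
Qed.

Definition modeC (s : R) : R := 2 * s * modeK + 2.

(** Three ranges of the frequency. If |f| <= 2 s^2 the previous bound suffices. If f < -2 s^2 the
    integral runs over t < -2, outside the support of g. If f > 2 s^2 then t <= 1 on the support of
    g, and the phase decreases there at rate at least f / 2. *)
Lemma modesol_freq_half s f g x (M : R) : 1 <= s -> ccont g -> 0 <= M ->
  (forall t : R, cnorm (g t) <= M) -> (forall t : R, 1 < `|t| -> g t = 0) ->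
  x <= f / s ^+ 2 ->
  `|f| * cnorm (modesol (s ^+ 2) f g x) <= modeC s * M.
Proof.
move=> s1 cg M0 gM g0 xf.
have s0 : 0 < s by lra.
have s20 : 0 < s ^+ 2 by rewrite exprn_gt0.
have K0 := modeK_gt0.
have [fs|fs] := leP `|f| (2 * s ^+ 2).
  apply: le_trans (_ : (2 * s ^+ 2) * (modeK / s * M) <= _).
    by apply: ler_pM; rewrite ?cnorm_ge0 //; exact: modesol_le.
  have -> : 2 * s ^+ 2 * (modeK / s * M) = 2 * s * modeK * M.
    by field; rewrite gt_eqF.
  by apply: ler_wpM2r => //; rewrite /modeC lerDl.
have C2 : 2 * M <= modeC s * M.
  by apply: ler_wpM2r => //; rewrite /modeC lerDr !mulr_ge0 // ltW.
rewrite modesolE // cinteg_rev cnormN.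
have [f0|f0] := leP 0 f; last first.
  have fs2 : f / s ^+ 2 < -2.
    by rewrite ltr_pdivrMr //; move: fs; rewrite ltr0_norm //; lra.
  apply: le_trans C2.
  have : cnorm (cinteg (fun t =>
     (expR (phase (s ^+ 2) f t - phase (s ^+ 2) f x))%:C%C * g t) x (f / s ^+ 2)) <= 0.
    rewrite -(mul0r (f / s ^+ 2 - x)); apply: cinteg_norm_leM => //.
      exact: ccont_modeint.
    move=> t /andP[xt tf]; rewrite g0 ?mulr0 ?cnorm0 //.
    by rewrite ltr0_norm; lra.
  move=> h; apply: le_trans (_ : `|f| * 0 <= _); first by rewrite ler_wpM2l.
  by rewrite mulr0 mulr_ge0.
rewrite ger0_norm // in fs *.
have f00 : 0 < f by apply: lt_trans fs; rewrite mulr_gt0.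
apply: le_trans C2; rewrite -ler_pdivlMl //.
have -> : f^-1 * (2 * M) = M / (f / 2) by field; rewrite gt_eqF.
apply: cinteg_exp_le => //; first by rewrite divr_gt0.
  exact: ccont_modeint.
move=> t /andP[xt tf].
have [t1|t1] := ltP 1 `|t|.
  by rewrite g0 // mulr0 cnorm0 mulr_ge0 // expR_ge0.
rewrite cnormMRC ger0_norm ?expR_ge0 // mulrC.
apply: ler_pM; rewrite ?expR_ge0 ?cnorm_ge0 //.
rewrite ler_expR /phase.
have {}t1 : t <= 1 by apply: le_trans (ler_norm _) t1.
move: fs s20; move: (s ^+ 2) => l fs l0; rewrite !expr2.
have : 0 <= (t - x) * (f / 2 - l * (t + x) / 2).
  by rewrite mulr_ge0 ?subr_ge0 //; nra.
lra.
Qed.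

Lemma modesol_freq s f g x (M : R) : 1 <= s -> ccont g ->
  (forall t : R, cnorm (g t) <= M) -> (forall t : R, 1 < `|t| -> g t = 0) ->
  `|f| * cnorm (modesol (s ^+ 2) f g x) <= modeC s * M.
Proof.
move=> s1 cg gM g0.
have M0 : 0 <= M by apply: le_trans (gM 0); exact: cnorm_ge0.
have [xf|/ltW xf] := leP x (f / s ^+ 2); first exact: modesol_freq_half.
rewrite modesol_reflect // cnormN -normrN; apply: modesol_freq_half => //.
- by apply: (ccont_comp (h := -%R)) cg; exact: opp_continuous.
- by move=> t t1; rewrite g0 // normrN.
- by rewrite mulNr lerN2.
Qed.

End ModeSolution.

(** * Trigonometric polynomials and absolutely convergent Fourier series *)

Section TrigonometricPolynomials.
Variable R : realType.
Notation C := (R[i]).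

(* Trigonometric polynomials in y whose coefficients depend on a parameter. *)
Record trig (T : Type) := Trig {
  tJ : finType;
  tk : tJ -> int;
  tc : tJ -> T -> C
}.
Arguments Trig {T tJ}.
Arguments tk {T} t _.
Arguments tc {T} t _ _.

Definition tev T (w : trig T) (t : T) (y : R) : C :=
  \sum_j tc w j t * E (tk w j) y.

Definition tder T (w : trig T) : trig T :=
  Trig (tk w) (fun j t => Complex 0 (freq R (tk w j)) * tc w j t).

(** A bound on the Wiener norm of the p-th derivative in y, with the supremum over the parameter
    taken inside each term of the sum. *)
Definition tbd T (p : nat) (w : trig T) (nu : R) : Prop :=
  exists g : tJ w -> R, [/\ forall j, 0 <= g j,
    forall j t, `|freq R (tk w j)| ^+ p * cnorm (tc w j t) <= g j &
    \sum_j g j <= nu].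

(** Frequencies may repeat, so a sum is a disjoint union of index types and nothing has to be
    regrouped. *)
Definition tadd T (w v : trig T) : trig T :=
  @Trig T (tJ w + tJ v)%type
    (fun j => match j with inl a => tk w a | inr b => tk v b end)
    (fun j t => match j with inl a => tc w a t | inr b => tc v b t end).

Definition tmul T (c : T -> C) (w : trig T) : trig T :=
  Trig (tk w) (fun j t => c t * tc w j t).

Definition tconj T (w : trig T) : trig T :=
  Trig (fun j => - tk w j) (fun j t => (tc w j t)^*%C).

Definition tcomp T S (w : trig T) (f : S -> T) : trig S :=
  Trig (tk w) (fun j s => tc w j (f s)).

Definition tre T (w : trig T) : trig T :=
  tmul (fun=> (2^-1)%:C%C) (tadd w (tconj w)).

Definition tim T (w : trig T) : trig T :=
  tre (tmul (fun=> Complex 0 (-1)) w).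

Section Evaluation.
Variable T : Type.
Implicit Types (w v : trig T) (t : T) (y : R).

Lemma cderiv_tev w t y : cderiv (tev w t) y (tev (tder w) t y).
Proof.
apply: cderiv_sum => j _ /=.
by apply: cderiv_eq (cderivZ _ (cderiv_E _ _)) _; rewrite mulrCA mulrA.
Qed.

Lemma ccont_tev w t : ccont (tev w t).
Proof. exact: cderiv_ccont (cderiv_tev w t). Qed.

Lemma tev_add w v t y : tev (tadd w v) t y = tev w t y + tev v t y.
Proof. by rewrite /tev big_sumType. Qed.

Lemma tev_mul c w t y : tev (tmul c w) t y = c t * tev w t y.
Proof. by rewrite /tev mulr_sumr; apply: eq_bigr => j _; rewrite mulrA. Qed.

Lemma tev_conj w t y : tev (tconj w) t y = (tev w t y)^*%C.
Proof.
rewrite /tev rmorph_sum; apply: eq_bigr => j _ /=.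
by rewrite rmorphM /= EN.
Qed.

Lemma tev_re w t y : tev (tre w) t y = (Re (tev w t y))%:C%C.
Proof.
rewrite tev_mul tev_add tev_conj.
by apply: ceqP; rewrite !ReImE; field.
Qed.

Lemma tev_im w t y : tev (tim w) t y = (Im (tev w t y))%:C%C.
Proof. by rewrite tev_re tev_mul ReM mul0r sub0r mulN1r opprK. Qed.

Lemma tbd_der p w nu : tbd p.+1 w nu -> tbd p (tder w) nu.
Proof.
move=> [g [g0 hg sg]]; exists g; split=> // j t /=.
by rewrite cnorm_freq mulrA -exprSr.
Qed.

Lemma tbd_le p w nu nu' : nu <= nu' -> tbd p w nu -> tbd p w nu'.
Proof. by move=> h [g [g0 hg sg]]; exists g; split=> //; exact: le_trans h. Qed.

Lemma tbd_add p w v a b : tbd p w a -> tbd p v b -> tbd p (tadd w v) (a + b).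
Proof.
move=> [g [g0 hg sg]] [h [h0 hh sh]].
exists (fun j : tJ (tadd w v) => match j with inl a => g a | inr b => h b end).
split; [by case|by case|].
by rewrite big_sumType /= lerD.
Qed.

Lemma tbd_mul p c w M nu : 0 <= M -> (forall t, cnorm (c t) <= M) ->
  tbd p w nu -> tbd p (tmul c w) (M * nu).
Proof.
move=> M0 cM [g [g0 hg sg]]; exists (fun j => M * g j); split.
- by move=> j; rewrite mulr_ge0.
- move=> j t.
  apply: le_trans (_ : M * (`|freq R (tk w j)| ^+ p * cnorm (tc w j t)) <= _).
    rewrite mulrCA ler_wpM2l ?exprn_ge0 //=.
    apply: le_trans (cnormM _ _) _.
    by apply: ler_wpM2r; [exact: cnorm_ge0|].
  by rewrite ler_wpM2l.
- by rewrite -mulr_sumr ler_wpM2l.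
Qed.

Lemma tbd_conj p w nu : tbd p w nu -> tbd p (tconj w) nu.
Proof.
move=> [g [g0 hg sg]]; exists g; split=> // j t /=.
by rewrite freqN normrN cnormJ.
Qed.

Lemma tbd_re p w nu : tbd p w nu -> tbd p (tre w) nu.
Proof.
move=> h; apply: (@tbd_le _ _ (2^-1 * (nu + nu))); first lra.
apply: tbd_mul; [by []| |exact: tbd_add h (tbd_conj h)].
by move=> t; rewrite cnormRC ger0_norm.
Qed.

Lemma tbd_im p w nu : tbd p w nu -> tbd p (tim w) nu.
Proof.
move=> h; apply: tbd_re; rewrite -[nu]mul1r; apply: tbd_mul => //.
by move=> t; rewrite /cnorm /= normr0 add0r normrN normr1.
Qed.

Lemma tbd_comp S p w nu (f : S -> T) : tbd p w nu -> tbd p (tcomp w f) nu.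
Proof. by move=> [g [g0 hg sg]]; exists g; split=> // j s; exact: hg. Qed.

Lemma tev_le w nu t y : tbd 0 w nu -> cnorm (tev w t y) <= 2 * nu.
Proof.
move=> [g [g0 hg sg]]; apply: le_trans (cnorm_sum _ _ _) _.
apply: le_trans (_ : \sum_j 2 * g j <= _); last by rewrite -mulr_sumr ler_wpM2l.
apply: ler_sum => j _; apply: le_trans (cnormM _ _) _.
rewrite mulrC; apply: ler_pM; rewrite ?cnorm_ge0 ?cnorm_E //.
by have := hg j t; rewrite expr0 mul1r.
Qed.

End Evaluation.

Lemma ccont_tev2 (T : topologicalType) (w : trig T) :
  (forall j, ccont (tc w j)) -> ccont (fun p : T * R => tev w p.1 p.2).
Proof.
move=> cw; apply: ccont_sum => j _; apply: ccontM.
  by apply: (ccont_comp (h := fst)); [move=> x; exact: cvg_fst|].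
by apply: (ccont_comp (h := snd)); [move=> x; exact: cvg_snd|exact: ccont_E].
Qed.

(* Weighted l^1 bounds on Fourier coefficients, uniform in the parameter. *)
Definition summ (al : int -> R) (c : R) : Prop :=
  (forall k, 0 <= al k) /\ forall s : seq int, uniq s -> \sum_(k <- s) al k <= c.

Definition Abd T (c : R) (h : T -> R -> C) : Prop :=
  exists2 al, summ al c & forall t k, cnorm (fc (h t) k) <= al k.

Section Wiener.
Variable T : Type.
Implicit Types (h : T -> R -> C) (t : T) (y : R).

Lemma Abd_ext h1 h2 c : (forall t y, h1 t y = h2 t y) -> Abd c h1 -> Abd c h2.
Proof.
move=> e; suff -> : h1 = h2 by [].
by apply/funext => t; apply/funext => y.
Qed.

Lemma Abd_le h c c' : c <= c' -> Abd c h -> Abd c' h.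
Proof.
move=> cc [al [al0 sal] hal]; exists al => //; split => // s us.
exact: le_trans (sal s us) cc.
Qed.

Lemma Abd_ge0 h c : Abd c h -> 0 <= c.
Proof.
by move=> [al [_ sal] _]; have := sal [::] isT; rewrite big_nil.
Qed.

Lemma Abd_add h1 h2 c1 c2 : (forall t, ccont (h1 t)) -> (forall t, ccont (h2 t)) ->
  Abd c1 h1 -> Abd c2 h2 -> Abd (c1 + c2) (fun t y => h1 t y + h2 t y).
Proof.
move=> ch1 ch2 [al [al0 sal] hal] [be [be0 sbe] hbe].
exists (fun k => al k + be k); first split.
- by move=> k; rewrite addr_ge0.
- by move=> s us; rewrite big_split lerD ?sal ?sbe.
by move=> t k; rewrite fcD //; apply: le_trans (cnormD _ _) _; rewrite lerD.
Qed.

Lemma Abd_sum (I : finType) (F : I -> T -> R -> C) (c : I -> R) :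
  (forall i t, ccont (F i t)) -> (forall i, Abd (c i) (F i)) ->
  Abd (\sum_i c i) (fun t y => \sum_i F i t y).
Proof.
move=> cF aF.
have H i : exists al, summ al (c i) /\ forall t k, cnorm (fc (F i t) k) <= al k.
  by have [al a1 a2] := aF i; exists al.
have [al hal] := choice H.
exists (fun k => \sum_i al i k); first split.
- by move=> k; apply: sumr_ge0 => i _; exact: (hal i).1.1.
- move=> s us; rewrite exchange_big /=; apply: ler_sum => i _.
  exact: (hal i).1.2.
move=> t k; rewrite fc_sum //; apply: le_trans (cnorm_sum _ _ _) _.
by apply: ler_sum => i _; exact: (hal i).2.
Qed.

Lemma Abd_mulc h c (u : T -> C) M : (forall t, ccont (h t)) -> 0 <= M ->
  (forall t, cnorm (u t) <= M) -> Abd c h -> Abd (M * c) (fun t y => u t * h t y).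
Proof.
move=> ch M0 uM [al [al0 sal] hal]; exists (fun k => M * al k); first split.
- by move=> k; rewrite mulr_ge0.
- by move=> s us; rewrite -mulr_sumr ler_wpM2l ?sal.
move=> t k; rewrite fcZ //; apply: le_trans (cnormM _ _) _.
by rewrite ler_pM ?cnorm_ge0.
Qed.

(** Coefficients of a product are convolved, and the convolution of two l^1 sequences is bounded by
    the product of their norms. *)
Lemma Abd_mul h c (w : trig T) nu : (forall t, ccont (h t)) ->
  Abd c h -> tbd 0 w nu -> Abd (c * nu) (fun t y => h t y * tev w t y).
Proof.
move=> ch A [g [g0 hg sg]]; have c0 := Abd_ge0 A.
have [al [al0 sal] hal] := A.
exists (fun k => \sum_j g j * al (k - tk w j)); first split.
- by move=> k; apply: sumr_ge0 => j _; rewrite mulr_ge0.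
- move=> s us; rewrite exchange_big /=.
  apply: le_trans (_ : \sum_j g j * c <= _).
    apply: ler_sum => j _; rewrite -mulr_sumr ler_wpM2l //.
    rewrite -(big_map (fun k => k - tk w j) predT al); apply: sal.
    by rewrite map_inj_uniq // => x y /addIr.
  by rewrite -mulr_suml mulrC ler_wpM2l.
move=> t k.
rewrite (_ : fc _ k = \sum_j tc w j t * fc (h t) (k - tk w j)).
  apply: le_trans (cnorm_sum _ _ _) _; apply: ler_sum => j _.
  apply: le_trans (cnormM _ _) _; rewrite ler_pM ?cnorm_ge0 //.
  by have := hg j t; rewrite expr0 mul1r.
rewrite (fc_ext (g := fun y => \sum_j tc w j t * (h t y * E (tk w j) y))).
  rewrite fc_sum; last first.
    by move=> j _; apply: ccontM; [exact: ccont_cst|apply: ccontM => //; exact: ccont_E].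
  apply: eq_bigr => j _; rewrite fcZ; last by apply: ccontM => //; exact: ccont_E.
  by rewrite fcE.
by move=> y; rewrite /tev mulr_sumr; apply: eq_bigr => j _; rewrite mulrCA.
Qed.

(** The constant is the 2 of [fc_bern] times the 6 of [sum_bern]. *)
Lemma Abd_bern (f df ddf : T -> R -> C) M : 0 <= M ->
  (forall t y, cderiv (f t) y (df t y)) -> (forall t y, cderiv (df t) y (ddf t y)) ->
  (forall t, ccont (ddf t)) ->
  (forall t, f t 0 = f t 1) -> (forall t, df t 0 = df t 1) ->
  (forall t y, 0 <= y <= 1 -> cnorm (f t y) <= M) ->
  (forall t y, 0 <= y <= 1 -> cnorm (ddf t y) <= M) ->
  Abd (12 * M) f.
Proof.
move=> M0 hf hdf cddf f01 df01 fM ddfM.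
exists (fun k => 2 * M * bern R k); first split.
- by move=> k; rewrite !mulr_ge0 // bern_ge0.
- move=> s us; rewrite -mulr_sumr.
  have -> : 12 * M = 2 * M * 6 by ring.
  by rewrite ler_wpM2l ?mulr_ge0 // sum_bern.
move=> t k; apply: (fc_bern (df := df t) (ddf := ddf t)) => //.
- by move=> y; exact: fM.
- by move=> y; exact: ddfM.
Qed.

(* Mean value inequality for the Fourier coefficients along a path in th. *)
Lemma Abd_path (K dK : T -> R -> R -> C) c :
  (forall t th, ccont (K t th)) ->
  (forall t th y, cderiv (fun th => K t th y) th (dK t th y)) ->
  (forall t, ccont (fun p : R * R => dK t p.1 p.2)) ->
  Abd c (fun p : T * {th : R | 0 <= th <= 1} => dK p.1 (sval p.2)) ->
  Abd (2 * c) (fun t y => K t 1 y - K t 0 y).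
Proof.
move=> cK hK cdK [al [al0 sal] hal].
exists (fun k => 2 * al k); first split.
- by move=> k; rewrite mulr_ge0.
- by move=> s us; rewrite -mulr_sumr ler_wpM2l ?sal.
move=> t k; rewrite fcB //.
have D th : cderiv (fun th => fc (K t th) k) th (fc (dK t th) k).
  apply: (@cderiv_integ R (fun th y => K t th y * E (- k) y)
    (fun th y => dK t th y * E (- k) y)) => //.
  - by move=> x; apply: ccontM => //; exact: ccont_E.
  - move=> x y; apply: cderiv_eq (cderivM (hK t x y) (cderiv_cst _ _)) _.
    by rewrite mulr0 addr0.
  - apply: ccontM => //.
    by apply: (ccont_comp (h := snd)); [move=> x; exact: cvg_snd|exact: ccont_E].
have := @cMVT R _ _ 0 1 (al k) ler01 D; rewrite subr0 mulr1; apply.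
move=> th h; exact: (hal (t, exist _ th h)).
Qed.

End Wiener.
End TrigonometricPolynomials.
Arguments Trig {R T tJ}.
Arguments tk {R T} t _.
Arguments tc {R T} t _ _.

(** * The linear equation, solved on finitely many modes *)

Section TruncatedSolution.
Variable R : realType.
Notation C := (R[i]).
Implicit Types (S : seq int) (h : R -> R -> C) (s x y c : R).

(** Solves u_x + i u_y + s^2 x u = h on the modes in S: the operator i d/dy multiplies the mode k by
    - 2 pi k. *)
Definition tsol s S h : trig R R :=
  @Trig R R 'I_(size S) (fun j => nth 0 S j)
    (fun j x => modesol (s ^+ 2) (freq R (nth 0 S j))
                  (fun t => fc (h t) (nth 0 S j)) x).

Definition fourier_sum S h x y : C := \sum_(k <- S) fc (h x) k * E k y.

Definition wsum p S h c : Prop := exists al : int -> R,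
  [/\ forall k, 0 <= al k,
      forall x k, k \in S -> `|freq R k| ^+ p * cnorm (fc (h x) k) <= al k &
      \sum_(k <- S) al k <= c].

Lemma tev_tsol s S h x y : tev (tsol s S h) x y =
  \sum_(k <- S) modesol (s ^+ 2) (freq R k) (fun t => fc (h t) k) x * E k y.
Proof. by rewrite /tev /= (big_nth 0) big_mkord. Qed.

Lemma ccont_fc (T : topologicalType) (h : T -> R -> C) k :
  ccont (fun p : T * R => h p.1 p.2) -> ccont (fun t => fc (h t) k).
Proof.
move=> ch; apply: (@ccont_cinteg R T (fun t y => h t y * E (- k) y) 0 1) => //.
apply: ccontM => //.
by apply: (ccont_comp (h := snd)); [move=> x; exact: cvg_snd|exact: ccont_E].
Qed.

Section Solution.
Variables (s : R) (h : R -> R -> C).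
Hypothesis s1 : 1 <= s.
Hypothesis ch : ccont (fun p : R * R => h p.1 p.2).

Let s0 : 0 < s. Proof. by apply: lt_le_trans s1. Qed.

Lemma ccont_tsol S j : ccont (tc (tsol s S h) j).
Proof. by apply: ccont_modesol; exact: ccont_fc. Qed.

Lemma cderiv_tsol S x y :
  cderiv (fun x => tev (tsol s S h) x y) x
    (fourier_sum S h x y - (s ^+ 2 * x)%:C%C * tev (tsol s S h) x y
     - Complex 0 1 * tev (tder (tsol s S h)) x y).
Proof.
have D k : cderiv (fun x =>
    modesol (s ^+ 2) (freq R k) (fun t => fc (h t) k) x * E k y) x
    ((fc (h x) k - (s ^+ 2 * x - freq R k)%:C%C *
      modesol (s ^+ 2) (freq R k) (fun t => fc (h t) k) x) * E k y).
  apply: cderiv_eq (cderivM (cderiv_modesol _ _ x (ccont_fc k ch)) (cderiv_cst _ x)) _.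
  by rewrite mulr0 addr0.
have := @cderiv_sum R _ S predT _ x _ (fun k _ => D k).
move=> H; apply: cderiv_eq (cderiv_ext _ H) _.
  by move=> t; rewrite tev_tsol.
rewrite tev_tsol /fourier_sum {H D}.
have -> : tev (tder (tsol s S h)) x y = \sum_(k <- S) Complex 0 (freq R k) *
   modesol (s ^+ 2) (freq R k) (fun t => fc (h t) k) x * E k y.
  by rewrite /tev /= [RHS](big_nth 0) big_mkord.
rewrite !mulr_sumr -!sumrB; apply: eq_bigr => k _.
have -> : (s ^+ 2 * x - freq R k)%:C%C = (s ^+ 2 * x)%:C%C - (freq R k)%:C%C.
  by apply: ceqP; rewrite !ReImE ?subr0.
have -> : Complex 0 (freq R k) = Complex 0 1 * (freq R k)%:C%C.
  by apply: ceqP; rewrite ReImE /= !(mul0r, mul1r, mulr0) ?subrr ?add0r.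
have ii : (Complex 0 1 : C) * Complex 0 1 = -1 by rewrite -expr2; exact: sqr_i.
move: (modesol _ _ _ _) (fc _ _) (E k y) (freq R k)%:C%C (s ^+ 2 * x)%:C%C => a b e f l.
rewrite !mulrA ii; ring.
Qed.

(** By linearity the mode estimate applies to the coefficients weighted by powers of the frequency.
    The gain 1 / s is what makes the iteration contract. *)
Lemma tbd_tsol p S c : wsum p S h c -> tbd p (tsol s S h) (modeK R / s * c).
Proof.
move=> [al [al0 hal sal]].
have K0 : 0 <= modeK R / s by rewrite divr_ge0 // ltW // modeK_gt0.
exists (fun j : 'I_(size S) => modeK R / s * al (nth 0 S j)); split.
- by move=> j; rewrite mulr_ge0.
- move=> j x /=; have kS : nth 0 S j \in S by rewrite mem_nth.
  set k := nth 0 S j.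
  rewrite -[X in X * _ <= _](ger0_norm (exprn_ge0 _ (normr_ge0 _))).
  rewrite -cnormMRC -modesolZ; last exact: ccont_fc.
  apply: modesol_le => //.
    by apply: ccontM; [exact: ccont_cst|exact: ccont_fc].
  by move=> t; rewrite cnormMRC ger0_norm ?exprn_ge0 // hal.
- by rewrite -mulr_sumr ler_wpM2l //; apply: le_trans sal; rewrite [leRHS](big_nth 0) big_mkord.
Qed.

(** The elliptic gain of one derivative. Its constant grows with s, and it rests on the support of
    the source in |x| <= 1. *)
Lemma tbd_tsolS p S c : (forall x y, 1 < `|x| -> h x y = 0) ->
  wsum p S h c -> tbd p.+1 (tsol s S h) (modeC s * c).
Proof.
move=> h0 [al [al0 hal sal]].
have K0 : 0 <= modeC s.
  by rewrite /modeC addr_ge0 // !mulr_ge0 // ltW // modeK_gt0.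
exists (fun j : 'I_(size S) => modeC s * al (nth 0 S j)); split.
- by move=> j; rewrite mulr_ge0.
- move=> j x /=; have kS : nth 0 S j \in S by rewrite mem_nth.
  set k := nth 0 S j.
  rewrite exprS -mulrA -[X in _ * (X * _) <= _](ger0_norm (exprn_ge0 _ (normr_ge0 _))).
  rewrite -cnormMRC -modesolZ; last exact: ccont_fc.
  apply: modesol_freq => //.
  + by apply: ccontM; [exact: ccont_cst|exact: ccont_fc].
  + by move=> t; rewrite cnormMRC ger0_norm ?exprn_ge0 // hal.
  + move=> t t1; rewrite (_ : fc _ _ = 0) ?mulr0 //.
    rewrite -(cinteg0 (R := R) 0 1); apply: cinteg_ext => y.
    by rewrite h0 // mul0r.
- by rewrite -mulr_sumr ler_wpM2l //; apply: le_trans sal; rewrite [leRHS](big_nth 0) big_mkord.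
Qed.

End Solution.

Definition modes (N : nat) : seq int := [seq Posz j - Posz N | j <- iota 0 (N + N).+1].

Lemma mem_modes N (k : int) : (k \in modes N) = (`|k| <= N)%N.
Proof.
apply/mapP/idP => [[j]|kN]; first by rewrite mem_iota => jN ->; lia.
by exists (absz (k + Posz N)); [rewrite mem_iota|]; lia.
Qed.

Lemma uniq_modes N : uniq (modes N).
Proof. by rewrite map_inj_uniq ?iota_uniq // => i j; lia. Qed.

Definition tail_modes N M := [seq k <- modes M | (N < `|k|)%N].

Lemma uniq_tail N M : uniq (tail_modes N M).
Proof. by rewrite filter_uniq // uniq_modes. Qed.

Lemma perm_modes N M : (N <= M)%N -> perm_eq (modes M) (modes N ++ tail_modes N M).
Proof.
move=> NM; apply: uniq_perm; rewrite ?uniq_modes //.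
  rewrite cat_uniq uniq_modes uniq_tail andbT /=; apply/hasPn => k.
  by rewrite mem_filter !mem_modes => /andP[h _]; rewrite -ltnNge.
by move=> k; rewrite mem_cat mem_filter !mem_modes; lia.
Qed.

Lemma wsum_Abd S h c : uniq S -> Abd c h -> wsum 0 S h c.
Proof.
move=> uS [al [al0 sal] hal]; exists al; split=> //; last exact: sal.
by move=> x k _; rewrite expr0 mul1r.
Qed.

Lemma wsum_Abd_der S (h dh : R -> R -> C) c : uniq S ->
  (forall x y, cderiv (h x) y (dh x y)) -> (forall x, ccont (dh x)) ->
  (forall x, h x 0 = h x 1) -> Abd c dh -> wsum 1 S h c.
Proof.
move=> uS dhh cdh h01 [al [al0 sal] hal]; exists al; split=> //; last exact: sal.
move=> x k _; rewrite expr1 -cnorm_freq -(fc_deriv k (dhh x)) //.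
Qed.

(** A coefficient of h is the one of [dh] divided by 2 pi i k, so the modes with |k| > N carry at
    most a fraction 1 / (N + 1) of the norm of the derivative. *)
Lemma wsum_tail N M (h dh : R -> R -> C) c :
  (forall x y, cderiv (h x) y (dh x y)) -> (forall x, ccont (dh x)) ->
  (forall x, h x 0 = h x 1) -> Abd c dh -> wsum 0 (tail_modes N M) h (c / N.+1%:R).
Proof.
move=> dhh cdh h01 [al [al0 sal] hal].
exists (fun k => al k / N.+1%:R); split.
- by move=> k; rewrite divr_ge0.
- move=> x k; rewrite mem_filter => /andP[Nk _]; rewrite expr0 mul1r.
  rewrite ler_pdivlMr ?ltr0n //; apply: le_trans (hal x k).
  rewrite (fc_deriv k (dhh x)) // cnorm_freq mulrC.
  apply: ler_wpM2r; first exact: cnorm_ge0.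
  rewrite /freq normrM ger0_norm ?mulr_ge0 ?pi_ge0 // -intr_norm.
  have Nk' : N.+1%:R <= (`|k|%:~R : R).
    by rewrite -abszE -[N.+1%:R]/((Posz N.+1)%:~R) ler_int lez_nat.
  apply: (le_trans Nk'); rewrite ler_peMl //.
  by have := @pi_ge2 R; lra.
- by rewrite -mulr_suml ler_wpM2r ?invr_ge0 ?sal ?uniq_tail.
Qed.

End TruncatedSolution.

(** * Functions of class C^n of several variables *)

Section ScalarCalculus.
Variable R : realType.

Definition pd k (i : 'I_k) (f : 'rV[R]_k -> R) (x : 'rV[R]_k) : R :=
  'D_(delta_mx 0 i) f x.

(* Functions of class C^n on U (meant for open U). *)
Fixpoint Cn k (n : nat) (U : set 'rV[R]_k) (f : 'rV[R]_k -> R) : Prop :=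
  match n with
  | 0 => forall x, U x -> {for x, continuous f}
  | n'.+1 => (forall x, U x -> differentiable f x) /\
             forall i, Cn n' U (pd i f)
  end.

Lemma mx_entry_norm k l (A : 'M[R]_(k, l)) i j : `|A i j| <= `|A|.
Proof.
rewrite [leRHS]/Num.Def.normr /= mx_normrE.
by apply: le_trans (le_bigmax _ _ (i, j)).
Qed.

Lemma mx_norm_le k l (A : 'M[R]_(k, l)) e : 0 <= e ->
  (forall i j, `|A i j| <= e) -> `|A| <= e.
Proof.
move=> e0 h; rewrite [leLHS]/Num.Def.normr /= mx_normrE.
by apply: bigmax_le => // -[i j] _; exact: h.
Qed.

Lemma mx_norm_lt k l (A : 'M[R]_(k, l)) e : 0 < e ->
  (forall i j, `|A i j| < e) -> `|A| < e.
Proof.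
move=> e0 h; rewrite [ltLHS]/Num.Def.normr /= mx_normrE.
by apply: bigmax_lt => // -[i j] _; exact: h.
Qed.

Lemma nbhs_normP (V : normedModType R) (a : V) (P : set V) :
  (\forall x \near a, P x) <->
  exists2 del : R, 0 < del & forall x, `|x - a| < del -> P x.
Proof.
split=> [/nbhs_ballP[d d0 h]|[d d0 h]].
  by exists d => // x xa; apply: h; rewrite -ball_normE /= distrC.
apply/nbhs_ballP; exists d => // x; rewrite -ball_normE /= distrC.
exact: h.
Qed.

Lemma row_delta k (v : 'rV[R]_k) : v = \sum_i v 0 i *: delta_mx 0 i.
Proof.
apply/rowP => j; rewrite summxE (bigD1 j) //= big1 ?addr0 => [|i ij].
  by rewrite !mxE !eqxx mulr1.
by rewrite !mxE eqxx /= (eq_sym j) (negbTE ij) mulr0.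
Qed.

Lemma diff_pd k (f : 'rV[R]_k -> R) x v : differentiable f x ->
  'd f x v = \sum_i v 0 i * pd i f x.
Proof.
move=> df; rewrite {1}(row_delta v) linear_sum; apply: eq_bigr => i _.
by rewrite linearZ /= /pd deriveE.
Qed.

Lemma cvg_sumR (T : Type) (F : set_system T) {FF : Filter F} (V : normedModType R)
    (I : Type) (s : seq I) (P : pred I) (f : I -> T -> V) (a : I -> V) :
  (forall i, P i -> f i x @[x --> F] --> a i) ->
  (\sum_(i <- s | P i) f i x) @[x --> F] --> \sum_(i <- s | P i) a i.
Proof.
move=> cf; elim: s => [|i s IH].
  rewrite big_nil; under eq_fun do rewrite big_nil; exact: cvg_cst.
rewrite big_cons; case Pi: (P i).
  by under eq_fun do rewrite big_cons Pi; apply: cvgD => //; exact: cf.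
by under eq_fun do rewrite big_cons Pi.
Qed.

Lemma differentiable_eps k (f : 'rV[R]_k -> R) a (c : 'I_k -> R) :
  (forall e, 0 < e -> exists2 del, 0 < del & forall h, `|h| < del ->
     `|f (h + a) - f a - \sum_i c i * h 0 i| <= e * `|h|) ->
  differentiable f a /\ forall i, pd i f a = c i.
Proof.
move=> H.
pose L (h : 'rV[R]_k) : R := \sum_i c i * h 0 i.
have linL : linear L.
  move=> u x y; rewrite /L scaler_sumr -big_split; apply: eq_bigr => i _.
  by rewrite !mxE /GRing.scale /=; ring.
pose Lm : {linear 'rV[R]_k -> R} :=
  HB.pack L (GRing.isLinear.Build R _ _ _ L linL).
have cL : continuous Lm.
  move=> x; apply: (@cvg_sumR _ (nbhs x) _ R _ _ _ (fun i (y : 'rV[R]_k) => c i * y 0 i)) => i _.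
  by apply: cvgM; [exact: cvg_cst|exact: coord_continuous].
have E : f \o shift a = cst (f a) + Lm +o_ (0 : 'rV[R]_k) id.
  apply/eqaddoP => e e0; have [d d0 h] := H e e0.
  suff : \forall x \near (0 : 'rV[R]_k), `|f (x + a) - f a - L x| <= e * `|x|.
    by apply: filterS => x; rewrite -[(f \o shift a - _) x]/(f (x + a) - (f a + L x)) opprD addrA.
  by apply/nbhs_normP; exists d => // x; rewrite subr0 => /h.
have dE := diff_unique cL E.
have df : differentiable f a.
  apply/diff_locallyP; split; first by rewrite dE.
  by rewrite dE.
split=> // i; rewrite /pd deriveE // dE /= /L.
rewrite (bigD1 i) //= big1 => [|j ji]; first by rewrite !mxE !eqxx addr0 mulr1.
by rewrite !mxE eqxx /= (negbTE ji) mulr0.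
Qed.

Lemma is_derive_line (V W : normedModType R) (f : V -> W) (p v : V) (t : R) :
  derivable f (p + t *: v) v ->
  is_derive t 1 (fun t => f (p + t *: v)) ('D_v f (p + t *: v)).
Proof.
move=> df.
have e : (fun h : R => h^-1 *: (f (p + (h *: 1 + t) *: v) - f (p + t *: v))) =
   (fun h => h^-1 *: (f (h *: v + (p + t *: v)) - f (p + t *: v))).
  apply/funext => h; congr (_ *: (f _ - _)).
  have -> : h *: (1 : R) = h by exact: mulr1.
  by rewrite scalerDl addrCA.
apply: DeriveDef; first by rewrite /derivable e.
by rewrite /derive e.
Qed.

Lemma sum_telescope (V : zmodType) (F : nat -> V) k :
  \sum_(i < k) (F i.+1 - F i) = F k - F 0.
Proof. by rewrite -(big_mkord predT (fun i => F i.+1 - F i)) telescope_sumr. Qed.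

(* Telescoping along the coordinate axes and the mean value theorem. *)
Lemma differentiable_partials k (U : set 'rV[R]_k) (f : 'rV[R]_k -> R) : open U ->
  (forall x, U x -> forall i, derivable f x (delta_mx 0 i)) ->
  (forall i x, U x -> {for x, continuous (pd i f)}) ->
  forall x, U x -> differentiable f x.
Proof.
move=> oU df cf a Ua.
apply: (fun H => (@differentiable_eps k f a (fun i => pd i f a) H).1).
move=> e e0.
have [e' e'0 e'k] : exists2 e', 0 < e' & e' * k%:R <= e.
  have k1 : 0 < k%:R + 1 :> R by rewrite ltr_wpDl.
  exists (e / (k%:R + 1)); first by rewrite divr_gt0.
  by rewrite mulrAC ler_pdivrMr // ler_wpM2l ?lerDl // ltW.
have [d d0 hd] : exists2 d : R, 0 < d & forall x, `|x - a| < d ->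
    U x /\ forall i, `|pd i f x - pd i f a| < e'.
  apply/nbhs_normP; apply: filterI; first exact: open_nbhs_nbhs.
  suff : forall i : 'I_k, \forall x \near a, `|pd i f x - pd i f a| < e' by move=> H; apply: (filter_forall (nbhs_filter a)) H.
  move=> i.
  have /cvgrPdist_lt/(_ _ e'0) := cf i a Ua.
  by apply: filterS => x; rewrite distrC.
exists d => // h hd'.
(* [p i] has the first i coordinates of a + h and the remaining ones of a, so consecutive points
   differ along one axis. *)
pose p (i : nat) := a + \row_(j < k) (if (j < i)%N then h 0 j else 0).
have p0 : p 0 = a by rewrite /p -[RHS]addr0; congr (_ + _); apply/rowP => j; rewrite !mxE.
have pk : p k = h + a.
  by rewrite /p addrC; congr (_ + _); apply/rowP => j; rewrite !mxE ltn_ord.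
have pS (i : 'I_k) : p i.+1 = p i + h 0 i *: delta_mx 0 i.
  rewrite /p -addrA; congr (_ + _); apply/rowP => j; rewrite !mxE eqxx /= ltnS leq_eqVlt.
  rewrite -val_eqE /=; case: ltngtP => //= ij; rewrite ?mulr0 ?addr0 ?mulr1 ?add0r //.
  by congr (h 0 _); apply/val_inj.
have pin (i : 'I_k) (t : R) : `|t| <= `|h 0 i| -> `|p i + t *: delta_mx 0 i - a| < d.
  move=> th; apply: le_lt_trans hd'.
  rewrite /p addrAC [a + _]addrC addrK; apply: mx_norm_le => // i0 j.
  rewrite !mxE !ord1 eqxx /=; case: (altP (j =P i)) => [->|ji].
    by rewrite ltnn add0r mulr1; apply: le_trans th _; exact: mx_entry_norm.
  by rewrite mulr0 addr0; case: ifP => _; rewrite ?normr0 ?mx_entry_norm.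
have step (i : 'I_k) : `|f (p i.+1) - f (p i) - pd i f a * h 0 i| <= e' * `|h|.
  pose g t := f (p i + t *: delta_mx 0 i).
  have dg (t : R) : `|t| <= `|h 0 i| ->
      is_derive t 1 g (pd i f (p i + t *: delta_mx 0 i)).
    by move=> th; apply: is_derive_line; apply: df; apply: (hd _ (pin i t th)).1.
  have [c ch E] : exists2 c, `|c| <= `|h 0 i| &
      g (h 0 i) - g 0 = pd i f (p i + c *: delta_mx 0 i) * h 0 i.
    have cg (u v : R) : (forall t, u <= t <= v -> `|t| <= `|h 0 i|) ->
        {within `[u, v], continuous g}.
      move=> uv; apply: continuous_in_subspaceT => t; rewrite inE /= in_itv /= => /uv th.
      by apply: differentiable_continuous; apply/derivable1_diffP;
        exact: (@ex_derive _ _ _ _ _ _ _ (dg t th)).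
    have [h0|h0] := leP 0 (h 0 i).
      have hh t : 0 <= t <= h 0 i -> `|t| <= `|h 0 i|.
        by move=> /andP[t0 th]; rewrite !ger0_norm.
      have hI (t : R) : t \in `]0, (h 0 i)[ -> is_derive t 1 g (pd i f (p i + t *: delta_mx 0 i)).
        rewrite in_itv /= => /andP[t0 th]; apply: dg; apply: hh.
        by rewrite !ltW.
      have [c] := MVT_segment h0 hI (cg _ _ hh).
      by rewrite in_itv /= subr0 => ci E; exists c => //; exact: hh.
    have hh t : h 0 i <= t <= 0 -> `|t| <= `|h 0 i|.
      by move=> /andP[t0 th]; rewrite !ler0_norm ?lerN2 // ltW.
    have hI (t : R) : t \in `](h 0 i), 0[ -> is_derive t 1 g (pd i f (p i + t *: delta_mx 0 i)).
      rewrite in_itv /= => /andP[t0 th]; apply: dg; apply: hh.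
      by rewrite !ltW.
    have [c] := MVT_segment (ltW h0) hI (cg _ _ hh).
    rewrite in_itv /= sub0r => ci E; exists c; first exact: hh.
    by apply: oppr_inj; rewrite opprB E mulrN.
  have -> : f (p i.+1) = g (h 0 i) by rewrite /g pS.
  have -> : f (p i) = g 0 by rewrite /g scale0r addr0.
  rewrite E -mulrBl normrM; apply: ler_pM => //; last exact: mx_entry_norm.
  by apply/ltW; apply: (hd _ (pin i c ch)).2.
rewrite -pk -{1}p0 -(sum_telescope (fun i => f (p i))) -sumrB.
apply: le_trans (ler_norm_sum _ _ _) _.
apply: le_trans (_ : \sum_(i < k) e' * `|h| <= _); first by apply: ler_sum => i _; exact: step.
by rewrite sumr_const card_ord -mulr_natr mulrAC ler_wpM2r.
Qed.

End ScalarCalculus.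

(** * Closure properties of the classes C^n *)

Section ClosureOfCn.
Variable R : realType.
Implicit Types (k l n : nat).

Lemma Cn_continuous k n (U : set 'rV[R]_k) f : Cn n U f ->
  forall x, U x -> {for x, continuous f}.
Proof.
case: n => [|n] // [df _] x Ux.
by apply: differentiable_continuous; exact: df.
Qed.

Lemma CnW k n (U : set 'rV[R]_k) f : Cn n.+1 U f -> Cn n U f.
Proof.
elim: n f => [|n IH] f; first exact: Cn_continuous.
by move=> [df pdf]; split=> // i; apply: IH; exact: pdf.
Qed.

Lemma Cn_le k n m (U : set 'rV[R]_k) f : (n <= m)%N -> Cn m U f -> Cn n U f.
Proof.
move=> /subnK <-; elim: (m - n)%N => [|d IH] //.
by rewrite addSn => /CnW.
Qed.

Lemma Cn_sub k n (U V : set 'rV[R]_k) f : V `<=` U -> Cn n U f -> Cn n V f.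
Proof.
move=> VU; elim: n f => [|n IH] f; first by move=> h x /VU; exact: h.
by move=> [df pdf]; split=> [x /VU|i]; [exact: df|apply: IH; exact: pdf].
Qed.

Lemma pd_near k i (f g : 'rV[R]_k -> R) x :
  (\forall y \near x, f y = g y) -> pd i f x = pd i g x.
Proof. exact: near_eq_derive. Qed.

Lemma differentiable_epsP k (f : 'rV[R]_k -> R) a : differentiable f a <->
  exists c : 'I_k -> R,
  (forall e, 0 < e -> exists2 del, 0 < del & forall h, `|h| < del ->
     `|f (h + a) - f a - \sum_i c i * h 0 i| <= e * `|h|).
Proof.
split=> [df|[c hc]]; last by have [] := differentiable_eps hc.
exists (fun i => pd i f a) => e e0.
have /diff_locallyP[_ E] := df.
have /eqaddoP/(_ _ e0) h := E.
have /nbhs_normP[d d0 hd] : \forall x \near (0 : 'rV[R]_k),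
    `|f (x + a) - f a - \sum_i pd i f a * x 0 i| <= e * `|x|.
  move: h; apply: filterS => x.
  rewrite -[(f \o shift a - _) x]/(f (x + a) - (f a + 'd f a x)) opprD addrA.
  rewrite diff_pd //.
  by under eq_bigr do rewrite mulrC.
by exists d => // x xd; apply: hd; rewrite subr0.
Qed.

Lemma differentiable_near k (f g : 'rV[R]_k -> R) x :
  (\forall y \near x, f y = g y) -> differentiable f x -> differentiable g x.
Proof.
move=> fg /differentiable_epsP[c hc]; apply/differentiable_epsP; exists c => e e0.
have [d d0 hd] := hc e e0; have /nbhs_normP[d' d'0 hd'] := fg.
exists (Num.min d d') => [|h]; first by rewrite lt_min d0.
rewrite lt_min => /andP[h1 h2]; rewrite -!hd'; first exact: hd.
  by rewrite subrr normr0.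
by rewrite addrK.
Qed.

Lemma Cn_ext k n (U : set 'rV[R]_k) f g : open U -> (forall x, U x -> f x = g x) ->
  Cn n U f -> Cn n U g.
Proof.
move=> oU.
have nearU h1 h2 : (forall x, U x -> h1 x = h2 x) ->
    forall x, U x -> \forall y \near x, h1 y = h2 y :> R.
  move=> e x Ux; have : nbhs x U by exact: open_nbhs_nbhs.
  by apply: filterS => y; exact: e.
elim: n f g => [|n IH] f g fg /=.
  move=> h x Ux; have c := h x Ux; rewrite /prop_for /continuous_at -fg //.
  exact: cvg_trans (near_eq_cvg (nearU _ _ fg x Ux)) c.
move=> [df pdf]; split=> [x Ux|i].
  exact: (differentiable_near (nearU _ _ fg x Ux) (df x Ux)).
apply: IH (pdf i) => x Ux; apply: pd_near; exact: nearU Ux.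
Qed.

Lemma pd_cst k i (c : R) : pd (k := k) i (fun=> c) = fun=> 0.
Proof. by apply/funext => x; exact: derive_cst. Qed.

Lemma Cn_cst k n (U : set 'rV[R]_k) (c : R) : Cn n U (fun=> c).
Proof.
elim: n c => [|n IH] c /=; first by move=> x _; exact: cst_continuous.
by split=> [x _|i]; [exact: differentiable_cst|rewrite pd_cst].
Qed.

Lemma pd_coord k (i j : 'I_k) (x : 'rV[R]_k) :
  pd i (fun x : 'rV[R]_k => x 0 j) x = (i == j)%:R.
Proof.
have [|_ d] := @differentiable_eps R k (fun x => x 0 j) x (fun i => (i == j)%:R); last exact: d.
move=> e e0; exists 1 => // h _; rewrite mxE addrK (bigD1 j) //= eqxx mul1r.
rewrite big1 ?addr0 ?subrr ?normr0 ?mulr_ge0 // => [|i' /negbTE ->].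
  exact: ltW.
by rewrite mul0r.
Qed.

Lemma Cn_coord k n (U : set 'rV[R]_k) (j : 'I_k) : Cn n U (fun x => x 0 j).
Proof.
case: n => [|n] /=; first by move=> x _; exact: coord_continuous.
split=> [x _|i]; first exact: differentiable_coord.
rewrite (_ : pd _ _ = fun=> (i == j)%:R); first exact: Cn_cst.
by apply/funext => x; rewrite pd_coord.
Qed.

Lemma Cn_add k n (U : set 'rV[R]_k) f g : open U -> Cn n U f -> Cn n U g ->
  Cn n U (fun x => f x + g x).
Proof.
move=> oU; elim: n f g => [|n IH] f g /=.
  by move=> cf cg x Ux; exact: continuousD (cf x Ux) (cg x Ux).
move=> [df pdf] [dg pdg]; split=> [x Ux|i].
  by apply: differentiableD; [exact: df|exact: dg].
apply: Cn_ext (IH _ _ (pdf i) (pdg i)) => // x Ux.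
by rewrite /pd -deriveD //; apply: diff_derivable; [exact: df|exact: dg].
Qed.

Lemma Cn_mul k n (U : set 'rV[R]_k) f g : open U -> Cn n U f -> Cn n U g ->
  Cn n U (fun x => f x * g x).
Proof.
move=> oU; elim: n f g => [|n IH] f g.
  by move=> cf cg x Ux; exact: continuousM (cf x Ux) (cg x Ux).
move=> cf cg; have [df pdf] := cf; have [dg pdg] := cg; split=> [x Ux|i].
  by apply: differentiableM; [exact: df|exact: dg].
apply: Cn_ext (Cn_add oU (IH _ _ (CnW cf) (pdg i)) (IH _ _ (CnW cg) (pdf i))) => // x Ux.
by rewrite /pd [RHS]deriveM //; apply: diff_derivable; [exact: df|exact: dg].
Qed.

Lemma Cn_opp k n (U : set 'rV[R]_k) f : open U -> Cn n U f -> Cn n U (fun x => - f x).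
Proof.
move=> oU cf; apply: Cn_ext (Cn_mul oU (Cn_cst n U (-1)) cf) => // x _.
by rewrite mulN1r.
Qed.

Lemma Cn_sub2 k n (U : set 'rV[R]_k) f g : open U -> Cn n U f -> Cn n U g ->
  Cn n U (fun x => f x - g x).
Proof. by move=> oU cf cg; apply: Cn_add => //; exact: Cn_opp. Qed.

Lemma Cn_sum k n (U : set 'rV[R]_k) (I : Type) (s : seq I) (P : pred I)
    (f : I -> 'rV[R]_k -> R) : open U -> (forall i, P i -> Cn n U (f i)) ->
  Cn n U (fun x => \sum_(i <- s | P i) f i x).
Proof.
move=> oU cf; elim: s => [|i s IH].
  by apply: Cn_ext (Cn_cst n U 0) => // x _; rewrite big_nil.
case Pi: (P i); last by apply: Cn_ext IH => // x _; rewrite big_cons Pi.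
by apply: Cn_ext (Cn_add oU (cf i Pi) IH) => // x _; rewrite big_cons Pi.
Qed.

Lemma Cn_prod k n (U : set 'rV[R]_k) (I : Type) (s : seq I) (P : pred I)
    (f : I -> 'rV[R]_k -> R) : open U -> (forall i, P i -> Cn n U (f i)) ->
  Cn n U (fun x => \prod_(i <- s | P i) f i x).
Proof.
move=> oU cf; elim: s => [|i s IH].
  by apply: Cn_ext (Cn_cst n U 1) => // x _; rewrite big_nil.
case Pi: (P i); last by apply: Cn_ext IH => // x _; rewrite big_cons Pi.
by apply: Cn_ext (Cn_mul oU (cf i Pi) IH) => // x _; rewrite big_cons Pi.
Qed.

Lemma Cn_inv k n (U : set 'rV[R]_k) f : open U -> (forall x, U x -> f x != 0) ->
  Cn n U f -> Cn n U (fun x => (f x)^-1).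
Proof.
move=> oU f0; elim: n f f0 => [|n IH] f f0.
  by move=> cf x Ux; exact: continuousV (f0 x Ux) (cf x Ux).
move=> cf; have [df pdf] := cf; split=> [x Ux|i].
  by apply: differentiableV; [exact: df|exact: f0].
have ci := IH f f0 (CnW cf).
apply: Cn_ext (Cn_opp oU (Cn_mul oU (Cn_mul oU ci ci) (pdf i))) => // x Ux.
rewrite /pd deriveV ?f0 //; last by apply: diff_derivable; exact: df.
by rewrite /GRing.scale /= -exprVn expr2 mulNr.
Qed.

Lemma rV_differentiable k l (f : 'rV[R]_k -> 'rV[R]_l) x :
  (forall j, differentiable (fun y => f y 0 j) x) -> differentiable f x.
Proof.
move=> df.
rewrite (_ : f = \sum_(j < l) (fun y => f y 0 j *: delta_mx 0 j)).
  apply: differentiable_sum => j; apply: differentiableZl; exact: df.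
by apply/funext => y; rewrite fct_sumE; exact: row_delta.
Qed.

Lemma diff_rV k l (f : 'rV[R]_k -> 'rV[R]_l) x v j :
  (forall j, differentiable (fun y => f y 0 j) x) ->
  'd f x v 0 j = \sum_i v 0 i * pd i (fun y => f y 0 j) x.
Proof.
move=> df; have dff := rV_differentiable df.
rewrite -(deriveE v dff) derive_mx; last exact: diff_derivable.
by rewrite mxE deriveE // diff_pd.
Qed.

Lemma jacobianE k l (f : 'rV[R]_k -> 'rV[R]_l) x i j :
  (forall j, differentiable (fun y => f y 0 j) x) ->
  'J f x i j = pd i (fun y => f y 0 j) x.
Proof.
move=> df; rewrite /jacobian /lin1_mx mxE diff_rV // (bigD1 i) //= big1.
  by rewrite mxE !eqxx mul1r addr0.
by move=> i' ii'; rewrite mxE eqxx /= (negbTE ii') mul0r.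
Qed.

Lemma pd_comp k l (g : 'rV[R]_l -> R) (f : 'rV[R]_k -> 'rV[R]_l) x i :
  differentiable g (f x) -> (forall j, differentiable (fun y => f y 0 j) x) ->
  pd i (fun y => g (f y)) x = \sum_j pd j g (f x) * pd i (fun y => f y 0 j) x.
Proof.
move=> dg df; have dff := rV_differentiable df.
have dgf : differentiable (g \o f) x by exact: differentiable_comp.
rewrite -[pd i _]/(pd i (g \o f)) /pd deriveE // diff_comp //= diff_pd //.
apply: eq_bigr => j _; rewrite mulrC diff_rV //; congr (_ * _).
rewrite (bigD1 i) //= big1; first by rewrite mxE !eqxx mul1r addr0.
by move=> i' ii'; rewrite mxE eqxx /= (negbTE ii') mul0r.
Qed.

Lemma mx_continuous_entries (T : topologicalType) p r (F : T -> 'M[R]_(p, r)) t :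
  (forall i j, {for t, continuous (fun y => F y i j)}) -> {for t, continuous F}.
Proof.
move=> cF; apply/cvgrPdist_lt => e e0.
have : \forall y \near t, forall i j, `|F t i j - F y i j| < e.
  apply: (filter_forall (nbhs_filter t)) => i; apply: (filter_forall (nbhs_filter t)) => j.
  by have /cvgrPdist_lt/(_ _ e0) := cF i j.
apply: filterS => y h; apply: mx_norm_lt => // i j.
by rewrite !mxE.
Qed.

(** By the chain rule a partial derivative of the composite is a sum of products of composites with
    functions of one class less, so induction on n applies. *)
Lemma Cn_comp k l n (U : set 'rV[R]_k) (V : set 'rV[R]_l) g (f : 'rV[R]_k -> 'rV[R]_l) :
  open U -> (forall x, U x -> V (f x)) -> Cn n V g ->
  (forall j, Cn n U (fun x => f x 0 j)) -> Cn n U (fun x => g (f x)).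
Proof.
move=> oU UV; elim: n g => [|n IH] g.
  move=> cg cf x Ux; apply: (@continuous_comp _ _ _ f g).
    by apply: mx_continuous_entries => i j; rewrite ord1; exact: cf.
  by apply: cg; exact: UV.
move=> [dg pdg] cf.
have df j x : U x -> differentiable (fun y => f y 0 j) x by case: (cf j) => d _; exact: d.
split=> [x Ux|i].
  apply: (@differentiable_comp _ _ _ _ f g).
    by apply: rV_differentiable => j; exact: df.
  by apply: dg; exact: UV.
have c : Cn n U (fun x => \sum_j pd j g (f x) * pd i (fun y => f y 0 j) x).
  apply: Cn_sum => // j _; apply: Cn_mul => //; last by case: (cf j) => _; exact.
  by apply: IH => [|j']; [exact: pdg|exact: CnW].
apply: Cn_ext c => // x Ux; rewrite pd_comp //; last by move=> j; exact: df.
by apply: dg; exact: UV.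
Qed.

Lemma deriv_curve k (g : 'rV[R]_k -> R) (q : R -> 'rV[R]_k) (dq : 'I_k -> R) (y : R) :
  differentiable g (q y) -> (forall i, is_derive y 1 (fun t => q t 0 i) (dq i)) ->
  is_derive y 1 (fun t => g (q t)) (\sum_i pd i g (q y) * dq i).
Proof.
move=> dg hq.
have dqq : differentiable q y.
  apply/derivable1_diffP/derivable_mxP => i j; rewrite ord1.
  exact: (@ex_derive _ _ _ _ _ _ _ (hq j)).
have dgq : differentiable (g \o q) y by exact: differentiable_comp.
apply: DeriveDef; first exact/diff_derivable.
rewrite -[fun t => _]/(g \o q) deriveE // diff_comp //= diff_pd //.
apply: eq_bigr => i _; rewrite mulrC; congr (_ * _).
rewrite -(deriveE (1 : R) dqq) derive_mx; last exact: diff_derivable.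
by rewrite mxE; exact: (@derive_val _ _ _ _ _ _ _ (hq i)).
Qed.

(* Comparison with smooth_on. *)

Lemma iter_partial_entry k p r (U : set 'rV[R]_k) (f : 'rV[R]_k -> 'M[R]_(p, r)) s x i j :
  open U -> smooth_on U f -> U x ->
  iter_partial s f x i j = iter_partial s (fun y => f y i j) x.
Proof.
move=> oU sf; elim: s x => [|a s IH] x Ux //=.
rewrite derive_mx; last by have [_] := sf s x Ux; exact.
rewrite mxE; apply: near_eq_derive.
have : nbhs x U by exact: open_nbhs_nbhs.
by apply: filterS => y Uy; exact: IH.
Qed.

Lemma smooth_on_Cn k (U : set 'rV[R]_k) (f : 'rV[R]_k -> R) : open U ->
  (smooth_on U f <-> forall n, Cn n U f).
Proof.
move=> oU; split=> [sf n|cf s x Ux].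
  suff H : forall s, Cn n U (iter_partial s f) by exact: (H [::]).
  elim: n => [|n IH] s; first by move=> x Ux; have [] := sf s x Ux.
  split=> [|i]; last exact: (IH (i :: s)).
  apply: (differentiable_partials oU) => [x Ux i|i x Ux].
    by have [_] := sf s x Ux; exact.
  by have [] := sf (i :: s) x Ux.
have H n s' : Cn n U (iter_partial s' f).
  elim: s' n => [|i s' IH] n; first exact: cf.
  by have [_] := IH n.+1; exact.
split; first exact: (Cn_continuous (H 0%N s)).
by move=> i; apply: diff_derivable; have [d _] := H 1%N s; exact: d.
Qed.

(** Iterated partial derivatives of a matrix-valued map agree with the entrywise ones on U; since U
    is open, this agreement survives each further derivative. *)
Lemma smooth_on_entries k p r (U : set 'rV[R]_k) (f : 'rV[R]_k -> 'M[R]_(p, r)) :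
  open U -> (smooth_on U f <-> forall i j n, Cn n U (fun x => f x i j)).
Proof.
move=> oU; split=> [sf i j|sf].
  apply/(smooth_on_Cn _ oU) => s x Ux.
  have near_E : \forall y \near x,
      iter_partial s f y i j = iter_partial s (fun y => f y i j) y.
    have : nbhs x U by exact: open_nbhs_nbhs.
    by apply: filterS => y Uy; exact: iter_partial_entry oU sf Uy.
  have [c d] := sf s x Ux; split.
    rewrite /prop_for /continuous_at -(iter_partial_entry s i j oU sf Ux).
    have c2 : {for x, continuous (fun y => iter_partial s f y i j)}.
      apply: (@continuous_comp _ _ _ (iter_partial s f) (fun A : 'M[R]_(p, r) => A i j)).
        exact: c.
      exact: coord_continuous.
    exact: cvg_trans (near_eq_cvg near_E) c2.
  move=> a; apply: near_eq_derivable near_E _.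
  by have /derivable_mxP := d a; exact.
have sfe i j : smooth_on U (fun x => f x i j) by apply/(smooth_on_Cn _ oU).
have E s x : U x ->
    iter_partial s f x = \matrix_(i, j) iter_partial s (fun y => f y i j) x.
  elim: s x => [|a s IH] x Ux /=; first by apply/matrixP => i j; rewrite mxE.
  have nE : \forall y \near x,
      iter_partial s f y = \matrix_(i, j) iter_partial s (fun y => f y i j) y.
    have : nbhs x U by exact: open_nbhs_nbhs.
    by apply: filterS => y Uy; exact: IH.
  rewrite (near_eq_derive _ nE) derive_mx; last first.
    apply/derivable_mxP => i j.
    rewrite (_ : (fun y => _) = iter_partial s (fun y => f y i j)).
      by have [_] := sfe i j s x Ux; exact.
    by apply/funext => y; rewrite mxE.
  apply/matrixP => i j; rewrite !mxE; congr ('D_ _ _ x).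
  by apply/funext => y; rewrite mxE.
move=> s x Ux.
have nE : \forall y \near x,
    (\matrix_(i, j) iter_partial s (fun y => f y i j) y) = iter_partial s f y.
  have : nbhs x U by exact: open_nbhs_nbhs.
  by apply: filterS => y Uy; rewrite E.
split.
  rewrite /prop_for /continuous_at E //.
  have c : {for x, continuous
      (fun y => \matrix_(i, j) iter_partial s (fun y => f y i j) y)}.
    apply: mx_continuous_entries => i j.
    rewrite (_ : (fun y => _) = iter_partial s (fun y => f y i j)).
      by have [] := sfe i j s x Ux.
    by apply/funext => y; rewrite mxE.
  exact: cvg_trans (near_eq_cvg nE) c.
move=> a; apply: near_eq_derivable nE _; apply/derivable_mxP => i j.
rewrite (_ : (fun y => _) = iter_partial s (fun y => f y i j)).
  by have [_] := sfe i j s x Ux; exact.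
by apply/funext => y; rewrite mxE.
Qed.

End ClosureOfCn.

(** * Composites with curves as absolutely convergent Fourier series *)

Section Composites.
Variable R : realType.
Notation C := (R[i]).

Fixpoint Cb k (N : nat) (be : R) (U : set 'rV[R]_k) (f : 'rV[R]_k -> R) : Prop :=
  match N with
  | 0 => forall x, U x -> {for x, continuous f} /\ `|f x| <= be
  | N'.+1 => (forall x, U x -> differentiable f x /\ `|f x| <= be) /\
             forall i, Cb N' be U (pd i f)
  end.

Lemma CbW k N be (U : set 'rV[R]_k) f : Cb N.+1 be U f -> Cb N be U f.
Proof.
elim: N f => [|N IH] f /=.
  move=> [h _] x Ux; have [d b] := h x Ux.
  by split=> //; exact: differentiable_continuous.
by move=> [df pdf]; split=> // i; apply: IH; exact: pdf.
Qed.

Lemma Cb_bound k N be (U : set 'rV[R]_k) f x : Cb N be U f -> U x -> `|f x| <= be.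
Proof. by case: N => [|N] => [h /h[]|[h _] /h[]]. Qed.

Lemma Cb_cont k N be (U : set 'rV[R]_k) f x :
  Cb N be U f -> U x -> {for x, continuous f}.
Proof.
case: N => [|N] => [h /h[]|[h _] /h[d _]] //.
exact: differentiable_continuous.
Qed.

Lemma Cb_le k N be be' (U : set 'rV[R]_k) f : be <= be' -> Cb N be U f -> Cb N be' U f.
Proof.
move=> bb; elim: N f => [|N IH] f /=.
  by move=> h x /h[c b]; split=> //; exact: le_trans bb.
move=> [h pdf]; split=> [x /h[c b]|i]; last by apply: IH; exact: pdf.
by split=> //; exact: le_trans bb.
Qed.

Variable m : nat.
Notation M := (m + m)%N.
Notation K := (1 + 1 + M)%N.

Definition pt (x y : R) (s : 'rV[R]_M) : 'rV[R]_K := row_mx (row_mx x%:M y%:M) s.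
Definition ix : 'I_K := lshift M (lshift 1 ord0).
Definition iy : 'I_K := lshift M (rshift 1 ord0).
Definition iS (l : 'I_M) : 'I_K := rshift (1 + 1) l.

Lemma pt_x x y s : pt x y s 0 ix = x.
Proof. by rewrite /pt /ix !row_mxEl mxE eqxx. Qed.
Lemma pt_y x y s : pt x y s 0 iy = y.
Proof. by rewrite /pt /iy row_mxEl row_mxEr mxE eqxx. Qed.
Lemma pt_s x y s l : pt x y s 0 (iS l) = s 0 l.
Proof. by rewrite /pt /iS row_mxEr. Qed.

Lemma idx_case (P : 'I_K -> Prop) :
  P ix -> P iy -> (forall l, P (iS l)) -> forall i, P i.
Proof.
move=> Px Py Ps i; case: (split_ordP i) => [j ->|l ->]; last exact: Ps.
by case: (split_ordP j) => o ->; rewrite ord1; [exact: Px|exact: Py].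
Qed.

Lemma sum_idx (V : nmodType) (F : 'I_K -> V) :
  \sum_i F i = F ix + F iy + \sum_l F (iS l).
Proof.
by rewrite big_split_ord /= big_split_ord /= !big_ord1; congr (F _ + F _ + _); apply/val_inj.
Qed.

(** The coefficients of the equation vanish here. The margins 1/8 at y = 0 and y = 1 make their
    composites flat at both ends, hence periodic in y; the condition on x gives the bounded support
    that [tbd_tsolS] asks for. *)
Definition off_box (q : 'rV[R]_K) : Prop :=
  [\/ 1 < `|q 0 ix|, q 0 iy < 8^-1 | 1 - 8^-1 < q 0 iy].

Lemma open_off_box : open off_box.
Proof.
have -> : off_box = [set q | 1 < `|q 0 ix|] `|` ([set q | q 0 iy < 8^-1] `|`
    [set q | 1 - 8^-1 < q 0 iy]).
  apply/seteqP; split=> q /=.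
    by case=> h; [left|right; left|right; right].
  by case=> [h|[h|h]]; [apply: Or31|apply: Or32|apply: Or33].
have c j : continuous (fun q : 'rV[R]_K => q 0 j) by exact: coord_continuous.
apply: openU; [|apply: openU].
- have cn : continuous (fun q : 'rV[R]_K => `|q 0 ix|).
    by move=> q; apply: (@continuous_comp _ _ _ (fun q : 'rV[R]_K => q 0 ix) (fun t : R => `|t|));
      [exact: c|exact: norm_continuous].
  exact: (open_comp (fun q _ => cn q) (@open_gt R 1)).
- exact: (open_comp (fun q _ => c iy q) (@open_lt R 8^-1)).
- exact: (open_comp (fun q _ => c iy q) (@open_gt R (1 - 8^-1))).
Qed.

Variables (U : set 'rV[R]_K) (rho : R).
Hypothesis Uoff : off_box `<=` U.
Hypothesis Urho : forall q : 'rV[R]_K, (forall l, `|q 0 (iS l)| < rho) -> U q.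

Definition van (H : 'rV[R]_K -> R) : Prop := forall q, off_box q -> H q = 0.

Lemma van_pd i H : van H -> van (pd i H).
Proof.
move=> vH q oq; rewrite (@pd_near _ _ i H (fun=> 0)) ?pd_cst //.
have : nbhs q off_box by apply: open_nbhs_nbhs; split=> //; exact: open_off_box.
by apply: filterS => z /vH.
Qed.

Definition good N be H := Cb N be U H /\ van H.

Lemma good_pd N be H i : good N.+1 be H -> good N be (pd i H).
Proof. by move=> [[_ h] vH]; split; [exact: h|exact: van_pd]. Qed.

Lemma goodW N be H : good N.+1 be H -> good N be H.
Proof. by move=> [h vH]; split=> //; exact: CbW. Qed.

Lemma good_diff N be H q : good N.+1 be H -> U q -> differentiable H q.
Proof. by move=> [[h _] _] /h[]. Qed.

Lemma pt_off x y s : 1 < `|x| -> off_box (pt x y s).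
Proof. by move=> h; apply: Or31; rewrite pt_x. Qed.

Section Family.
Variables (T : Type) (X : T -> R) (v v1 v2 : T -> 'I_M -> R -> R).
Hypothesis dv : forall t l y, is_derive (y : R) 1 (v t l) (v1 t l y).
Hypothesis dv1 : forall t l y, is_derive (y : R) 1 (v1 t l) (v2 t l y).
Hypothesis cv2 : forall t l, continuous (v2 t l).
Hypothesis vrho : forall t l y, `|X t| <= 1 -> `|v t l y| < rho.
Hypothesis v1le : forall t l y, `|X t| <= 1 -> `|v1 t l y| <= 1.
Hypothesis v2le : forall t l y, `|X t| <= 1 -> `|v2 t l y| <= 1.

Definition curve t y : 'rV[R]_K := pt (X t) y (\row_l v t l y).

Lemma curveU t y : U (curve t y).
Proof.
have [h|h] := ltP 1 `|X t|; first by apply: Uoff; exact: pt_off.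
by apply: Urho => l; rewrite pt_s mxE; exact: vrho.
Qed.

Definition dcurve t (y : R) (i : 'I_K) : R :=
  match fintype.split i with inr l => v1 t l y | inl _ => (i == iy)%:R end.

Lemma dcurve_s t y l : dcurve t y (iS l) = v1 t l y.
Proof. by rewrite /dcurve /iS (unsplitK (inr l)). Qed.
Lemma dcurve_x t y : dcurve t y ix = 0.
Proof. by rewrite /dcurve /ix (unsplitK (inl _)). Qed.
Lemma dcurve_y t y : dcurve t y iy = 1.
Proof. by rewrite /dcurve {1}/iy (unsplitK (inl _)) eqxx. Qed.

Lemma deriv_curve_i t y i : is_derive (y : R) 1 (fun y => curve t y 0 i) (dcurve t y i).
Proof.
move: i; apply: idx_case => [||l].
- by rewrite dcurve_x; apply: deriv_ext (deriv_cst (X t) y) => z; rewrite pt_x.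
- by rewrite dcurve_y; apply: deriv_ext (deriv_id y) => z; rewrite pt_y.
- by rewrite dcurve_s; apply: deriv_ext (dv t l y) => z; rewrite pt_s mxE.
Qed.

Lemma deriv_H N be H t y : good N.+1 be H ->
  is_derive (y : R) 1 (fun y => H (curve t y))
    (pd iy H (curve t y) + \sum_l pd (iS l) H (curve t y) * v1 t l y).
Proof.
move=> gH; have := deriv_curve (good_diff gH (curveU t y)) (deriv_curve_i t y).
move=> h; apply: deriv_eq h _.
rewrite sum_idx dcurve_x dcurve_y mulr0 add0r mulr1; congr (_ + _).
by apply: eq_bigr => l _; rewrite dcurve_s.
Qed.

Lemma continuous_curve t : continuous (curve t).
Proof.
move=> y; apply: mx_continuous_entries => i j; rewrite ord1.
apply: differentiable_continuous; apply/derivable1_diffP.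
exact: (@ex_derive _ _ _ _ _ _ _ (deriv_curve_i t y j)).
Qed.

Lemma continuous_H N be H t : good N be H -> continuous (fun y => H (curve t y)).
Proof.
move=> [cH _] y; apply: (@continuous_comp _ _ _ (curve t) H).
  exact: continuous_curve.
by apply: Cb_cont cH _; exact: curveU.
Qed.

Lemma continuous_v1 t l : continuous (v1 t l).
Proof. exact: is_derive_continuous (dv1 t l). Qed.

Definition compK : R := 12 * (K%:R * K%:R + K%:R + 1).

Definition dH H t y := pd iy H (curve t y) + \sum_l pd (iS l) H (curve t y) * v1 t l y.

Lemma continuous_dH N be H t : good N.+1 be H -> continuous (dH H t).
Proof.
move=> gH y; apply: cvgD.   exact: (@continuous_H N be _ t (good_pd iy gH) y).
apply: cvg_sumR => l _; apply: cvgM; last exact: continuous_v1.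
exact: (@continuous_H N be _ t (good_pd (iS l) gH) y).
Qed.

Definition ddH H t y := dH (pd iy H) t y +
  \sum_l (dH (pd (iS l) H) t y * v1 t l y + pd (iS l) H (curve t y) * v2 t l y).

Lemma deriv_sumR (J : finType) (f : J -> R -> R) (df : J -> R) (y : R) :
  (forall j, is_derive y 1 (f j) (df j)) ->
  is_derive y 1 (fun y => \sum_j f j y) (\sum_j df j).
Proof.
move=> h; have H : cderiv (fun t => \sum_j (f j t)%:C%C) y (\sum_j (df j)%:C%C).
  by apply: cderiv_sum => j _; exact: cderivRC.
have [H1 _] := H; move: H1; rewrite Re_sum /=.
by apply: deriv_ext => t; rewrite Re_sum.
Qed.

Lemma deriv_dH N be H t y : good N.+2 be H ->
  is_derive (y : R) 1 (dH H t) (ddH H t y).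
Proof.
move=> gH; apply: derivD; first exact: (@deriv_H N be _ t y (good_pd iy gH)).
apply: deriv_sumR => l.
exact: (derivM (@deriv_H N be _ t y (good_pd (iS l) gH)) (dv1 t l y)).
Qed.

Lemma le_dH N be H t y : good N.+1 be H -> 0 <= be -> `|X t| <= 1 ->
  `|dH H t y| <= K%:R * be.
Proof.
move=> gH be0 Xt; have b i : `|pd i H (curve t y)| <= be.
  by have [c _] := good_pd i gH; apply: Cb_bound c _; exact: curveU.
apply: le_trans (ler_normD _ _) _.
apply: le_trans (_ : be + \sum_(l < M) be <= _).
  apply: lerD => //; apply: le_trans (ler_norm_sum _ _ _) _; apply: ler_sum => l _.
  by rewrite normrM -[leRHS]mulr1; apply: ler_pM => //; exact: v1le.
rewrite sumr_const card_ord -(mulr_natl _ M).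
have KM : (K%:R : R) = 2 + M%:R by rewrite natrD.
rewrite KM; move: (M%:R) => n.
rewrite -subr_ge0.
by have -> : (2 + n) * be - (be + n * be) = be by ring.
Qed.

Lemma le_ddH N be H t y : good N.+2 be H -> 0 <= be -> `|X t| <= 1 ->
  `|ddH H t y| <= (K%:R * K%:R + K%:R) * be.
Proof.
move=> gH be0 Xt; have b i : `|pd i H (curve t y)| <= be.
  by have [c _] := good_pd i gH; apply: Cb_bound c _; exact: curveU.
apply: le_trans (ler_normD _ _) _.
apply: le_trans (_ : K%:R * be + \sum_(l < M) (K%:R * be + be) <= _).
  apply: lerD => //; first exact: (@le_dH N be _ t y (good_pd iy gH) be0 Xt).
  apply: le_trans (ler_norm_sum _ _ _) _; apply: ler_sum => l _.
  apply: le_trans (ler_normD _ _) _; rewrite !normrM; apply: lerD.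
    rewrite -[leRHS]mulr1; apply: ler_pM => //; last exact: v1le.
    exact: (@le_dH N be _ t y (good_pd (iS l) gH) be0 Xt).
  by rewrite -[leRHS]mulr1; apply: ler_pM => //; exact: v2le.
rewrite sumr_const card_ord -(mulr_natl _ M).
have K0 : (0 : R) <= K%:R by [].
have KM : (K%:R : R) = 2 + M%:R by rewrite natrD.
move: K0; rewrite KM; move: (M%:R) => n n0.
rewrite -subr_ge0.
have -> : ((2 + n) * (2 + n) + (2 + n)) * be - ((2 + n) * be + n * ((2 + n) * be + be))
  = (4 + n) * be by ring.
by rewrite mulr_ge0 //; lra.
Qed.

(** The chain rule bounds the composite and its second derivative in y, and both the composite and
    its first derivative vanish at y = 0 and y = 1, so [Abd_bern] applies. For |X t| > 1 everything
    is zero, which is why the curve is controlled only for |X t| <= 1. *)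
Lemma Abd_comp be H : 0 <= be -> good 2 be H ->
  Abd (compK * be) (fun t y => (H (curve t y))%:C%C).
Proof.
move=> be0 gH; rewrite /compK -mulrA.
have [cH vH] := gH.
have zero i t y : off_box (curve t y) -> H (curve t y) = 0 /\ pd i H (curve t y) = 0.
  by move=> h; split; [exact: vH|exact: van_pd].
have c1 : 0 <= (K%:R * K%:R + K%:R + 1) * be.
  by rewrite mulr_ge0 // addr_ge0 // addr_ge0 // mulr_ge0.
have offy0 t : off_box (curve t 0) by apply: Or32; rewrite pt_y; lra.
have offy1 t : off_box (curve t 1) by apply: Or33; rewrite pt_y; lra.
have dH0 t y : off_box (curve t y) -> dH H t y = 0.
  move=> h; rewrite /dH (zero iy t y h).2 big1 ?addr0 // => l _.
  by rewrite (zero (iS l) t y h).2 mul0r.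
have ddH0 t y : off_box (curve t y) -> ddH H t y = 0.
  move=> h; have pz i j : pd i (pd j H) (curve t y) = 0.
    by apply: van_pd h; exact: van_pd.
  have z1 i : \sum_l pd (iS l) (pd i H) (curve t y) * v1 t l y = 0.
    by apply: big1 => l _; rewrite pz mul0r.
  have z2 i : dH (pd i H) t y = 0 by rewrite /dH (pz iy i) (z1 i) addr0.
  rewrite /ddH (z2 iy) add0r; apply: big1 => l _.
  by rewrite (z2 (iS l)) (zero (iS l) t y h).2 !mul0r addr0.
apply: (@Abd_bern R T _ (fun t y => (dH H t y)%:C%C) (fun t y => (ddH H t y)%:C%C)) => //.
- by move=> t y; apply: cderivRC; exact: (@deriv_H 1 be).
- by move=> t y; apply: cderivRC; exact: (@deriv_dH 0 be).
- move=> t; apply: ccontRC => y; apply: cvgD.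
    exact: (@continuous_dH 0 be _ t (good_pd iy gH) y).
  apply: cvg_sumR => l _; apply: cvgD; apply: cvgM.
  + exact: (@continuous_dH 0 be _ t (good_pd (iS l) gH) y).
  + exact: continuous_v1.
  + exact: (@continuous_H 1 be _ t (good_pd (iS l) gH) y).
  + exact: cv2.
- by move=> t; rewrite (zero iy t 0 (offy0 t)).1 (zero iy t 1 (offy1 t)).1.
- by move=> t; rewrite (dH0 t 0 (offy0 t)) (dH0 t 1 (offy1 t)).
- move=> t y _; rewrite cnormRC; apply: le_trans (Cb_bound cH (curveU t y)) _.
  by rewrite ler_peMl // lerDr addr_ge0 // mulr_ge0.
- move=> t y _; rewrite cnormRC; have [h|h] := ltP 1 `|X t|.
    by rewrite ddH0 ?normr0 //; exact: pt_off.
  apply: le_trans (@le_ddH 0 be _ t y gH be0 h) _.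
  by rewrite ler_wpM2r // lerDl.
Qed.

End Family.

End Composites.

(** * Lipschitz estimates for composites *)

Section Differences.
Variable R : realType.
Notation C := (R[i]).
Variable m : nat.
Notation M := (m + m)%N.
Notation K := (1 + 1 + M)%N.
Implicit Types (w : 'I_m -> trig R R) (l : 'I_M) (x y th : R).

Lemma continuous_pairR (S : topologicalType) (a : S) : continuous (fun y : R => (a, y)).
Proof. by move=> y; exact: cvg_pair (cvg_cst _) cvg_id. Qed.

Definition rcomp w l : trig R R :=
  match fintype.split l with inl i => tre (w i) | inr i => tim (w i) end.

Definition rvl w l x y : R :=
  match fintype.split l with
  | inl i => Re (tev (w i) x y) | inr i => Im (tev (w i) x y) end.

Lemma tev_rcomp w l x y : tev (rcomp w l) x y = (rvl w l x y)%:C%C.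
Proof. by rewrite /rcomp /rvl; case: fintype.split => i; [exact: tev_re|exact: tev_im]. Qed.

Lemma tbd_rcomp p w l nu : (forall i, tbd p (w i) nu) -> tbd p (rcomp w l) nu.
Proof. by move=> h; rewrite /rcomp; case: fintype.split => i; [apply: tbd_re|apply: tbd_im]. Qed.

Lemma deriv_rvl w l x y :
  is_derive y 1 (rvl w l x) (rvl (fun i => tder (w i)) l x y).
Proof.
rewrite /rvl; case: fintype.split => i; first exact: (cderiv_tev (w i) x y).1.
exact: (cderiv_tev (w i) x y).2.
Qed.

Lemma continuous_rvl w l x : continuous (rvl w l x).
Proof. exact: is_derive_continuous (deriv_rvl w l x). Qed.

Lemma continuous_rvl2 w l : (forall i j, ccont (tc (w i) j)) ->
  continuous (fun p : R * R => rvl w l p.1 p.2).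
Proof.
move=> cw; rewrite /rvl; case: fintype.split => i.
  exact: (ccont_tev2 (cw i)).1.
exact: (ccont_tev2 (cw i)).2.
Qed.

Lemma rvl_le w l x y nu : (forall i, tbd 0 (w i) nu) -> `|rvl w l x y| <= 2 * nu.
Proof.
move=> h; rewrite /rvl; case: fintype.split => i.
  exact: le_trans (cnorm_Re _) (tev_le _ _ (h i)).
exact: le_trans (cnorm_Im _) (tev_le _ _ (h i)).
Qed.

(** A path from 0 to 1 that stays in [0, 1] for every real parameter: derivatives are taken on the
    whole line, and the convex combinations along the path must remain in the tube. *)
Definition ramp th : R := sin (th * (pi / 2)) ^+ 2.
Definition dramp th : R := 2 * (sin (th * (pi / 2)) * (cos (th * (pi / 2)) * (pi / 2))).

Lemma ramp0 : ramp 0 = 0. Proof. by rewrite /ramp mul0r sin0 expr0n. Qed.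
Lemma ramp1 : ramp 1 = 1. Proof. by rewrite /ramp mul1r sin_pihalf expr1n. Qed.
Lemma ramp_ge0 th : 0 <= ramp th. Proof. exact: sqr_ge0. Qed.
Lemma ramp_le1 th : ramp th <= 1.
Proof. by rewrite /ramp sin2cos2 gerBl sqr_ge0. Qed.
Lemma deriv_ramp th : is_derive th 1 ramp (dramp th).
Proof.
have h1 : is_derive th 1 (fun t : R => t * (pi / 2)) (pi / 2).
  apply: deriv_eq (derivM (deriv_id th) (deriv_cst (pi / 2) th)) _.
  by rewrite mul1r mulr0 addr0.
have h2 := deriv_comp h1 (is_derive_sin _).
apply: deriv_eq (deriv_ext _ (derivM h2 h2)) _.
  by move=> t; rewrite /ramp expr2.
by rewrite /dramp; ring.
Qed.
Lemma dramp_le th : `|dramp th| <= 4.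
Proof.
rewrite /dramp.
have := sin_max (th * (pi / 2)); have := cos_max (th * (pi / 2)).
have c0 : 0 <= pi / 2 :> R by rewrite divr_ge0 // pi_ge0.
have c2 := ltW (@pihalf_lt2 R).
move: (pi / 2) c0 c2 => c c0 c2.
move: (sin _) (cos _) => a b b1 a1.
rewrite !normrM (ger0_norm c0) (ger0_norm (x := 2)) //.
apply: le_trans (_ : 2 * (1 * (1 * 2)) <= _); last by lra.
apply: ler_wpM2l => //; apply: ler_pM => //; first by rewrite mulr_ge0.
exact: ler_pM.
Qed.
Lemma continuous_dramp : continuous dramp.
Proof.
have c1 : continuous (fun th : R => th * (pi / 2)).
  by move=> th; apply: cvgM; [exact: cvg_id|exact: cvg_cst].
move=> th; apply: cvgM; first exact: cvg_cst.
apply: cvgM; last apply: cvgM; last exact: cvg_cst.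
  apply: (@continuous_comp _ _ _ (fun th : R => th * (pi / 2)) sin); first exact: c1.
  exact: continuous_sin.
apply: (@continuous_comp _ _ _ (fun th : R => th * (pi / 2)) cos); first exact: c1.
exact: continuous_cos.
Qed.

Variables (U : set 'rV[R]_K) (rho : R) (s : R).
Hypothesis Uoff : @off_box R m `<=` U.
Hypothesis Urho : forall q : 'rV[R]_K, (forall l, `|q 0 (iS l)| < rho) -> U q.

(** The Gaussian weight between the unknown w of the linear problem and S = om w. *)
Definition om x : R := expR (s ^+ 2 / 2 * x ^+ 2).
Definition om1 : R := expR (s ^+ 2 / 2).

Lemma om_gt0 x : 0 < om x. Proof. exact: expR_gt0. Qed.
Lemma om_ge1 x : 1 <= om x.
Proof. by rewrite -expR0 ler_expR mulr_ge0 ?divr_ge0 ?sqr_ge0. Qed.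
Lemma om_le x : `|x| <= 1 -> om x <= om1.
Proof.
move=> x1; rewrite ler_expR ler_piMr ?divr_ge0 ?sqr_ge0 //.
by rewrite -real_normK ?num_real // expr_le1.
Qed.
Lemma om1_ge1 : 1 <= om1.
Proof. by rewrite -expR0 ler_expR divr_ge0 ?sqr_ge0. Qed.
Lemma continuous_om : continuous om.
Proof.
have D (x : R) := deriv_expR (derivM (deriv_cst (s ^+ 2 / 2) x) (deriv_sq x)).
exact: is_derive_continuous D.
Qed.
Lemma continuous_omV : continuous (fun x => (om x)^-1).
Proof. by move=> x; apply: cvgV; [rewrite gt_eqF // om_gt0|exact: continuous_om]. Qed.

(** The last three conditions are the requirements of [Abd_comp] on om w and its first two
    derivatives in y for |x| <= 1; the 2 is that of [tev_le]. *)
Definition small w (n0 n1 n2 : R) : Prop :=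
  [/\ forall i, tbd 0 (w i) n0 /\ tbd 0 (tder (w i)) n1 /\ tbd 0 (tder (tder (w i))) n2,
      forall i j, ccont (tc (w i) j),
      2 * (om1 * n0) < rho, 2 * (om1 * n1) <= 1 & 2 * (om1 * n2) <= 1].

Definition ov w l x y := om x * rvl w l x y.
Definition qw w x y : 'rV[R]_K := pt x y (\row_l ov w l x y).

Section Path.
Variables (w w' : 'I_m -> trig R R) (n0 n1 n2 : R).
Hypothesis sw : small w n0 n1 n2.
Hypothesis sw' : small w' n0 n1 n2.

(** The operation [d] stands for zero, one or two derivatives in y, so that differentiating a
    mixture gives a mixture. *)
Definition mix (d : trig R R -> trig R R) th l x y :=
  om x * (ramp th * rvl (fun i => d (w i)) l x y + (1 - ramp th) * rvl (fun i => d (w' i)) l x y).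

Lemma mix_le d th l x y nu : (forall i, tbd 0 (d (w i)) nu) ->
  (forall i, tbd 0 (d (w' i)) nu) -> `|x| <= 1 -> `|mix d th l x y| <= 2 * (om1 * nu).
Proof.
move=> h h' x1; rewrite normrM (gtr0_norm (om_gt0 x)) mulrCA.
apply: ler_pM => //; first exact: ltW (om_gt0 x); first exact: om_le.
have := ramp_ge0 th; have := ramp_le1 th; move: (ramp th) => r r1 r0.
apply: le_trans (ler_normD _ _) _; rewrite !normrM.
rewrite (ger0_norm r0) (ger0_norm (x := 1 - _)) ?subr_ge0 //.
have -> : 2 * nu = r * (2 * nu) + (1 - r) * (2 * nu) by ring.
by apply: lerD; apply: ler_wpM2l; rewrite ?subr_ge0 //; exact: rvl_le.
Qed.

Lemma deriv_mix d th l x y :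
  is_derive y 1 (mix d th l x) (mix (fun z => tder (d z)) th l x y).
Proof.
have h1 := derivM (deriv_cst (ramp th) y) (deriv_rvl (fun i => d (w i)) l x y).
have h2 := derivM (deriv_cst (1 - ramp th) y) (deriv_rvl (fun i => d (w' i)) l x y).
apply: deriv_eq (derivM (deriv_cst (om x) y) (derivD h1 h2)) _.
by rewrite /mix !mul0r !add0r.
Qed.

Definition qmix th x y : 'rV[R]_K := pt x y (\row_l mix id th l x y).

Lemma qmix1 x y : qmix 1 x y = qw w x y.
Proof.
rewrite /qmix /qw; congr pt; apply/rowP => l; rewrite !mxE /mix /ov ramp1.
by rewrite mul1r subrr mul0r addr0.
Qed.

Lemma qmix0 x y : qmix 0 x y = qw w' x y.
Proof.
rewrite /qmix /qw; congr pt; apply/rowP => l; rewrite !mxE /mix /ov ramp0.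
by rewrite mul0r add0r subr0 mul1r.
Qed.

Variables (T : Type) (Th : T -> R) (X : T -> R).

Lemma Abd_mix be H : 0 <= be -> good U 2 be H ->
  Abd (compK R m * be) (fun t y => (H (qmix (Th t) (X t) y))%:C%C).
Proof.
move=> be0 gH; have [b _ e0 e1 e2] := sw; have [b' _ _ _ _] := sw'.
have dv0 t l y := deriv_mix id (Th t) l (X t) y.
have dv1 t l y := deriv_mix (@tder R R) (Th t) l (X t) y.
have dv2 t l y := deriv_mix (fun z => tder (tder z)) (Th t) l (X t) y.
have cv2 t l : continuous (mix (fun z => tder (tder z)) (Th t) l (X t)).
  exact: (is_derive_continuous (dv2 t l)).
have b0 t l y : `|X t| <= 1 -> `|mix id (Th t) l (X t) y| < rho.
  by move=> x1; apply: le_lt_trans e0; apply: mix_le => // i; [have [] := b i|have [] := b' i].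
have b1 t l y : `|X t| <= 1 -> `|mix (@tder R R) (Th t) l (X t) y| <= 1.
  by move=> x1; apply: le_trans e1; apply: mix_le => // i; [have [_ []] := b i|have [_ []] := b' i].
have b2 t l y : `|X t| <= 1 -> `|mix (fun z => tder (tder z)) (Th t) l (X t) y| <= 1.
  by move=> x1; apply: le_trans e2; apply: mix_le => // i; [have [_ []] := b i|have [_ []] := b' i].
exact: (@Abd_comp R m U rho Uoff Urho T X _ _ _ dv0 dv1 cv2 b0 b1 b2 be H be0 gH).
Qed.

Lemma qmixU th x y : U (qmix th x y).
Proof.
have [b _ e0 _ _] := sw; have [b' _ _ _ _] := sw'.
have [h|h] := ltP 1 `|x|; first by apply: Uoff; exact: pt_off.
apply: Urho => l; rewrite pt_s mxE; apply: le_lt_trans e0; apply: mix_le => // i.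
  by have [] := b i.
by have [] := b' i.
Qed.

Lemma continuous_qmix x : continuous (fun p : R * R => qmix p.1 x p.2).
Proof.
move=> p; apply: mx_continuous_entries => i j; rewrite ord1.
move: j; apply: idx_case => [||l].
- rewrite (_ : (fun _ => _) = fun=> x); first exact: cst_continuous.
  by apply/funext => z; rewrite pt_x.
- rewrite (_ : (fun _ => _) = fun z : R * R => z.2); first exact: cvg_snd.
  by apply/funext => z; rewrite pt_y.
rewrite (_ : (fun _ => _) = fun z : R * R => mix id z.1 l x z.2); last first.
  by apply/funext => z; rewrite pt_s mxE.
have cr : {for p, continuous (fun z : R * R => ramp z.1)}.
  apply: (@continuous_comp _ _ _ (fun z : R * R => z.1) ramp); first exact: cvg_fst.
  exact: (is_derive_continuous deriv_ramp).
have cv u : {for p, continuous (fun z : R * R => rvl u l x z.2)}.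
  apply: (@continuous_comp _ _ _ (fun z : R * R => z.2) (rvl u l x)); first exact: cvg_snd.
  exact: continuous_rvl.
apply: continuousM; first exact: cst_continuous.
apply: continuousD; first exact: continuousM.
apply: continuousM => //; apply: continuousB => //; exact: cst_continuous.
Qed.

End Path.

(** Differentiate H along the path from w' to w. The derivative carries a factor om, which cancels
    against its inverse, so the Lipschitz constant does not depend on s: this is why the gain 1 / s
    can win. The 8 is the 2 of [Abd_path] times the 4 of [dramp_le]. *)
Lemma Abd_diff w w' n0 n1 n2 be H (D : 'I_M -> trig R R) d :
  small w n0 n1 n2 -> small w' n0 n1 n2 -> 0 <= be -> good U 3 be H ->
  (forall l, tbd 0 (D l) d) ->
  (forall l x y, tev (D l) x y = (rvl w l x y - rvl w' l x y)%:C%C) ->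
  Abd (8 * (M%:R * (compK R m * be * d)))
    (fun x y => ((om x)^-1 * (H (qw w x y) - H (qw w' x y)))%:C%C).
Proof.
move=> sw sw' be0 gH bD eD.
pose kk x th y : C := ((om x)^-1 * H (qmix w w' th x y))%:C%C.
pose dk x th y : C := (dramp th)%:C%C *
  \sum_l (pd (iS l) H (qmix w w' th x y))%:C%C * tev (D l) x y.
have gW := goodW gH.
have cH i x : continuous (fun p : R * R => pd i H (qmix w w' p.1 x p.2)).
  move=> p; apply: (@continuous_comp _ _ _ (fun p : R * R => qmix w w' p.1 x p.2) (pd i H)).
    exact: continuous_qmix.
  by apply: Cb_cont (good_pd i gH).1 _; exact: (qmixU sw sw').
have cHy th x : continuous (fun y => H (qmix w w' th x y)).
  move=> y; apply: (@continuous_comp _ _ _ (qmix w w' th x) H).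
    apply: (@continuous_comp _ _ _ (fun y => (th, y)) (fun p : R * R => qmix w w' p.1 x p.2)).
      exact: continuous_pairR.
    exact: continuous_qmix.
  by apply: Cb_cont gH.1 _; exact: (qmixU sw sw').
apply: (@Abd_ext R R (fun x y => kk x 1 y - kk x 0 y)).
  move=> x y; rewrite /kk qmix1 qmix0.
  by apply: ceqP; rewrite !ReImE ?subrr //; ring.
have -> : 8 * (M%:R * (compK R m * be * d)) = 2 * (4 * (M%:R * (compK R m * be * d))).
  by ring.
apply: (@Abd_path R R kk dk).
- by move=> x th; apply: ccontRC => y; apply: cvgM; [exact: cvg_cst|exact: cHy].
- move=> x th y; rewrite /kk /dk.
  have dq l : is_derive th 1 (fun th => mix w w' id th l x y)
     (om x * (dramp th * (rvl w l x y - rvl w' l x y))).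
    have h1 := derivM (deriv_ramp th) (deriv_cst (rvl w l x y) th).
    have h2 := derivM (derivB (deriv_cst 1 th) (deriv_ramp th)) (deriv_cst (rvl w' l x y) th).
    apply: deriv_eq (derivM (deriv_cst (om x) th) (derivD h1 h2)) _.
    by ring.
  have dqq i : is_derive th 1 (fun th => qmix w w' th x y 0 i)
     (match fintype.split i with inr l => om x * (dramp th * (rvl w l x y - rvl w' l x y))
       | inl _ => 0 end).
    move: i; apply: idx_case => [||l].
    + rewrite /ix (unsplitK (inl _)); apply: deriv_ext (deriv_cst x th) => z.
      by rewrite pt_x.
    + rewrite /iy (unsplitK (inl _)); apply: deriv_ext (deriv_cst y th) => z.
      by rewrite pt_y.
    + rewrite {2}/iS (unsplitK (inr l)); apply: deriv_ext (dq l) => z.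
      by rewrite pt_s mxE.
  have h := @deriv_curve R K H (fun th => qmix w w' th x y) _ th (good_diff gH (qmixU sw sw' th x y)) dqq.
  apply: cderiv_eq (cderivRC (derivM (deriv_cst (om x)^-1 th) h)) _.
  rewrite sum_idx /ix /iy !(unsplitK (inl _)) !mulr0 !add0r mul0r add0r.
  have -> : \sum_l (pd (iS l) H (qmix w w' th x y))%:C%C * tev (D l) x y =
      (\sum_l pd (iS l) H (qmix w w' th x y) * (rvl w l x y - rvl w' l x y))%:C%C.
    rewrite (big_morph (fun r : R => (r%:C)%C) (id1 := 0) (op1 := +%R)) //.
      by apply: eq_bigr => l _; rewrite eD; apply: ceqP; rewrite !ReImE; ring.
    by move=> u v; apply: ceqP; rewrite !ReImE // addr0.
  have RCM (u v : R) : u%:C%C * v%:C%C = (u * v)%:C%C.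
    by apply: ceqP; rewrite !ReImE; ring.
  rewrite RCM; congr (_%:C%C); rewrite !mulr_sumr; apply: eq_bigr => l _.
  rewrite /iS (unsplitK (inr l)).
  by field; rewrite gt_eqF // om_gt0.
- move=> x; apply: ccontM.
    apply: ccontRC => p; apply: (@continuous_comp _ _ _ (fun p : R * R => p.1) dramp).
      exact: cvg_fst.
    exact: continuous_dramp.
  apply: ccont_sum => l _; apply: ccontM; first by apply: ccontRC; exact: cH.
  by apply: (ccont_comp (h := snd)); [move=> p; exact: cvg_snd|exact: ccont_tev].
set T' := (R * _)%type.
have cy (t : T') l : ccont (fun y => (pd (iS l) H (qmix w w' (sval t.2) t.1 y))%:C%C).
  apply: ccontRC => y.
  apply: (@continuous_comp _ _ _ (fun y => (sval t.2, y))
     (fun p : R * R => pd (iS l) H (qmix w w' p.1 t.1 p.2))).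
    exact: continuous_pairR.
  exact: cH.
apply: (@Abd_mulc R T' (fun t y => \sum_l (pd (iS l) H (qmix w w' (sval t.2) t.1 y))%:C%C * tev (D l) t.1 y)
   _ (fun t => (dramp (sval t.2))%:C%C)) => //.
- move=> t; apply: ccont_sum => l _; apply: ccontM; first exact: cy.
  exact: ccont_tev.
- by move=> t; rewrite cnormRC; exact: dramp_le.
have -> : M%:R * (compK R m * be * d) = \sum_(l < M) (compK R m * be * d).
  by rewrite sumr_const card_ord mulr_natl.
apply: (@Abd_sum R T' _ (fun l t y => (pd (iS l) H (qmix w w' (sval t.2) t.1 y))%:C%C * tev (D l) t.1 y)).
  by move=> l t; apply: ccontM; [exact: cy|exact: ccont_tev].
move=> l.
apply: (@Abd_mul R T' (fun t y => (pd (iS l) H (qmix w w' (sval t.2) t.1 y))%:C%C) _ (tcomp (D l) fst)).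
- by move=> t; exact: cy.
- exact: (Abd_mix sw sw' (fun t : T' => sval t.2) (fun t : T' => t.1) be0 (good_pd (iS l) gH)).
- exact: tbd_comp.
Qed.

End Differences.

(** * Estimates for the nonlinear source *)

Section SourceEstimates.
Variable R : realType.
Notation C := (R[i]).
Variable m : nat.
Notation M := (m + m)%N.
Notation K := (1 + 1 + M)%N.
Variables (U : set 'rV[R]_K) (rho : R) (s : R).
Hypothesis Uoff : @off_box R m `<=` U.
Hypothesis Urho : forall q : 'rV[R]_K, (forall l, `|q 0 (iS l)| < rho) -> U q.
Variables (a : 'I_M -> 'rV[R]_K -> R) (b : 'I_M -> 'I_M -> 'rV[R]_K -> R) (be del : R).
Hypothesis be0 : 0 <= be.
Hypothesis del0 : 0 <= del.
Hypothesis ga : forall l, good U 4 be (a l).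
Hypothesis gb : forall j l, good U 3 be (b j l).

(** Smallness on the zero section v = 0, in the form consumed by [Abd_bern] when y alone varies. *)
Definition atzero (H : 'rV[R]_K -> R) : Prop := forall x y,
  `|H (pt x y 0)| <= del /\ `|pd (iy m) (pd (iy m) H) (pt x y 0)| <= del.

Hypothesis za : forall l, atzero (a l) /\ atzero (pd (iy m) (a l)).
Hypothesis zb : forall j l, atzero (b j l).

Notation small := (@small R m rho s).
Notation om := (om s).
Notation om1 := (om1 s).
Notation qw := (qw s).
Implicit Types (w : 'I_m -> trig R R) (l : 'I_M) (x y : R).

Lemma RCD (u v : R) : (u + v)%:C%C = u%:C%C + v%:C%C.
Proof. by apply: ceqP; rewrite !ReImE // addr0. Qed.
Lemma RCM (u v : R) : (u * v)%:C%C = u%:C%C * v%:C%C.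
Proof. by apply: ceqP; rewrite !ReImE; ring. Qed.
Lemma RC_sum (J : finType) (F : J -> R) : (\sum_j F j)%:C%C = \sum_j (F j)%:C%C.
Proof. exact: (big_morph (fun r : R => (r%:C)%C) RCD). Qed.

Definition tder1 w : 'I_m -> trig R R := fun i => tder (w i).
Definition wzero : 'I_m -> trig R R := fun _ => @Trig R R 'I_0 (fun _ => 0) (fun _ _ => 0).

Lemma rvl_wzero l x y : rvl wzero l x y = 0.
Proof. by rewrite /rvl; case: fintype.split => i; rewrite /tev big_ord0. Qed.

Lemma tbd_empty p (w : trig R R) n : 0 <= n -> #|tJ w| = 0%N -> tbd p w n.
Proof.
move=> n0 w0; exists (fun=> 0); split=> // [j|]; last by rewrite big1.
by have := fintype0 j w0.
Qed.

Lemma small_wzero w n0 n1 n2 : 0 <= n0 -> 0 <= n1 -> 0 <= n2 -> small w n0 n1 n2 -> small wzero n0 n1 n2.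
Proof.
move=> n00 n10 n20 [_ _ h1 h2 h3]; split=> // [i|i j]; last by case: j.
by split; [|split]; apply: tbd_empty; rewrite ?card_ord.
Qed.

Lemma qw_wzero x y : qw wzero x y = pt x y 0.
Proof.
by rewrite /qw; congr pt; apply/rowP => l; rewrite !mxE /ov rvl_wzero mulr0.
Qed.

Section Fixed.
Variables (w : 'I_m -> trig R R) (n0 n1 n2 : R).
Hypothesis sw : small w n0 n1 n2.
Hypothesis (n00 : 0 <= n0) (n10 : 0 <= n1) (n20 : 0 <= n2).

Let ovl l x := ov s w l x.

Lemma deriv_ov w' l x y : is_derive y 1 (ov s w' l x) (ov s (tder1 w') l x y).
Proof.
apply: deriv_eq (derivM (deriv_cst (om x) y) (deriv_rvl w' l x y)) _.
by rewrite mul0r add0r.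
Qed.

Lemma ov_le w' l x y nu : (forall i, tbd 0 (w' i) nu) -> `|x| <= 1 ->
  `|ov s w' l x y| <= 2 * (om1 * nu).
Proof.
move=> h x1; rewrite normrM (gtr0_norm (om_gt0 s x)) mulrCA.
by apply: ler_pM => //; [exact: ltW (om_gt0 s x)|exact: om_le|exact: rvl_le].
Qed.

Lemma small_rho l x y : `|x| <= 1 -> `|ov s w l x y| < rho.
Proof.
have [h _ e0 _ _] := sw.
by move=> x1; apply: le_lt_trans e0; apply: ov_le => // i; have [] := h i.
Qed.

Lemma small_v1 l x y : `|x| <= 1 -> `|ov s (tder1 w) l x y| <= 1.
Proof.
have [h _ _ e1 _] := sw.
by move=> x1; apply: le_trans e1; apply: ov_le => // i; have [_ []] := h i.
Qed.

Lemma small_v2 l x y : `|x| <= 1 -> `|ov s (tder1 (tder1 w)) l x y| <= 1.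
Proof.
have [h _ _ _ e2] := sw.
by move=> x1; apply: le_trans e2; apply: ov_le => // i; have [_ []] := h i.
Qed.

Let dv (x : R) l y := deriv_ov w l x y.
Let dv1 (x : R) l y := deriv_ov (tder1 w) l x y.
Let cv2 (x : R) l : continuous (ov s (tder1 (tder1 w)) l x) :=
  is_derive_continuous (deriv_ov (tder1 (tder1 w)) l x).
Let vrho (x : R) l y := @small_rho l x y.
Let v1le (x : R) l y := @small_v1 l x y.
Let v2le (x : R) l y := @small_v2 l x y.

Lemma qwU x y : U (qw w x y).
Proof. exact: (@curveU R m U rho Uoff Urho R id (fun x l y => ov s w l x y) vrho x y). Qed.

Lemma Abd_qw H : good U 2 be H -> Abd (compK R m * be) (fun x y => (H (qw w x y))%:C%C).
Proof.
exact: (@Abd_comp R m U rho Uoff Urho R id (fun x l y => ov s w l x y)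
  (fun x l y => ov s (tder1 w) l x y) (fun x l y => ov s (tder1 (tder1 w)) l x y)
  dv dv1 cv2 vrho v1le v2le be H be0).
Qed.

Lemma deriv_qw N H x y : good U N.+1 be H ->
  is_derive y 1 (fun y => H (qw w x y))
    (pd (iy m) H (qw w x y) + \sum_l pd (iS l) H (qw w x y) * ov s (tder1 w) l x y).
Proof.
exact: (@deriv_H R m U rho Uoff Urho R id (fun x l y => ov s w l x y)
  (fun x l y => ov s (tder1 w) l x y) dv vrho N be H x y).
Qed.

Lemma continuous_qw : continuous (fun p : R * R => qw w p.1 p.2).
Proof.
have [_ cw _ _ _] := sw.
move=> p; apply: mx_continuous_entries => i j; rewrite ord1.
move: j; apply: idx_case => [||l].
- rewrite (_ : (fun _ => _) = fun z : R * R => z.1); first exact: cvg_fst.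
  by apply/funext => z; rewrite pt_x.
- rewrite (_ : (fun _ => _) = fun z : R * R => z.2); first exact: cvg_snd.
  by apply/funext => z; rewrite pt_y.
rewrite (_ : (fun _ => _) = fun z : R * R => ov s w l z.1 z.2); last first.
  by apply/funext => z; rewrite pt_s mxE.
apply: continuousM; last exact: continuous_rvl2.
apply: (@continuous_comp _ _ _ (fun z : R * R => z.1) om); first exact: cvg_fst.
exact: continuous_om.
Qed.

Lemma continuous_Hqw N H : good U N be H -> continuous (fun p : R * R => H (qw w p.1 p.2)).
Proof.
move=> gH p; apply: (@continuous_comp _ _ _ (fun p : R * R => qw w p.1 p.2) H).
  exact: continuous_qw.
by apply: Cb_cont gH.1 _; exact: qwU.
Qed.

Lemma continuous_Hqwy N H x : good U N be H -> continuous (fun y => H (qw w x y)).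
Proof.
move=> gH y; apply: (@continuous_comp _ _ _ (fun y => (x, y)) (fun p : R * R => H (qw w p.1 p.2))).
  exact: continuous_pairR.
exact: (@continuous_Hqw N).
Qed.

Lemma ccont_Hqwy N H x : good U N be H -> ccont (fun y => (H (qw w x y))%:C%C).
Proof. by move=> gH; apply: ccontRC; exact: (@continuous_Hqwy N). Qed.

End Fixed.

Definition c8 : R := 8 * (M%:R * compK R m).

Lemma compK_ge0 : 0 <= compK R m.
Proof. by rewrite /compK mulr_ge0 // addr_ge0 // addr_ge0 // mulr_ge0. Qed.
Lemma c8_ge0 : 0 <= c8. Proof. by rewrite /c8 !mulr_ge0 // compK_ge0. Qed.

Lemma cnorm_omV x : cnorm ((om x)^-1)%:C%C <= 1.
Proof.
rewrite cnormRC ger0_norm ?invr_ge0; last exact: ltW (om_gt0 s x).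
by rewrite -[leRHS]invr1 lef_pV2 ?posrE ?om_gt0 // om_ge1.
Qed.

Section Fixed2.
Variables (w : 'I_m -> trig R R) (n0 n1 n2 : R).
Hypothesis sw : small w n0 n1 n2.
Hypothesis (n00 : 0 <= n0) (n10 : 0 <= n1) (n20 : 0 <= n2).
Let sz := small_wzero n00 n10 n20 sw.

Lemma Abd_zero H : good U 2 be H -> atzero H ->
  Abd (12 * del) (fun x y => (H (qw wzero x y))%:C%C).
Proof.
move=> gH zH; have [cH vH] := gH.
have gy := good_pd (iy m) gH.
have D1 N H' x y : good U N.+1 be H' ->
   is_derive y 1 (fun y => H' (qw wzero x y)) (pd (iy m) H' (qw wzero x y)).
  move=> gH'; apply: deriv_eq (deriv_qw sz x y gH') _.
  rewrite big1 ?addr0 // => l _.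
  rewrite /ov (_ : rvl _ _ _ _ = 0) ?mulr0 ?mulr0 //.
  by rewrite /rvl; case: fintype.split => i; rewrite /tev big_ord0.
have o0 x : off_box (qw wzero x 0) by apply: Or32; rewrite pt_y; lra.
have o1 x : off_box (qw wzero x 1) by apply: Or33; rewrite pt_y; lra.
pose f0 x y : C := (H (qw wzero x y))%:C%C.
pose f1 x y : C := (pd (iy m) H (qw wzero x y))%:C%C.
pose f2 x y : C := (pd (iy m) (pd (iy m) H) (qw wzero x y))%:C%C.
have d0 x y : cderiv (f0 x) y (f1 x y) by apply: cderivRC; exact: (D1 1%N).
have d1 x y : cderiv (f1 x) y (f2 x y) by apply: cderivRC; exact: (D1 0%N).
have c2 x : ccont (f2 x) by exact: (ccont_Hqwy sz x (good_pd (iy m) gy)).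
have b0 x : f0 x 0 = f0 x 1 by rewrite /f0 (vH _ (o0 x)) (vH _ (o1 x)).
have b1 x : f1 x 0 = f1 x 1 by rewrite /f1 (gy.2 _ (o0 x)) (gy.2 _ (o1 x)).
have l0 x y : 0 <= y <= 1 -> cnorm (f0 x y) <= del.
  by move=> _; rewrite cnormRC qw_wzero; have [] := zH x y.
have l2 x y : 0 <= y <= 1 -> cnorm (f2 x y) <= del.
  by move=> _; rewrite cnormRC qw_wzero; have [] := zH x y.
exact: (@Abd_bern R R f0 f1 f2 del del0 d0 d1 c2 b0 b1 l0 l2).
Qed.

Definition NB : R := c8 * be * n0 + 12 * del.

Lemma NB_ge0 : 0 <= NB.
Proof. by rewrite /NB addr_ge0 // !mulr_ge0 // c8_ge0. Qed.

(** The composite is its value on the zero section, of order del, plus a difference that is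
    Lipschitz in w, of order n0. *)
Lemma Abd_omV_H H : good U 3 be H -> atzero H ->
  Abd NB (fun x y => ((om x)^-1 * H (qw w x y))%:C%C).
Proof.
move=> gH zH; have g2 := goodW gH.
have e x y : ((om x)^-1 * (H (qw w x y) - H (qw wzero x y)))%:C%C +
   ((om x)^-1)%:C%C * (H (qw wzero x y))%:C%C = ((om x)^-1 * H (qw w x y))%:C%C.
  by apply: ceqP; rewrite !ReImE; ring.
apply: Abd_ext e _; rewrite /NB; apply: Abd_add.
- move=> x; apply: ccontRC => y; apply: cvgM; first exact: cvg_cst.
  by apply: cvgB; [exact: (continuous_Hqwy sw gH)|exact: (continuous_Hqwy sz gH)].
- by move=> x; apply: ccontM; [exact: ccont_cst|exact: (ccont_Hqwy sz x gH)].
- have -> : c8 * be * n0 = 8 * (M%:R * (compK R m * be * n0)) by rewrite /c8; ring.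
  apply: (Abd_diff Uoff Urho sw sz be0 gH (D := rcomp w)).
    by move=> l; apply: tbd_rcomp => i; have [h _ _ _ _] := sw; have [] := h i.
  by move=> l x y; rewrite tev_rcomp rvl_wzero subr0.
rewrite -[12 * del]mul1r; apply: Abd_mulc => //.
- by move=> x; exact: (ccont_Hqwy sz x gH).
- exact: cnorm_omV.
- exact: Abd_zero.
Qed.

(** Multiplying back by om costs om1, the composite being zero for |x| > 1. *)
Lemma Abd_H H : good U 3 be H -> atzero H ->
  Abd (om1 * NB) (fun x y => (H (qw w x y))%:C%C).
Proof.
move=> gH zH.
have e x y : (if `|x| <= 1 then (om x)%:C%C else 0) * ((om x)^-1 * H (qw w x y))%:C%C
   = (H (qw w x y))%:C%C.
  case: ifP => x1.
    by apply: ceqP; rewrite !ReImE ?mul0r ?subr0 ?mulr0 ?addr0 // mulVKf ?gt_eqF ?om_gt0.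
  by rewrite mul0r gH.2 //; apply: pt_off; rewrite ltNge x1.
apply: Abd_ext e _; apply: Abd_mulc.
- move=> x; apply: ccontRC => y; apply: cvgM; first exact: cvg_cst.
  exact: (continuous_Hqwy sw gH).
- exact: le_trans (om1_ge1 s).
- move=> x; case: ifP => x1; last by rewrite cnorm0 (le_trans _ (om1_ge1 s)).
  by rewrite cnormRC gtr0_norm ?om_gt0 // om_le.
- exact: Abd_omV_H.
Qed.

(** With S = om w, the equation S_x + i S_y + a + S_y b = 0 divided by om reads w_x + i w_y + s^2 x
    w = - G. The inverse weight survives on a only, since S_y = om w_y. *)
Definition G l x y : R := (om x)^-1 * a l (qw w x y) +
  \sum_j rvl (tder1 w) j x y * b j l (qw w x y).

Definition dGb j l x y : R := pd (iy m) (b j l) (qw w x y) +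
  \sum_k pd (iS k) (b j l) (qw w x y) * ov s (tder1 w) k x y.

Definition dG l x y : R := (om x)^-1 * (pd (iy m) (a l) (qw w x y) +
    \sum_k pd (iS k) (a l) (qw w x y) * ov s (tder1 w) k x y) +
  \sum_j (rvl (tder1 (tder1 w)) j x y * b j l (qw w x y) +
          rvl (tder1 w) j x y * dGb j l x y).

Lemma deriv_G l x y : is_derive y 1 (G l x) (dG l x y).
Proof.
apply: derivD.
  apply: deriv_eq (derivM (deriv_cst (om x)^-1 y) (deriv_qw sw x y (ga l))) _.
  by rewrite mul0r add0r.
apply: deriv_sumR => j.
exact: (derivM (deriv_rvl (tder1 w) j x y) (deriv_qw sw x y (gb j l))).
Qed.

Lemma ccont_Gc l x y : (G l x y)%:C%C = ((om x)^-1 * a l (qw w x y))%:C%C +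
   \sum_j (b j l (qw w x y))%:C%C * tev (rcomp (tder1 w) j) x y.
Proof.
rewrite /G RCD RC_sum; congr (_ + _); apply: eq_bigr => j _.
by rewrite tev_rcomp RCM mulrC.
Qed.

Lemma tbd_p1 j : tbd 0 (rcomp (tder1 w) j) n1.
Proof. by apply: tbd_rcomp => i; have [h _ _ _ _] := sw; have [_ []] := h i. Qed.

Lemma tbd_p2 j : tbd 0 (rcomp (tder1 (tder1 w)) j) n2.
Proof. by apply: tbd_rcomp => i; have [h _ _ _ _] := sw; have [_ []] := h i. Qed.

Lemma Abd_sumM (F : 'I_M -> R -> R -> C) c : (forall j x, ccont (F j x)) ->
  (forall j, Abd c (F j)) -> Abd (M%:R * c) (fun x y => \sum_j F j x y).
Proof.
move=> cF aF; have -> : M%:R * c = \sum_(l < M) c.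
  by rewrite sumr_const card_ord mulr_natl.
exact: Abd_sum.
Qed.

Lemma Abd_G l : Abd (NB + M%:R * (om1 * NB * n1)) (fun x y => (G l x y)%:C%C).
Proof.
have g3 := goodW (ga l).
apply: (Abd_ext (fun x y => esym (ccont_Gc l x y))).
have cc j x : ccont (fun y => (b j l (qw w x y))%:C%C * tev (rcomp (tder1 w) j) x y).
  by apply: ccontM; [exact: (ccont_Hqwy sw x (gb j l))|exact: ccont_tev].
apply: Abd_add.
- move=> x; apply: ccontRC => y; apply: cvgM; first exact: cvg_cst.
  exact: (continuous_Hqwy sw g3).
- by move=> x; exact: ccont_sum.
- by apply: Abd_omV_H => //; have [] := za l.
apply: Abd_sumM => // j; apply: Abd_mul.
- by move=> x; exact: (ccont_Hqwy sw x (gb j l)).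
- exact: Abd_H.
- exact: tbd_p1.
Qed.

Lemma ccont_dGc l x y : (dG l x y)%:C%C =
   ((om x)^-1 * pd (iy m) (a l) (qw w x y))%:C%C +
   (\sum_k (pd (iS k) (a l) (qw w x y))%:C%C * tev (rcomp (tder1 w) k) x y +
   (\sum_j (b j l (qw w x y))%:C%C * tev (rcomp (tder1 (tder1 w)) j) x y +
   (\sum_j (pd (iy m) (b j l) (qw w x y))%:C%C * tev (rcomp (tder1 w) j) x y +
    \sum_j \sum_k (if `|x| <= 1 then (om x)%:C%C else 0) *
      ((pd (iS k) (b j l) (qw w x y))%:C%C * tev (rcomp (tder1 w) k) x y *
       tev (rcomp (tder1 w) j) x y)))).
Proof.
have o0 : om x != 0 by rewrite gt_eqF // om_gt0.
rewrite /dG mulrDr RCD [in LHS]RCD -addrA; congr (_ + _); rewrite mulr_sumr !RC_sum -!big_split /=.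
apply: eq_bigr => j _; congr (_ + _).
  by rewrite tev_rcomp -RCM; congr (_%:C%C); rewrite /ov; field.
rewrite RCD !RCM !tev_rcomp mulrC; congr (_ + _).
rewrite /dGb RCD mulrDr mulrC; congr (_ + _); rewrite RC_sum mulr_sumr; apply: eq_bigr => k _.
rewrite !tev_rcomp; case: ifP => x1; first by rewrite /ov !RCM; ring.
rewrite (_ : pd (iS k) (b j l) _ = 0) ?mul0r ?mulr0 ?RCM ?mul0r ?mulr0 //.
by apply: (good_pd (iS k) (gb j l)).2; apply: pt_off; rewrite ltNge x1.
Qed.

(** The second derivative of w appears only multiplied by b, which is of order [NB]. In the terms
    that are quadratic in w_y one factor om is left over and is bounded by om1 on |x| <= 1. *)
Lemma Abd_dG l : Abd (NB + (M%:R * (compK R m * be * n1) +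
   (M%:R * (om1 * NB * n2) + (M%:R * (compK R m * be * n1) +
    M%:R * (M%:R * (om1 * (compK R m * be * n1 * n1)))))))
   (fun x y => (dG l x y)%:C%C).
Proof.
have g3 := goodW (ga l); have gy := good_pd (iy m) (ga l).
apply: (Abd_ext (fun x y => esym (ccont_dGc l x y))).
have ck k x : ccont (fun y => (pd (iS k) (a l) (qw w x y))%:C%C * tev (rcomp (tder1 w) k) x y).
  by apply: ccontM; [exact: (ccont_Hqwy sw x (good_pd (iS k) (ga l)))|exact: ccont_tev].
have cb j x : ccont (fun y => (b j l (qw w x y))%:C%C * tev (rcomp (tder1 (tder1 w)) j) x y).
  by apply: ccontM; [exact: (ccont_Hqwy sw x (gb j l))|exact: ccont_tev].
have cb1 j x : ccont (fun y => (pd (iy m) (b j l) (qw w x y))%:C%C * tev (rcomp (tder1 w) j) x y).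
  by apply: ccontM; [exact: (ccont_Hqwy sw x (good_pd (iy m) (gb j l)))|exact: ccont_tev].
have cb2' j k x : ccont (fun y => (pd (iS k) (b j l) (qw w x y))%:C%C * tev (rcomp (tder1 w) k) x y).
  by apply: ccontM; [exact: (ccont_Hqwy sw x (good_pd (iS k) (gb j l)))|exact: ccont_tev].
have cb2 j k x : ccont (fun y => (if `|x| <= 1 then (om x)%:C%C else 0) *
   ((pd (iS k) (b j l) (qw w x y))%:C%C * tev (rcomp (tder1 w) k) x y *
       tev (rcomp (tder1 w) j) x y)).
  by apply: ccontM; [exact: ccont_cst|apply: ccontM; [exact: cb2'|exact: ccont_tev]].
have csum (F : 'I_M -> R -> R -> C) x : (forall j, ccont (F j x)) -> ccont (fun y => \sum_j F j x y).
  by move=> h; apply: ccont_sum.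
have c4 x : ccont (fun y => \sum_j \sum_k (if `|x| <= 1 then (om x)%:C%C else 0) *
      ((pd (iS k) (b j l) (qw w x y))%:C%C * tev (rcomp (tder1 w) k) x y *
       tev (rcomp (tder1 w) j) x y)).
  by apply: ccont_sum => j _; apply: ccont_sum => k _; exact: cb2.
have c3 x : ccont (fun y => \sum_j (pd (iy m) (b j l) (qw w x y))%:C%C * tev (rcomp (tder1 w) j) x y).
  by apply: ccont_sum.
have c2 x : ccont (fun y => \sum_j (b j l (qw w x y))%:C%C * tev (rcomp (tder1 (tder1 w)) j) x y).
  by apply: ccont_sum.
have c1 x : ccont (fun y => \sum_k (pd (iS k) (a l) (qw w x y))%:C%C * tev (rcomp (tder1 w) k) x y).
  by apply: ccont_sum.
apply: Abd_add; [| |by apply: Abd_omV_H => //; have [] := za l|apply: Abd_add; [| | |apply: Abd_add; [| | |apply: Abd_add]]] => //.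
- move=> x; apply: ccontRC => y; apply: cvgM; first exact: cvg_cst.
  exact: (continuous_Hqwy sw gy).
- by move=> x; apply: ccontD => //; apply: ccontD => //; exact: ccontD.
- by move=> x; apply: ccontD => //; exact: ccontD.
- apply: Abd_sumM => // k; apply: Abd_mul.
  + by move=> x; exact: (ccont_Hqwy sw x (good_pd (iS k) (ga l))).
  + by apply: (Abd_qw sw); exact: goodW (good_pd (iS k) (ga l)).
  + exact: tbd_p1.
- by move=> x; exact: ccontD.
- apply: Abd_sumM => // j; apply: Abd_mul.
  + by move=> x; exact: (ccont_Hqwy sw x (gb j l)).
  + exact: Abd_H.
  + exact: tbd_p2.
- apply: Abd_sumM => // j; apply: Abd_mul.
  + by move=> x; exact: (ccont_Hqwy sw x (good_pd (iy m) (gb j l))).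
  + by apply: (Abd_qw sw); exact: (good_pd (iy m) (gb j l)).
  + exact: tbd_p1.
- apply: Abd_sumM => // [j x|j]; first by apply: ccont_sum.
  apply: Abd_sumM => // k; apply: Abd_mulc.
  + by move=> x; apply: ccontM; [exact: cb2'|exact: ccont_tev].
  + exact: le_trans (om1_ge1 s).
  + move=> x; case: ifP => x1; last by rewrite cnorm0 (le_trans _ (om1_ge1 s)).
    by rewrite cnormRC gtr0_norm ?om_gt0 // om_le.
  apply: Abd_mul => //; last exact: tbd_p1.
  apply: Abd_mul; last exact: tbd_p1.
  + by move=> x; exact: (ccont_Hqwy sw x (good_pd (iS k) (gb j l))).
  + by apply: (Abd_qw sw); exact: (good_pd (iS k) (gb j l)).
Qed.

End Fixed2.
Section Regularity.
Variables (w : 'I_m -> trig R R) (n0 n1 n2 : R).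
Hypothesis sw : small w n0 n1 n2.
Hypothesis (n00 : 0 <= n0) (n10 : 0 <= n1) (n20 : 0 <= n2).

Lemma ccont_tder1 (w' : 'I_m -> trig R R) : (forall i j, ccont (tc (w' i) j)) ->
  forall i j, ccont (tc (tder1 w' i) j).
Proof. by move=> h i j; apply: ccontM; [exact: ccont_cst|exact: h]. Qed.

Lemma continuous_G l : continuous (fun p : R * R => G w l p.1 p.2).
Proof.
have [_ cw _ _ _] := sw.
move=> p.
suff : {for p, continuous (fun z : R * R => (om z.1)^-1 * a l (qw w z.1 z.2) +
    \sum_j rvl (tder1 w) j z.1 z.2 * b j l (qw w z.1 z.2))} by [].
apply: continuousD.
  apply: continuousM; last exact: (continuous_Hqw sw (ga l)).
  apply: (@continuous_comp _ _ _ (fun z : R * R => z.1) (fun x => (om x)^-1)); first exact: cvg_fst.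
  exact: continuous_omV.
apply: (@cvg_sumR _ _ (nbhs p) _ R _ _ _ (fun j (z : R * R) => rvl (tder1 w) j z.1 z.2 * b j l (qw w z.1 z.2))) => j _.
suff : {for p, continuous (fun z : R * R => rvl (tder1 w) j z.1 z.2 * b j l (qw w z.1 z.2))} by [].
apply: continuousM; last exact: (continuous_Hqw sw (gb j l)).
by apply: continuous_rvl2; exact: ccont_tder1.
Qed.

Lemma continuous_dGy l x : continuous (dG w l x).
Proof.
move=> y; apply: cvgD.
  apply: cvgM; first exact: cvg_cst.
  apply: cvgD; first exact: (continuous_Hqwy sw (good_pd (iy m) (ga l))).
  apply: cvg_sumR => k _; apply: cvgM; first exact: (continuous_Hqwy sw (good_pd (iS k) (ga l))).
  by apply: cvgM; [exact: cvg_cst|exact: continuous_rvl].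
apply: cvg_sumR => j _; apply: cvgD; apply: cvgM.
- exact: continuous_rvl.
- exact: (continuous_Hqwy sw (gb j l)).
- exact: continuous_rvl.
apply: cvgD; first exact: (continuous_Hqwy sw (good_pd (iy m) (gb j l))).
apply: cvg_sumR => k _; apply: cvgM; first exact: (continuous_Hqwy sw (good_pd (iS k) (gb j l))).
by apply: cvgM; [exact: cvg_cst|exact: continuous_rvl].
Qed.

Lemma G_off l x y : off_box (qw w x y) -> G w l x y = 0.
Proof.
move=> o; rewrite /G (ga l).2 // mulr0 add0r big1 // => j _.
by rewrite (gb j l).2 // mulr0.
Qed.

(** The right-hand side - G in complex form, the two halves of the index being real and imaginary
    parts. *)
Definition src (i : 'I_m) x y : C :=
  - ((G w (lshift m i) x y)%:C%C + Complex 0 1 * (G w (rshift m i) x y)%:C%C).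
Definition dsrc (i : 'I_m) x y : C :=
  - ((dG w (lshift m i) x y)%:C%C + Complex 0 1 * (dG w (rshift m i) x y)%:C%C).

Lemma ccont_src i : ccont (fun p : R * R => src i p.1 p.2).
Proof.
apply: ccontN; apply: ccontD; first by apply: ccontRC; exact: continuous_G.
by apply: ccontM; [exact: ccont_cst|apply: ccontRC; exact: continuous_G].
Qed.

Lemma ccont_dsrc i x : ccont (dsrc i x).
Proof.
apply: ccontN; apply: ccontD; first by apply: ccontRC; exact: continuous_dGy.
by apply: ccontM; [exact: ccont_cst|apply: ccontRC; exact: continuous_dGy].
Qed.

Lemma cderiv_src i x y : cderiv (src i x) y (dsrc i x y).
Proof.
apply: cderivN; apply: cderivD; first by apply: cderivRC; exact: (deriv_G sw).
by apply: cderivZ; apply: cderivRC; exact: (deriv_G sw).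
Qed.

Lemma ccont_srcy i x : ccont (src i x).
Proof. exact: cderiv_ccont (cderiv_src i x). Qed.

Lemma src_off i x y : off_box (qw w x y) -> src i x y = 0.
Proof.
move=> o; rewrite /src !G_off //.
by apply: ceqP; rewrite !ReImE /=; ring.
Qed.

Lemma src01 i x : src i x 0 = src i x 1.
Proof.
rewrite !src_off //; first by apply: Or33; rewrite pt_y; lra.
by apply: Or32; rewrite pt_y; lra.
Qed.

Lemma src_far i x y : 1 < `|x| -> src i x y = 0.
Proof. by move=> x1; apply: src_off; exact: pt_off. Qed.

Lemma Abd_complex (F : 'I_M -> R -> R -> R) c i :
  (forall l x, continuous (F l x)) -> (forall l, Abd c (fun x y => (F l x y)%:C%C)) ->
  Abd (2 * c) (fun x y => - ((F (lshift m i) x y)%:C%C + Complex 0 1 * (F (rshift m i) x y)%:C%C)).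
Proof.
move=> cF aF.
have cc l x : ccont (fun y => (F l x y)%:C%C) by apply: ccontRC; exact: cF.
have e x y : (-1) * ((F (lshift m i) x y)%:C%C + Complex 0 1 * (F (rshift m i) x y)%:C%C) =
  - ((F (lshift m i) x y)%:C%C + Complex 0 1 * (F (rshift m i) x y)%:C%C) by rewrite mulN1r.
apply: Abd_ext e _; rewrite -[2 * c]mul1r.
apply: (Abd_mulc (u := fun=> -1)) => //.
- by move=> x; apply: ccontD => //; apply: ccontM; [exact: ccont_cst|exact: cc].
- by move=> x; rewrite cnormN /cnorm /= normr1 normr0 addr0.
rewrite mulr_natl mulr2n; apply: Abd_add => //.
- by move=> x; apply: ccontM; [exact: ccont_cst|exact: cc].
rewrite -[c]mul1r; apply: (Abd_mulc (u := fun=> Complex 0 1)) => //.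
by move=> x; rewrite /cnorm /= normr1 normr0 add0r.
Qed.

Definition X0 : R := NB n0 + M%:R * (om1 * NB n0 * n1).
Definition X1 : R := NB n0 + (M%:R * (compK R m * be * n1) +
   (M%:R * (om1 * NB n0 * n2) + (M%:R * (compK R m * be * n1) +
    M%:R * (M%:R * (om1 * (compK R m * be * n1 * n1)))))).

Lemma Abd_src i : Abd (2 * X0) (src i).
Proof.
apply: (@Abd_complex (G w)) => [l x|l]; last exact: (Abd_G sw).
by apply: is_derive_continuous => y; exact: (deriv_G sw).
Qed.

Lemma Abd_dsrc i : Abd (2 * X1) (dsrc i).
Proof.
apply: (@Abd_complex (dG w)) => [l x|l]; last exact: (Abd_dG sw).
exact: continuous_dGy.
Qed.

End Regularity.

Section DifferenceEstimate.
Variables (w w' d : 'I_m -> trig R R) (n0 n1 n2 d0 d1 : R).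
Hypothesis sw : small w n0 n1 n2.
Hypothesis sw' : small w' n0 n1 n2.
Hypothesis (n00 : 0 <= n0) (n10 : 0 <= n1) (n20 : 0 <= n2).
Hypothesis dE : forall i x y, tev (d i) x y = tev (w i) x y - tev (w' i) x y.
Hypothesis bd0 : forall i, tbd 0 (d i) d0.
Hypothesis bd1 : forall i, tbd 0 (tder (d i)) d1.

Lemma rvlB (u v e : 'I_m -> trig R R) :
  (forall i x y, tev (e i) x y = tev (u i) x y - tev (v i) x y) ->
  forall l x y, rvl e l x y = rvl u l x y - rvl v l x y.
Proof.
by move=> E l x y; rewrite /rvl; case: fintype.split => i; rewrite E !ReImE.
Qed.

Lemma tev_tderB (u v e : trig R R) :
  (forall x y, tev e x y = tev u x y - tev v x y) ->
  forall x y, tev (tder e) x y = tev (tder u) x y - tev (tder v) x y.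
Proof.
move=> E' x y.
apply: (cderiv_unique (cderiv_tev e x y)).
apply: cderiv_ext (cderivB (cderiv_tev u x y) (cderiv_tev v x y)) => z.
by rewrite E'.
Qed.

Lemma GB l x y : (G w l x y - G w' l x y)%:C%C =
  ((om x)^-1 * (a l (qw w x y) - a l (qw w' x y)))%:C%C +
  (\sum_j (if `|x| <= 1 then (om x)%:C%C else 0) *
     (((om x)^-1 * (b j l (qw w x y) - b j l (qw w' x y)))%:C%C * tev (rcomp (tder1 w) j) x y) +
   \sum_j (b j l (qw w' x y))%:C%C * tev (rcomp (tder1 d) j) x y).
Proof.
have o0 : om x != 0 by rewrite gt_eqF // om_gt0.
have e2 j : rvl (tder1 d) j x y = rvl (tder1 w) j x y - rvl (tder1 w') j x y.
  by apply: rvlB => i x' y'; exact: tev_tderB.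
rewrite -big_split /= /G opprD addrACA -sumrB RCD -mulrBr; congr (_ + _).
rewrite RC_sum; apply: eq_bigr => j _; rewrite !tev_rcomp e2.
case: ifP => x1.
  rewrite -!RCM -RCD; congr (_%:C%C); by field.
have o q : off_box (qw q x y) by apply: pt_off; rewrite ltNge x1.
rewrite !(gb j l).2 //; apply: ceqP; rewrite !ReImE; ring.
Qed.

(** In the product of w_y and b, the difference of the values of b is Lipschitz in w, while the
    difference of the derivatives is multiplied by b itself, of order [NB n0]. Hence d1 enters with
    a small factor only. *)
Lemma Abd_GB l : Abd (c8 * be * d0 + (M%:R * (om1 * (c8 * be * d0 * n1)) +
     M%:R * (om1 * NB n0 * d1))) (fun x y => (G w l x y - G w' l x y)%:C%C).
Proof.
have g3 := goodW (ga l).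
apply: (Abd_ext (fun x y => esym (GB l x y))).
have cH N H x : good U N be H -> ccont (fun y => ((om x)^-1 * (H (qw w x y) - H (qw w' x y)))%:C%C).
  move=> gH; apply: ccontRC => y; apply: cvgM; first exact: cvg_cst.
  by apply: cvgB; [exact: (continuous_Hqwy sw gH)|exact: (continuous_Hqwy sw' gH)].
have cb j x : ccont (fun y => ((om x)^-1 * (b j l (qw w x y) - b j l (qw w' x y)))%:C%C * tev (rcomp (tder1 w) j) x y).
  by apply: ccontM; [exact: (cH 3%N)|exact: ccont_tev].
have cu j x : ccont (fun y => (if `|x| <= 1 then (om x)%:C%C else 0) *
     (((om x)^-1 * (b j l (qw w x y) - b j l (qw w' x y)))%:C%C * tev (rcomp (tder1 w) j) x y)).
  by apply: ccontM; [exact: ccont_cst|exact: cb].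
have cd j x : ccont (fun y => (b j l (qw w' x y))%:C%C * tev (rcomp (tder1 d) j) x y).
  by apply: ccontM; [exact: (ccont_Hqwy sw' x (gb j l))|exact: ccont_tev].
have D H : good U 3 be H ->
   Abd (c8 * be * d0) (fun x y => ((om x)^-1 * (H (qw w x y) - H (qw w' x y)))%:C%C).
  move=> gH; have -> : c8 * be * d0 = 8 * (M%:R * (compK R m * be * d0)) by rewrite /c8; ring.
  apply: (Abd_diff Uoff Urho sw sw' be0 gH (D := rcomp d)).
    by move=> l'; exact: tbd_rcomp.
  by move=> l' x y; rewrite tev_rcomp (rvlB dE).
apply: Abd_add; [| |exact: D|apply: Abd_add].
- by move=> x; exact: (cH 3%N _ x g3).
- by move=> x; apply: ccontD; apply: ccont_sum.
- by move=> x; apply: ccont_sum.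
- by move=> x; apply: ccont_sum.
- apply: Abd_sumM => // j; apply: Abd_mulc => //.
  + exact: le_trans (om1_ge1 s).
  + move=> x; case: ifP => x1; last by rewrite cnorm0 (le_trans _ (om1_ge1 s)).
    by rewrite cnormRC gtr0_norm ?om_gt0 // om_le.
  apply: Abd_mul; [by move=> x; apply: (cH 3%N); exact: gb|exact: D|].
  exact: (tbd_p1 sw).
apply: Abd_sumM => // j; apply: Abd_mul.
- by move=> x; exact: (ccont_Hqwy sw' x (gb j l)).
- exact: (Abd_H sw').
- by apply: tbd_rcomp => i; exact: bd1.
Qed.

Definition X3 : R := c8 * be * d0 + (M%:R * (om1 * (c8 * be * d0 * n1)) +
     M%:R * (om1 * NB n0 * d1)).

Lemma Abd_srcB i : Abd (2 * X3) (fun x y => src w i x y - src w' i x y).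
Proof.
have cF l x : continuous (fun y => G w l x y - G w' l x y).
  have D y := derivB (deriv_G sw l x y) (deriv_G sw' l x y).
  exact: is_derive_continuous D.
have := @Abd_complex (fun l x y => G w l x y - G w' l x y) X3 i cF Abd_GB.
apply: Abd_ext => x y; rewrite /src.
have RCB (u v : R) : (u - v)%:C%C = u%:C%C - v%:C%C by apply: ceqP; rewrite !ReImE // subr0.
by rewrite !RCB; ring.
Qed.

End DifferenceEstimate.
End SourceEstimates.

(** * Two-point interpolation by homogeneous solutions *)

Section Interpolation.
Variable R : realType.
Notation C := (R[i]).
Variables (s y1 y2 : R).
Hypothesis s1 : 1 <= s.

Definition slope (d1 d2 : C) : C := (d1 - d2) / (E 1 y1 - E 1 y2).

(** The functions 1 and exp(2 pi (x + i y)) are holomorphic, so their quotients by the Gaussian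
    weight solve the homogeneous linear equation. This combination of them is meant to take the
    values d1 and d2 at (0, y1) and (0, y2). *)
Definition interp (d1 d2 : C) : trig R R :=
  @Trig R R bool (fun j => if j then 1 else 0)
    (fun j x => if j then (expR (2 * pi * x - s ^+ 2 / 2 * x ^+ 2))%:C%C * slope d1 d2
       else (expR (- (s ^+ 2 / 2 * x ^+ 2)))%:C%C * (d1 - slope d1 d2 * E 1 y1)).

Lemma tev_interp d1 d2 x y : tev (interp d1 d2) x y =
  (expR (2 * pi * x - s ^+ 2 / 2 * x ^+ 2))%:C%C * slope d1 d2 * E 1 y +
  (expR (- (s ^+ 2 / 2 * x ^+ 2)))%:C%C * (d1 - slope d1 d2 * E 1 y1).
Proof. by rewrite /tev big_bool /= E0 mulr1. Qed.

Lemma interp_y1 d1 d2 : tev (interp d1 d2) 0 y1 = d1.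
Proof. by rewrite tev_interp !expr0n /= !mulr0 subr0 oppr0 expR0 !mul1r; ring. Qed.

Lemma interp_y2 d1 d2 : E 1 y1 != E 1 y2 :> C -> tev (interp d1 d2) 0 y2 = d2.
Proof.
move=> y12; rewrite tev_interp !expr0n /= !mulr0 subr0 oppr0 expR0 !mul1r.
by rewrite /slope; field; rewrite subr_eq0.
Qed.

Lemma interpB d1 d2 d1' d2' x y : tev (interp d1 d2) x y - tev (interp d1' d2') x y =
  tev (interp (d1 - d1') (d2 - d2')) x y.
Proof.
rewrite !tev_interp /slope.
set a := (expR (_ - _))%:C%C; set b := (expR _)%:C%C; set e := (_ - _)^-1.
by ring.
Qed.

Lemma deriv_gauss (c x : R) : is_derive x 1 (fun x : R => expR (c * x - s ^+ 2 / 2 * x ^+ 2))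
  (expR (c * x - s ^+ 2 / 2 * x ^+ 2) * (c - s ^+ 2 * x)).
Proof.
apply: deriv_eq (deriv_expR (derivB (deriv_lin c x) (derivM (deriv_cst (s ^+ 2 / 2) x) (deriv_sq x)))) _.
by field.
Qed.

Lemma ccont_interp d1 d2 j : ccont (tc (interp d1 d2) j).
Proof.
case: j => /=; apply: ccontM; try exact: ccont_cst; apply: ccontRC.
  exact: (is_derive_continuous (deriv_gauss (2 * pi))).
have := is_derive_continuous (deriv_gauss 0).
by under eq_fun do rewrite mul0r sub0r.
Qed.

Lemma cderiv_interp d1 d2 x y : cderiv (fun x => tev (interp d1 d2) x y) x
  (- (s ^+ 2 * x)%:C%C * tev (interp d1 d2) x y
     - Complex 0 1 * tev (tder (interp d1 d2)) x y).
Proof.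
have h0 : is_derive x 1 (fun x : R => expR (- (s ^+ 2 / 2 * x ^+ 2)))
  (expR (- (s ^+ 2 / 2 * x ^+ 2)) * (- (s ^+ 2 * x))).
  apply: deriv_eq (deriv_ext _ (deriv_gauss 0 x)) _; last by rewrite mul0r !sub0r.
  by move=> t; rewrite mul0r sub0r.
have h1 := cderivM (cderivRC (deriv_gauss (2 * pi) x)) (cderiv_cst (slope d1 d2 * E 1 y) x).
have h2 := cderivM (cderivRC h0) (cderiv_cst (d1 - slope d1 d2 * E 1 y1) x).
apply: cderiv_eq (cderiv_ext _ (cderivD h1 h2)) _.
  by move=> t; rewrite tev_interp mulrA.
rewrite tev_interp /tev big_bool /= E0 freq0.
have -> : freq R 1 = 2 * pi by rewrite /freq mulr1.
move: (expR _) (expR _) (slope d1 d2) (E 1 y1) => a b e f.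
move: (E 1 y) (s ^+ 2) => g l.
have ReC (u v : R) : Re (Complex u v) = u by [].
have ImC (u v : R) : Im (Complex u v) = v by [].
by apply: ceqP; rewrite ?(ReImE, ReC, ImC) ?(ReImE, ReC, ImC); ring.
Qed.

Definition cI : R := (1 + 2 * pi) ^+ 2 * (1 + (2 + expR (2 * pi ^+ 2)) *
   cnorm ((E 1 y1 - E 1 y2 : C)^-1)).

Lemma cI_ge0 : 0 <= cI.
Proof.
rewrite /cI mulr_ge0 ?sqr_ge0 // addr_ge0 // mulr_ge0 ?cnorm_ge0 //.
Qed.

(** For s >= 1 the factor exp(2 pi x - s^2 x^2 / 2) is at most exp(2 pi^2), so [cI] is independent
    of s, which can therefore be chosen after it. *)
Lemma tbd_interp p d1 d2 : (p <= 2)%N -> tbd p (interp d1 d2) (cI * (cnorm d1 + cnorm d2)).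
Proof.
move=> p2; set z := cnorm ((E 1 y1 - E 1 y2 : C)^-1).
set D := cnorm d1 + cnorm d2.
have D0 : 0 <= D by rewrite addr_ge0 // cnorm_ge0.
have z0 : 0 <= z := cnorm_ge0 _.
have pi0 : 0 <= pi :> R := pi_ge0 _.
have sl : cnorm (slope d1 d2) <= D * z.
  apply: le_trans (cnormM _ _) _; apply: ler_pM; rewrite ?cnorm_ge0 //.
  exact: cnormB.
have g0 : 1 <= (1 + 2 * pi :> R) ^+ 2 by rewrite expr2; nra.
exists (fun j : bool => if j then (1 + 2 * pi) ^+ 2 * (expR (2 * pi ^+ 2) * (D * z))
   else D + (D * z) * 2); split.
- by case; rewrite ?mulr_ge0 ?addr_ge0 ?expR_ge0 ?sqr_ge0 ?mulr_ge0.
- case=> x /=.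
    rewrite cnormMRC (gtr0_norm (expR_gt0 _)).
    have -> : freq R 1 = 2 * pi by rewrite /freq mulr1.
    apply: ler_pM; rewrite ?exprn_ge0 ?mulr_ge0 ?expR_ge0 ?cnorm_ge0 //.
      rewrite ger0_norm ?mulr_ge0 //.
      case: p p2 => [|[|[|p]]] // _; rewrite ?expr0 //; first by rewrite expr1 expr2; nra.
      by rewrite ler_pXn2r ?nnegrE ?addr_ge0 ?mulr_ge0 // lerDr.
    apply: ler_pM; rewrite ?expR_ge0 ?cnorm_ge0 //.
    rewrite ler_expR; have := sqr_ge0 (x - 2 * pi).
    have : x ^+ 2 <= s ^+ 2 * x ^+ 2.
      by rewrite ler_peMl ?sqr_ge0 //; apply: exprn_ege1.
    rewrite !expr2; move: (pi) => q; lra.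
  rewrite freq0 normr0 cnormMRC (gtr0_norm (expR_gt0 _)).
  have h : cnorm (d1 - slope d1 d2 * E 1 y1) <= D + D * z * 2.
    apply: le_trans (cnormB _ _) _; apply: lerD; first by rewrite lerDl cnorm_ge0.
    apply: le_trans (cnormM _ _) _; apply: ler_pM; rewrite ?cnorm_ge0 //.
    exact: cnorm_E.
  have e1 : expR (- (s ^+ 2 / 2 * x ^+ 2)) <= 1.
    by rewrite expR_le1 oppr_le0 mulr_ge0 ?divr_ge0 ?sqr_ge0.
  have X0 := cnorm_ge0 (d1 - slope d1 d2 * E 1 y1).
  have e0 := expR_ge0 (- (s ^+ 2 / 2 * x ^+ 2)).
  apply: le_trans h; case: p {p2} => [|p].
    by rewrite expr0 mul1r ler_piMl.
  by rewrite expr0n /= mul0r.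
rewrite big_bool /= /cI -/z.
have : D + D * z * 2 <= (1 + 2 * pi) ^+ 2 * (D + D * z * 2).
  by rewrite ler_peMl // addr_ge0 // !mulr_ge0.
by move: ((1 + 2 * pi) ^+ 2) (expR _) => g e; lra.
Qed.

End Interpolation.

(** * Linear dependence on the source and on the set of modes *)

Section LinearSource.
Variable R : realType.
Notation C := (R[i]).
Implicit Types (S : seq int) (h : R -> R -> C) (s x y c : R).

Lemma modesolB lam f (g g' : R -> C) x : ccont g -> ccont g' ->
  modesol lam f (fun t => g t - g' t) x = modesol lam f g x - modesol lam f g' x.
Proof.
move=> cg cg'; rewrite !modesolE //; last exact: ccontB.
rewrite -cintegB; try exact: ccont_modeint.
by apply: cinteg_ext => t; rewrite mulrBr.
Qed.

Lemma tev_tsolB s S h h' x y :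
  ccont (fun p : R * R => h p.1 p.2) -> ccont (fun p : R * R => h' p.1 p.2) ->
  tev (tsol s S (fun x y => h x y - h' x y)) x y = tev (tsol s S h) x y - tev (tsol s S h') x y.
Proof.
move=> ch ch'; rewrite !tev_tsol -sumrB; apply: eq_bigr => k _.
rewrite -mulrBl -modesolB; try exact: ccont_fc.
congr (modesol _ _ _ _ * _); apply/funext => t; apply: fcB.
  by apply: (ccont_comp (h := fun y => (t, y))) ch; exact: continuous_pairR.
by apply: (ccont_comp (h := fun y => (t, y))) ch'; exact: continuous_pairR.
Qed.

Lemma tev_tsol_cat s S S' h x y :
  tev (tsol s (S ++ S') h) x y = tev (tsol s S h) x y + tev (tsol s S' h) x y.
Proof. by rewrite !tev_tsol big_cat. Qed.

Lemma tev_tsol_perm s S S' h x y : perm_eq S S' ->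
  tev (tsol s S h) x y = tev (tsol s S' h) x y.
Proof. by move=> p; rewrite !tev_tsol; apply: perm_big. Qed.

Lemma fourier_sumB S h h' x y : ccont (h x) -> ccont (h' x) ->
  fourier_sum S (fun x y => h x y - h' x y) x y = fourier_sum S h x y - fourier_sum S h' x y.
Proof.
move=> ch ch'; rewrite /fourier_sum -sumrB; apply: eq_bigr => k _.
by rewrite -mulrBl fcB.
Qed.

Lemma fourier_sum_le S h c x y : wsum 0 S h c -> cnorm (fourier_sum S h x y) <= 2 * c.
Proof.
move=> [al [al0 hal sal]]; rewrite /fourier_sum.
apply: le_trans (_ : \sum_(k <- S) 2 * al k <= _); last by rewrite -mulr_sumr ler_wpM2l.
apply: le_trans (cnorm_sum _ _ _) _; rewrite !big_seq.
apply: ler_sum => k kS; apply: le_trans (cnormM _ _) _.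
rewrite mulrC; apply: ler_pM; rewrite ?cnorm_ge0 ?cnorm_E //.
by have := hal x k kS; rewrite expr0 mul1r.
Qed.

End LinearSource.

(** * Limits with geometric rate *)

Section GeometricLimits.
Variable R : realType.
Notation C := (R[i]).
Implicit Types (c q : R) (u : nat -> R).

(** The ratio 3/4 lies between 1 and the contraction factor 1/2 of the iteration; the room left over
    absorbs a truncation error of order 2^-n. *)
Definition geo c : nat -> R := fun n => c * (3 / 4) ^+ n.

Lemma geoS c n : geo c n.+1 = 3 / 4 * geo c n.
Proof. by rewrite /geo exprS; ring. Qed.
Lemma geo_ge0 c n : 0 <= c -> 0 <= geo c n.
Proof. by move=> c0; rewrite mulr_ge0 // exprn_ge0 // divr_ge0. Qed.
Lemma geoM k c n : k * geo c n = geo (k * c) n.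
Proof. by rewrite /geo mulrA. Qed.
Lemma geoD c c' n : geo c n + geo c' n = geo (c + c') n.
Proof. by rewrite /geo -mulrDl. Qed.

Lemma bernoulli (e : R) (n : nat) : 0 <= e -> 1 + e *+ n <= (1 + e) ^+ n.
Proof.
move=> e0; elim: n => [|n IH]; first by rewrite mulr0n addr0 expr0.
rewrite exprS mulrS.
apply: le_trans (_ : (1 + e) * (1 + e *+ n) <= _).
  have : 0 <= e *+ n by rewrite mulrn_wge0.
  by move: (e *+ n) => z z0; nra.
by apply: ler_wpM2l => //; lra.
Qed.

Lemma ratio_small (k1 k2 c e : R) : 0 <= k1 -> k1 < k2 -> 0 <= c -> 0 < e ->
  exists n, c * k1 ^+ n < e * k2 ^+ n.
Proof.
move=> k10 k12 c0 e0; have [->|k1p] := eqVneq k1 0.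
  by exists 1%N; rewrite !expr1 mulr0 mulr_gt0 //; lra.
have {}k1p : 0 < k1 by rewrite lt_neqAle eq_sym k1p.
pose z := k2 / k1 - 1.
have z0 : 0 < z by rewrite /z subr_gt0 ltr_pdivlMr // mul1r; exact: k12.
have [n hn] : exists n : nat, c < (e * z) *+ n.
  exists (Num.truncn (c / (e * z))).+1.
  rewrite -mulr_natr mulrC -ltr_pdivrMr ?mulr_gt0 //.
  exact: truncnS_gt.
exists n; have k2E : k2 = k1 * (1 + z) by rewrite /z; field; rewrite gt_eqF.
rewrite k2E exprMn mulrCA mulrC; rewrite ltr_pM2l ?exprn_gt0 //.
apply: lt_le_trans hn _; rewrite -mulrnAr; apply: ler_wpM2l; first exact: ltW.
apply: le_trans (bernoulli n (ltW z0)); lra.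
Qed.

Lemma geo_small c e : 0 <= c -> 0 < e -> exists n, forall k, (n <= k)%N -> geo c k < e.
Proof.
move=> c0 e0; have [//|||//|n hn] := @ratio_small (3 / 4) 1 c e; [lra|lra|].
exists n => k nk; rewrite expr1n mulr1 in hn; apply: le_lt_trans hn.
by rewrite /geo ler_wpM2l // ler_wiXn2l //; lra.
Qed.

(** The sequences u - 4 c (3/4)^n and u + 4 c (3/4)^n are monotone in opposite directions and
    enclose the limit; 4 is the sum of the powers of 3/4. *)
Lemma geo_cvg (u : nat -> R) c : 0 <= c ->
  (forall n, `|u n.+1 - u n| <= geo c n) ->
  exists l, forall n, `|u n - l| <= geo (4 * c) n.
Proof.
move=> c0 hu; pose z n := u n - geo (4 * c) n; pose v n := u n + geo (4 * c) n.
have zS n : z n <= z n.+1.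
  have := hu n; rewrite ler_norml /z geoS => /andP[h1 h2].
  have := geo_ge0 n c0; rewrite -geoM; move: (geo c n) h1 h2 => g; lra.
have vS n : v n.+1 <= v n.
  have := hu n; rewrite ler_norml /v geoS => /andP[h1 h2].
  have := geo_ge0 n c0; rewrite -geoM; move: (geo c n) h1 h2 => g; lra.
have zm n k : z n <= z (n + k)%N.
  by elim: k => [|k IH]; rewrite ?addn0 // addnS; exact: le_trans (zS _).
have vm n k : v (n + k)%N <= v n.
  by elim: k => [|k IH]; rewrite ?addn0 // addnS; exact: le_trans (vS _) IH.
have zv n : z n <= v n.
  by have := @geo_ge0 (4 * c) n; rewrite /z /v mulr_ge0 // => /(_ isT); lra.
have zvv n k : z n <= v k.
  apply: le_trans (zm n k) _; apply: le_trans (zv _) _.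
  by rewrite addnC; exact: vm.
have ub : has_ubound (range z) by exists (v 0%N) => _ [n _ <-].
exists (sup (range z)) => n.
have h1 : z n <= sup (range z) by apply: ub_le_sup => //; exists n.
have h2 : sup (range z) <= v n.
  by apply: ge_sup => [|_ [k _ <-]] //; exists (z 0%N); exists 0%N.
by rewrite /z /v in h1 h2; rewrite ler_norml; apply/andP; split; lra.
Qed.

Lemma MVT_near (f df : R -> R) (x h : R) : (forall z : R, is_derive z 1 f (df z)) ->
  exists2 z, `|z - x| <= `|h| & f (x + h) - f x = df z * h.
Proof.
move=> D; have [h0|/ltW h0] := leP 0 h.
  have [|z /andP[z1 z2] e] := @MVTR R f df x (x + h) _ D; first by rewrite lerDl.
  exists z; last by rewrite e; congr (_ * _); ring.
  by rewrite !ger0_norm ?subr_ge0 // lerBlDl.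
have [|z /andP[z1 z2] e] := @MVTR R f df (x + h) x _ D; first by rewrite gerDl.
exists z; first by rewrite (ler0_norm h0) ler0_norm ?subr_le0 //; lra.
by rewrite -opprB e -mulrN; congr (_ * _); ring.
Qed.

(** The mean value theorem applied to f k - f n, with k tending to infinity, compares the increments
    of F and of one fixed f n up to a small multiple of |h|. *)
Lemma geo_deriv (f : nat -> R -> R) (df : nat -> R -> R) (F dF : R -> R) c c' (x : R) :
  0 <= c' ->
  (forall n (z : R), is_derive z 1 (f n) (df n z)) ->
  (forall n z, `|z - x| <= 1 -> `|f n z - F z| <= geo c n) ->
  (forall n z, `|z - x| <= 1 -> `|df n z - dF z| <= geo c' n) ->
  is_derive x 1 F (dF x).
Proof.
move=> c'0 hf hF hdF; apply/is_derive1_epsP => e e0.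
have e80 : 0 < e / 8 by rewrite divr_gt0.
have [n hn] := geo_small c'0 e80.
have e40 : 0 < e / 4 by rewrite divr_gt0.
have /is_derive1_epsP/(_ _ e40)[d d0 hd] := hf n x.
exists (Num.min d 1); first by rewrite lt_min d0 ltr01.
move=> h; rewrite lt_min => /andP[hd' h1].
have key : `|F (x + h) - F x - (f n (x + h) - f n x)| <= e / 2 * `|h|.
  have step k : (n <= k)%N ->
      `|f k (x + h) - f k x - (f n (x + h) - f n x)| <= e / 4 * `|h|.
    move=> nk.
    have D (z : R) : is_derive z 1 (fun z => f k z - f n z) (df k z - df n z) by exact: derivB.
    have [z zI ->] : exists2 z, `|z - x| <= 1 & f k (x + h) - f k x - (f n (x + h) - f n x)
        = (df k z - df n z) * h.
      have [z zx e1] := MVT_near x h D.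
      exists z; first by apply: le_trans zx _; exact: ltW.
      have -> : f k (x + h) - f k x - (f n (x + h) - f n x) =
        f k (x + h) - f n (x + h) - (f k x - f n x) by ring.
      exact: e1.
    rewrite normrM; apply: ler_wpM2r => //.
    have -> : df k z - df n z = (df k z - dF z) - (df n z - dF z) by ring.
    apply: le_trans (ler_normB _ _) _.
    have := hdF k z zI; have := hdF n z zI; have := hn n (leqnn _); have := hn k nk.
    by lra.
  apply/ler_addgt0Pr => eta eta0.
  have c0 : 0 <= c.
    have := hF 0%N x; rewrite subrr normr0 => /(_ ler01) /(le_trans (normr_ge0 _)).
    by rewrite /geo expr0 mulr1.
  have eta40 : 0 < eta / 4 by rewrite divr_gt0.
  have [k hk] := geo_small c0 eta40.
  have s1 := step (maxn n k) (leq_maxl _ _).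
  have s2 := hk (maxn n k) (leq_maxr _ _).
  have a1 := hF (maxn n k) x; rewrite subrr normr0 in a1.
  have a2 := hF (maxn n k) (x + h); rewrite addrC addKr in a2.
  have {}a1 := a1 ler01; have {}a2 := a2 (ltW h1).
  move: (maxn n k) s1 s2 a1 a2 => K s1 s2 a1 a2.
  have -> : F (x + h) - F x - (f n (x + h) - f n x) =
    (f K (x + h) - f K x - (f n (x + h) - f n x)) - (f K (x + h) - F (x + h)) + (f K x - F x).
    by ring.
  apply: le_trans (ler_normD _ _) _; apply: le_trans (lerD (ler_normB _ _) (lexx _)) _.
  have := normr_ge0 h; have : 0 <= e * `|h| by rewrite mulr_ge0 // ltW.
  lra.
have b := hd h hd'; have := hdF n x; rewrite subrr normr0 => /(_ ler01) cc.
have := hn n (leqnn _) => cn.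
have -> : F (x + h) - F x - dF x * h =
  (F (x + h) - F x - (f n (x + h) - f n x)) + (f n (x + h) - f n x - df n x * h)
  + (df n x - dF x) * h by ring.
apply: le_trans (ler_normD _ _) _; apply: le_trans (lerD (ler_normD _ _) (lexx _)) _.
rewrite normrM.
have : `|df n x - dF x| * `|h| <= e / 8 * `|h| by apply: ler_wpM2r => //; lra.
move: key b; move: `|h| (normr_ge0 h) => H H0; have : 0 <= e * H by rewrite mulr_ge0 // ltW.
lra.
Qed.

Lemma geo_continuous (T : topologicalType) (f : nat -> T -> R) (F : T -> R) (A : set T) c t :
  0 <= c -> open A -> A t -> (forall n, continuous (f n)) ->
  (forall n z, A z -> `|f n z - F z| <= geo c n) -> {for t, continuous F}.
Proof.
move=> c0 oA At cf hf; apply/cvgrPdist_lt => e e0.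
have e30 : 0 < e / 3 by rewrite divr_gt0.
have [n hn] := geo_small c0 e30.
have /cvgrPdist_lt/(_ _ e30) h := cf n t.
have := hf n t At; have := hn n (leqnn _) => b at'.
near=> z.
have bz : `|f n z - F z| <= geo c n.
  by apply: hf; near: z; exact: open_nbhs_nbhs.
have fz : `|f n t - f n z| < e / 3 by near: z.
have -> : F t - F z = - (f n t - F t) + (f n t - f n z) + (f n z - F z) by ring.
apply: le_lt_trans (ler_normD _ _) _; apply: le_lt_trans (lerD (ler_normD _ _) (lexx _)) _.
rewrite normrN; lra.
Unshelve. all: by end_near.
Qed.

End GeometricLimits.

(** * Uniqueness and inversion for Fourier series *)

Section FourierInversion.
Variable R : realType.
Notation C := (R[i]).

Lemma cgeo_cvg (u : nat -> C) c : 0 <= c ->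
  (forall n, cnorm (u n.+1 - u n) <= geo c n) ->
  exists l, forall n, cnorm (u n - l) <= geo (8 * c) n.
Proof.
move=> c0 hu.
have [a ha] : exists l, forall n, `|Re (u n) - l| <= geo (4 * c) n.
  apply: geo_cvg => // n; apply: le_trans (hu n).
  by apply: le_trans (cnorm_Re _); rewrite !ReImE.
have [b hb] : exists l, forall n, `|Im (u n) - l| <= geo (4 * c) n.
  apply: geo_cvg => // n; apply: le_trans (hu n).
  by apply: le_trans (cnorm_Im _); rewrite !ReImE.
exists (Complex a b) => n; rewrite /cnorm !ReImE.
have := lerD (ha n) (hb n); rewrite geoD => h; apply: (le_trans h).
by rewrite /geo; apply: ler_wpM2r; [rewrite exprn_ge0 // divr_ge0|lra].
Qed.

Lemma cgeo_ccont (T : topologicalType) (f : nat -> T -> C) (F : T -> C) c :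
  0 <= c -> (forall n, ccont (f n)) ->
  (forall n z, cnorm (f n z - F z) <= geo c n) -> ccont F.
Proof.
move=> c0 cf hf; split=> t.
  apply: (@geo_continuous R T (fun n z => Re (f n z)) _ setT c) => //; first exact: openT.
    by move=> n; exact: (cf n).1.
  move=> n z _; apply: le_trans (hf n z).
  by apply: le_trans (cnorm_Re _); rewrite !ReImE.
apply: (@geo_continuous R T (fun n z => Im (f n z)) _ setT c) => //; first exact: openT.
  by move=> n; exact: (cf n).2.
move=> n z _; apply: le_trans (hf n z).
by apply: le_trans (cnorm_Im _); rewrite !ReImE.
Qed.

Lemma geo_eq0 (z : C) c : 0 <= c -> (forall n, cnorm z <= geo c n) -> z = 0.
Proof.
move=> c0 h; apply: cnorm0_eq; apply/le_anti; rewrite cnorm_ge0 andbT.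
rewrite leNgt; apply/negP => z0; have [n hn] := geo_small c0 z0.
by have := lt_le_trans (hn n (leqnn n)) (h n); rewrite ltxx.
Qed.

(* The kernel (1 + cos 2 pi (y - y0))^n is a trigonometric polynomial concentrating at y0. *)
Lemma fourier_unique (g : R -> C) (y0 : R) : ccont g -> (forall k, fc g k = 0) -> 0 < y0 < 1 ->
  g y0 = 0.
Proof.
move=> cg g0 /andP[y00 y01].
pose K y : R := 1 + cos (2 * pi * (y - y0)).
have cK : continuous K.
  move=> y; apply: cvgD; first exact: cvg_cst.
  apply: (@continuous_comp _ _ _ (fun y => 2 * pi * (y - y0)) cos); last exact: continuous_cos.
  by apply: cvgM; [exact: cvg_cst|apply: cvgB; [exact: cvg_id|exact: cvg_cst]].
have cKn n : continuous (fun y => K y ^+ n).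
  elim: n => [|n IH] y.
    by under eq_fun do rewrite expr0; exact: cvg_cst.
  by under eq_fun do rewrite exprS; apply: cvgM; [exact: cK|exact: IH].
have KE y : (K y)%:C%C = 1 + (2^-1)%:C%C * E (-1) y0 * E 1 y + (2^-1)%:C%C * E 1 y0 * E (-1) y.
  rewrite /K mulrBr cosB /E.
  have -> : freq R 1 = 2 * pi by rewrite /freq mulr1.
  have -> : freq R (-1) = - (2 * pi) by rewrite freqN /freq mulr1.
  rewrite !mulNr !cosN !sinN.
  have RC1 : Re (1 : C) = 1 by []. have IC1 : Im (1 : C) = 0 by [].
  have ReC (u v : R) : Re (Complex u v) = u by [].
  have ImC (u v : R) : Im (Complex u v) = v by [].
  by apply: ceqP; rewrite ?(ReImE, ReC, ImC, RC1, IC1) ?(ReImE, ReC, ImC, RC1, IC1); field.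
(* Multiplication by K combines shifted coefficients, all of them zero. *)
have gK n k : fc (fun y => g y * (K y ^+ n)%:C%C) k = 0.
  elim: n k => [|n IH] k.
    by rewrite -[RHS](g0 k); apply: fc_ext => y; rewrite expr0 mulr1.
  pose f y := g y * (K y ^+ n)%:C%C.
  have cf : ccont f by apply: ccontM => //; apply: ccontRC.
  pose f1 y := (2^-1)%:C%C * E (-1) y0 * (f y * E 1 y).
  pose f2 y := (2^-1)%:C%C * E 1 y0 * (f y * E (-1) y).
  have cfE j : ccont (fun y => f y * E j y) by apply: ccontM => //; exact: ccont_E.
  have c1 : ccont f1 by apply: ccontM; [exact: ccont_cst|exact: cfE].
  have c2 : ccont f2 by apply: ccontM; [exact: ccont_cst|exact: cfE].
  rewrite (@fc_ext R _ (fun y => f y + f1 y + f2 y)); last first.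
    move=> y; rewrite exprSr RCM KE /f1 /f2 /f.
    by move: (2^-1)%:C%C (K y ^+ n)%:C%C => u v; ring.
  rewrite fcD //; last exact: ccontD.
  rewrite fcD // (fcZ _ _ (cfE _)) (fcZ _ _ (cfE _)) !fcE /f !IH.
  by rewrite !mulr0 !addr0.
(* If G y0 were positive, G would exceed G y0 / 2 near y0, while K^n is exponentially smaller at
   distance at least d from y0 than within d / 2; a large n contradicts the zero integral. *)
have main (G : R -> R) : continuous G ->
    (forall n, integ (fun y => G y * K y ^+ n) 0 1 = 0) -> G y0 <= 0.
  move=> cG G0; rewrite leNgt; apply/negP => Gp.
  have c0 : 0 < G y0 / 2 by rewrite divr_gt0.
  have /cvgrPdist_lt/(_ _ c0)/nbhs_normP[/= d0 d0p hd0] := cG y0.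
  pose d := Num.min (Num.min d0 (1 - y0)) (Num.min y0 (4^-1 : R)).
  have dp : 0 < d by rewrite !lt_min d0p subr_gt0 y01 y00 invr_gt0 ltr0n.
  have [dd0 dy dy0 d4] : [/\ d <= d0, d <= 1 - y0, d <= y0 & d <= 4^-1].
    by split; rewrite /d !ge_min ?lexx ?orbT.
  have [Q Q0 hQ] : exists2 Q : R, 0 <= Q & forall y : R, 0 <= y <= 1 -> - Q <= G y.
    have [c _ hc] := @EVT_min R G 0 1 ler01 (continuous_subspaceT cG).
    exists `|G c| => // y yI; apply: le_trans (hc y _); last by rewrite in_itv.
    by rewrite lerNl -normrN ler_norm.
  have pi0 := @pi_gt0 R.
  have cosE t : cos `|t| = cos t :> R.
    by case: (leP 0 t) => h; [rewrite ger0_norm|rewrite ltr0_norm // cosN].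
  pose k1 : R := 1 + cos (2 * pi * d); pose k2 : R := 1 + cos (2 * pi * (d / 2)).
  have d4' : 2 * pi * d <= pi by nra.
  have k10 : 0 <= k1 by have := cos_geN1 (2 * pi * d); rewrite /k1; lra.
  have k12 : k1 < k2.
    rewrite /k1 /k2 ltrD2l ltr_cos ?in_itv /=; [nra|nra|nra].
  have KE' y : K y = 1 + cos (2 * pi * `|y - y0|).
    rewrite /K -cosE normrM ger0_norm //; lra.
  have Kfar (y : R) : 0 <= y <= 1 -> d <= `|y - y0| -> K y <= k1.
    (* As d is at most y0 and 1 - y0, the neighbouring peaks of the periodic kernel also stay at
       distance d from [0, 1]. *)
    move=> /andP[yge yle] dt; have t1 : `|y - y0| <= 1 - d.
      by rewrite ler_norml; apply/andP; split; lra.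
    rewrite KE' /k1 lerD2l; move: `|y - y0| dt t1 => t dt t1.
    have [th|th] := leP t 2^-1.
      by rewrite leNgt ltr_cos ?in_itv /= -?leNgt; nra.
    have -> : cos (2 * pi * t) = cos (2 * pi * (1 - t)).
      have -> : 2 * pi * t = - (2 * pi * (1 - t)) + pi + pi :> R by ring.
      by rewrite !cosDpi opprK cosN.
    by rewrite leNgt ltr_cos ?in_itv /= -?leNgt; nra.
  have Knear y : `|y - y0| <= d / 2 -> k2 <= K y.
    move=> th; rewrite KE' /k2 lerD2l; move: `|y - y0| (normr_ge0 (y - y0)) th => t t0 th.
    by rewrite leNgt ltr_cos ?in_itv /= -?leNgt; nra.
  have K0 y : 0 <= K y by have := cos_geN1 (2 * pi * (y - y0)); rewrite /K; lra.
  have [n hn] := @ratio_small R k1 k2 (Q + G y0 / 2) (G y0 / 2 * (d / 2)) k10 k12 ltac:(lra) ltac:(nra).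
  have low : G y0 / 2 * (k2 ^+ n * (d / 2)) <= (Q + G y0 / 2) * k1 ^+ n.
    (* Pointwise, G K^n is at least (G y0 / 2) K^n - (Q + G y0 / 2) k1^n: away from y0 because G >=
       - Q and K <= k1, near y0 because G >= G y0 / 2. *)
    have cut : G y0 / 2 * integ (fun y => K y ^+ n) 0 1 - (Q + G y0 / 2) * k1 ^+ n * (1 - 0) <= 0.
      apply: (@le_trans _ _ (integ (fun y => G y * K y ^+ n) 0 1)); last by rewrite G0.
      rewrite -integZ // -integ_cst -integB; try by move=> y; exact: cvg_cst.
        apply: integ_le => //.
        - by move=> y; apply: cvgB; [apply: cvgM; [exact: cvg_cst|exact: cKn]|exact: cvg_cst].
        - by move=> y; apply: cvgM; [exact: cG|exact: cKn].
        move=> y yI; have Kp := exprn_ge0 n (K0 y).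
        have [yd|yd] := leP d `|y - y0|.
          have Kk : K y ^+ n <= k1 ^+ n by apply: lerXn2r; rewrite ?nnegrE ?K0 ?Kfar.
          have := hQ y yI; move: (G y) (G y0) (K y ^+ n) (k1 ^+ n) c0 Kk Kp Q0 => u v p q; nra.
        have /= := hd0 y => /(_ (lt_le_trans yd dd0)).
        rewrite ltr_distl => /andP[_ Gy].
        have := exprn_ge0 n k10.
        move: (G y) (G y0) (K y ^+ n) (k1 ^+ n) c0 Kp Q0 Gy => u v p q v0 p0 Q0' uv q0.
        have : 0 <= (u - v / 2) * p by rewrite mulr_ge0 //; lra.
        have : 0 <= (Q + v / 2) * q by rewrite mulr_ge0 //; lra.
        lra.
      by move=> y; apply: cvgM; [exact: cvg_cst|exact: cKn].
    have Kint (a b : R) (k : R) : a <= b -> (forall y, a <= y <= b -> k <= K y ^+ n) ->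
        k * (b - a) <= integ (fun y => K y ^+ n) a b.
      by move=> ab h; rewrite -integ_cst; apply: integ_le => // y; exact: cvg_cst.
    have i1 : 0 * (y0 - 0) <= integ (fun y => K y ^+ n) 0 y0.
      by apply: Kint => [|y _]; [exact: ltW|rewrite exprn_ge0].
    have i2 : k2 ^+ n * (y0 + d / 2 - y0) <= integ (fun y => K y ^+ n) y0 (y0 + d / 2).
      apply: Kint => [|y /andP[h1 h2]]; first lra.
      apply: lerXn2r; rewrite ?nnegrE ?K0 //; first by lra.
      by apply: Knear; rewrite ger0_norm; lra.
    have i3 : 0 * (1 - (y0 + d / 2)) <= integ (fun y => K y ^+ n) (y0 + d / 2) 1.
      by apply: Kint => [|y _]; [lra|rewrite exprn_ge0].
    rewrite -(integ_cat _ 0 (y0 + d / 2) 1) -(integ_cat _ 0 y0 (y0 + d / 2)) in cut.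
    move: (integ _ 0 y0) (integ _ y0 _) (integ _ _ 1) i1 i2 i3 cut => I1 I2 I3.
    by move: (k2 ^+ n) (k1 ^+ n) (G y0) c0 => p q v c0; nra.
  by move: hn; rewrite mulrA in low; lra.
have z1 (f : R -> C) n : ccont f -> cinteg (fun y => f y * (K y ^+ n)%:C%C) 0 1 = 
    Complex (integ (fun y => Re (f y) * K y ^+ n) 0 1) (integ (fun y => Im (f y) * K y ^+ n) 0 1).
  move=> cf; rewrite /cinteg; congr Complex; congr integ; apply/funext => y; rewrite !ReImE.
    by rewrite mulr0 subr0.
  by rewrite mulr0 add0r.
have z2 n : cinteg (fun y => g y * (K y ^+ n)%:C%C) 0 1 = 0.
  rewrite -[RHS](gK n 0); apply: cinteg_ext => y; by rewrite oppr0 E0 mulr1.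
have z3 n : integ (fun y => Re (g y) * K y ^+ n) 0 1 = 0 /\ integ (fun y => Im (g y) * K y ^+ n) 0 1 = 0.
  by have := z2 n; rewrite z1 // => -[].
have cR := cg.1; have cIm := cg.2.
have neg (G : R -> R) : continuous G -> (forall n, integ (fun y => G y * K y ^+ n) 0 1 = 0) ->
   forall n, integ (fun y => - G y * K y ^+ n) 0 1 = 0.
  move=> cG h n; rewrite (_ : (fun y => _) = fun y => -1 * (G y * K y ^+ n)).
    rewrite integZ ?h ?mulr0 // => y; apply: cvgM; [exact: cG|exact: cKn].
  by apply/funext => y; ring.
have cN (G : R -> R) : continuous G -> continuous (fun y => - G y).
  by move=> h y; apply: cvgN; exact: h.
have fin (G : R -> R) : continuous G -> (forall n, integ (fun y => G y * K y ^+ n) 0 1 = 0) -> G y0 = 0.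
  move=> cG h; apply/le_anti; rewrite (main G) //=.
  by have := main (fun y => - G y) (cN G cG) (neg G cG h); rewrite oppr_le0.
apply: ceqP; rewrite ReImE.
  by apply: (fin (fun y => Re (g y))) => // n; exact: (z3 n).1.
by apply: (fin (fun y => Im (g y))) => // n; exact: (z3 n).2.
Qed.

Lemma fc_E j k : fc (E (R := R) j) k = if k == j then 1 else 0.
Proof.
have -> : fc (E (R := R) j) k = fc (fun=> 1 : C) (k - j).
  by rewrite -fcE; apply: fc_ext => y; rewrite mul1r.
rewrite -subr_eq0; have [->|kj] := eqVneq (k - j) 0.
  have D (x : R) : cderiv (fun x => x%:C%C) x (1 : C).
    exact: cderivRC (deriv_id x).
  rewrite -[RHS]subr0 -[1 in RHS]/(1%:C)%C -(cintegE 0 1 D).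
  by apply: cinteg_ext => y; rewrite oppr0 E0 mulr1.
have := @fc_deriv R (fun=> 1) (fun=> 0) (k - j) (fun y => cderiv_cst _ y) (ccont_cst _ _) erefl.
rewrite (_ : fc (fun=> 0) _ = 0); last first.
  by rewrite -[RHS](cinteg0 (R := R) 0 1); apply: cinteg_ext => y; rewrite mul0r.
move=> /esym e; apply: cnorm0_eq; apply/eqP.
have : cnorm (Complex 0 (freq R (k - j)) * fc (fun=> 1 : C) (k - j)) = 0 by rewrite e cnorm0.
rewrite cnorm_freq => /eqP; rewrite mulf_eq0 => /orP[|//].
rewrite normr_eq0 /freq !mulf_eq0 pnatr_eq0 /= gt_eqF ?pi_gt0 //=.
by rewrite intr_eq0 (negbTE kj).
Qed.

Lemma fc_fourier_sum S (h : R -> R -> C) x k : uniq S -> k \in S ->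
  fc (fourier_sum S h x) k = fc (h x) k.
Proof.
move=> uS kS; rewrite /fourier_sum fc_sum; last first.
  by move=> j _; apply: ccontM; [exact: ccont_cst|exact: ccont_E].
under eq_bigr => j _ do rewrite (fcZ _ _ (ccont_E _ j)) fc_E.
rewrite (bigD1_seq k) //= eqxx mulr1 big1 ?addr0 // => j jk.
by rewrite eq_sym (negbTE jk) mulr0.
Qed.

(** By [wsum_tail] the dyadic partial sums converge geometrically to a continuous function. It has
    the coefficients of h, so uniqueness identifies it with h inside (0, 1). *)
Lemma fourier_inversion (h dh : R -> R -> C) c x y n : 
  (forall x y, cderiv (h x) y (dh x y)) -> (forall x, ccont (dh x)) ->
  (forall x, h x 0 = h x 1) -> Abd c dh -> 0 < y < 1 ->
  cnorm (fourier_sum (modes (2 ^ n)) h x y - h x y) <= geo (16 * c) n.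
Proof.
move=> dhh cdh h01 A y01; have c0 := Abd_ge0 A.
pose f k z := fourier_sum (modes (2 ^ k)) h x z.
have cf k : ccont (f k).
  by apply: ccont_sum => j _; apply: ccontM; [exact: ccont_cst|exact: ccont_E].
have ch : ccont (h x) := cderiv_ccont (dhh x).
have step k z : cnorm (f k.+1 z - f k z) <= geo (2 * c) k.
  have le2 : (2 ^ k <= 2 ^ k.+1)%N by rewrite leq_exp2l.
  have -> : f k.+1 z - f k z = fourier_sum (tail_modes (2 ^ k) (2 ^ k.+1)) h x z.
    by rewrite /f /fourier_sum (perm_big _ (perm_modes le2)) big_cat /= addrAC subrr add0r.
  apply: le_trans (fourier_sum_le _ _ (wsum_tail _ _ dhh cdh h01 A)) _.
  rewrite /geo mulrA ler_wpM2l ?mulr_ge0 // -[leRHS]invrK lef_pV2 ?posrE ?ltr0n ?invr_gt0 ?exprn_gt0 ?divr_gt0 //.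
  rewrite -exprVn invf_div; apply: le_trans (_ : 2 ^+ k <= _).
    by apply: lerXn2r; rewrite ?nnegrE //; lra.
  by rewrite -natrX ler_nat.
have /choice[F hF] z := cgeo_cvg (mulr_ge0 (ler0n R 2) c0) (fun k => step k z).
have e16 : 8 * (2 * c) = 16 * c by ring.
have c160 : 0 <= 16 * c by rewrite mulr_ge0.
have hF' k z : cnorm (f k z - F z) <= geo (16 * c) k by rewrite -e16; exact: hF.
have cF : ccont F := cgeo_ccont c160 cf hF'.
have -> : h x y = F y; last exact: hF'.
apply/eqP; rewrite -subr_eq0; apply/eqP.
apply: (@fourier_unique (fun z => h x z - F z)) => //; first exact: ccontB.
(* The partial sum of index n is sure to contain the mode k once n >= |k|, whence the shift of the
   index by |k|. *)
move=> k; rewrite fcB //; apply: (@geo_eq0 _ (geo (32 * c) `|k|)) => [|i].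
  by rewrite geo_ge0 // mulr_ge0.
have kin : k \in modes (2 ^ (`|k| + i)).
  rewrite mem_modes; apply: (leq_trans (leq_addr i _)); exact/ltnW/ltn_expl.
rewrite -(fc_fourier_sum h x (uniq_modes _) kin) -fcB; try exact: cf; try exact: cF.
apply: le_trans (fc_norm_le _ _ _) _; [by apply: ccontB; [exact: cf|exact: cF]|by move=> z _; exact: hF'|].
by rewrite /geo exprD le_eqVlt; apply/orP; left; apply/eqP; ring.
Qed.

End FourierInversion.

Lemma Re_i (R : realType) (z : R[i]) : Re (Complex 0 1 * z) = - Im z.
Proof. by case: z => u v /=; rewrite mul0r mul1r sub0r. Qed.

Lemma Im_i (R : realType) (z : R[i]) : Im (Complex 0 1 * z) = Re z.
Proof. by case: z => u v /=; rewrite mul0r mul1r add0r. Qed.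

Lemma cnorm_i (R : realType) (z : R[i]) : cnorm (Complex 0 1 * z) = cnorm z.
Proof. by rewrite /cnorm Re_i Im_i normrN addrC. Qed.

(** * The nonlinear iteration *)

Section Iteration.
Variable R : realType.
Notation C := (R[i]).
Variable m : nat.
Notation M := (m + m)%N.
Notation K := (1 + 1 + M)%N.
Variables (U : set 'rV[R]_K) (rho : R) (s : R).
Hypothesis Uoff : @off_box R m `<=` U.
Hypothesis Urho : forall q : 'rV[R]_K, (forall l, `|q 0 (iS l)| < rho) -> U q.
Variables (a : 'I_M -> 'rV[R]_K -> R) (b : 'I_M -> 'I_M -> 'rV[R]_K -> R) (be del : R).
Hypothesis be0 : 0 <= be.
Hypothesis del0 : 0 <= del.
Hypothesis ga : forall l, good U 4 be (a l).
Hypothesis gb : forall j l, good U 3 be (b j l).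
Hypothesis za : forall l, atzero del (a l) /\ atzero del (pd (iy m) (a l)).
Hypothesis zb : forall j l, atzero del (b j l).
Variables (y1 y2 : R) (sg1 sg2 : 'I_m -> C) (r kap sg : R).
Hypothesis s1 : 1 <= s.
Hypothesis y12 : E 1 y1 != E 1 y2 :> C.
(** [B] bounds the sources relative to the radius r, [mu] is the gain 1 / s of the linear solver,
    [nu] its constant for one more derivative, [ci] the interpolation constant. Differences are
    measured by d0 + kap d1: as [nu] is not small, the derivative gets the small weight [kap]. *)
Let P := M%:R * compK R m * be.
Let B := 40 * P + 1.
Let mu := modeK R / s.
Let nu := modeC s.
Let ci := @cI R y1 y2.
Let o1 := @om1 R s.
Hypothesis Hmu : (2 + 8 * ci) * mu * B <= 8^-1.
Hypothesis Hnu : 8 * nu * B * kap <= 1.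
Hypothesis Hkap : kap * (2 * nu * B + 1) <= 1.
Hypothesis (kap0 : 0 < kap) (kap1 : kap <= 1) (r0 : 0 < r).
Hypothesis Hrho : 2 * (o1 * r) < rho.
Hypothesis Hr1 : 2 * (o1 * r) <= kap.
Hypothesis Hr2 : M%:R * (o1 * r) <= kap.
Hypothesis Hdel : 24 * del <= r.
Hypothesis Hsg1 : forall i, cnorm (sg1 i) <= sg.
Hypothesis Hsg2 : forall i, cnorm (sg2 i) <= sg.
Hypothesis Hsg : 4 * ci * sg <= r.

Notation sml w := (@small R m rho s w r r (r / kap)).
Notation srcc w i := (src s a b w i).

Let s0 : 0 < s. Proof. exact: lt_le_trans s1. Qed.
Let mu0 : 0 <= mu. Proof. by rewrite divr_ge0 ?ltW // modeK_gt0. Qed.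
Let nu0 : 0 <= nu. Proof. by rewrite addr_ge0 // !mulr_ge0 // ltW // modeK_gt0. Qed.
Let P0 : 0 <= P. Proof. by rewrite !mulr_ge0 // compK_ge0. Qed.
Let B0 : 0 <= B. Proof. by rewrite addr_ge0 // mulr_ge0. Qed.
Let ci0 : 0 <= ci. Proof. exact: cI_ge0. Qed.
Let o10 : 0 <= o1. Proof. exact: le_trans (om1_ge1 s). Qed.
Let rk0 : 0 <= r / kap. Proof. by rewrite divr_ge0 // ltW. Qed.
Let r0' : 0 <= r. Proof. exact: ltW. Qed.

Let NBr : NB m be del r <= (8 * P + 2^-1) * r.
Proof.
rewrite /NB /c8 (_ : _ * be * r = 8 * P * r); last by rewrite /P; ring.
by move: (P) Hdel => p h; rewrite mulrDl; lra.
Qed.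
Let NBr0 : 0 <= NB m be del r. Proof. exact: NB_ge0. Qed.

Let Q := M%:R * (o1 * r).
Let Q0 : 0 <= Q. Proof. by rewrite /Q !mulr_ge0. Qed.

Lemma X0_le : X0 m s be del r r <= B * r.
Proof.
rewrite /X0 (_ : M%:R * _ = NB m be del r * Q); last by rewrite /Q /o1; ring.
have : NB m be del r * Q <= NB m be del r * 1.
  by apply: ler_wpM2l => //; apply: le_trans Hr2 kap1.
have : 0 <= P * r by rewrite mulr_ge0.
by move: NBr; rewrite /B; move: (NB _ _ _ _) => N; lra.
Qed.

Lemma X1_le : X1 m s be del r r (r / kap) <= B * r.
Proof.
rewrite /X1 (_ : M%:R * (om1 s * _ * _) = NB m be del r * (Q / kap)); last first.
  by rewrite /Q /o1; ring.
rewrite (_ : M%:R * (compK R m * be * r) = P * r); last by rewrite /P; ring.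
rewrite (_ : M%:R * (M%:R * _) = (P * r) * Q); last by rewrite /P /Q /o1; ring.
have h1 : NB m be del r * (Q / kap) <= NB m be del r * 1.
  by apply: ler_wpM2l => //; rewrite ler_pdivrMr // mul1r.
have Pr : 0 <= P * r by rewrite mulr_ge0.
have h2 : P * r * Q <= P * r * 1.
  by apply: ler_wpM2l => //; apply: le_trans Hr2 kap1.
by move: NBr h1 h2; rewrite /B; move: (NB _ _ _ _) => N; lra.
Qed.

(** The difference d1 comes multiplied by M om1 [NB]; [NB] is of order r and M om1 r <= kap, which
    accounts for the weight of d1. *)
Lemma X3_le d0 d1 : 0 <= d0 -> 0 <= d1 -> X3 m s be del r r d0 d1 <= B * (d0 + kap * d1).
Proof.
move=> d00 d10; rewrite /X3 /c8.
rewrite (_ : 8 * (M%:R * compK R m) * be * d0 = 8 * P * d0); last by rewrite /P; ring.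
rewrite (_ : M%:R * (om1 s * (_ * r)) = 8 * P * d0 * Q); last by rewrite /Q /o1; ring.
have Pd : 0 <= P * d0 by rewrite mulr_ge0.
have h1 : P * d0 * Q <= P * d0 * 1.
  by apply: ler_wpM2l => //; apply: le_trans Hr2 kap1.
have h2 : M%:R * (om1 s * NB m be del r * d1) <= kap * (8 * P + 2^-1) * d1.
  apply: (@le_trans _ _ (M%:R * (om1 s * ((8 * P + 2^-1) * r) * d1))).
    apply: ler_wpM2l => //; apply: ler_wpM2r => //; apply: ler_wpM2l => //; exact: NBr.
  rewrite (_ : M%:R * _ = Q * ((8 * P + 2^-1) * d1)); last by rewrite /Q /o1; ring.
  rewrite -mulrA; apply: ler_wpM2r; last exact: Hr2.
  by rewrite mulr_ge0 // addr_ge0 // mulr_ge0.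
have h3 : 0 <= kap * P * d1 by rewrite !mulr_ge0 // ltW.
have h4 : 0 <= kap * d1 by rewrite !mulr_ge0 // ltW.
move: h2 h1 Pd h3 h4; rewrite /B; move: (M%:R * _) (P) (Q) => N p q; lra.
Qed.

(** The linear equation is solved for the modes of the source up to N; a homogeneous solution then
    restores the two prescribed values. *)
Definition pstep N (w : 'I_m -> trig R R) (i : 'I_m) : trig R R :=
  let t := tsol s (modes N) (srcc w i) in
  tadd t (interp s y1 y2 (sg1 i - tev t 0 y1) (sg2 i - tev t 0 y2)).

Lemma pstep_y1 N w i : tev (pstep N w i) 0 y1 = sg1 i.
Proof. by rewrite tev_add interp_y1 addrC subrK. Qed.
Lemma pstep_y2 N w i : tev (pstep N w i) 0 y2 = sg2 i.
Proof. by rewrite tev_add interp_y2 // addrC subrK. Qed.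

Section OneStep.
Variables (w : 'I_m -> trig R R).
Hypothesis sw : sml w.

Let cs i := ccont_src Uoff Urho ga gb sw i.

(** The norms of order 0 and 1 use the gain [mu]. The norm of order 2 uses the elliptic gain on one
    derivative of the source, with the constant [nu], and is therefore allowed to reach r / kap. *)
Lemma small_pstep N : sml (pstep N w).
Proof.
have r20 : 0 <= r / kap by [].
have A0 i : wsum 0 (modes N) (srcc w i) (2 * X0 m s be del r r).
  by apply: wsum_Abd (uniq_modes N) _; exact: (Abd_src Uoff Urho be0 del0 ga gb za zb sw).
have A1 i : wsum 1 (modes N) (srcc w i) (2 * X1 m s be del r r (r / kap)).
  apply: (wsum_Abd_der (uniq_modes N) (dh := dsrc s a b w i)).
  - by move=> x y; exact: (cderiv_src Uoff Urho ga gb sw).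
  - by move=> x; exact: (ccont_dsrc Uoff Urho ga gb sw).
  - by move=> x; exact: (src01 s ga gb).
  - exact: (Abd_dsrc Uoff Urho be0 del0 ga gb za zb sw).
have Br0 : 0 <= B * r by rewrite mulr_ge0.
have t0 i : tbd 0 (tsol s (modes N) (srcc w i)) (mu * (2 * (B * r))).
  apply: tbd_le (tbd_tsol s1 (cs i) (A0 i)); apply: ler_wpM2l => //.
  by have := X0_le; lra.
have t1 i : tbd 1 (tsol s (modes N) (srcc w i)) (mu * (2 * (B * r))).
  apply: tbd_le (tbd_tsol s1 (cs i) (A1 i)); apply: ler_wpM2l => //.
  by have := X1_le; lra.
have t2 i : tbd 2 (tsol s (modes N) (srcc w i)) (nu * (2 * (B * r))).
  apply: tbd_le (tbd_tsolS s1 (cs i) _ (A1 i)); last by move=> x y; exact: (src_far s ga gb).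
  apply: ler_wpM2l => //; by have := X1_le; lra.
pose v := ci * (2 * sg + 8 * mu * (B * r)).
have ib p i : (p <= 2)%N -> tbd p (interp s y1 y2 
    (sg1 i - tev (tsol s (modes N) (srcc w i)) 0 y1)
    (sg2 i - tev (tsol s (modes N) (srcc w i)) 0 y2)) v.
  move=> p2; apply: tbd_le (@tbd_interp R s y1 y2 s1 p _ _ p2); apply: ler_wpM2l => //.
  have := tev_le 0 y1 (t0 i); have := tev_le 0 y2 (t0 i).
  have := cnormB (sg1 i) (tev (tsol s (modes N) (srcc w i)) 0 y1).
  have := cnormB (sg2 i) (tev (tsol s (modes N) (srcc w i)) 0 y2).
  have := Hsg1 i; have := Hsg2 i.
  move: (cnorm _) (cnorm _) (cnorm _) (cnorm _) (cnorm _) (cnorm _) => q1 q2 q3 q4 q5 q6.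
  by move: (B * r) => z; lra.
have muB : (2 + 8 * ci) * mu * B * r <= 8^-1 * r by apply: ler_wpM2r.
have vle : mu * (2 * (B * r)) + v <= r.
  by rewrite /v; move: muB Hsg r0; move: (mu) (B) (ci) => u z c; lra.
have vle' : v <= r.
  by apply: le_trans vle; rewrite lerDr; exact: mulr_ge0 mu0 (mulr_ge0 _ Br0).
split.
- move=> i; split; [|split].
  + by apply: tbd_le vle _; apply: tbd_add (t0 i) _; exact: ib.
  + by apply: tbd_der; apply: tbd_le vle _; apply: tbd_add (t1 i) _; exact: ib.
  + apply: tbd_der; apply: tbd_der.
    apply: (@tbd_le _ _ _ _ (nu * (2 * (B * r)) + v)); last by apply: tbd_add (t2 i) _; exact: ib.
    rewrite ler_pdivlMr //; apply: le_trans (_ : (nu * (2 * (B * r)) + r) * kap <= _).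
      by apply: ler_wpM2r; [exact: ltW|rewrite lerD2l].
    have := ler_wpM2r r0' Hkap; rewrite mul1r; lra.
- move=> i [j|j] /=; last exact: (@ccont_interp R s y1 y2 _ _ j).
  by apply: ccont_tsol; exact: cs.
- exact: Hrho.
- by apply: le_trans Hr1 kap1.
- by rewrite !mulrA ler_pdivrMr // mul1r -mulrA; exact: Hr1.
Qed.

End OneStep.

(** Two steps differ by the solution for the difference of the sources on the common modes, the
    solution for the new modes, and the interpolation of the resulting errors at the two points.
    [Hmu] and [Hnu] bound the total by half of the old difference and half of the truncation
    error. *)
Lemma pstepB N N' w w' (d : 'I_m -> trig R R) d0 d1 : (N <= N')%N -> sml w -> sml w' ->
  0 <= d0 -> 0 <= d1 ->
  (forall i x y, tev (d i) x y = tev (w' i) x y - tev (w i) x y) ->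
  (forall i, tbd 0 (d i) d0) -> (forall i, tbd 0 (tder (d i)) d1) ->
  (forall i, wsum 0 (modes N) (fun x y => srcc w' i x y - srcc w i x y) (2 * (B * (d0 + kap * d1)))) /\
  (forall i, wsum 0 (tail_modes N N') (srcc w' i) (2 * (B * r) / N.+1%:R)) /\
  exists d' : 'I_m -> trig R R, exists e0 e1 : R, [/\
    (forall i x y, tev (d' i) x y = tev (pstep N' w' i) x y - tev (pstep N w i) x y),
    (forall i, tbd 0 (d' i) e0), (forall i, tbd 0 (tder (d' i)) e1),
    0 <= e0 /\ 0 <= e1 & e0 + kap * e1 <= 2^-1 * (d0 + kap * d1) + 2^-1 * (r / N.+1%:R)].
Proof.
move=> NN sw sw' d00 d10 dE bd0 bd1.
have cs i := ccont_src Uoff Urho ga gb sw i.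
have cs' i := ccont_src Uoff Urho ga gb sw' i.
have A i : Abd (2 * (B * (d0 + kap * d1))) (fun x y => srcc w' i x y - srcc w i x y).
  apply: Abd_le (Abd_srcB Uoff Urho be0 del0 ga gb zb sw' sw r0' r0' rk0 dE bd0 bd1 i).
  by rewrite ler_pM2l //; exact: X3_le.
have wA i := wsum_Abd (uniq_modes N) (A i).
have wT i : wsum 0 (tail_modes N N') (srcc w' i) (2 * (B * r) / N.+1%:R).
  apply: (@wsum_tail R N N' (srcc w' i) (dsrc s a b w' i)).
  - by move=> x y; exact: (cderiv_src Uoff Urho ga gb sw').
  - by move=> x; exact: (ccont_dsrc Uoff Urho ga gb sw').
  - by move=> x; exact: (src01 s ga gb).
  apply: Abd_le (Abd_dsrc Uoff Urho be0 del0 ga gb za zb sw' r0' r0' rk0 i).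
  by rewrite ler_pM2l //; exact: X1_le.
split=> //; split=> //.
pose Z := 2 * (B * (d0 + kap * d1)) + 2 * (B * r) / N.+1%:R.
have D0 : 0 <= d0 + kap * d1 by rewrite addr_ge0 // mulr_ge0 // ltW.
have rN : 0 <= r / N.+1%:R by rewrite divr_ge0.
have Z0 : 0 <= Z by rewrite /Z -!mulrA addr_ge0 // mulr_ge0 // mulr_ge0.
pose tA i := tsol s (modes N) (fun x y => srcc w' i x y - srcc w i x y).
pose tT i := tsol s (tail_modes N N') (srcc w' i).
pose t i := tadd (tA i) (tT i).
have csB i : ccont (fun p : R * R => srcc w' i p.1 p.2 - srcc w i p.1 p.2) by apply: ccontB.
have tE i x y : tev (t i) x y =
    tev (tsol s (modes N') (srcc w' i)) x y - tev (tsol s (modes N) (srcc w i)) x y.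
  rewrite (tev_tsol_perm _ _ _ _ (perm_modes NN)) tev_tsol_cat /t tev_add (@tev_tsolB R s (modes N) (srcc w' i) (srcc w i)) //.
  by rewrite addrAC.
have t0 i : tbd 0 (t i) (mu * Z).
  rewrite /Z mulrDr; apply: tbd_add; first exact: (@tbd_tsol R s (fun x y => srcc w' i x y - srcc w i x y) s1 (csB i) _ _ _ (wA i)).
  exact: (tbd_tsol s1 (cs' i) (wT i)).
have t1 i : tbd 1 (t i) (nu * Z).
  rewrite /Z mulrDr; apply: tbd_add.
    apply: (@tbd_tsolS R s (fun x y => srcc w' i x y - srcc w i x y) s1 (csB i) _ _ _ _ (wA i)) => x y x1.
    by rewrite !(src_far s ga gb) // subrr.
  apply: (tbd_tsolS s1 (cs' i) _ (wT i)) => x y x1.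
  by rewrite (src_far s ga gb).
pose ip i := interp s y1 y2 (- tev (t i) 0 y1) (- tev (t i) 0 y2).
have ib p i : (p <= 2)%N -> tbd p (ip i) (ci * (4 * (mu * Z))).
  move=> p2; apply: tbd_le (@tbd_interp R s y1 y2 s1 p _ _ p2); apply: ler_wpM2l => //.
  have := tev_le 0 y1 (t0 i); have := tev_le 0 y2 (t0 i); rewrite !cnormN.
  by move: (mu * Z) => z; lra.
exists (fun i => tadd (t i) (ip i)).
exists (mu * Z + ci * (4 * (mu * Z))), (nu * Z + ci * (4 * (mu * Z))).
have muZ : 0 <= mu * Z by rewrite mulr_ge0.
split.
- move=> i x y; rewrite [LHS]tev_add tE /pstep /= 2!(tev_add (tsol _ _ _)).
  rewrite opprD [RHS]addrACA; congr (_ + _); rewrite interpB /ip !tE; congr (tev (interp _ _ _ _ _) _ _); ring.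
- by move=> i; apply: tbd_add => //; exact: ib.
- by move=> i; apply: tbd_der; apply: tbd_add => //; exact: ib.
- by split; rewrite addr_ge0 // mulr_ge0 // mulr_ge0.
pose z := d0 + kap * d1 + r / N.+1%:R.
have z0 : 0 <= z by rewrite addr_ge0.
have Zz : Z = 2 * (B * z) by rewrite /Z /z; ring.
have kZ : kap * (ci * (4 * (mu * Z))) <= 1 * (ci * (4 * (mu * Z))).
  by apply: ler_wpM2r => //; exact: mulr_ge0 ci0 (mulr_ge0 _ muZ).
have kmu : kap * (mu * Z) <= 1 * (mu * Z) by apply: ler_wpM2r.
have h1 := ler_wpM2r z0 Hmu; have h2 := ler_wpM2r z0 Hnu.
move: kZ muZ h1 h2 z0; rewrite -mulrDr -/z Zz; move: (mu) (nu) (ci) (B) (z) => u v c q z2; lra.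
Qed.

(** Doubling the range of modes makes the truncation error decay like 2^-n, within the geometric
    rate. *)
Fixpoint W n : 'I_m -> trig R R := if n is k.+1 then pstep (2 ^ k) (W k) else (fun i => wzero R i).

Lemma small_W n : sml (W n).
Proof.
elim: n => [|n IH] /=; last exact: small_pstep.
split=> //.
- by move=> i; split; [|split]; apply: tbd_empty; rewrite ?card_ord.
- by move=> i [].
- by apply: le_trans Hr1 kap1.
- by rewrite !mulrA ler_pdivrMr // mul1r -mulrA; exact: Hr1.
Qed.

Lemma half_geo n (c : R) : 0 <= c -> c / (2 ^ n).+1%:R <= geo c n.
Proof.
move=> c0; rewrite /geo ler_wpM2l // -[leRHS]invrK lef_pV2 ?posrE ?ltr0n ?invr_gt0 ?exprn_gt0 ?divr_gt0 //.
rewrite -exprVn invf_div; apply: le_trans (_ : 2 ^+ n <= _).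
  by apply: lerXn2r; rewrite ?nnegrE //; lra.
by rewrite -natrX ler_nat.
Qed.

Lemma WB n : exists d : 'I_m -> trig R R, exists d0 d1 : R, [/\
    (forall i x y, tev (d i) x y = tev (W n.+1 i) x y - tev (W n i) x y),
    (forall i, tbd 0 (d i) d0), (forall i, tbd 0 (tder (d i)) d1),
    0 <= d0 /\ 0 <= d1 & d0 + kap * d1 <= geo (2 * r) n].
Proof.
elim: n => [|n [d [d0 [d1 [dE bd0 bd1 [d00 d10] dg]]]]].
  have [h _ _ _ _] := small_W 1; exists (W 1), r, r; split=> //.
  - by move=> i x y; rewrite /= {3}/tev big_ord0 subr0.
  - by move=> i; have [] := h i.
  - by move=> i; have [_ []] := h i.
  rewrite /geo expr0 mulr1; have := ler_wpM2r r0' kap1; lra.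
have le2 : (2 ^ n <= 2 ^ n.+1)%N by rewrite leq_exp2l.
have [_ [_ [d' [e0 [e1 [dE' b0 b1 e00 e]]]]]] :=
  pstepB le2 (small_W n) (small_W n.+1) d00 d10 dE bd0 bd1.
exists d', e0, e1; split=> //; apply: le_trans e _.
(* The induction closes because half of 2 r plus half of r equals 3/4 of 2 r. *)
have := half_geo n r0'; move: dg; rewrite geoS -[geo (2 * r) n]geoM.
by move: (geo r n) (r / _) (d0 + _) => g q1 q2; lra.
Qed.

(** Multiplication by i on C^m, real parts first. *)
Definition jrow (v : 'I_M -> R) (l : 'I_M) : R :=
  match fintype.split l with inl i => - v (rshift m i) | inr i => v (lshift m i) end.

Definition comp2 (f : 'I_m -> R -> R -> C) (l : 'I_M) x y : R :=
  match fintype.split l with inl i => Re (f i x y) | inr i => Im (f i x y) end.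

Lemma geo_to (u : nat -> R) l c : 0 <= c -> (forall n, `|u n - l| <= geo c n) -> u @ \oo --> l.
Proof.
move=> c0 h; apply/cvgrPdist_lt => e e0; have [n hn] := geo_small c0 e0.
near=> k; rewrite distrC; apply: le_lt_trans (h k) _; apply: hn.
by near: k; exact: nbhs_infty_ge.
Unshelve. all: by end_near.
Qed.

Lemma cvg_rV (p : nat) (u : nat -> 'rV[R]_p) (v : 'rV[R]_p) :
  (forall j, (fun n => u n 0 j) @ \oo --> v 0 j) -> u @ \oo --> v.
Proof.
move=> h; apply/cvgrPdist_lt => e e0.
have : \forall n \near \oo, forall j, `|v 0 j - u n 0 j| < e.
  by apply: (filter_forall eventually_filter) => j; have /cvgrPdist_lt/(_ _ e0) := h j.
apply: filterS => n hn; apply: mx_norm_lt => // i j.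
by rewrite ord1 !mxE.
Qed.

Let Br0 : 0 <= B * r. Proof. by rewrite mulr_ge0. Qed.

(** Iterates, their derivatives in y and their truncated sources all converge geometrically. The
    linear equation expresses the derivative in x through these three, so it converges too, locally
    uniformly. Fourier inversion identifies the limit source, for 0 < y < 1 only. *)
Lemma pde_limit : exists S Sy : 'I_M -> R -> R -> R, [/\
  (forall l, continuous (fun p : R * R => S l p.1 p.2) /\ continuous (fun p : R * R => Sy l p.1 p.2)),
  (forall l (x y : R), is_derive y 1 (S l x) (Sy l x y)),
  (forall l (x y : R), 0 < y < 1 -> is_derive x 1 (fun x => S l x y)
    (- (jrow (fun j => Sy j x y) l + a l (pt x y (\row_j S j x y)) +
        \sum_j Sy j x y * b j l (pt x y (\row_j S j x y))))),
  (forall l (x y : R), `|x| <= 1 -> `|S l x y| < rho) &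
  forall i, [/\ S (lshift m i) 0 y1 = Re (sg1 i), S (rshift m i) 0 y1 = Im (sg1 i),
     S (lshift m i) 0 y2 = Re (sg2 i) & S (rshift m i) 0 y2 = Im (sg2 i)]].
Proof.
have gr2 : 0 <= 2 * r by rewrite mulr_ge0.
have stepW n i x y : cnorm (tev (W n.+1 i) x y - tev (W n i) x y) <= geo (4 * r) n /\
    cnorm (tev (tder (W n.+1 i)) x y - tev (tder (W n i)) x y) <= geo (4 * r / kap) n.
  have [d [d0 [d1 [dE bd0 bd1 [d00 d10] dg]]]] := WB n; split.
    rewrite -dE; apply: le_trans (tev_le _ _ (bd0 i)) _.
    rewrite (_ : 4 * r = 2 * (2 * r)); last by ring.
    by rewrite -geoM ler_pM2l //; apply: le_trans dg; rewrite lerDl mulr_ge0 // ltW.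
  rewrite -(tev_tderB (dE i)); apply: le_trans (tev_le _ _ (bd1 i)) _.
  rewrite (_ : 4 * r / kap = 2 * (kap^-1 * (2 * r))); last by ring.
  rewrite -(geoM 2) -(geoM kap^-1) ler_pM2l // ler_pdivlMl //; apply: le_trans dg; by rewrite lerDr.
have r40 : 0 <= 4 * r by rewrite mulr_ge0.
have rk40 : 0 <= 4 * r / kap by rewrite divr_ge0 // ltW.
have lw : forall i, exists f, forall x y n, cnorm (tev (W n i) x y - f x y) <= geo (8 * (4 * r)) n.
  move=> i; have /choice[f hf] (p : R * R) := cgeo_cvg r40 (fun n => (stepW n i p.1 p.2).1).
  by exists (fun x y => f (x, y)) => x y n; exact: (hf (x, y)).
have lv : forall i, exists f, forall x y n, cnorm (tev (tder (W n i)) x y - f x y) <= geo (8 * (4 * r / kap)) n.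
  move=> i; have /choice[f hf] (p : R * R) := cgeo_cvg rk40 (fun n => (stepW n i p.1 p.2).2).
  by exists (fun x y => f (x, y)) => x y n; exact: (hf (x, y)).
have [wl hw] := choice lw; have [vl hv] := choice lv => {lw lv}.
pose f n i x y := fourier_sum (modes (2 ^ n)) (srcc (W n) i) x y.
have csW n i := ccont_src Uoff Urho ga gb (small_W n) i.
have csWy n i x := ccont_srcy Uoff Urho ga gb (small_W n) i x.
have stepf n i x y : cnorm (f n.+1 i x y - f n i x y) <= geo (12 * (B * r)) n.
  have [d [d0 [d1 [dE bd0 bd1 [d00 d10] dg]]]] := WB n.
  have le2 : (2 ^ n <= 2 ^ n.+1)%N by rewrite leq_exp2l.
  have [h1 [h2 _]] := pstepB le2 (small_W n) (small_W n.+1) d00 d10 dE bd0 bd1.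
  have -> : f n.+1 i x y - f n i x y =
    fourier_sum (modes (2 ^ n)) (fun x y => srcc (W n.+1) i x y - srcc (W n) i x y) x y +
    fourier_sum (tail_modes (2 ^ n) (2 ^ n.+1)) (srcc (W n.+1) i) x y.
    rewrite (@fourier_sumB R _ (srcc (W n.+1) i) (srcc (W n) i) x y (csWy _ _ _) (csWy _ _ _)) addrAC; congr (_ - _).
    by rewrite /f /fourier_sum (perm_big _ (perm_modes le2)) big_cat.
  apply: le_trans (cnormD _ _) _.
  have g1 := fourier_sum_le x y (h1 i); have g2 := fourier_sum_le x y (h2 i).
  have g3 := half_geo n Br0.
  have g4 : B * (d0 + kap * d1) <= geo (2 * (B * r)) n.
    by rewrite mulrCA -geoM; apply: ler_wpM2l.
  move: g1 g2 g3 g4; rewrite -!geoM -!mulrA.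
  move: (cnorm _) (cnorm _) (geo _ n) (B * (r / _)) (B * (d0 + _)) => q1 q2 q3 q4 q5; lra.
have B12 : 0 <= 12 * (B * r) by rewrite mulr_ge0.
have lf : forall i, exists F, forall x y n, cnorm (f n i x y - F x y) <= geo (8 * (12 * (B * r))) n.
  move=> i; have /choice[F hF] (p : R * R) := cgeo_cvg B12 (fun n => stepf n i p.1 p.2).
  by exists (fun x y => F (x, y)) => x y n; exact: (hF (x, y)).
have [Fl hF] := choice lf => {lf}.
have c32 : 0 <= 8 * (4 * r) by rewrite mulr_ge0.
have c32k : 0 <= 8 * (4 * r / kap) by rewrite mulr_ge0.
have c96 : 0 <= 8 * (12 * (B * r)) by rewrite mulr_ge0.
pose S l x y := om s x * comp2 wl l x y.
pose Sy l x y := om s x * comp2 vl l x y.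
have cmp_le (u : 'I_m -> trig R R) g l x y c n :
    (forall i, cnorm (tev (u i) x y - g i x y) <= geo c n) ->
    `|rvl u l x y - comp2 g l x y| <= geo c n.
  move=> h; rewrite /rvl /comp2; case: fintype.split => i; apply: le_trans (h i).
    by apply: le_trans (cnorm_Re _); rewrite !ReImE.
  by apply: le_trans (cnorm_Im _); rewrite !ReImE.
have cvw l x y : (fun n => rvl (W n) l x y) @ \oo --> comp2 wl l x y.
  by apply: geo_to c32 _ => n; apply: cmp_le => i; exact: hw.
have cvv l x y : (fun n => rvl (tder1 (W n)) l x y) @ \oo --> comp2 vl l x y.
  by apply: geo_to c32k _ => n; apply: cmp_le => i; exact: hv.
have Srho l x y : `|x| <= 1 -> `|S l x y| <= 2 * (o1 * r).
  move=> x1; apply: (@closed_cvg _ _ \oo eventually_filter (fun n => ov s (W n) l x y) [set z : R | `|z| <= 2 * (o1 * r)]).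
  - apply: (@closed_comp _ _ (fun z : R => `|z|) [set z | z <= 2 * (o1 * r)]).
      by move=> z _; exact: norm_continuous.
    exact: closed_le.
  - by apply: nearW => n; have [h _ _ _ _] := small_W n; apply: (@ov_le R m s (W n)) => // i; have [] := h i.
  - by apply: cvgM; [exact: cvg_cst|exact: cvw].
pose q x y := pt x y (\row_j S j x y).
have qU x y : U (q x y).
  have [h|h] := ltP 1 `|x|; first by apply: Uoff; exact: pt_off.
  by apply: Urho => l; rewrite pt_s mxE; apply: le_lt_trans Hrho; exact: Srho.
have cvq x y : (fun n => qw s (W n) x y) @ \oo --> q x y.
  apply: cvg_rV => j; move: j; apply: idx_case => [||l].
  - by rewrite pt_x; under eq_fun do rewrite pt_x; exact: cvg_cst.
  - by rewrite pt_y; under eq_fun do rewrite pt_y; exact: cvg_cst.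
  rewrite pt_s mxE; under eq_fun do rewrite pt_s mxE.
  by apply: cvgM; [exact: cvg_cst|exact: cvw].
pose Gl l x y := (om s x)^-1 * a l (q x y) + \sum_j comp2 vl j x y * b j l (q x y).
have cvG l x y : (fun n => G s a b (W n) l x y) @ \oo --> Gl l x y.
  apply: cvgD.
    apply: cvgM; first exact: cvg_cst.
    by apply: (continuous_cvg _ _ (cvq x y)); exact: Cb_cont (ga l).1 (qU x y).
  apply: cvg_sumR => j _; apply: cvgM; first exact: cvv.
  by apply: (continuous_cvg _ _ (cvq x y)); exact: Cb_cont (gb j l).1 (qU x y).
(* The truncated sources approach the full sources by Fourier inversion, and the latter tend to the
   source of the limit by continuity of the coefficients. *)
have FE i x y : 0 < y < 1 -> Re (Fl i x y) = - Gl (lshift m i) x y /\ Im (Fl i x y) = - Gl (rshift m i) x y.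
  move=> y01.
  have inv n : cnorm (f n i x y - srcc (W n) i x y) <= geo (32 * (B * r)) n.
    have := @fourier_inversion R (srcc (W n) i) (dsrc s a b (W n) i) (2 * (B * r)) x y n.
    rewrite (_ : 16 * (2 * _) = 32 * (B * r)); last by ring.
    apply=> //.
    - by move=> x' y'; exact: (cderiv_src Uoff Urho ga gb (small_W n)).
    - by move=> x'; exact: (ccont_dsrc Uoff Urho ga gb (small_W n)).
    - by move=> x'; exact: (src01 s ga gb).
    apply: Abd_le (Abd_dsrc Uoff Urho be0 del0 ga gb za zb (small_W n) r0' r0' rk0 i).
    by rewrite ler_pM2l //; exact: X1_le.
  have tot n : cnorm (srcc (W n) i x y - Fl i x y) <= geo (128 * (B * r)) n.
    have -> : srcc (W n) i x y - Fl i x y = - (f n i x y - srcc (W n) i x y) + (f n i x y - Fl i x y) by ring.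
    apply: le_trans (cnormD _ _) _; rewrite cnormN.
    have := inv n; have := hF i x y n; rewrite -!geoM; move: (cnorm _) (cnorm _) (geo _ n) => q1 q2 q3; lra.
  have c128 : 0 <= 128 * (B * r) by rewrite mulr_ge0.
  have srcRe n : Re (srcc (W n) i x y) = - G s a b (W n) (lshift m i) x y.
    have ReC := Re_i.
    have ImC := Im_i.
    by rewrite /src ?(ReC, ImC, ReImE); ring.
  have srcIm n : Im (srcc (W n) i x y) = - G s a b (W n) (rshift m i) x y.
    have ReC := Re_i.
    have ImC := Im_i.
    by rewrite /src ?(ReC, ImC, ReImE); ring.
  split.
    apply: (@cvg_unique _ (@norm_hausdorff R R) ((fun n => Re (srcc (W n) i x y)) @ \oo)).
      apply: geo_to c128 _ => n; apply: le_trans (tot n).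
      by apply: le_trans (cnorm_Re _); rewrite !ReImE.
    have -> : (fun n => Re (srcc (W n) i x y)) = (fun n => - G s a b (W n) (lshift m i) x y) by apply/funext => n; exact: srcRe.
  apply: cvgN; exact: cvG.
  apply: (@cvg_unique _ (@norm_hausdorff R R) ((fun n => Im (srcc (W n) i x y)) @ \oo)).
    apply: geo_to c128 _ => n; apply: le_trans (tot n).
    by apply: le_trans (cnorm_Im _); rewrite !ReImE.
  have -> : (fun n => Im (srcc (W n) i x y)) = (fun n => - G s a b (W n) (rshift m i) x y) by apply/funext => n; exact: srcIm.
  apply: cvgN; exact: cvG.
have cwl i : ccont (fun p : R * R => wl i p.1 p.2).
  apply: (@cgeo_ccont R _ (fun n (p : R * R) => tev (W n i) p.1 p.2) _ _ c32).
    by move=> n; apply: ccont_tev2 => j; have [_ h _ _ _] := small_W n; exact: h.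
  by move=> n p; exact: hw.
have cvl i : ccont (fun p : R * R => vl i p.1 p.2).
  apply: (@cgeo_ccont R _ (fun n (p : R * R) => tev (tder (W n i)) p.1 p.2) _ _ c32k).
    move=> n; apply: ccont_tev2 => j; have [_ h _ _ _] := small_W n.
    by apply: ccontM; [exact: ccont_cst|exact: h].
  by move=> n p; exact: hv.
have cmp_cont g l : (forall i, ccont (fun p : R * R => g i p.1 p.2)) ->
    continuous (fun p : R * R => om s p.1 * comp2 g l p.1 p.2).
  move=> cg p.
  have c1 : {for p, continuous (fun p : R * R => om s p.1)}.
    apply: (@continuous_comp _ _ _ (fun z : R * R => z.1) (om s)); first exact: cvg_fst.
    exact: continuous_om.
  have c2 : {for p, continuous (fun p : R * R => comp2 g l p.1 p.2)}.
    by rewrite /comp2; case: fintype.split => i; [exact: (cg i).1|exact: (cg i).2].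
  by suff : {for p, continuous (fun p : R * R => om s p.1 * comp2 g l p.1 p.2)} by []; exact: continuousM.
have dwl i (x y : R) : cderiv (wl i x) y (vl i x y).
  split.
    apply: (@geo_deriv R (fun n y => Re (tev (W n i) x y)) (fun n y => Re (tev (tder (W n i)) x y))
      (fun y => Re (wl i x y)) (fun y => Re (vl i x y)) _ _ y c32k).
    - by move=> n z; exact: (cderiv_tev (W n i) x z).1.
    - by move=> n z _; apply: le_trans (hw i x z n); apply: le_trans (cnorm_Re _); rewrite !ReImE.
    - by move=> n z _; apply: le_trans (hv i x z n); apply: le_trans (cnorm_Re _); rewrite !ReImE.
  apply: (@geo_deriv R (fun n y => Im (tev (W n i) x y)) (fun n y => Im (tev (tder (W n i)) x y))
    (fun y => Im (wl i x y)) (fun y => Im (vl i x y)) _ _ y c32k).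
  - by move=> n z; exact: (cderiv_tev (W n i) x z).2.
  - by move=> n z _; apply: le_trans (hw i x z n); apply: le_trans (cnorm_Im _); rewrite !ReImE.
  - by move=> n z _; apply: le_trans (hv i x z n); apply: le_trans (cnorm_Im _); rewrite !ReImE.
pose wx i x y := Fl i x y - (s ^+ 2 * x)%:C%C * wl i x y - Complex 0 1 * vl i x y.
pose wxn n i x y := f n i x y - (s ^+ 2 * x)%:C%C * tev (W n.+1 i) x y
     - Complex 0 1 * tev (tder (W n.+1 i)) x y.
have dWx n i (x y : R) : cderiv (fun x => tev (W n.+1 i) x y) x (wxn n i x y).
  have h1 := cderiv_tsol s (csW n i) (modes (2 ^ n)) x y.
  have h2 := @cderiv_interp R s y1 y2 (sg1 i - tev (tsol s (modes (2 ^ n)) (srcc (W n) i)) 0 y1)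
    (sg2 i - tev (tsol s (modes (2 ^ n)) (srcc (W n) i)) 0 y2) x y.
  apply: cderiv_eq (cderiv_ext _ (cderivD h1 h2)) _.
    by move=> z; rewrite /= /pstep [RHS](tev_add (tsol _ _ _)).
  rewrite /wxn /= /pstep (tev_add (tsol _ _ _)).
  have -> : forall u v : trig R R, tev (tder (tadd u v)) x y = tev (tder u) x y + tev (tder v) x y.
    by move=> u v; rewrite {1}/tev /= big_sumType.
  by rewrite /f; ring.
have wxc x : exists2 c, 0 <= c & forall n i z y, `|z - x| <= 1 -> cnorm (wxn n i z y - wx i z y) <= geo c n.
  exists (8 * (12 * (B * r)) + s ^+ 2 * (`|x| + 1) * (8 * (4 * r)) + 8 * (4 * r / kap)).
    by rewrite !addr_ge0 // mulr_ge0 // mulr_ge0 ?sqr_ge0 // addr_ge0.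
  move=> n i z y zx.
  have z1 : `|z| <= `|x| + 1.
    by rewrite -[z](subrK x) addrC; apply: le_trans (ler_normD _ _) _; rewrite lerD2l.
  have -> : wxn n i z y - wx i z y = (f n i z y - Fl i z y)
    - (s ^+ 2 * z)%:C%C * (tev (W n.+1 i) z y - wl i z y)
    - Complex 0 1 * (tev (tder (W n.+1 i)) z y - vl i z y).
    by rewrite /wxn /wx; move: (s ^+ 2 * z)%:C%C (Complex 0 1) => u v; ring.
  apply: le_trans (cnormB _ _) _; apply: le_trans (lerD (cnormB _ _) (lexx _)) _.
  rewrite cnormMRC cnorm_i -!geoD; apply: lerD; first apply: lerD.
  - exact: hF.
  - rewrite -geoM; apply: ler_pM; rewrite ?cnorm_ge0 //.
      by rewrite normrM (ger0_norm (sqr_ge0 s)); apply: ler_wpM2l => //; exact: sqr_ge0.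
    apply: le_trans (hw i z y n.+1) _; rewrite geoS.
    by have := geo_ge0 n c32; lra.
  - apply: le_trans (hv i z y n.+1) _; rewrite geoS.
    by have := geo_ge0 n c32k; lra.
have dwx i (x y : R) : cderiv (fun x => wl i x y) x (wx i x y).
  have [c c0 hc] := wxc x.
  have hwS n z : cnorm (tev (W n.+1 i) z y - wl i z y) <= geo (8 * (4 * r)) n.
    by apply: le_trans (hw i z y n.+1) _; rewrite geoS; have := geo_ge0 n c32; lra.
  split.
    apply: (@geo_deriv R (fun n x => Re (tev (W n.+1 i) x y)) (fun n x => Re (wxn n i x y))
      (fun x => Re (wl i x y)) (fun x => Re (wx i x y)) _ _ x c0).
    - by move=> n z; exact: (dWx n i z y).1.
    - by move=> n z _; apply: le_trans (hwS n z); apply: le_trans (cnorm_Re _); rewrite !ReImE.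
    - by move=> n z zx; apply: le_trans (hc n i z y zx); apply: le_trans (cnorm_Re _); rewrite !ReImE.
  apply: (@geo_deriv R (fun n x => Im (tev (W n.+1 i) x y)) (fun n x => Im (wxn n i x y))
    (fun x => Im (wl i x y)) (fun x => Im (wx i x y)) _ _ x c0).
  - by move=> n z; exact: (dWx n i z y).2.
  - by move=> n z _; apply: le_trans (hwS n z); apply: le_trans (cnorm_Im _); rewrite !ReImE.
  - by move=> n z zx; apply: le_trans (hc n i z y zx); apply: le_trans (cnorm_Im _); rewrite !ReImE.
have dom (x : R) : is_derive x 1 (om s) (s ^+ 2 * x * om s x).
  apply: deriv_eq (deriv_expR (derivM (deriv_cst (s ^+ 2 / 2) x) (deriv_sq x))) _.
  by rewrite /om; field.
have wl1 i : wl i 0 y1 = sg1 i.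
  apply/eqP; rewrite -subr_eq0; apply/eqP; apply: (@geo_eq0 R _ _ c32) => n.
  rewrite -opprB cnormN; have := hw i 0 y1 n.+1; rewrite /= pstep_y1 geoS.
  by have := geo_ge0 n c32; move: (cnorm _) => z; lra.
have wl2 i : wl i 0 y2 = sg2 i.
  apply/eqP; rewrite -subr_eq0; apply/eqP; apply: (@geo_eq0 R _ _ c32) => n.
  rewrite -opprB cnormN; have := hw i 0 y2 n.+1; rewrite /= pstep_y2 geoS.
  by have := geo_ge0 n c32; move: (cnorm _) => z; lra.
have om0 : om s 0 = 1 by rewrite /om expr0n /= mulr0 expR0.
have splitl i : fintype.split (lshift m i) = inl i by exact: (unsplitK (inl i)).
have splitr i : fintype.split (rshift m i) = inr i by exact: (unsplitK (inr i)).
exists S, Sy; split.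
- by move=> l; split; exact: cmp_cont.
- move=> l x y; rewrite /S /Sy.
  have h : is_derive y 1 (comp2 wl l x) (comp2 vl l x y).
    by rewrite /comp2; case: fintype.split => i; [exact: (dwl i x y).1|exact: (dwl i x y).2].
  apply: deriv_eq (derivM (deriv_cst (om s x) y) h) _.
  by rewrite mul0r add0r.
- move=> l x y y01.
  have om0' : om s x != 0 by rewrite gt_eqF // om_gt0.
  have GE l' : om s x * Gl l' x y = a l' (q x y) + \sum_j Sy j x y * b j l' (q x y).
    rewrite /Gl mulrDr mulrA divff // mul1r mulr_sumr; congr (_ + _).
    by apply: eq_bigr => j _; rewrite mulrA.
  have h : is_derive x 1 (fun x => comp2 wl l x y) (comp2 wx l x y).
    by rewrite /comp2; case: fintype.split => i; [exact: (dwx i x y).1|exact: (dwx i x y).2].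
  apply: deriv_eq (derivM (dom x) h) _.
  rewrite -addrA -GE /jrow /Sy /comp2.
  have ReC := Re_i.
  have ImC := Im_i.
  case: (fintype.splitP l) => i li; have [F1 F2] := FE i x y y01.
    have -> : l = lshift m i by exact: val_inj.
    by rewrite splitr /wx ?(ReC, ImC, ReImE) F1; ring.
  have -> : l = rshift m i by exact: val_inj.
  by rewrite splitl /wx ?(ReC, ImC, ReImE) F2; ring.
- by move=> l x y x1; apply: le_lt_trans Hrho; exact: Srho.
- by move=> i; rewrite /S om0 /comp2 splitl splitr wl1 wl2 !mul1r.
Qed.

End Iteration.

(** * Choice of the constants *)

Lemma E1_neq (R : realType) (y1 y2 : R) : 0 < y1 < 1 -> 0 < y2 < 1 -> y1 != y2 ->
  E 1 y1 != E 1 y2 :> R[i].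
Proof.
wlog y12 : y1 y2 / y1 < y2 => [H h1 h2 ne|].
  by case: (ltgtP y1 y2) ne => // lt _; [|rewrite eq_sym]; apply: H; rewrite // lt_eqF.
move=> /andP[h1 h1'] /andP[h2 h2'] _; apply/eqP => e.
have : E 1 (y2 - y1) = 1 :> R[i].
  rewrite EyD -[RHS](@Ey0 R 1) -(subrr y1) EyD; congr (_ * _); exact: esym e.
have -> : E 1 (y2 - y1) = (cos (2 * pi * (y2 - y1)) +i* sin (2 * pi * (y2 - y1)))%C :> R[i].
  by rewrite /E /freq mulr1.
case=> + _.
have -> : 2 * pi * (y2 - y1) = (pi * (y2 - y1)) *+ 2 :> R by rewrite mulr2n; ring.
rewrite cos_mulr2n.
have : 0 < sin (pi * (y2 - y1)).
  have pi0 := @pi_gt0 R.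
  by apply: sin_gt0_pi; rewrite ?mulr_gt0 ?gtr_pMr //; lra.
move=> s0; have := sin2cos2 (pi * (y2 - y1)); have : 0 < sin (pi * (y2 - y1)) ^+ 2 by rewrite exprn_gt0.
move: (sin _ ^+ 2) (cos _ ^+ 2) => p q; rewrite mulr2n; lra.
Qed.

(** The order is s, kap, r, del: s beats the bound be on the coefficients through the gain 1 / s,
    kap absorbs [modeC s], r is small against om1, kap and rho, and del against r. None of them
    depends on the coefficients beyond be and rho, so one del serves all structures near J. *)
Theorem pde_solution (R : realType) (m : nat) (be rho y1 y2 : R) :
  0 <= be -> 0 < rho -> 0 < y1 < 1 -> 0 < y2 < 1 -> y1 != y2 ->
  exists2 del, 0 < del & forall (U : set 'rV[R]_(1 + 1 + (m + m)))
    (a : 'I_(m + m) -> 'rV[R]_(1 + 1 + (m + m)) -> R)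
    (b : 'I_(m + m) -> 'I_(m + m) -> 'rV[R]_(1 + 1 + (m + m)) -> R)
    (t1 t2 : 'I_(m + m) -> R),
  @off_box R m `<=` U ->
  (forall q : 'rV[R]_(1 + 1 + (m + m)), (forall l, `|q 0 (iS l)| < rho) -> U q) ->
  (forall l, good U 4 be (a l)) -> (forall j l, good U 3 be (b j l)) ->
  (forall l, atzero del (a l) /\ atzero del (pd (iy m) (a l))) ->
  (forall j l, atzero del (b j l)) ->
  (forall l, `|t1 l| <= del /\ `|t2 l| <= del) ->
  exists S Sy : 'I_(m + m) -> R -> R -> R, [/\
  (forall l, continuous (fun p : R * R => S l p.1 p.2) /\ continuous (fun p : R * R => Sy l p.1 p.2)),
  (forall l (x y : R), is_derive y 1 (S l x) (Sy l x y)),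
  (forall l (x y : R), 0 < y < 1 -> is_derive x 1 (fun x => S l x y)
    (- (jrow (fun j => Sy j x y) l + a l (pt x y (\row_j S j x y)) +
        \sum_j Sy j x y * b j l (pt x y (\row_j S j x y))))),
  (forall l (x y : R), `|x| <= 1 -> `|S l x y| < rho) &
  forall l, S l 0 y1 = t1 l /\ S l 0 y2 = t2 l].
Proof.
move=> be0 rho0 y1I y2I y12.
have e12 := E1_neq y1I y2I y12.
pose ci := @cI R y1 y2; have ci0 : 0 <= ci := cI_ge0 _ _.
pose B := 40 * ((m + m)%:R * compK R m * be) + 1.
have B0 : 0 < B by rewrite ltr_wpDl // !mulr_ge0 // compK_ge0.
have K0 := modeK_gt0 R.
pose s := Num.max 1 (8 * ((2 + 8 * ci) * modeK R * B)).
have s1 : 1 <= s by rewrite le_max lexx.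
have s0 : 0 < s by apply: lt_le_trans s1.
have sle : 8 * ((2 + 8 * ci) * modeK R * B) <= s by rewrite le_max lexx orbT.
have Hmu : (2 + 8 * ci) * (modeK R / s) * B <= 8^-1.
  rewrite (_ : _ * B = (2 + 8 * ci) * modeK R * B / s); last by ring.
  by rewrite ler_pdivrMr //; lra.
pose nu := modeC s.
have nu0 : 0 <= nu by rewrite addr_ge0 // !mulr_ge0 // ltW.
have nB0 : 0 <= nu * B by rewrite mulr_ge0 // ltW.
pose kap := (8 * nu * B + 1)^-1.
have kd : 0 < 8 * nu * B + 1 by rewrite ltr_wpDl // -mulrA mulr_ge0.
have kap0 : 0 < kap by rewrite invr_gt0.
have kE : kap * (8 * nu * B + 1) = 1 by rewrite mulVf // gt_eqF.
have kn : 0 <= kap * (nu * B) by rewrite mulr_ge0 // ltW.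
have kap1 : kap <= 1 by move: kE kn; lra.
have Hnu : 8 * nu * B * kap <= 1 by move: kE kn; lra.
have Hkap : kap * (2 * nu * B + 1) <= 1 by move: kE kn; lra.
pose o1 := @om1 R s; have o11 : 1 <= o1 := om1_ge1 s.
have o10 : 0 < o1 by apply: lt_le_trans o11.
pose mm : R := (m + m)%:R; have mm0 : 0 <= mm by [].
pose r := Num.min rho kap / (4 * (mm + 1) * o1).
have mn0 : 0 < Num.min rho kap by rewrite lt_min rho0.
have d0 : 0 < 4 * (mm + 1) * o1 by rewrite !mulr_gt0 // ltr_wpDl.
have r0 : 0 < r by rewrite divr_gt0.
have rE : 4 * (mm + 1) * (o1 * r) = Num.min rho kap.
  by rewrite mulrA /r mulrC divfK // gt_eqF.
have or0 : 0 < o1 * r by rewrite mulr_gt0.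
have mor : 0 <= mm * (o1 * r) by rewrite mulr_ge0 // ltW.
have min1 : Num.min rho kap <= rho by rewrite ge_min lexx.
have min2 : Num.min rho kap <= kap by rewrite ge_min lexx orbT.
have Hrho : 2 * (o1 * r) < rho by move: rE or0 mor min1; lra.
have Hr1 : 2 * (o1 * r) <= kap by move: rE or0 mor min2; lra.
have Hr2 : mm * (o1 * r) <= kap by move: rE or0 mor min2; lra.
pose del := Num.min (r / 24) (r / (8 * ci + 1)).
have c1 : 0 < 8 * ci + 1 by rewrite ltr_wpDl // mulr_ge0.
have del0 : 0 < del by rewrite lt_min !divr_gt0.
have Hdel : 24 * del <= r.
  have : del <= r / 24 by rewrite ge_min lexx.
  by lra.
have Hsg : 4 * ci * (2 * del) <= r.
  have : del <= r / (8 * ci + 1) by rewrite ge_min lexx orbT.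
  by rewrite ler_pdivlMr // => h; have := ltW del0; lra.
exists del => // U a b t1 t2 Uoff Urho ga gb za zb ht.
pose sg1 (i : 'I_m) : R[i] := Complex (t1 (lshift m i)) (t1 (rshift m i)).
pose sg2 (i : 'I_m) : R[i] := Complex (t2 (lshift m i)) (t2 (rshift m i)).
have Hsg1 i : cnorm (sg1 i) <= 2 * del.
  by rewrite /cnorm /=; have := (ht (lshift m i)).1; have := (ht (rshift m i)).1; lra.
have Hsg2 i : cnorm (sg2 i) <= 2 * del.
  by rewrite /cnorm /=; have := (ht (lshift m i)).2; have := (ht (rshift m i)).2; lra.
have [S [Sy [h1 h2 h3 h4 h5]]] := @pde_limit R m U rho s Uoff Urho a b be del be0 (ltW del0) ga gb za zb
  y1 y2 sg1 sg2 r kap (2 * del) s1 e12 Hmu Hnu Hkap kap0 kap1 r0 Hrho Hr1 Hr2 Hdel Hsg1 Hsg2 Hsg.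
exists S, Sy; split=> // l.
case: (fintype.splitP l) => i li; have [a1 a2 a3 a4] := h5 i.
  by have -> : l = lshift m i by exact: val_inj.
by have -> : l = rshift m i by exact: val_inj.
Qed.

(** * Cut-off functions of finite smoothness *)

Section Bumps.
Variable R : realType.

Lemma pd_comp1 k (f : R -> R) (h : 'rV[R]_k -> R) x (d : R) :
  is_derive (h x) 1 f d -> differentiable h x ->
  differentiable (fun y => f (h y)) x /\ forall i, pd i (fun y => f (h y)) x = d * pd i h x.
Proof.
move=> [df fd] dh; have dff : differentiable f (h x) by exact/derivable1_diffP.
have dfh : differentiable (f \o h) x by exact: differentiable_comp.
have E (c : R) : 'd f (h x) c = d * c.
  rewrite -{1}[c]mulr1 -[c * 1]/(c *: (1 : R)) linearZ /= -deriveE // fd.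
  exact: mulrC.
by split=> // i; rewrite -[pd i _]/(pd i (f \o h)) /pd deriveE // diff_comp //= E -deriveE.
Qed.

(** Powers of the positive part serve as cut-offs: they are of class C^(p-1), and the construction
    uses a bounded number of derivatives. *)
Definition pospow (p : nat) (t : R) : R := Num.max 0 t ^+ p.

Lemma pospow_ge0 p t : 0 <= pospow p t.
Proof. by rewrite exprn_ge0 // le_max lexx. Qed.

Lemma pospow_eq0 p t : t <= 0 -> pospow p.+1 t = 0.
Proof. by move=> t0; rewrite /pospow (max_idPl t0) expr0n. Qed.

Lemma pospow_gt0 p t : 0 < t -> 0 < pospow p t.
Proof. by move=> t0; rewrite exprn_gt0 // lt_max t0 orbT. Qed.

Lemma deriv_exprn (p : nat) (x : R) : is_derive x 1 (fun t : R => t ^+ p.+1) (p.+1%:R * x ^+ p).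
Proof.
elim: p => [|p IH].
  apply: (deriv_eq (deriv_ext (fun t => esym (expr1 t)) (deriv_id x))).
  by rewrite expr0 mulr1.
apply: (deriv_eq (deriv_ext (fun t => esym (exprS t p.+1)) (derivM (deriv_id x) IH))).
by rewrite -[p.+2%:R]natr1 exprS; move: p.+1%:R => c; ring.
Qed.

Lemma deriv_near (f g : R -> R) (x d : R) : (\forall t \near x, f t = g t) ->
  is_derive x 1 f d -> is_derive x 1 g d.
Proof.
move=> fg /is_derive1_epsP H; apply/is_derive1_epsP => e e0.
have [d1 d10 h1] := H e e0; have /nbhs_normP[d2 d20 h2] := fg.
exists (Num.min d1 d2) => [|t]; first by rewrite lt_min d10.
rewrite lt_min => /andP[t1 t2]; rewrite -!h2 ?h1 ?subrr ?normr0 //.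
by rewrite addrC addKr.
Qed.

Lemma deriv_pospow (p : nat) (t : R) :
  is_derive t 1 (pospow p.+2) (p.+2%:R * pospow p.+1 t).
Proof.
have [t0|t0|t0] := ltgtP t 0.
- apply: deriv_eq (deriv_near _ (deriv_cst 0 t)) _; last by rewrite pospow_eq0 ?mulr0 // ltW.
  apply/nbhs_normP; exists (- t) => [|z]; first by rewrite oppr_gt0.
  by rewrite ltr_norml => /andP[_ h]; rewrite pospow_eq0 //; lra.
- apply: deriv_eq (deriv_near _ (deriv_exprn p.+1 t)) _; last first.
    by rewrite /pospow (max_idPr (ltW t0)).
  apply/nbhs_normP; exists t => // z.
  rewrite ltr_norml => /andP[h _]; rewrite /pospow (max_idPr _) //; lra.
rewrite t0 pospow_eq0 // mulr0; apply/is_derive1_epsP => e e0.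
exists (Num.min 1 e) => [|h]; first by rewrite lt_min ltr01.
rewrite lt_min => /andP[h1 he]; rewrite mul0r add0r !subr0 (pospow_eq0 _ (lexx 0)) subr0.
have hm : Num.max 0 h <= `|h| by rewrite ge_max normr_ge0 ler_norm.
have m0 : 0 <= Num.max 0 h by rewrite le_max lexx.
rewrite /pospow normrX ger0_norm // -[p.+2]addn2 exprD expr2.
apply: le_trans (_ : 1 * (e * `|h|) <= _); last by rewrite mul1r.
apply: ler_pM; rewrite ?exprn_ge0 ?mulr_ge0 //.
  by rewrite exprn_ile1 // (le_trans hm) // ltW.
by apply: ler_pM => //; apply: le_trans hm (ltW he).
Qed.

Lemma Cn_pospow k n p (U : set 'rV[R]_k) h : open U -> Cn n U h ->
  Cn n U (fun q => pospow (n + p).+1 (h q)).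
Proof.
move=> oU; elim: n p => [|n IH] p ch.
  move=> x Ux; apply: (@continuous_comp _ _ _ h (pospow (0 + p).+1)); first exact: ch.
  have c : continuous (fun t : R => Num.max 0 t).
    have -> : (fun t : R => Num.max 0 t) = (fun t => (t + `|t|) / 2).
      by apply/funext => t; rewrite maxr_absE add0r sub0r normrN.
    move=> t; apply: cvgM; last exact: cvg_cst.
    by apply: cvgD; [exact: cvg_id|exact: norm_continuous].
  suff cp r : continuous (fun t : R => Num.max 0 t ^+ r.+1) by exact: cp.
  elim: r => [|r IH'].
    by have -> : (fun t : R => Num.max 0 t ^+ 1) = (fun t => Num.max 0 t) by apply/funext => t; rewrite expr1.
  have -> : (fun t : R => Num.max 0 t ^+ r.+2) = (fun t => Num.max 0 t * Num.max 0 t ^+ r.+1).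
    by apply/funext => t; rewrite exprS.
  by move=> t; apply: cvgM; [exact: c|exact: IH'].
have [dh pdh] := ch.
have D x : U x -> differentiable (fun q => pospow (n.+1 + p).+1 (h q)) x /\ forall i,
    pd i (fun q => pospow (n.+1 + p).+1 (h q)) x = (n.+1 + p).+1%:R * pospow (n + p).+1 (h x) * pd i h x.
  by move=> Ux; apply: pd_comp1; [exact: deriv_pospow|exact: dh].
split=> [x Ux|i]; first exact: (D x Ux).1.
apply: (@Cn_ext R k n U (fun x => (n.+1 + p).+1%:R * pospow (n + p).+1 (h x) * pd i h x)) => //.
  by move=> x Ux; rewrite (D x Ux).2.
have c1 := Cn_mul oU (Cn_cst n U (n.+1 + p).+1%:R) (IH p (CnW ch)).
exact: Cn_mul oU c1 (pdh i).
Qed.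

End Bumps.

(** * Matrix-valued functions of class C^n *)

Section MatrixFunctions.
Variable R : realType.
Variables (k n : nat) (U : set 'rV[R]_k).
Hypothesis oU : open U.

Definition Cnm p r (A : 'rV[R]_k -> 'M[R]_(p, r)) := forall i j, Cn n U (fun x => A x i j).

Lemma Cnm_mul p r t (A : 'rV[R]_k -> 'M[R]_(p, r)) (B : 'rV[R]_k -> 'M[R]_(r, t)) :
  Cnm A -> Cnm B -> Cnm (fun x => A x *m B x).
Proof.
move=> cA cB i j; apply: (Cn_ext oU (f := fun x => \sum_l A x i l * B x l j)).
  by move=> x _; rewrite mxE.
by apply: Cn_sum => // l _; exact: Cn_mul.
Qed.

Lemma Cn_det p (A : 'rV[R]_k -> 'M[R]_p) : Cnm A -> Cn n U (fun x => \det (A x)).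
Proof.
move=> cA; apply: Cn_sum => // s _; apply: Cn_mul => //; first exact: Cn_cst.
by apply: Cn_prod => // i _; exact: cA.
Qed.

Lemma Cnm_inv p (A : 'rV[R]_k -> 'M[R]_p) : Cnm A -> (forall x, U x -> A x \in unitmx) ->
  Cnm (fun x => invmx (A x)).
Proof.
move=> cA uA i j.
apply: (Cn_ext oU (f := fun x => (\det (A x))^-1 * cofactor (A x) j i)).
  by move=> x Ux; rewrite /invmx (uA x Ux) !mxE.
apply: Cn_mul => //.
  apply: Cn_inv => // [x Ux|]; last exact: Cn_det.
  by have := uA x Ux; rewrite unitmxE unitfE.
apply: Cn_mul => //; first exact: Cn_cst.
apply: (@Cn_det _ (fun x => row' j (col' i (A x)))) => i' j'.
apply: (@Cn_ext R k n U (fun x => A x (lift j i') (lift i j'))) => //.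
by move=> x _; rewrite !mxE.
Qed.

End MatrixFunctions.

(** * Families that tend to zero with their derivatives *)

Section NullFamilies.
Variable R : realType.
Variables (X : Type) (F : set_system X).
Context {FF : Filter F}.

Definition unif0 k (W : set 'rV[R]_k) (h : X -> 'rV[R]_k -> R) : Prop :=
  forall K e, compact K -> K `<=` W -> 0 < e ->
    \forall x \near F, forall q, K q -> `|h x q| <= e.

(* Families of functions of class C^n tending to 0 along F, together with their partial
   derivatives of order at most n, uniformly on the compact subsets of W. *)
Fixpoint nul k (n : nat) (W : set 'rV[R]_k) (h : X -> 'rV[R]_k -> R) : Prop :=
  [/\ forall x, Cn n W (h x), unif0 W h &
      match n with 0 => True | n'.+1 => forall i, nul n' W (fun x => pd i (h x)) end].

Lemma nul_unif0 k n (W : set 'rV[R]_k) h : nul n W h -> unif0 W h.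
Proof. by case: n => [|n] []. Qed.

Lemma nulW k n (W : set 'rV[R]_k) h : nul n.+1 W h -> nul n W h.
Proof.
elim: n h => [|n IH] h [c u d]; first by split=> // x; exact: CnW.
by split=> // [x|i]; [exact: CnW|apply: IH; exact: d].
Qed.

Lemma pd_eqW k (W : set 'rV[R]_k) (f g : 'rV[R]_k -> R) i : open W ->
  (forall q, W q -> f q = g q) -> forall q, W q -> pd i f q = pd i g q.
Proof.
move=> oW e q Wq; apply: pd_near.
have : nbhs q W by exact: open_nbhs_nbhs.
by apply: filterS => z; exact: e.
Qed.

Lemma nul_ext k n (W : set 'rV[R]_k) h h' : open W -> (forall x q, W q -> h x q = h' x q) ->
  nul n W h -> nul n W h'.
Proof.
move=> oW; elim: n h h' => [|n IH] h h' e [c u d]; split=> //.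
- by move=> x; apply: (Cn_ext oW _ (c x)); exact: e.
- move=> K eps cK KW e0; apply: filterS (u K eps cK KW e0) => x hx q Kq.
  by rewrite -e; [exact: hx|exact: KW].
- by move=> x; apply: (Cn_ext oW _ (c x)); exact: e.
- move=> K eps cK KW e0; apply: filterS (u K eps cK KW e0) => x hx q Kq.
  by rewrite -e; [exact: hx|exact: KW].
- move=> i; apply: (IH _ _ _ (d i)) => x q Wq; apply: (pd_eqW i oW) => // z; exact: e.
Qed.

Lemma unif0_add k (W : set 'rV[R]_k) h h' : unif0 W h -> unif0 W h' ->
  unif0 W (fun x q => h x q + h' x q).
Proof.
move=> u u' K e cK KW e0; have e20 : 0 < e / 2 by rewrite divr_gt0.
apply: filterS2 (u K _ cK KW e20) (u' K _ cK KW e20) => x h1 h2 q Kq.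
by apply: le_trans (ler_normD _ _) _; have := h1 q Kq; have := h2 q Kq; lra.
Qed.

Lemma nul_add k n (W : set 'rV[R]_k) h h' : open W -> nul n W h -> nul n W h' ->
  nul n W (fun x q => h x q + h' x q).
Proof.
move=> oW; elim: n h h' => [|n IH] h h' [c u d] [c' u' d']; split=> //.
- by move=> x; exact: Cn_add.
- exact: unif0_add.
- by move=> x; exact: Cn_add.
- exact: unif0_add.
move=> i; apply: (nul_ext oW _ (IH _ _ (d i) (d' i))) => x q Wq.
have [dh _] := c x; have [dh' _] := c' x; have {}dh := dh q Wq; have {}dh' := dh' q Wq.
by rewrite /pd deriveD //; apply: diff_derivable.
Qed.

Lemma compact_bound k (W K : set 'rV[R]_k) (f : 'rV[R]_k -> R) :
  compact K -> K `<=` W -> Cn 0 W f -> exists2 M, 0 < M & forall q, K q -> `|f q| <= M.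
Proof.
move=> cK KW cf; have cfK : {within K, continuous f}.
  by apply: continuous_in_subspaceT => q; rewrite inE => qK; apply: cf; exact: KW.
have /compact_bounded[M [_ hM]] := continuous_compact cfK cK.
exists (`|M| + 1) => [|q Kq]; first by rewrite ltr_wpDl.
by apply: hM; [exact: le_lt_trans (ler_norm _) (ltr_pwDr _ _)|exists q].
Qed.

Lemma unif0_mul k (W : set 'rV[R]_k) f h : Cn 0 W f -> unif0 W h ->
  unif0 W (fun x q => f q * h x q).
Proof.
move=> cf u K e cK KW e0; have [M M0 hM] := compact_bound cK KW cf.
have eM : 0 < e / M by rewrite divr_gt0.
apply: filterS (u K _ cK KW eM) => x hx q Kq; rewrite normrM.
have -> : e = M * (e / M) by field; rewrite gt_eqF.
by apply: ler_pM => //; [exact: hM|exact: hx].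
Qed.

Lemma nul_mul k n (W : set 'rV[R]_k) f h : open W -> Cn n W f -> nul n W h ->
  nul n W (fun x q => f q * h x q).
Proof.
move=> oW; elim: n f h => [|n IH] f h cf [c u d]; split=> //.
- by move=> x; exact: Cn_mul.
- exact: unif0_mul.
- by move=> x; exact: Cn_mul.
- by apply: unif0_mul => //; exact: (Cn_le (leq0n _) cf).
move=> i; have [df pdf] := cf.
have n1 := IH f _ (CnW cf) (d i).
have n2 := IH (pd i f) h (pdf i) (nulW (And3 c u d)).
apply: (nul_ext oW _ (nul_add oW n1 n2)) => x q Wq.
have [dh _] := c x; have {}dh := dh q Wq; have {}df := df q Wq.
by rewrite /pd deriveM; [rewrite /GRing.scale /= [X in _ + X]mulrC|exact: diff_derivable|exact: diff_derivable].
Qed.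

Lemma nul_sum k n (W : set 'rV[R]_k) (I : finType) (h : I -> X -> 'rV[R]_k -> R) : open W ->
  (forall i, nul n W (h i)) -> nul n W (fun x q => \sum_i h i x q).
Proof.
move=> oW nh.
have z : nul n W (fun _ _ => 0).
  elim: n {nh} => [|n IH]; split=> //.
  - by move=> x; exact: Cn_cst.
  - by move=> K e _ _ e0; apply: nearW => x q _; rewrite normr0 ltW.
  - by move=> x; exact: Cn_cst.
  - by move=> K e _ _ e0; apply: nearW => x q _; rewrite normr0 ltW.
  by move=> i; apply: (nul_ext oW _ IH) => x q _; rewrite pd_cst.
suff H : forall s, nul n W (fun x q => \sum_(i <- s) h i x q) by exact: H.
elim=> [|i s IH]; first by apply: (nul_ext oW _ z) => x q _; rewrite big_nil.
by apply: (nul_ext oW _ (nul_add oW (nh i) IH)) => x q _; rewrite big_cons.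
Qed.

Lemma nul_comp k l n (W : set 'rV[R]_k) (V : set 'rV[R]_l) (G : 'rV[R]_k -> 'rV[R]_l) h :
  open W -> (forall q, W q -> V (G q)) -> (forall j, Cn n W (fun q => G q 0 j)) ->
  nul n V h -> nul n W (fun x q => h x (G q)).
Proof.
move=> oW WV; have u0 (h' : X -> 'rV[R]_l -> R) : (forall j, Cn 0 W (fun q => G q 0 j)) ->
    unif0 V h' -> unif0 W (fun x q => h' x (G q)).
  move=> cG u K e cK KW e0.
  have cGK : {within K, continuous G}.
    apply: continuous_in_subspaceT => q; rewrite inE => qK.
    apply: mx_continuous_entries => i j.
    by rewrite ord1; apply: cG; exact: KW.
  have cGG := continuous_compact cGK cK.
  have GV : G @` K `<=` V by move=> _ [q Kq <-]; apply: WV; exact: KW.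
  by apply: filterS (u _ e cGG GV e0) => x hx q Kq; apply: hx; exists q.
elim: n h => [|n IH] h cG [c u d]; split=> //.
- by move=> x; exact: (Cn_comp oW WV (c x)).
- exact: u0.
- by move=> x; exact: (Cn_comp oW WV (c x)).
- by apply: u0 => // j; exact: (Cn_le (leq0n _) (cG j)).
move=> i; have nn : nul n W (fun x q => \sum_j pd i (fun q => G q 0 j) q * pd j (h x) (G q)).
  apply: nul_sum => // j; apply: nul_mul => //; first by case: (cG j) => _; exact.
  by apply: (IH (fun x => pd j (h x)) _ (d j)) => j'; exact: CnW.
apply: (nul_ext oW _ nn) => x q Wq; rewrite pd_comp.
- by apply: eq_bigr => j _; rewrite mulrC.
- by have [dh _] := c x; apply: dh; exact: WV.
- by move=> j; have [dG _] := cG j; exact: dG.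
Qed.

Lemma nul_pd k n (W : set 'rV[R]_k) h i : nul n.+1 W h -> nul n W (fun x => pd i (h x)).
Proof. by move=> [_ _ d]; exact: d. Qed.

(** The bound is fixed by the limit f and the compact set, before any family is considered. *)
Lemma nul_bound k n (W K : set 'rV[R]_k) (f : 'rV[R]_k -> R) : open W -> compact K -> K `<=` W ->
  Cn n W f -> exists2 M, 0 < M & forall h, (forall x, Cn n W (h x)) ->
    nul n W (fun x q => h x q - f q) -> \forall x \near F, Cb n M K (h x).
Proof.
move=> oW cK KW; elim: n f => [|n IH] f cf.
  have [M M0 hM] := compact_bound cK KW cf; exists (M + 1); first by rewrite addr_gt0.
  move=> h ch [_ u _]; apply: filterS (u K 1 cK KW ltr01) => x hx q Kq.
  split; first by apply: ch; exact: KW.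
  rewrite -[h x q](subrK (f q)) addrC; apply: le_trans (ler_normD _ _) _.
  by apply: lerD; [exact: hM|exact: hx].
have [df pdf] := cf; have [M M0 hM] := compact_bound cK KW (Cn_le (leq0n _) cf).
have exN i : exists N, 0 < N /\ forall h, (forall x, Cn n W (h x)) ->
    nul n W (fun x q => h x q - pd i f q) -> \forall x \near F, Cb n N K (h x).
  by have [N N0 hN] := IH (pd i f) (pdf i); exists N.
have [N hN] := choice exN.
have N0 i : 0 <= N i by have [h _] := hN i; exact: ltW.
exists (M + 1 + \sum_i N i) => [|h ch nh].
  by rewrite ltr_pwDl ?sumr_ge0 // addr_gt0 // ltr01.
have [_ u _] := nh.
have hi i : \forall x \near F, Cb n (N i) K (pd i (h x)).
  apply: (hN i).2 => [x|]; first by case: (ch x) => _; exact.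
  apply: (nul_ext oW _ (nul_pd i nh)) => x q Wq.
  by have [dh _] := ch x; rewrite /pd deriveB //; apply: diff_derivable; [exact: dh|exact: df].
apply: filterS2 (u K 1 cK KW ltr01) (filter_forall FF hi) => x hx hx'.
split=> [q Kq|i].
  split; first by case: (ch x) => dh _; apply: dh; exact: KW.
  rewrite -[h x q](subrK (f q)) addrC; apply: le_trans (ler_normD _ _) _.
  rewrite -[leLHS]addr0; apply: lerD; last by rewrite sumr_ge0.
  by apply: lerD; [exact: hM|exact: hx].
apply: Cb_le (hx' i); rewrite (bigD1 i) //= addrCA lerDl addr_ge0 //.
  by rewrite addr_ge0 // ltW.
exact: sumr_ge0.
Qed.

End NullFamilies.

(** * Regularity of C^1 solutions of the Cauchy-Riemann equations *)

Section CauchyRiemann.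
Variable R : realType.
Notation C := (R[i]).
Notation i0 := (lshift 1 (0 : 'I_1) : 'I_(1 + 1)).
Notation i1 := (rshift 1 (0 : 'I_1) : 'I_(1 + 1)).

Definition vecz (c : C) : 'rV[R]_(1 + 1) := row_mx (Re c)%:M (Im c)%:M.

Lemma vecz0 c : vecz c 0 i0 = Re c.
Proof. by rewrite /vecz row_mxEl mxE eqxx. Qed.
Lemma vecz1 c : vecz c 0 i1 = Im c.
Proof. by rewrite /vecz row_mxEr mxE eqxx. Qed.

Lemma ord2_case (P : 'I_(1 + 1) -> Prop) : P i0 -> P i1 -> forall j, P j.
Proof.
move=> h0 h1 j; rewrite -(splitK j); case: (fintype.split j) => l; rewrite ord1.
  exact: h0.
exact: h1.
Qed.

Lemma sum_ord2 (V : nmodType) (F : 'I_(1 + 1) -> V) : \sum_j F j = F i0 + F i1.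
Proof. by rewrite big_split_ord !big_ord1. Qed.

Lemma vecz_complex (z : 'rV[R]_(1 + 1)) : vecz (to_complex z) = z.
Proof. by apply/rowP; apply: ord2_case; rewrite ?vecz0 ?vecz1. Qed.

Definition cinv (x : C) : C :=
  Complex (Re x / (Re x ^+ 2 + Im x ^+ 2)) (- Im x / (Re x ^+ 2 + Im x ^+ 2)).

Lemma cinvP x : 0 < Re x ^+ 2 + Im x ^+ 2 -> x * cinv x = 1.
Proof.
move=> n0; have e (u v : R) : Re (Complex u v) = u by [].
have e' (u v : R) : Im (Complex u v) = v by [].
have n1 : Re x ^+ 2 + Im x ^+ 2 != 0 by rewrite gt_eqF.
case: x n0 n1 {e e'} => p q /= n0 n1.
have r1 : p * (p / (p ^+ 2 + q ^+ 2)) - q * (- q / (p ^+ 2 + q ^+ 2)) = 1 by field; exact: n1.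
have r2 : p * (- q / (p ^+ 2 + q ^+ 2)) + q * (p / (p ^+ 2 + q ^+ 2)) = 0 by field; exact: n1.
by apply: ceqP; [exact: r1|exact: r2].
Qed.

Lemma ccont_cinv (T : topologicalType) (f : T -> C) : ccont f ->
  (forall t, 0 < Re (f t) ^+ 2 + Im (f t) ^+ 2) -> ccont (fun t => cinv (f t)).
Proof.
move=> [c1 c2] n0.
have cn : continuous (fun t => (Re (f t) ^+ 2 + Im (f t) ^+ 2)^-1).
  move=> t; apply: cvgV; first by rewrite gt_eqF.
  by apply: cvgD; rewrite expr2; under eq_fun do rewrite expr2; apply: cvgM; (exact: c1 || exact: c2).
split=> t; rewrite /cinv.
  by apply: cvgM; [exact: c1|exact: cn].
by apply: cvgM; [apply: cvgN; exact: c2|exact: cn].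
Qed.

Section Kernel.
Variables (a : C) (r : R) (phi : R -> C) (Phi : R).
Hypothesis r0 : 0 < r.
Hypothesis cphi : ccont phi.
Hypothesis phiM : forall t, cnorm (phi t) <= Phi.

Definition circ (t : R) : C := a + r%:C%C * E 1 t.
Definition inball (z : C) : Prop := `|Re (z - a)| <= r / 8 /\ `|Im (z - a)| <= r / 8.
Definition ker (z : C) (t : R) : C := cinv (circ t - z).
Definition cauchyint (k : nat) (z : C) : C := cinteg (fun t => phi t * ker z t ^+ k) 0 1.

Lemma circ_Re t : Re (circ t) = Re a + r * cos (freq R 1 * t).
Proof. by rewrite /circ ReD ReM ReRC ImRC mul0r subr0. Qed.
Lemma circ_Im t : Im (circ t) = Im a + r * sin (freq R 1 * t).
Proof. by rewrite /circ ImD ImM ReRC ImRC mul0r addr0. Qed.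

(** The squared distance is r^2 minus cross terms plus |z - a|^2, and with z - a of size r / 8 in
    each coordinate the cross terms are at most r^2 / 2 in total. *)
Lemma circ_den z t : inball z ->
  r ^+ 2 / 2 <= Re (circ t - z) ^+ 2 + Im (circ t - z) ^+ 2 /\
  `|Re (circ t - z)| <= 2 * r /\ `|Im (circ t - z)| <= 2 * r.
Proof.
move=> [h1 h2]; pose c := cos (freq R 1 * t); pose s := sin (freq R 1 * t).
have cs : c ^+ 2 + s ^+ 2 = 1 by exact: cos2Dsin2.
have lc : `|c| <= 1 by exact: cos_max.
have ls : `|s| <= 1 by exact: sin_max.
rewrite ReD ReN ImD ImN circ_Re circ_Im -/c -/s.
rewrite !ReImE in h1 h2; move: (Re z) (Im z) (Re a) (Im a) h1 h2 => x y p q h1 h2.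
have e1 : p + r * c - x = r * c - (x - p) by ring.
have e2 : q + r * s - y = r * s - (y - q) by ring.
rewrite e1 e2; move: (x - p) (y - q) h1 h2 => u v h1 h2.
have b1 : `|r * c| <= r by rewrite normrM gtr0_norm // ger_pMr.
have b2 : `|r * s| <= r by rewrite normrM gtr0_norm // ger_pMr.
have b3 : `|r * c * u| <= r * (r / 8) by rewrite normrM; apply: ler_pM.
have b4 : `|r * s * v| <= r * (r / 8) by rewrite normrM; apply: ler_pM.
split; last first.
  by split; (apply: le_trans (ler_normB _ _) _); [apply: le_trans (lerD b1 h1) _|apply: le_trans (lerD b2 h2) _]; move: r0; lra.
have -> : (r * c - u) ^+ 2 + (r * s - v) ^+ 2 =
  r ^+ 2 * (c ^+ 2 + s ^+ 2) - 2 * (r * c * u) - 2 * (r * s * v) + (u ^+ 2 + v ^+ 2) by ring.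
rewrite cs mulr1; have uv : 0 <= u ^+ 2 + v ^+ 2 by rewrite addr_ge0 // sqr_ge0.
move: b3 b4; rewrite !ler_norml expr2 => /andP[_ b3] /andP[_ b4].
move: (r * c * u) (r * s * v) (u ^+ 2 + v ^+ 2) b3 b4 uv => A B D b3 b4 uv.
lra.
Qed.

Lemma circ_pos z t : inball z -> 0 < Re (circ t - z) ^+ 2 + Im (circ t - z) ^+ 2.
Proof.
move=> zb; have [h _] := circ_den t zb; apply: lt_le_trans h.
by rewrite divr_gt0 // exprn_gt0.
Qed.

Lemma kerP z t : inball z -> (circ t - z) * ker z t = 1.
Proof. by move=> zb; apply: cinvP; exact: circ_pos. Qed.

Definition Qk : R := 8 / r.
Let Q0 : 0 <= Qk. Proof. by rewrite divr_ge0 // ltW. Qed.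

Lemma ker_le z t : inball z -> cnorm (ker z t) <= Qk.
Proof.
move=> zb; have [h [h1 h2]] := circ_den t zb; have p := circ_pos t zb.
rewrite /ker /cinv /cnorm /= mulNr normrN !normrM normfV (gtr0_norm p) -mulrDl.
rewrite ler_pdivrMr //; apply: le_trans (_ : 4 * r <= _); first lra.
apply: le_trans (_ : Qk * (r ^+ 2 / 2) <= _); last by rewrite ler_wpM2l.
by rewrite le_eqVlt /Qk; apply/orP; left; apply/eqP; field; rewrite gt_eqF.
Qed.

Lemma ccont_circ : ccont circ.
Proof.
by apply: ccontD; [exact: ccont_cst|apply: ccontM; [exact: ccont_cst|exact: ccont_E]].
Qed.

Lemma ccont_ker z : inball z -> ccont (ker z).
Proof.
move=> zb; apply: ccont_cinv; last by move=> t; exact: circ_pos.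
by apply: ccontB; [exact: ccont_circ|exact: ccont_cst].
Qed.

Lemma ccont_exp (T : topologicalType) (f : T -> C) k : ccont f -> ccont (fun t => f t ^+ k).
Proof.
move=> cf; elim: k => [|k IH].
  by apply: ccont_ext (ccont_cst T 1) => t; rewrite expr0.
by apply: ccont_ext (ccontM cf IH) => t; rewrite exprS.
Qed.

Lemma kerB z h t : inball z -> inball (z + h) ->
  ker (z + h) t - ker z t = h * ker z t * ker (z + h) t.
Proof.
move=> zb zhb; have e1 := kerP t zb; have e2 := kerP t zhb.
have {}e2 : circ t * ker (z + h) t = 1 + (z + h) * ker (z + h) t by rewrite -e2; ring.
have {}e1 : circ t * ker z t = 1 + z * ker z t by rewrite -e1; ring.
move: (circ t) (ker z t) (ker (z + h) t) e1 e2 => c u v e1 e2.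
have E1 : (c - z) * u = 1 by rewrite mulrBl e1; ring.
have E2 : (c - (z + h)) * v = 1 by rewrite mulrBl e2; ring.
transitivity (v * ((c - z) * u) - u * ((c - (z + h)) * v)); last by ring.
by rewrite E1 E2 !mulr1.
Qed.

(** Induction on k from the resolvent identity [kerB]; both the Lipschitz bound and the second-order
    remainder are carried along. *)
Lemma ker_expB k : exists2 c, 0 <= c & forall z h t, inball z -> inball (z + h) ->
  cnorm (ker (z + h) t ^+ k - ker z t ^+ k) <= c * cnorm h /\
  cnorm (ker (z + h) t ^+ k - ker z t ^+ k - k%:R * h * ker z t ^+ k.+1) <= c * cnorm h ^+ 2.
Proof.
have cn1 : cnorm (1 : C) = 1 by rewrite /cnorm /= normr1 normr0 addr0.
have cexp k' (u : C) : cnorm u <= Qk -> cnorm (u ^+ k') <= (1 + Qk) ^+ k'.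
  move=> uQ; elim: k' => [|k' IH]; first by rewrite !expr0 cn1.
  rewrite !exprS; apply: le_trans (cnormM _ _) _; apply: ler_pM; rewrite ?cnorm_ge0 //.
  by apply: le_trans uQ _; rewrite lerDr.
elim: k => [|k [c c0 IH]].
  exists 0 => // z h t _ _; rewrite !expr0 subrr !mul0r sub0r oppr0 cnorm0; split; exact: lexx.
pose T := (1 + Qk) ^+ k.
have Q1 : 0 <= 1 + Qk by rewrite addr_ge0.
have T0 : 0 <= T by rewrite exprn_ge0.
exists (T * (Qk * Qk) * (1 + Qk) + c * Qk + c * (Qk * Qk)); first exact: addr_ge0 (addr_ge0 (mulr_ge0 (mulr_ge0 T0 (mulr_ge0 Q0 Q0)) Q1) (mulr_ge0 c0 Q0)) (mulr_ge0 c0 (mulr_ge0 Q0 Q0)).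
move=> z h t zb zhb; have [i1 i2] := IH z h t zb zhb.
have e := kerB t zb zhb.
have u1 := ker_le t zb; have v1 := ker_le t zhb; have vk := cexp k _ v1.
move: (ker z t) (ker (z + h) t) e u1 v1 vk i1 i2 => u v e u1 v1 vk i1 i2.
have H0 := cnorm_ge0 h; have U0 := cnorm_ge0 u; have V0 := cnorm_ge0 v.
have huv : cnorm (v - u) <= cnorm h * Qk * Qk.
  rewrite e; apply: le_trans (cnormM _ _) _; apply: ler_pM; rewrite ?cnorm_ge0 //.
  by apply: le_trans (cnormM _ _) _; apply: ler_pM; rewrite ?cnorm_ge0.
split.
  have -> : v ^+ k.+1 - u ^+ k.+1 = v ^+ k * (v - u) + (v ^+ k - u ^+ k) * u by rewrite !exprS; ring.
  apply: le_trans (cnormD _ _) _.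
  have g1 : cnorm (v ^+ k * (v - u)) <= T * (cnorm h * Qk * Qk).
    by apply: le_trans (cnormM _ _) _; apply: ler_pM; rewrite ?cnorm_ge0.
  have g2 : cnorm ((v ^+ k - u ^+ k) * u) <= c * cnorm h * Qk.
    by apply: le_trans (cnormM _ _) _; apply: ler_pM; rewrite ?cnorm_ge0.
  apply: le_trans (lerD g1 g2) _.
  have z1 : 0 <= T * (Qk * Qk) * Qk * cnorm h := mulr_ge0 (mulr_ge0 (mulr_ge0 T0 (mulr_ge0 Q0 Q0)) Q0) H0.
  have z2 : 0 <= c * (Qk * Qk) * cnorm h := mulr_ge0 (mulr_ge0 c0 (mulr_ge0 Q0 Q0)) H0.
  by move: (cnorm h) (T) (Qk) z1 z2 => H t' q; lra.
have -> : v ^+ k.+1 - u ^+ k.+1 - k.+1%:R * h * u ^+ k.+2 =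
  v ^+ k * ((v - u) * (h * u)) + (v ^+ k - u ^+ k) * (h * u * u) + (v ^+ k - u ^+ k - k%:R * h * u ^+ k.+1) * u
   + v ^+ k * (v - u - h * u * v).
  rewrite -[k.+1%:R]natr1 !exprS; move: (k%:R) => kk; ring.
rewrite e subrr mulr0 addr0 -e.
have hu : cnorm (h * u) <= cnorm h * Qk.
  by apply: le_trans (cnormM _ _) _; apply: ler_pM; rewrite ?cnorm_ge0.
apply: le_trans (cnormD _ _) _; apply: le_trans (lerD (cnormD _ _) (lexx _)) _.
have g1 : cnorm (v ^+ k * ((v - u) * (h * u))) <= T * (cnorm h * Qk * Qk * (cnorm h * Qk)).
  apply: le_trans (cnormM _ _) _; apply: ler_pM; rewrite ?cnorm_ge0 //.
  by apply: le_trans (cnormM _ _) _; apply: ler_pM; rewrite ?cnorm_ge0.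
have g2 : cnorm ((v ^+ k - u ^+ k) * (h * u * u)) <= c * cnorm h * (cnorm h * Qk * Qk).
  apply: le_trans (cnormM _ _) _; apply: ler_pM; rewrite ?cnorm_ge0 //.
  by apply: le_trans (cnormM _ _) _; apply: ler_pM; rewrite ?cnorm_ge0.
have g3 : cnorm ((v ^+ k - u ^+ k - k%:R * h * u ^+ k.+1) * u) <= c * cnorm h ^+ 2 * Qk.
  by apply: le_trans (cnormM _ _) _; apply: ler_pM; rewrite ?cnorm_ge0.
apply: le_trans (lerD (lerD g1 g2) g3) _.
have z1 : 0 <= T * (Qk * Qk) * cnorm h ^+ 2 := mulr_ge0 (mulr_ge0 T0 (mulr_ge0 Q0 Q0)) (sqr_ge0 _).
rewrite expr2 in z1 *; by move: (cnorm h) (T) (Qk) z1 => H t' q; lra.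
Qed.

Lemma cauchyint_diff k : exists2 c, 0 <= c & forall z h, inball z -> inball (z + h) ->
  cnorm (cauchyint k (z + h) - cauchyint k z - k%:R * h * cauchyint k.+1 z) <= c * cnorm h ^+ 2.
Proof.
have Phi0 : 0 <= Phi := le_trans (cnorm_ge0 _) (phiM 0).
have [c c0 hc] := ker_expB k; exists (2 * (Phi * c)); first by rewrite !mulr_ge0.
move=> z h zb zhb; have cz := ccont_ker zb; have czh := ccont_ker zhb.
have c1 := ccontM cphi (ccont_exp k czh); have c2 := ccontM cphi (ccont_exp k cz).
have c3 := ccontM cphi (ccont_exp k.+1 cz).
have c4 := ccontM (ccont_cst R (k%:R * h)) c3.
rewrite /cauchyint -(cintegB _ _ c1 c2) -(cintegZ _ _ _ c3) -(cintegB _ _ (ccontB c1 c2) c4).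
rewrite (@cinteg_ext R _ (fun t => phi t * (ker (z + h) t ^+ k - ker z t ^+ k - k%:R * h * ker z t ^+ k.+1))); last first.
  by move=> t; ring.
have := @cinteg_norm_leM _ (fun t => phi t * (ker (z + h) t ^+ k - ker z t ^+ k - k%:R * h * ker z t ^+ k.+1)) (Phi * (c * cnorm h ^+ 2)) 0 1 ler01.
rewrite subr0 mulr1 => H; apply: le_trans (H _ _) _.
- apply: ccontM => //; apply: ccontB; last by apply: ccontM; [exact: ccont_cst|exact: ccont_exp].
  by apply: ccontB; exact: ccont_exp.
- move=> t _; apply: le_trans (cnormM _ _) _; apply: ler_pM; rewrite ?cnorm_ge0 //.
  by have [] := hc z h t zb zhb.
have : 0 <= Phi * (c * cnorm h ^+ 2) := mulr_ge0 Phi0 (mulr_ge0 c0 (sqr_ge0 _)).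
by move: (cnorm h ^+ 2) => H2; lra.
Qed.

Let B : set 'rV[R]_(1 + 1) := [set z | `|z - vecz a| < r / 8].

Lemma open_B : open B.
Proof.
rewrite openE => z zB; suff : \forall y \near z, B y by [].
apply/nbhs_normP; exists (r / 8 - `|z - vecz a|); first by rewrite subr_gt0.
move=> y yz; rewrite /B /= -(subrK z y) -addrA; apply: le_lt_trans (ler_normD _ _) _.
by rewrite -ltrBrDr.
Qed.

Lemma B_inball z : B z -> inball (to_complex z).
Proof.
move=> zB; split; rewrite !ReImE.
  by apply: le_trans (ltW zB); rewrite -(vecz0 a); have := mx_entry_norm (z - vecz a) 0 i0; rewrite !mxE.
by apply: le_trans (ltW zB); rewrite -(vecz1 a); have := mx_entry_norm (z - vecz a) 0 i1; rewrite !mxE.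
Qed.

Lemma to_complexD (z h : 'rV[R]_(1 + 1)) : to_complex (z + h) = to_complex z + to_complex h.
Proof. by apply: ceqP; rewrite [RHS](ReD, ImD) /to_complex /= mxE. Qed.

Lemma cnorm_to_complex (h : 'rV[R]_(1 + 1)) : cnorm (to_complex h) <= 2 * `|h|.
Proof.
rewrite /cnorm /=; have := mx_entry_norm h 0 i0; have := mx_entry_norm h 0 i1; lra.
Qed.

Lemma Re_RM (k : nat) (z : C) : Re (k%:R * z) = k%:R * Re z /\ Im (k%:R * z) = k%:R * Im z.
Proof. by rewrite !mulr_natl; elim: k => [|k [IH1 IH2]]; rewrite ?mulr0n // !mulrS !ReImE IH1 IH2. Qed.

(** The complex derivative of [cauchyint k] is k times [cauchyint k.+1], so partial derivatives are
    again Cauchy integrals. *)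
Lemma Cn_cauchyint n k :
  Cn n B (fun z => Re (cauchyint k (to_complex z))) /\
  Cn n B (fun z => Im (cauchyint k (to_complex z))).
Proof.
have D k' z : B z ->
   [/\ differentiable (fun z => Re (cauchyint k' (to_complex z))) z /\
       differentiable (fun z => Im (cauchyint k' (to_complex z))) z,
     forall i, pd i (fun z => Re (cauchyint k' (to_complex z))) z =
        (if i == i0 then k'%:R * Re (cauchyint k'.+1 (to_complex z)) else - (k'%:R * Im (cauchyint k'.+1 (to_complex z)))) &
     forall i, pd i (fun z => Im (cauchyint k' (to_complex z))) z =
        (if i == i0 then k'%:R * Im (cauchyint k'.+1 (to_complex z)) else k'%:R * Re (cauchyint k'.+1 (to_complex z)))].
  move=> zB; have [c c0 hc] := cauchyint_diff k'.
  have i10 : (i1 == i0) = false by [].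
  have key e : 0 < e -> exists2 del, 0 < del & forall h : 'rV[R]_(1 + 1), `|h| < del ->
     cnorm (cauchyint k' (to_complex (h + z)) - cauchyint k' (to_complex z) -
       k'%:R * to_complex h * cauchyint k'.+1 (to_complex z)) <= e * `|h|.
    move=> e0; have /nbhs_normP[d d0 hd] : \forall y \near z, B y.
      by apply: open_nbhs_nbhs; split=> //; exact: open_B.
    exists (Num.min d (e / (4 * c + 1))) => [|h].
      by rewrite lt_min d0 divr_gt0 // ltr_wpDl // mulr_ge0.
    rewrite lt_min => /andP[h1 h2].
    have hB : B (h + z) by apply: hd; rewrite addrK.
    have := hc (to_complex z) (to_complex h); rewrite -to_complexD [z + h]addrC => H.
    apply: le_trans (H (B_inball zB) (B_inball hB)) _.
    have hh := cnorm_to_complex h; have n0 := cnorm_ge0 (to_complex h).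
    have h20 := normr_ge0 h.
    move: h2; rewrite ltr_pdivlMr ?ltr_wpDl ?mulr_ge0 // => h2.
    apply: le_trans (_ : c * (2 * `|h| * (2 * `|h|)) <= _).
      by apply: ler_wpM2l => //; rewrite expr2; apply: ler_pM.
    have -> : c * (2 * `|h| * (2 * `|h|)) = (`|h| * (4 * c)) * `|h| by ring.
    apply: ler_wpM2r => //; lra.
  have d1 := @differentiable_eps R _ (fun z => Re (cauchyint k' (to_complex z))) z
    (fun i => if i == i0 then k'%:R * Re (cauchyint k'.+1 (to_complex z)) else - (k'%:R * Im (cauchyint k'.+1 (to_complex z)))).
  have d2 := @differentiable_eps R _ (fun z => Im (cauchyint k' (to_complex z))) z
    (fun i => if i == i0 then k'%:R * Im (cauchyint k'.+1 (to_complex z)) else k'%:R * Re (cauchyint k'.+1 (to_complex z))).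
  have [|d11 d12] := d1; last have [|d21 d22] := d2; last by split.
    move=> e e0; have [d d0 hd] := key e e0; exists d => // h hh.
    apply: le_trans (hd h hh); apply: le_trans (cnorm_Re _).
    rewrite sum_ord2 eqxx i10 -(mulrA (k'%:R : C) (to_complex h)) !ReD !ReN (Re_RM k' (to_complex h * cauchyint k'.+1 (to_complex z))).1 ReM -[Re (to_complex h)]/(h 0 i0) -[Im (to_complex h)]/(h 0 i1).
    rewrite le_eqVlt; apply/orP; left; apply/eqP; congr (`|_ - _|).
    by move: (cauchyint k'.+1 _) (h 0 _) (h 0 _) (k'%:R) => c' u v q; ring.
  move=> e e0; have [d d0 hd] := key e e0; exists d => // h hh.
  apply: le_trans (hd h hh); apply: le_trans (cnorm_Im _).
  rewrite sum_ord2 eqxx i10 -(mulrA (k'%:R : C) (to_complex h)) !ImD !ImN (Re_RM k' (to_complex h * cauchyint k'.+1 (to_complex z))).2 ImM -[Re (to_complex h)]/(h 0 i0) -[Im (to_complex h)]/(h 0 i1).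
  rewrite le_eqVlt; apply/orP; left; apply/eqP; congr (`|_ - _|).
  by move: (cauchyint k'.+1 _) (h 0 _) (h 0 _) (k'%:R) => c' u v q; ring.
elim: n k => [|n IH] k.
  split=> z zB; have [[h1 h2] _ _] := D k z zB.
    exact: differentiable_continuous h1.
  exact: differentiable_continuous h2.
have [J1 J2] := IH k.+1; have oB := open_B.
have cM (f : 'rV[R]_(1 + 1) -> R) : Cn n B f -> Cn n B (fun z => k%:R * f z).
  by move=> cf; exact: Cn_mul oB (Cn_cst n B k%:R) cf.
split; split.
- by move=> z zB; have [[]] := D k z zB.
- move=> i; apply: (Cn_ext oB (f := fun z => if i == i0 then k%:R * Re (cauchyint k.+1 (to_complex z))
     else - (k%:R * Im (cauchyint k.+1 (to_complex z))))) => [z zB|].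
    by have [_ h _] := D k z zB; rewrite h.
  by case: (i == i0); [exact: cM|apply: Cn_opp => //; exact: cM].
- by move=> z zB; have [[]] := D k z zB.
- move=> i; apply: (Cn_ext oB (f := fun z => if i == i0 then k%:R * Im (cauchyint k.+1 (to_complex z))
     else k%:R * Re (cauchyint k.+1 (to_complex z)))) => [z zB|].
    by have [_ _ h] := D k z zB; rewrite h.
  by case: (i == i0); exact: cM.
Qed.

End Kernel.

Section Regularity.
Variables (W : set 'rV[R]_(1 + 1)) (h1 h2 : 'rV[R]_(1 + 1) -> R).
Hypothesis oW : open W.
Hypothesis (c1 : Cn 1 W h1) (c2 : Cn 1 W h2).
Hypothesis CR1 : forall z, W z -> pd i0 h1 z = pd i1 h2 z.
Hypothesis CR2 : forall z, W z -> pd i1 h1 z = - pd i0 h2 z.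

Let w (z : C) : C := Complex (h1 (vecz z)) (h2 (vecz z)).
Let dw (z : C) : C := Complex (pd i0 h1 (vecz z)) (pd i0 h2 (vecz z)).

Lemma cderiv_w (g : R -> C) (t : R) (d : C) : cderiv g t d -> W (vecz (g t)) ->
  cderiv (fun t => w (g t)) t (dw (g t) * d).
Proof.
move=> [d1 d2] Wg.
have dq j : is_derive t 1 (fun t => vecz (g t) 0 j) (if j == i0 then Re d else Im d).
  move: j; apply: ord2_case; first by apply: deriv_ext d1 => z; rewrite vecz0.
  by apply: deriv_ext d2 => z; rewrite vecz1.
have e (u v : R) : Re (Complex u v) = u by [].
have e' (u v : R) : Im (Complex u v) = v by [].
split.
  have := @deriv_curve R _ h1 (fun t => vecz (g t)) _ t (c1.1 _ Wg) dq.
  by rewrite sum_ord2 eqxx /= CR2 // => H; apply: deriv_eq H _; rewrite ReM /dw e e'; ring.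
have := @deriv_curve R _ h2 (fun t => vecz (g t)) _ t (c2.1 _ Wg) dq.
by rewrite sum_ord2 eqxx /= -CR1 // => H; apply: deriv_eq H _; rewrite ImM /dw e e'; ring.
Qed.

Lemma ccont_on (T : topologicalType) (g : T -> C) (f1 f2 : 'rV[R]_(1 + 1) -> R) :
  Cn 0 W f1 -> Cn 0 W f2 -> ccont g -> (forall t, W (vecz (g t))) ->
  ccont (fun t => Complex (f1 (vecz (g t))) (f2 (vecz (g t)))).
Proof.
move=> cf1 cf2 [g1 g2] Wg.
have cv : continuous (fun t => vecz (g t)).
  move=> t; apply: mx_continuous_entries => i j; rewrite ord1; move: j; apply: ord2_case.
    by rewrite (_ : (fun y => _) = fun y => Re (g y)); [exact: g1|apply/funext => y; rewrite vecz0].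
  by rewrite (_ : (fun y => _) = fun y => Im (g y)); [exact: g2|apply/funext => y; rewrite vecz1].
split=> t /=.
  by apply: (@continuous_comp _ _ _ (fun t => vecz (g t)) f1); [exact: cv|exact: cf1].
by apply: (@continuous_comp _ _ _ (fun t => vecz (g t)) f2); [exact: cv|exact: cf2].
Qed.

(* Cauchy's formula, by differentiating the integral along the segments joining z to the circle. *)
Lemma cauchy_formula (a z : C) (r : R) : 0 < r ->
  (forall u : C, `|Re (u - a)| <= r -> `|Im (u - a)| <= r -> W (vecz u)) -> inball a r z ->
  w z * cauchyint a r (E 1) 1 z = cauchyint a r (fun t => w (circ a r t) * E 1 t) 1 z.
Proof.
move=> r0 BW zb; pose e t := circ a r t.
pose P s t : C := z + (ramp s)%:C%C * (e t - z).
have en t : `|Re (e t - a)| <= r /\ `|Im (e t - a)| <= r.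
  rewrite /e /circ addrC addKr (ReM, ImM) ImM !ReImE !mul0r subr0 addr0 !normrM (gtr0_norm r0).
  by rewrite !ger_pMr //=; split; [exact: cos_max|exact: sin_max].
have PW s t : W (vecz (P s t)).
  have [zb1 zb2] := zb; have [e1 e2] := en t.
  have q0 := ramp_ge0 s; have q1 := ramp_le1 s.
  rewrite !ReImE in zb1 zb2 e1 e2.
  apply: BW; rewrite /P !ReImE !mul0r ?subr0 ?addr0.
    move: (ramp s) (Re z) (Re (e t)) (Re a) q0 q1 zb1 e1 => q x y p q0 q1; rewrite !ler_norml => /andP[u1 u2] /andP[v1 v2].
    by apply/andP; split; nra.
  move: (ramp s) (Im z) (Im (e t)) (Im a) q0 q1 zb2 e2 => q x y p q0 q1; rewrite !ler_norml => /andP[u1 u2] /andP[v1 v2].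
  by apply/andP; split; nra.
have cP : ccont (fun p : R * R => P p.1 p.2).
  apply: ccontD; first exact: ccont_cst.
  apply: ccontM.
    apply: ccontRC => p; apply: (@continuous_comp _ _ _ (fun p : R * R => p.1) (@ramp R)); first exact: cvg_fst.
    exact: (is_derive_continuous (@deriv_ramp R)).
  apply: ccontB; last exact: ccont_cst.
  by apply: (ccont_comp (h := snd)); [move=> p; exact: cvg_snd|exact: ccont_circ].
have cdw : ccont (fun p : R * R => dw (P p.1 p.2)).
  by apply: ccont_on cP _ => //; [exact: c1.2|exact: c2.2].
have cw : ccont (fun p : R * R => w (P p.1 p.2)).
  apply: ccont_on cP _ => //; [exact: (Cn_le (leq0n _) c1)|exact: (Cn_le (leq0n _) c2)].
have slice (f : R -> R -> C) s : ccont (fun p : R * R => f p.1 p.2) -> ccont (f s).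
  by move=> cf; apply: (ccont_comp (h := fun t => (s, t))) cf; exact: continuous_pairR.
have dP s t : cderiv (fun s => P s t) s ((dramp s)%:C%C * (e t - z)).
  have := cderivD (cderiv_cst z s) (cderivM (cderivRC (deriv_ramp s)) (cderiv_cst (e t - z) s)).
  by move=> H; apply: cderiv_eq H _; rewrite mulr0 addr0 add0r.
have dPt s t : cderiv (P s) t ((ramp s)%:C%C * (r%:C%C * (Complex 0 (freq R 1) * E 1 t))).
  have d1 := cderivD (cderiv_cst a t) (cderivZ r%:C%C (cderiv_E 1 t)).
  have := cderivD (cderiv_cst z t) (cderivZ (ramp s)%:C%C (cderivB d1 (cderiv_cst z t))).
  by move=> H; apply: cderiv_eq H _; rewrite add0r subr0 add0r.
pose h s t := w (P s t) * (E 1 t * ker a r z t).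
pose hs s t := (dramp s)%:C%C * (dw (P s t) * E 1 t).
have cE2 : ccont (fun p : R * R => E 1 p.2 : C).
  by apply: (ccont_comp (h := snd)); [move=> p; exact: cvg_snd|exact: ccont_E].
have chs : ccont (fun p : R * R => hs p.1 p.2).
  apply: ccontM; last exact: ccontM.
  apply: ccontRC => p; apply: (@continuous_comp _ _ _ (fun p : R * R => p.1) (@dramp R)); first exact: cvg_fst.
  exact: continuous_dramp.
have ck := ccont_ker r0 zb.
have ch s : ccont (h s).
  apply: ccontM; first exact: (slice (fun s t => w (P s t))).
  by apply: ccontM => //; exact: ccont_E.
have dh s t : cderiv (h^~ t) s (hs s t).
  have H := cderivM (cderiv_w (dP s t) (PW s t)) (cderiv_cst (E 1 t * ker a r z t) s).
  apply: cderiv_eq H _; rewrite mulr0 addr0 /hs.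
  have := kerP r0 t zb; rewrite -/(e t); move: (dw _) (dramp s)%:C%C (ker a r z t) (E 1 t) (e t - z) => A B K F D DK.
  by rewrite -[RHS]mulr1 -DK; ring.
(* Up to a constant factor the integrand is the derivative in t of w along the closed curve [P s].
   That factor contains ramp s; where ramp s = 0, dramp s vanishes as well. *)
have zero s : cinteg (hs s) 0 1 = 0.
  have cdE : ccont (fun t => dw (P s t) * E 1 t).
    by apply: ccontM; [exact: (slice (fun s t => dw (P s t)))|exact: ccont_E].
  rewrite cintegZ //; set I := cinteg _ _ _.
  have [q0|q0] := eqVneq (sin (s * (pi / 2)) : R) 0.
    by rewrite /dramp q0 mul0r mulr0 mul0r.
  have qn : ramp s != 0 by rewrite /ramp expf_neq0.
  have D t := cderiv_w (dPt s t) (PW s t).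
  have := cintegE 0 1 D; rewrite {2}/P {2}/P /e /circ Ey1 Ey0 subrr.
  rewrite (@cinteg_ext R _ (fun t => ((ramp s)%:C%C * (r%:C%C * Complex 0 (freq R 1))) * (dw (P s t) * E 1 t))); last first.
    by move=> t; ring.
  rewrite cintegZ // -/I => /eqP; rewrite !mulf_eq0 => /orP[|/eqP ->]; last by rewrite mulr0.
  move=> H; exfalso; move: H; rewrite /freq mulr1.
  have pi0 := @pi_gt0 R.
  have nz (x : R) : x != 0 -> x%:C%C == 0 :> C = false.
    by move=> x0; apply/negP => /eqP e0; move: x0; rewrite -(ReRC x) e0 eqxx.
  rewrite (nz _ qn) (nz r (lt0r_neq0 r0)) /= => /eqP e0.
  have := congr1 (@complex.Im R) e0; rewrite /= => /eqP; rewrite gt_eqF // mulr_gt0 //.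
have D s : cderiv (fun s => cinteg (h s) 0 1) s 0.
  by rewrite -(zero s); exact: (@cderiv_integ R h hs s 0 1 ler01 ch dh chs).
have := cintegE 0 1 D; rewrite cinteg0 => /esym /eqP; rewrite subr_eq0 => /eqP.
rewrite /h /P ramp0 ramp1 => H.
rewrite /cauchyint -cintegZ; last first.
  by apply: ccontM; [exact: ccont_E|apply: ccont_exp; exact: ck].
transitivity (cinteg (fun t => w (z + 0%:C%C * (e t - z)) * (E 1 t * ker a r z t)) 0 1).
  by apply: cinteg_ext => t; rewrite expr1 mul0r addr0.
rewrite -H; apply: cinteg_ext => t; rewrite expr1 -mulrA; congr (w _ * _).
by rewrite -[1%:C%C]/(1 : C) mul1r addrC subrK.
Qed.

(** Cauchy's formula reads w D = N near x, where D and N are Cauchy integrals and therefore smooth.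
    Since D is nonzero at x one may divide, and D has to be computed at the centre only, where it is
    1 / r. *)
Lemma cr_smooth n : Cn n W h1 /\ Cn n W h2.
Proof.
suff H x : W x -> exists2 Nb : set 'rV[R]_(1 + 1), open Nb /\ Nb x & Cn n Nb h1 /\ Cn n Nb h2.
  have loc (f : 'rV[R]_(1 + 1) -> R) k :
     (forall x, W x -> exists2 Nb : set 'rV[R]_(1 + 1), open Nb /\ Nb x & Cn k Nb f) -> Cn k W f.
    elim: k f => [|k IH] f L; first by move=> x Wx; have [Nb [_ Nbx] c] := L x Wx; exact: c.
    split=> [x Wx|i]; first by have [Nb [_ Nbx] [d _]] := L x Wx; exact: d.
    by apply: IH => x Wx; have [Nb oNb [_ d]] := L x Wx; exists Nb; [exact: oNb|exact: d].
  by split; apply: loc => x Wx; have [Nb oNb [k1 k2]] := H x Wx; exists Nb.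
move=> Wx; have /nbhs_normP[d d0 hd] : \forall y \near x, W y by exact: open_nbhs_nbhs.
pose a := to_complex x; pose r := d / 2.
have r0 : 0 < r by rewrite divr_gt0.
have BW (u : C) : `|Re (u - a)| <= r -> `|Im (u - a)| <= r -> W (vecz u).
  move=> b1 b2; apply: hd; apply: mx_norm_lt => // i j; rewrite ord1.
  have -> : (vecz u - x) 0 j = vecz u 0 j - x 0 j by rewrite [LHS]mxE; congr (_ + _); rewrite mxE.
  move: j.
  have rd : r < d by rewrite /r; lra.
  apply: ord2_case; rewrite ?vecz0 ?vecz1; apply: le_lt_trans rd; rewrite !ReImE in b1 b2.
    exact: b1.
  exact: b2.
have va : vecz a = x by exact: vecz_complex.
pose phi t : C := w (circ a r t) * E 1 t.
have ew : W `<=` W by [].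
have cwc : ccont (fun t => w (circ a r t)).
  apply: ccont_on (ccont_circ a r) _ => //; [exact: (Cn_le (leq0n _) c1)|exact: (Cn_le (leq0n _) c2)|].
  move=> t; apply: BW; rewrite /circ addrC addKr ?ReM ?ImM !ReImE !mul0r ?subr0 ?addr0 normrM (gtr0_norm r0) ger_pMr //=.
    exact: cos_max.
  exact: sin_max.
have cphi : ccont phi by apply: ccontM => //; exact: ccont_E.
have [Phi phiM] : exists Phi, forall t, cnorm (phi t) <= Phi.
  pose K : set 'rV[R]_(1 + 1) := [set v | forall i, [set` `[x 0 i - r, x 0 i + r]] (v ord0 i)].
  have cK : compact K.
    apply: (@rV_compact R _ (fun i => [set` `[x 0 i - r, x 0 i + r]])) => i; exact: segment_compact.
  have KW : K `<=` W.
    move=> v Kv; rewrite -(vecz_complex v); apply: BW; rewrite !ReImE ler_distl.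
      by have := Kv i0; rewrite /= in_itv.
    by have := Kv i1; rewrite /= in_itv.
  have [M1 M10 hM1] := compact_bound cK KW (Cn_le (leq0n _) c1).
  have [M2 M20 hM2] := compact_bound cK KW (Cn_le (leq0n _) c2).
  exists ((M1 + M2) * 2) => t; apply: le_trans (cnormM _ _) _.
  apply: ler_pM; rewrite ?cnorm_ge0 ?cnorm_E //.
  have Kt : K (vecz (circ a r t)).
    move=> i; rewrite /= in_itv /= -ler_distl; move: i; apply: ord2_case.
      by rewrite vecz0 circ_Re /a /to_complex /= addrC addKr normrM (gtr0_norm r0) ger_pMr // cos_max.
    by rewrite vecz1 circ_Im /a /to_complex /= addrC addKr normrM (gtr0_norm r0) ger_pMr // sin_max.
  by apply: lerD; [exact: hM1|exact: hM2].
have [N1 N2] := @Cn_cauchyint a r phi Phi r0 cphi phiM n 1.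
have [D1 D2] := @Cn_cauchyint a r (E 1) 2 r0 (@ccont_E R 1) (@cnorm_E R 1) n 1.
pose d1 z := Re (cauchyint a r (E 1) 1 (to_complex z)).
pose d2 z := Im (cauchyint a r (E 1) 1 (to_complex z)).
pose n1 z := Re (cauchyint a r phi 1 (to_complex z)).
pose n2 z := Im (cauchyint a r phi 1 (to_complex z)).
pose dd z := d1 z * d1 z + d2 z * d2 z.
pose B := [set z : 'rV[R]_(1 + 1) | `|z - vecz a| < r / 8].
have oB : open B by exact: open_B.
have Bx : B x by rewrite /B /= va subrr normr0 divr_gt0.
have cdd : Cn n B dd by apply: Cn_add => //; exact: Cn_mul.
have ddx : dd x != 0.
  have za : inball a r a by split; rewrite subrr normr0 divr_ge0 // ltW.
  have E1 t : E 1 t * ker a r a t ^+ 1 = (r^-1)%:C%C.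
    have := kerP r0 t za; rewrite /circ addrC addKr expr1 -mulrA => e.
    have rr : (r^-1)%:C%C * r%:C%C = 1 :> C by rewrite -RCM mulVf // gt_eqF.
    by rewrite -[LHS]mul1r -rr -mulrA e mulr1.
  have e1 : cauchyint a r (E 1) 1 a = (r^-1)%:C%C.
    rewrite /cauchyint (cinteg_ext _ _ E1).
    have D (t : R) : cderiv (fun t => (t * r^-1)%:C%C) t (r^-1)%:C%C.
      apply: cderivRC; apply: deriv_eq (derivM (deriv_id t) (deriv_cst _ t)) _.
      by rewrite mul1r mulr0 addr0.
    by rewrite (cintegE _ _ D) mul0r mul1r subr0.
  rewrite /dd /d1 /d2 -/a e1 /= mulr0 addr0 mulf_neq0 // invr_neq0 // gt_eqF //.
have [e e0 he] : exists2 e, 0 < e & forall z, `|z - x| < e -> B z /\ dd z != 0.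
  have c := Cn_continuous cdd Bx.
  have /nbhs_normP[e e0 he] : \forall z \near x, B z /\ dd z != 0.
    apply: filterS2 (_ : \forall z \near x, B z) (c _ (_ : nbhs (dd x) [set u | u != 0])) => //.
      exact: open_nbhs_nbhs.
    by apply: open_nbhs_nbhs; split => //; exact: open_neq.
  by exists e.
pose Nb : set 'rV[R]_(1 + 1) := [set z | `|z - x| < e].
have oO : open Nb.
  rewrite openE => z zO; suff : \forall y \near z, Nb y by [].
  apply/nbhs_normP; exists (e - `|z - x|); first by rewrite subr_gt0.
  move=> y yz; rewrite /Nb /= -(subrK z y) -addrA; apply: le_lt_trans (ler_normD _ _) _.
  by rewrite -ltrBrDr.
exists Nb; first by split=> //; rewrite /Nb /= subrr normr0.
have OB : Nb `<=` B by move=> z /he[].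
have cOdd : Cn n Nb (fun z => (dd z)^-1).
  by apply: Cn_inv => // [z /he[]|] //; exact: Cn_sub OB cdd.
have cO f : Cn n B f -> Cn n Nb f by exact: Cn_sub.
have fE z : Nb z -> w (to_complex z) * cauchyint a r (E 1) 1 (to_complex z) = cauchyint a r phi 1 (to_complex z).
  by move=> /OB Bz; apply: cauchy_formula => //; exact: B_inball.
have wE z : w (to_complex z) = Complex (h1 z) (h2 z) by rewrite /w vecz_complex.
have solve z : Nb z -> h1 z = (n1 z * d1 z + n2 z * d2 z) * (dd z)^-1 /\
    h2 z = (n2 z * d1 z - n1 z * d2 z) * (dd z)^-1.
  move=> Oz; have := fE z Oz; rewrite wE => H; have [_ d0'] := he z Oz.
  have a1 : n1 z = h1 z * d1 z - h2 z * d2 z.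
    by have := congr1 (@complex.Re R) H; rewrite ReM => /esym.
  have a2 : n2 z = h1 z * d2 z + h2 z * d1 z.
    by have := congr1 (@complex.Im R) H; rewrite ImM => /esym.
  rewrite a1 a2; move: d0'; rewrite /dd; move: (d1 z) (d2 z) (h1 z) (h2 z) => p q u v d0'.
  by split; field; exact: d0'.
have cN := conj (cO _ N1) (cO _ N2); have cD := conj (cO _ D1) (cO _ D2).
split.
  apply: (Cn_ext oO (f := fun z => (n1 z * d1 z + n2 z * d2 z) * (dd z)^-1)) => [z /solve[-> _]//|].
  by apply: Cn_mul => //; apply: Cn_add => //; apply: Cn_mul => //; (exact: cN.1 || exact: cN.2 || exact: cD.1 || exact: cD.2).
apply: (Cn_ext oO (f := fun z => (n2 z * d1 z - n1 z * d2 z) * (dd z)^-1)) => [z /solve[_ ->]//|].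
by apply: Cn_mul => //; apply: Cn_sub2 => //; apply: Cn_mul => //; (exact: cN.1 || exact: cN.2 || exact: cD.1 || exact: cD.2).
Qed.

End Regularity.
End CauchyRiemann.

Lemma Cn_loc (R : realType) d k (W : set 'rV[R]_d) (f : 'rV[R]_d -> R) :
  (forall q, W q -> exists2 V : set 'rV[R]_d, open V /\ V q & Cn k V f) -> Cn k W f.
Proof.
elim: k f => [|k IH] f L; first by move=> q Wq; have [V [_ Vq] c] := L q Wq; exact: c.
split=> [q Wq|i]; first by have [V [_ Vq] [h _]] := L q Wq; exact: h.
by apply: IH => q Wq; have [V oV [_ h]] := L q Wq; exists V; [exact: oV|exact: h].
Qed.

Lemma open_preimage_on (S T : topologicalType) (W : set S) (A : set T) (f : S -> T) :
  open W -> open A -> (forall q, W q -> {for q, continuous f}) -> open (W `&` f @^-1` A).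
Proof.
move=> oW oA cf; rewrite openE => q [Wq Aq]; apply: filterI; first exact: open_nbhs_nbhs.
by apply: (cf q Wq); exact: open_nbhs_nbhs.
Qed.

(** * Maps into a manifold, read in charts *)

Section ChartCalculus.
Variables (R : realType) (n : nat) (M : manifold R n).
Implicit Types (c : chart R M (n + n)) (p : M).

Lemma chart_open c : atlas c -> open (chart_dom c).
Proof. by move=> /atlas_is_chart[]. Qed.
Lemma codom_open c : atlas c -> open (chart_codom c).
Proof. by move=> /atlas_is_chart[]. Qed.
Lemma coordK c p : atlas c -> chart_dom c p -> param c (coord c p) = p.
Proof. by move=> /atlas_is_chart[_ _ h _ _] cp; apply: h; rewrite inE. Qed.
Lemma coord_codom c p : chart_dom c p -> chart_codom c (coord c p).
Proof. by exists p. Qed.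
Lemma param_dom c x : atlas c -> chart_codom c x -> chart_dom c (param c x) /\ coord c (param c x) = x.
Proof. by move=> ac [p cp <-]; rewrite coordK. Qed.

Lemma coord_cont c p : atlas c -> chart_dom c p -> {for p, continuous (coord c)}.
Proof.
move=> ac cp; have [oc _ _ h _] := atlas_is_chart ac.
by rewrite continuous_open_subspace // in h; apply: h; rewrite inE.
Qed.
Lemma param_cont c x : atlas c -> chart_codom c x -> {for x, continuous (param c)}.
Proof.
move=> ac cp; have [_ oc _ _ h] := atlas_is_chart ac.
by rewrite continuous_open_subspace // in h; apply: h; rewrite inE.
Qed.

Lemma rep_domP c c' x : atlas c -> rep_dom c id c' x <-> chart_codom c x /\ chart_dom c' (param c x).
Proof.
move=> ac; split=> [[p [cp cp'] <-]|[[p cp <-]]].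
  by rewrite coordK //; split=> //; exists p.
by rewrite coordK // => cp'; exists p.
Qed.

Lemma rep_dom_open c c' : atlas c -> atlas c' -> open (rep_dom c id c').
Proof.
move=> ac ac'.
have -> : rep_dom c id c' = chart_codom c `&` param c @^-1` chart_dom c'.
  by apply/seteqP; split=> x /(rep_domP _ _ ac).
apply: open_preimage_on; [exact: codom_open|exact: chart_open|].
by move=> x; exact: param_cont.
Qed.

Lemma trans_Cn c c' k i : atlas c -> atlas c' -> Cn k (rep_dom c id c') (fun x => rep c id c' x 0 i).
Proof.
move=> ac ac'; have [sm _] := atlas_compat ac ac'.
by have /smooth_on_entries := sm; apply => //; exact: rep_dom_open.
Qed.

(** Continuity makes the sets on which the chart expressions are tested open. *)
Definition CnM d k (W : set 'rV[R]_d) (f : 'rV[R]_d -> M) : Prop :=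
  (forall q, W q -> {for q, continuous f}) /\
  forall c, atlas c -> forall i, Cn k (W `&` f @^-1` chart_dom c) (fun q => coord c (f q) 0 i).

Lemma CnM_open d k (W : set 'rV[R]_d) f c : open W -> CnM k W f -> atlas c ->
  open (W `&` f @^-1` chart_dom c).
Proof. by move=> oW [cf _] ac; apply: open_preimage_on => //; exact: chart_open. Qed.

Lemma rV_cont d e (f : 'rV[R]_d -> 'rV[R]_e) q : (forall i, {for q, continuous (fun q => f q 0 i)}) ->
  {for q, continuous f}.
Proof. by move=> h; apply: mx_continuous_entries => i j; rewrite ord1; exact: h. Qed.

Lemma CnM_local d k (W : set 'rV[R]_d) f : open W ->
  (forall q, W q -> exists V c, [/\ open V /\ V q, atlas c, forall q', V q' -> chart_dom c (f q') &
     forall i, Cn k V (fun q => coord c (f q) 0 i)]) -> CnM k W f.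
Proof.
move=> oW L; split=> [q Wq|c' ac' i].
  have [V [c [[oV Vq] ac Vc cV]]] := L q Wq.
  have h : {for q, continuous (fun q => param c (coord c (f q)))}.
    apply: (@continuous_comp _ _ _ (fun q => coord c (f q)) (param c)).
      by apply: rV_cont => i; exact: Cn_continuous (cV i) _ Vq.
    by apply: param_cont => //; apply: coord_codom; exact: Vc.
  have e : \forall q' \near q, param c (coord c (f q')) = f q'.
    have : nbhs q V by exact: open_nbhs_nbhs.
    by apply: filterS => q' Vq'; rewrite coordK //; exact: Vc.
  have E := nbhs_singleton e; suff : (f z @[z --> q]) --> param c (coord c (f q)) by rewrite E.
  exact: (cvg_trans (near_eq_cvg e) h).
apply: Cn_loc => q [Wq c'q]; have [V [c [[oV Vq] ac Vc cV]]] := L q Wq.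
have cf q' : V q' -> {for q', continuous (fun q => coord c (f q))}.
  by move=> Vq'; apply: rV_cont => j; exact: Cn_continuous (cV j) _ Vq'.
pose V' := V `&` (fun q => coord c (f q)) @^-1` rep_dom c id c'.
have oV' : open V' by apply: open_preimage_on => //; exact: rep_dom_open.
exists V'; first by split=> //; split=> //; exists (f q) => //; split=> //; exact: Vc.
apply: (Cn_ext oV' (f := fun q => rep c id c' (coord c (f q)) 0 i)).
  by move=> q' [Vq' _]; rewrite /rep coordK //; exact: Vc.
apply: (Cn_comp oV' _ (@trans_Cn c c' k i ac ac')); first by move=> q' [].
by move=> j; apply: Cn_sub (cV j) => q' [].
Qed.

Lemma CnM_le d k l (W : set 'rV[R]_d) f : (k <= l)%N -> CnM l W f -> CnM k W f.
Proof. by move=> kl [cf h]; split=> // c ac i; exact: Cn_le kl (h c ac i). Qed.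

Lemma CnM_comp d e k (W : set 'rV[R]_d) (V : set 'rV[R]_e) f g : open V -> open W -> CnM k W f ->
  (forall q, V q -> W (g q)) -> (forall i, Cn k V (fun q => g q 0 i)) -> CnM k V (f \o g).
Proof.
move=> oV oW cf VW cg; apply: CnM_local => // q Vq.
have [c ac cq] := atlas_cover (f (g q)).
have cgq q' : V q' -> {for q', continuous g}.
  by move=> Vq'; apply: rV_cont => i; exact: Cn_continuous (cg i) _ Vq'.
have oO := CnM_open oW cf ac.
pose V' := V `&` g @^-1` (W `&` f @^-1` chart_dom c).
have oV' : open V' by exact: open_preimage_on.
exists V', c; split=> //.
- by split=> //; split=> //; split=> //; exact: VW.
- by move=> q' [_ []].
move=> i; apply: (Cn_comp oV' _ (cf.2 c ac i)) => [q' []//|j].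
by apply: Cn_sub (cg j) => q' [].
Qed.

Section Step.
Variables (d k : nat) (W A : set 'rV[R]_d) (f : 'rV[R]_d -> M) (c : chart R M (n + n)).
Variable v : 'rV[R]_d -> 'rV[R]_(n + n).
Hypotheses (oW : open W) (oA : open A) (ac : atlas c).
Hypothesis cf : CnM k W f.
Hypothesis cv : forall i, Cn k W (fun q => v q 0 i).
Hypothesis vA : forall q, A q -> v q = 0.

(** One move of the spray: f q is displaced by v q in the chart c and left alone outside the chart.
    This is regular on [wstep]: either v vanishes on a neighbourhood, or the displaced point is
    still in the chart. *)
Definition cstep (q : 'rV[R]_d) : M :=
  if `[< chart_dom c (f q) >] then param c (coord c (f q) + v q) else f q.
Definition wmove : set 'rV[R]_d := [set q | (W `&` f @^-1` chart_dom c) q /\ chart_codom c (coord c (f q) + v q)].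
Definition wstep : set 'rV[R]_d := (W `&` A) `|` wmove.

Lemma cstep_A q : A q -> cstep q = f q.
Proof.
by move=> /vA v0; rewrite /cstep v0; case: asboolP => // cq; rewrite addr0 coordK.
Qed.

Lemma cstep_move q : chart_dom c (f q) -> cstep q = param c (coord c (f q) + v q).
Proof. by move=> h; rewrite /cstep asboolT. Qed.

Lemma open_wmove : open wmove.
Proof.
have -> : wmove = (W `&` f @^-1` chart_dom c) `&` (fun q => coord c (f q) + v q) @^-1` chart_codom c.
  by apply/seteqP; split=> q [].
have oF := CnM_open oW cf ac.
apply: open_preimage_on => // [|q [Wq cq]]; first exact: codom_open.
apply: continuousD.
  by apply: rV_cont => i; apply: Cn_continuous (cf.2 c ac i) _ _.
by apply: rV_cont => i; apply: Cn_continuous (cv i) _ _.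
Qed.

Lemma open_wstep : open wstep.
Proof. by apply: openU; [exact: openI|exact: open_wmove]. Qed.

Lemma CnM_step : CnM k wstep cstep.
Proof.
apply: CnM_local; first exact: open_wstep.
move=> q [[Wq Aq]|wq].
  have [c2 ac2 cq2] := atlas_cover (f q); have oF := CnM_open oW cf ac2.
  exists (A `&` (W `&` f @^-1` chart_dom c2)), c2; split=> //.
  - by split; [exact: openI|].
  - by move=> q' [Aq' [_ h]]; rewrite cstep_A.
  move=> i; apply: (@Cn_ext R d k _ (fun q => coord c2 (f q) 0 i)).
  - exact: openI.
  - by move=> q' [Aq' _]; rewrite cstep_A.
  by apply: Cn_sub (cf.2 c2 ac2 i) => q' [].
exists wmove, c; split=> //.
- by split=> //; exact: open_wmove.
- by move=> q' [[_ cq'] /(param_dom ac)[h _]]; rewrite cstep_move.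
move=> i; apply: (@Cn_ext R d k _ (fun q => coord c (f q) 0 i + v q 0 i)).
- exact: open_wmove.
- by move=> q' [[_ cq'] /(param_dom ac)[_ h]]; rewrite cstep_move // h mxE.
apply: Cn_add; first exact: open_wmove.
  by apply: Cn_sub (cf.2 c ac i) => q' [].
by apply: Cn_sub (cv i) => q' [[]].
Qed.

End Step.

Section CRdisk.
Variable J : complex_structure M.
Notation i0 := (lshift 1 (0 : 'I_1) : 'I_(1 + 1)).
Notation i1 := (rshift 1 (0 : 'I_1) : 'I_(1 + 1)).

(** The equation f_y = f_x J at one point, with tangent vectors as rows. The other half of df i = J
    df follows from J^2 = -1. *)
Definition crat (J : complex_structure M) (f : 'rV[R]_(1 + 1) -> M) c (z : 'rV[R]_(1 + 1)) : Prop := forall j,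
  pd i1 (fun z => coord c (f z) 0 j) z =
  \sum_l pd i0 (fun z => coord c (f z) 0 l) z * sval J c (coord c (f z)) l j.

(** One computation serves changes of chart, with h the identity, and biholomorphisms. *)
Lemma crat_map (J' : complex_structure M) (h : M -> M) (V : set 'rV[R]_(1 + 1)) f c c' z :
  open V -> CnM 1 V f -> V z -> atlas c ->
  chart_dom c (f z) -> open (rep_dom c h c') -> (forall j, Cn 1 (rep_dom c h c') (fun x => rep c h c' x 0 j)) ->
  rep_dom c h c' (coord c (f z)) ->
  sval J c (coord c (f z)) *m 'J (rep c h c') (coord c (f z)) =
  'J (rep c h c') (coord c (f z)) *m sval J' c' (rep c h c' (coord c (f z))) ->
  crat J f c z -> crat J' (h \o f) c' z.
Proof.
move=> oV cf Vz ac cz oT cT xd tens hc.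
have oF := CnM_open oV cf ac.
pose T := rep c h c'; pose x := coord c (f z).
have dT j : differentiable (fun y => T y 0 j) x by have [t _] := cT j; exact: t.
have dF j : differentiable (fun z => coord c (f z) 0 j) z by have [t _] := cf.2 c ac j; exact: t.
have e i j : pd i (fun z => coord c' ((h \o f) z) 0 j) z =
   \sum_l pd l (fun y => T y 0 j) x * pd i (fun z => coord c (f z) 0 l) z.
  rewrite -(pd_comp i (dT j) dF); apply: pd_near.
  have : nbhs z (V `&` f @^-1` chart_dom c) by exact: open_nbhs_nbhs.
  by apply: filterS => y [_ cy]; rewrite /T /rep coordK.
have tE l j : \sum_k sval J c x l k * pd k (fun y => T y 0 j) x =
   \sum_k pd l (fun y => T y 0 k) x * sval J' c' (coord c' (h (f z))) k j.
  have := congr1 (fun A : 'M[R]_(n + n, n + n) => (A : 'M[R]_(n + n)) l j) tens; rewrite !mxE.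
  rewrite (_ : rep c h c' x = coord c' (h (f z))); last by rewrite /rep /x coordK.
  move=> H; transitivity (\sum_j0 sval J c x l j0 * 'J (rep c h c') x j0 j).
    by apply: eq_bigr => k _; rewrite jacobianE.
  by rewrite H; apply: eq_bigr => k _; rewrite jacobianE.
move=> j; rewrite e.
transitivity (\sum_l pd l (fun y => T y 0 j) x *
    \sum_k pd i0 (fun z => coord c (f z) 0 k) z * sval J c x k l).
  by apply: eq_bigr => l _; rewrite hc.
under eq_bigr => l _ do rewrite mulr_sumr.
rewrite exchange_big /=.
transitivity (\sum_k pd i0 (fun z => coord c (f z) 0 k) z * \sum_l sval J c x k l * pd l (fun y => T y 0 j) x).
  by apply: eq_bigr => k _; rewrite mulr_sumr; apply: eq_bigr => l _; ring.
transitivity (\sum_k pd i0 (fun z => coord c (f z) 0 k) z *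
    \sum_l pd k (fun y => T y 0 l) x * sval J' c' (coord c' (h (f z))) l j).
  by apply: eq_bigr => k _; congr (_ * _); exact: tE.
transitivity (\sum_k \sum_l pd i0 (fun z => coord c (f z) 0 k) z *
    (pd k (fun y => T y 0 l) x * sval J' c' (coord c' (h (f z))) l j)).
  by apply: eq_bigr => k _; rewrite mulr_sumr.
rewrite exchange_big /=; apply: eq_bigr => k _; rewrite e mulr_suml; apply: eq_bigr => l _.
by ring.
Qed.

Lemma crat_change (V : set 'rV[R]_(1 + 1)) f c c' z : open V -> CnM 1 V f -> V z -> atlas c -> atlas c' ->
  chart_dom c (f z) -> chart_dom c' (f z) -> crat J f c z -> crat J f c' z.
Proof.
move=> oV cf Vz ac ac' cz cz' h.
have xd : rep_dom c id c' (coord c (f z)) by exists (f z).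
apply: (@crat_map J id V f c c' z oV cf Vz ac cz (rep_dom_open ac ac') _ xd _ h).
  by move=> j; exact: trans_Cn.
exact: (cs_tensor (svalP J) ac ac' xd).
Qed.

Lemma unit_diskE (z : 'rV[R]_(1 + 1)) : unit_disk R z <-> (z 0 i0) ^+ 2 + (z 0 i1) ^+ 2 < 1.
Proof.
have key (x : R) : (Num.sqrt x < 1) = (x < 1) by rewrite -{1}(@sqrtr1 R) ltr_sqrt.
by rewrite /unit_disk /to_complex /= key.
Qed.

Lemma open_unit_disk : open (unit_disk R).
Proof.
have -> : unit_disk R = setT `&` (fun z : 'rV[R]_(1 + 1) => (z 0 i0) ^+ 2 + (z 0 i1) ^+ 2) @^-1` [set x | x < 1].
  by apply/seteqP; split=> [z /unit_diskE|z [_ /unit_diskE]].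
apply: open_preimage_on; [exact: openT|exact: open_lt|].
move=> z _; apply: (@Cn_continuous R _ 0 setT) => //.
by apply: Cn_add; [exact: openT| |]; apply: Cn_mul; (exact: openT || exact: Cn_coord).
Qed.

Lemma stdJ_lin (v : 'I_(n + n) -> R) i :
  \sum_l v l * std_J R n l (lshift n i) = - v (rshift n i) /\
  \sum_l v l * std_J R n l (rshift n i) = v (lshift n i).
Proof.
have e l j : std_J R n l j = block_mx 0 1%:M (- 1%:M) 0 l j by [].
rewrite !big_split_ord /= !(eq_bigr _ (fun l _ => congr1 _ (e _ _))).
split.
  rewrite big1 ?add0r => [|l _]; last by rewrite block_mxEul mxE mulr0.
  rewrite (bigD1 i) //= big1 ?addr0 => [|l li].
    by rewrite block_mxEdl !mxE eqxx mulrN mulr1.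
  by rewrite block_mxEdl !mxE (negbTE li) oppr0 mulr0.
rewrite addrC big1 ?add0r => [|l _]; last by rewrite block_mxEdr mxE mulr0.
rewrite (bigD1 i) //= big1 ?addr0 => [|l li].
  by rewrite block_mxEur !mxE eqxx mulr1.
by rewrite block_mxEur !mxE (negbTE li) mulr0.
Qed.

Lemma stdJ1_row (r : nat) (A : 'M[R]_(1 + 1, r)) j :
  \sum_k std_J R 1 i0 k * A k j = A i1 j /\ \sum_k std_J R 1 i1 k * A k j = - A i0 j.
Proof.
split; rewrite sum_ord2 /std_J.
  by rewrite block_mxEul block_mxEur !mxE eqxx mul0r add0r mul1r.
by rewrite block_mxEdl block_mxEdr !mxE eqxx mul0r addr0 mulN1r.
Qed.

(** In a chart where J is multiplication by i the condition is the classical Cauchy-Riemann system,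
    so a C^1 map is smooth there by [cr_smooth]; integrability provides such a chart at every
    point. *)
Lemma holomorphic_diskP f : CnM 1 (unit_disk R) f ->
  (forall z, unit_disk R z -> exists2 c, atlas c /\ chart_dom c (f z) & crat J f c z) ->
  holomorphic_disk J f.
Proof.
move=> cf cr; have oD := open_unit_disk.
have crall c z : atlas c -> unit_disk R z -> chart_dom c (f z) -> crat J f c z.
  by move=> ac Dz cz; have [c' [ac' cz'] h] := cr z Dz; exact: (crat_change oD cf Dz ac' ac cz' cz).
have cfk k : CnM k (unit_disk R) f.
  apply: CnM_local => // z Dz; have [c [ac cz Jc]] := cs_integrable (svalP J) (f z).
  have oF := CnM_open oD cf ac; exists (unit_disk R `&` f @^-1` chart_dom c), c; split=> //.
    by move=> q' [].
  have CR q i : (unit_disk R `&` f @^-1` chart_dom c) q ->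
     pd i1 (fun z => coord c (f z) 0 (lshift n i)) q = - pd i0 (fun z => coord c (f z) 0 (rshift n i)) q /\
     pd i1 (fun z => coord c (f z) 0 (rshift n i)) q = pd i0 (fun z => coord c (f z) 0 (lshift n i)) q.
    move=> [Dq cq]; have h := crall c q ac Dq cq.
    have [s1 s2] := stdJ_lin (fun l => pd i0 (fun z => coord c (f z) 0 l) q) i.
    by rewrite !h Jc ?s1 ?s2 //; exact: coord_codom.
  move=> i.
  have key a := @cr_smooth R _ (fun z => coord c (f z) 0 (lshift n a)) (fun z => coord c (f z) 0 (rshift n a))
     oF (cf.2 c ac _) (cf.2 c ac _) (fun q Fq => esym (CR q a Fq).2) (fun q Fq => (CR q a Fq).1) k.
  case: (fintype.splitP i) => a ia.
    by have -> : i = lshift n a by [exact: val_inj]; exact: (key a).1.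
  by have -> : i = rshift n a by [exact: val_inj]; exact: (key a).2.
split.
  by rewrite continuous_open_subspace // => z; rewrite inE => Dz; exact: cf.1.
move=> c ac U; have oU : open U by exact: (CnM_open oD cf ac).
have sm : smooth_on U (coord c \o f).
  apply/(smooth_on_entries _ oU) => i j k; rewrite ord1; exact: ((cfk k).2 c ac j).
split=> // z [Dz cz].
have dF j : differentiable (fun z => coord c (f z) 0 j) z by have [t _] := cf.2 c ac j; exact: t.
have h := crall c z ac Dz cz.
have s1 j := (stdJ1_row ('J (coord c \o f) z) j).1; have s2 j := (stdJ1_row ('J (coord c \o f) z) j).2.
have Je i j : 'J (coord c \o f) z i j = pd i (fun z => coord c (f z) 0 j) z by rewrite jacobianE.
have sq := cs_square (svalP J) ac (coord_codom cz).
apply/matrixP => i j; rewrite !mxE; move: i; apply: ord2_case.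
  by rewrite s1 Je h; apply: eq_bigr => l _; rewrite Je.
rewrite s2 Je.
have -> : - pd i0 (fun z => coord c (f z) 0 j) z =
   \sum_k pd i0 (fun z => coord c (f z) 0 k) z * (sval J c (coord c (f z)) *m sval J c (coord c (f z))) k j.
  rewrite sq (bigD1 j) //= big1 ?addr0 => [|k kj].
    by rewrite !mxE eqxx mulrN mulr1.
  by rewrite !mxE (negbTE kj) oppr0 mulr0.
under eq_bigr => k _ do rewrite mxE mulr_sumr.
rewrite exchange_big /=; apply: eq_bigr => l _; rewrite Je h mulr_suml.
by apply: eq_bigr => k _; rewrite mulrA.
Qed.

Lemma holomorphic_disk_CnM f k : holomorphic_disk J f -> CnM k (unit_disk R) f.
Proof.
move=> [cf h]; have oD := open_unit_disk.
have cfc z : unit_disk R z -> {for z, continuous f}.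
  by move=> Dz; rewrite continuous_open_subspace // in cf; apply: cf; rewrite inE.
split=> // c ac i; have [sm _] := h c ac.
have oU : open (unit_disk R `&` f @^-1` chart_dom c) by apply: open_preimage_on => //; exact: chart_open.
by have /smooth_on_entries := sm; apply.
Qed.

Lemma holomorphic_disk_crat f c z : holomorphic_disk J f -> atlas c -> unit_disk R z ->
  chart_dom c (f z) -> crat J f c z.
Proof.
move=> hf ac Dz cz j; have cf := holomorphic_disk_CnM 1 hf.
have dF l : differentiable (fun z => coord c (f z) 0 l) z by have [t _] := cf.2 c ac l; exact: t.
have [_ e] := hf.2 c ac; have := congr1 (fun A : 'M[R]_(1 + 1, n + n) => (A : 'M[R]_(_, _)) i0 j) (e z (conj Dz cz)).
rewrite [in LHS]mxE [in RHS]mxE (stdJ1_row _ _).1 jacobianE // => ->.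
by apply: eq_bigr => l _; rewrite jacobianE.
Qed.

End CRdisk.
End ChartCalculus.

(** * Jacobians and transition matrices *)

Section Jacobians.
Variable R : realType.

Lemma jac_comp a b c (f : 'rV[R]_a -> 'rV[R]_b) (g : 'rV[R]_b -> 'rV[R]_c) x :
  (forall j, differentiable (fun y => f y 0 j) x) -> (forall j, differentiable (fun y => g y 0 j) (f x)) ->
  'J (g \o f) x = 'J f x *m 'J g (f x).
Proof.
move=> df dg; apply/matrixP => i j; rewrite [RHS]mxE.
have dgf k : differentiable (fun y => (g \o f) y 0 k) x.
  apply: (@differentiable_comp _ _ _ _ f (fun y => g y 0 k)); last exact: dg.
  exact: rV_differentiable.
rewrite (jacobianE i j dgf) (@pd_comp R _ _ (fun y => g y 0 j) f x i (dg j) df); apply: eq_bigr => l _.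
by rewrite (jacobianE i l df) (jacobianE l j dg) mulrC.
Qed.

Lemma jac_id a (x : 'rV[R]_a) : 'J (@id 'rV[R]_a) x = 1%:M.
Proof.
apply/matrixP => i j; rewrite jacobianE => [|k]; last exact: differentiable_coord.
by rewrite pd_coord mxE.
Qed.

Lemma jac_near a b (f g : 'rV[R]_a -> 'rV[R]_b) x : (\forall y \near x, f y = g y) ->
  (forall j, differentiable (fun y => g y 0 j) x) -> 'J f x = 'J g x.
Proof.
move=> fg dg; have fgj j : \forall y \near x, g y 0 j = f y 0 j.
  by apply: filterS fg => y ->.
have df j : differentiable (fun y => f y 0 j) x by exact: differentiable_near (fgj j) (dg j).
apply/matrixP => i j.
have h : \forall y \near x, f y 0 j = g y 0 j by apply: filterS (fgj j) => y ->.
transitivity (pd i (fun y => f y 0 j) x); first exact: jacobianE.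
rewrite (pd_near i h); symmetry; exact: jacobianE.
Qed.

End Jacobians.

Section Transitions.
Variables (R : realType) (n : nat) (M : manifold R n).
Implicit Types (c : chart R M (n + n)) (p : M).

Definition trM c c' p : 'M[R]_(n + n) := 'J (rep c id c') (coord c p).

Lemma trans_diff c c' p j : atlas c -> atlas c' -> chart_dom c p -> chart_dom c' p ->
  differentiable (fun x => rep c id c' x 0 j) (coord c p).
Proof.
by move=> ac ac' cp cp'; have [t _] := @trans_Cn R n M c c' 1 j ac ac'; apply: t; exists p.
Qed.

Lemma trM_comp c1 c2 c3 p : atlas c1 -> atlas c2 -> atlas c3 ->
  chart_dom c1 p -> chart_dom c2 p -> chart_dom c3 p ->
  trM c1 c3 p = trM c1 c2 p *m trM c2 c3 p.
Proof.
move=> a1 a2 a3 d1 d2 d3; rewrite /trM.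
have e12 : rep c1 id c2 (coord c1 p) = coord c2 p by rewrite /rep coordK.
rewrite -e12 -jac_comp.
- apply: jac_near.
    have : nbhs (coord c1 p) (rep_dom c1 id c2).
      by apply: open_nbhs_nbhs; split; [exact: rep_dom_open|exists p].
    by apply: filterS => x /(rep_domP _ _ a1)[_ h]; rewrite /rep /= coordK.
  move=> j; apply: (@differentiable_comp _ _ _ _ (rep c1 id c2) (fun y => rep c2 id c3 y 0 j)).
    by apply: rV_differentiable => k; exact: trans_diff.
  by rewrite e12; exact: trans_diff.
- by move=> j; exact: trans_diff.
- by move=> j; rewrite e12; exact: trans_diff.
Qed.

Lemma trM_id c p : atlas c -> chart_dom c p -> trM c c p = 1%:M.
Proof.
move=> ac cp; rewrite /trM -(jac_id (coord c p)); apply: jac_near.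
  have : nbhs (coord c p) (chart_codom c).
    by apply: open_nbhs_nbhs; split; [exact: codom_open|exists p].
  by apply: filterS => x /(param_dom ac)[_ h].
by move=> j; exact: differentiable_coord.
Qed.

Lemma trM_tensor (J : complex_structure M) c c' p : atlas c -> atlas c' -> chart_dom c p -> chart_dom c' p ->
  sval J c (coord c p) *m trM c c' p = trM c c' p *m sval J c' (coord c' p).
Proof.
move=> ac ac' cp cp'; have := cs_tensor (svalP J) ac ac' (x := coord c p).
by rewrite /rep coordK // => /(_ _)-> //; exists p.
Qed.

End Transitions.

(** * Indexing of the spray parameters *)

Section Packing.
Variables (R : realType) (N n : nat).
Notation m := (N * n)%N.

(** The parameters form N blocks of size n + n. The real halves of all blocks come first and the
    imaginary halves after them, so that multiplication by i on C^m restricts to [std_J] on each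
    block. *)
Definition sidx (k : 'I_N) (i : 'I_(n + n)) : 'I_(m + m) :=
  match fintype.split i with
  | inl a => lshift m (mxvec_index k a) | inr a => rshift m (mxvec_index k a) end.

Definition packS (G : 'I_N -> 'I_(n + n) -> R) (l : 'I_(m + m)) : R :=
  match fintype.split l with
  | inl b => mxvec (\matrix_(j, a) G j (lshift n a)) 0 b
  | inr b => mxvec (\matrix_(j, a) G j (rshift n a)) 0 b end.

Lemma split_lshift a b (i : 'I_a) : fintype.split (lshift b i) = inl i.
Proof. exact: (unsplitK (inl i)). Qed.
Lemma split_rshift a b (i : 'I_b) : fintype.split (rshift a i) = inr i.
Proof. exact: (unsplitK (inr i)). Qed.

Lemma sidxL k a : sidx k (lshift n a) = lshift m (mxvec_index k a).
Proof. by rewrite /sidx split_lshift. Qed.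
Lemma sidxR k a : sidx k (rshift n a) = rshift m (mxvec_index k a).
Proof. by rewrite /sidx split_rshift. Qed.

Lemma ordD_case a b (P : 'I_(a + b) -> Prop) : (forall i, P (lshift b i)) -> (forall i, P (rshift a i)) ->
  forall i, P i.
Proof. by move=> h1 h2 i; rewrite -(splitK i); case: (fintype.split i). Qed.

Lemma packS_sidx G k i : packS G (sidx k i) = G k i.
Proof.
move: i; apply: ordD_case => a.
  by rewrite sidxL /packS split_lshift mxvecE mxE.
by rewrite sidxR /packS split_rshift mxvecE mxE.
Qed.

Lemma sidx_case (P : 'I_(m + m) -> Prop) : (forall k i, P (sidx k i)) -> forall l, P l.
Proof.
move=> h; apply: ordD_case => b; case/mxvec_indexP: b => k a.
  by rewrite -sidxL.
by rewrite -sidxR.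
Qed.

Lemma sum_sidx (V : nmodType) (F : 'I_(m + m) -> V) : \sum_l F l = \sum_k \sum_i F (sidx k i).
Proof.
rewrite big_split_ord /=.
have e (G : 'I_m -> V) : \sum_b G b = \sum_k \sum_a G (mxvec_index k a).
  rewrite pair_big /= (reindex _ (curry_mxvec_bij N n)) /=.
  by apply: eq_bigr => [[]].
rewrite !e -big_split /=; apply: eq_bigr => k _; rewrite big_split_ord /=; congr (_ + _).
  by apply: eq_bigr => a _; rewrite sidxL.
by apply: eq_bigr => a _; rewrite sidxR.
Qed.

(** The transpose of [jrow]. *)
Definition jco (G : 'I_(m + m) -> R) (l : 'I_(m + m)) : R :=
  match fintype.split l with inl b => G (rshift m b) | inr b => - G (lshift m b) end.

Lemma jco_sidx G k i : jco G (sidx k i) = \sum_l std_J R n i l * G (sidx k l).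
Proof.
rewrite big_split_ord /=; move: i; apply: ordD_case => a; rewrite /std_J.
  rewrite sidxL /jco split_lshift big1 ?add0r => [|l _]; last by rewrite block_mxEul mxE mul0r.
  rewrite (bigD1 a) //= big1 ?addr0 => [|l la].
    by rewrite block_mxEur mxE eqxx mul1r sidxR.
  by rewrite block_mxEur mxE eq_sym (negbTE la) mul0r.
rewrite sidxR /jco split_rshift addrC big1 ?add0r => [|l _]; last by rewrite block_mxEdr mxE mul0r.
rewrite (bigD1 a) //= big1 ?addr0 => [|l la].
  by rewrite block_mxEdl !mxE eqxx mulN1r sidxL.
by rewrite block_mxEdl !mxE eq_sym (negbTE la) oppr0 mul0r.
Qed.

End Packing.

(** * Functions extended by zero *)

Section Gluing.
Variable R : realType.
Variables (X : Type) (F : set_system X).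
Context {FF : Filter F}.

Lemma Cn_glue k n (A V : set 'rV[R]_k) f : open A -> open V -> (forall q, A q -> f q = 0) ->
  Cn n V f -> Cn n (A `|` V) f.
Proof.
move=> oA oV f0 cf; apply: Cn_loc => q [Aq|Vq]; last by exists V.
exists A => //; apply: (Cn_ext oA _ (Cn_cst n A 0)) => z Az; by rewrite f0.
Qed.

Lemma nul_glue k n (A V : set 'rV[R]_k) h : open A -> open V -> (forall x q, A q -> h x q = 0) ->
  nul F n V h -> nul F n (A `|` V) h.
Proof.
move=> oA oV; elim: n h => [|n IH] h h0 nh.
  have [c u _] := nh; split=> // [x|K e cK KW e0]; first by apply: Cn_glue (c x) => // q; exact: h0.
  have cKA : compact (K `&` ~` A) by apply: compact_closedI => //; exact: open_closedC.
  have KV : K `&` ~` A `<=` V by move=> q [/KW[]].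
  apply: filterS (u _ e cKA KV e0) => x hx q Kq.
  have [Aq|nAq] := pselect (A q); first by rewrite h0 // normr0 ltW.
  exact: hx.
have [c u d] := nh; split=> [x|K e cK KW e0|i].
- by apply: Cn_glue (c x) => // q; exact: h0.
- have cKA : compact (K `&` ~` A) by apply: compact_closedI => //; exact: open_closedC.
  have KV : K `&` ~` A `<=` V by move=> q [/KW[]].
  apply: filterS (u _ e cKA KV e0) => x hx q Kq.
  have [Aq|nAq] := pselect (A q); first by rewrite h0 // normr0 ltW.
  exact: hx.
apply: IH (d i) => x q Aq.
rewrite (pd_eqW (W := A) (g := fun=> 0) i oA) ?pd_cst //.
by move=> z; exact: h0.
Qed.

Variable m : nat.
Notation K := (1 + 1 + (m + m))%N.

Lemma Cb_van N be (U W C : set 'rV[R]_K) f : 0 <= be -> U `<=` W -> (forall q, U q -> off_box q \/ C q) ->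
  Cn N W f -> van f -> Cb N be C f -> Cb N be U f.
Proof.
move=> be0 UW UC; elim: N f => [|N IH] f cf vf bf.
  move=> q Uq; split; first by apply: cf; exact: UW.
  have [ob|Cq] := UC q Uq; first by rewrite vf // normr0.
  by have [] := bf q Cq.
have [df pdf] := cf; have [b1 b2] := bf; split=> [q Uq|i].
  split; first by apply: df; exact: UW.
  have [ob|Cq] := UC q Uq; first by rewrite vf // normr0.
  by have [] := b1 q Cq.
by apply: IH; [exact: pdf|exact: van_pd|exact: b2].
Qed.

(** The y-direction is tangent to the zero section. *)
Lemma pd_iy_zero (f : 'rV[R]_K -> R) : (forall x y, f (pt x y 0) = 0) ->
  forall x y, pd (iy m) f (pt x y 0) = 0.
Proof.
move=> f0 x y; rewrite /pd /derive.
have e h : h *: delta_mx 0 (iy m) + pt x y 0 = pt x (y + h) 0 :> 'rV[R]_K.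
  have E j : (h *: delta_mx 0 (iy m) + pt x y 0 : 'rV[R]_K) 0 j = h * (j == iy m)%:R + (pt x y 0 : 'rV[R]_K) 0 j.
    by rewrite [LHS]mxE [X in X + _ = _]mxE [X in _ * X + _ = _]mxE eqxx.
  apply/rowP => j; rewrite E; move: j; apply: idx_case => [||l].
  - by rewrite !pt_x mulr0 add0r.
  - by rewrite !pt_y eqxx mulr1 addrC.
  - by rewrite !pt_s mulr0 add0r.
rewrite (_ : (fun h => _) = fun=> 0); first exact: lim_cst.
by apply/funext => h; rewrite /= e !f0 subrr scaler0.
Qed.

(** On the part of the zero section inside C, closeness to f in C^2 is smallness, as f and its
    derivatives in y vanish there; the rest of the zero section is off the box, where h itself
    vanishes. *)
Lemma nul_atzero (W C : set 'rV[R]_K) f (h : X -> 'rV[R]_K -> R) del : open W -> compact C -> C `<=` W ->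
  (forall x y, ~ @off_box R m (pt x y 0) -> C (pt x y 0)) ->
  Cn 2 W f -> (forall x y, f (pt x y 0) = 0) -> (forall x, van (h x)) ->
  nul F 2 W (fun x q => h x q - f q) -> (forall x, Cn 2 W (h x)) -> 0 < del ->
  \forall x \near F, atzero del (h x).
Proof.
move=> oW cC CW CP cf f0 vh nh ch del0.
have n2 := nul_pd (iy m) (nul_pd (iy m) nh).
apply: filterS2 (nul_unif0 nh cC CW del0) (nul_unif0 n2 cC CW del0) => z h1 h2 x y.
have [ob|no] := pselect (@off_box R m (pt x y 0)).
  by rewrite vh // (van_pd (iy m) (van_pd (iy m) (vh z))) // normr0 ltW.
have Cp := CP x y no; have Wp := CW _ Cp.
split; first by have := h1 _ Cp; rewrite f0 subr0.
have := h2 _ Cp.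
have e1 q : W q -> pd (iy m) (fun q => h z q - f q) q = pd (iy m) (h z) q - pd (iy m) f q.
  move=> Wq; have [dh _] := ch z; have [df _] := cf.
  by rewrite /pd deriveB //; apply: diff_derivable; [exact: dh|exact: df].
rewrite (pd_eqW (iy m) oW e1 Wp).
have -> : pd (iy m) (fun q => pd (iy m) (h z) q - pd (iy m) f q) (pt x y 0) =
   pd (iy m) (pd (iy m) (h z)) (pt x y 0) - pd (iy m) (pd (iy m) f) (pt x y 0).
  have [_ /(_ (iy m))[dh _]] := ch z; have [_ /(_ (iy m))[df _]] := cf.
  by rewrite /pd deriveB //; apply: diff_derivable; [exact: dh|exact: df].
by rewrite (pd_iy_zero (pd_iy_zero f0)) subr0.
Qed.

End Gluing.

(** * The Poincaré distance *)

Section Poincare.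
Variable R : realType.
Notation i0 := (lshift 1 (0 : 'I_1) : 'I_(1 + 1)).
Notation i1 := (rshift 1 (0 : 'I_1) : 'I_(1 + 1)).
Implicit Types z w : 'rV[R]_(1 + 1).

(** [pP] is |z - w|^2, [pQ] is the squared modulus of 1 minus the product of w with the conjugate of
    z, and [pT] is the pseudo-hyperbolic distance. *)
Definition pP z w : R := (z 0 i0 - w 0 i0) ^+ 2 + (z 0 i1 - w 0 i1) ^+ 2.
Definition pQ z w : R := (1 - (z 0 i0 * w 0 i0 + z 0 i1 * w 0 i1)) ^+ 2
  + (z 0 i0 * w 0 i1 - z 0 i1 * w 0 i0) ^+ 2.
Definition pT z w : R := Num.sqrt (pP z w / pQ z w).

Lemma pP_ge0 z w : 0 <= pP z w. Proof. by rewrite addr_ge0 // sqr_ge0. Qed.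

Lemma pQP z w : unit_disk R z -> unit_disk R w -> pP z w < pQ z w.
Proof.
move=> /unit_diskE hz /unit_diskE hw; rewrite -subr_gt0.
have -> : pQ z w - pP z w = (1 - ((z 0 i0) ^+ 2 + (z 0 i1) ^+ 2)) * (1 - ((w 0 i0) ^+ 2 + (w 0 i1) ^+ 2)).
  by rewrite /pQ /pP; ring.
by rewrite mulr_gt0 // subr_gt0.
Qed.

Lemma pQ_gt0 z w : unit_disk R z -> unit_disk R w -> 0 < pQ z w.
Proof. by move=> hz hw; exact: le_lt_trans (pP_ge0 z w) (pQP hz hw). Qed.

Lemma poincareE z w : unit_disk R z -> unit_disk R w ->
  poincare z w = ln ((1 + pT z w) / (1 - pT z w)).
Proof.
move=> hz hw; rewrite /poincare; set t := ComplexField.Normc.normc _; suff -> : t = pT z w by [].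
rewrite /t /pT.
have Q0 := pQ_gt0 hz hw.
set x := to_complex z - to_complex w; set y := 1 - _.
have nx : ComplexField.Normc.normc x = Num.sqrt (pP z w).
  by rewrite /x /pP /to_complex /=; congr Num.sqrt; ring.
have ny : ComplexField.Normc.normc y = Num.sqrt (pQ z w).
  by rewrite /y /pQ /to_complex /=; congr Num.sqrt; ring.
have y0 : y != 0.
  apply/eqP => e; move: ny; rewrite e ComplexField.Normc.normc0 => /esym/eqP.
  by rewrite sqrtr_eq0 leNgt Q0.
have h := ComplexField.Normc.normcM (x / y) y; rewrite divfK // nx ny in h.
rewrite sqrtrM ?pP_ge0 // sqrtrV ?ltW // h mulfK //.
by rewrite gt_eqF // sqrtr_gt0.
Qed.

Lemma pT_bounds z w : unit_disk R z -> unit_disk R w -> 0 <= pT z w < 1.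
Proof.
move=> hz hw; rewrite sqrtr_ge0 /= -{1}(@sqrtr1 R) ltr_sqrt // ltr_pdivrMr ?pQ_gt0 //.
by rewrite mul1r pQP.
Qed.

Lemma poincare_ge0 z w : unit_disk R z -> unit_disk R w -> 0 <= poincare z w.
Proof.
move=> hz hw; rewrite poincareE //; have /andP[t0 t1] := pT_bounds hz hw.
by rewrite ln_ge0 // ler_pdivlMr ?subr_gt0 // mul1r; lra.
Qed.

Lemma poincare_sym z w : unit_disk R z -> unit_disk R w -> poincare z w = poincare w z.
Proof.
move=> hz hw; rewrite !poincareE // /pT.
have -> : pP z w = pP w z by rewrite /pP; ring.
by have -> : pQ z w = pQ w z by rewrite /pQ; ring.
Qed.

(** Continuity of the distance under dilation by u = 1 / r at u = 1. It allows a disk to be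
    restricted to radius r < 1, where its image is relatively compact, at a small cost in length. *)
Lemma poincare_dilate z w (e : R) : unit_disk R z -> unit_disk R w -> 0 < e ->
  exists2 r, 0 < r < 1 & [/\ unit_disk R (r^-1 *: z), unit_disk R (r^-1 *: w) &
     poincare (r^-1 *: z) (r^-1 *: w) < poincare z w + e].
Proof.
move=> hz hw e0.
pose P u := pP (u *: z) (u *: w); pose Q u := pQ (u *: z) (u *: w).
have nD v : unit_disk R v -> \forall u \near (1 : R), unit_disk R (u *: v).
  move=> hv; have c : continuous (fun u : R => u *: v) by exact: scalel_continuous.
  have := c 1 (unit_disk R); rewrite /= scale1r => H; apply: H.
  by apply: open_nbhs_nbhs; split=> //; exact: open_unit_disk.
have cont : {for (1 : R), continuous (fun u : R => ln ((1 + pT (u *: z) (u *: w)) / (1 - pT (u *: z) (u *: w))))}.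
  have cP : continuous P.
    move=> u; rewrite /P /pP; under eq_fun do rewrite !mxE.
    by apply: cvgD; apply: cvgM; apply: cvgB; apply: cvgM; (exact: cvg_id || exact: cvg_cst).
  have cQ : continuous Q.
    have cm (x y : R) : continuous (fun u : R => u * x * (u * y)).
      by move=> u; apply: cvgM; apply: cvgM; (exact: cvg_id || exact: cvg_cst).
    move=> u; rewrite /Q /pQ; under eq_fun do rewrite !mxE.
    apply: cvgD; apply: cvgM; apply: cvgB; (exact: cvg_cst || exact: cm || (apply: cvgD; exact: cm)).
  have Q1 : Q 1 != 0 by rewrite /Q !scale1r gt_eqF // pQ_gt0.
  have cT : {for (1 : R), continuous (fun u : R => pT (u *: z) (u *: w))}.
    apply: (@continuous_comp _ _ _ (fun u : R => P u / Q u) Num.sqrt); last exact: sqrt_continuous.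
    by apply: continuousM; [exact: cP|apply: continuousV => //; exact: cQ].
  have /andP[t0 t1] := pT_bounds hz hw.
  apply: (@continuous_comp _ _ _ (fun u : R => (1 + pT (u *: z) (u *: w)) / (1 - pT (u *: z) (u *: w))) (@ln R)).
    apply: continuousM; first by apply: continuousD => //; exact: cst_continuous.
    apply: continuousV; first by rewrite !scale1r subr_eq0 eq_sym lt_eqF.
    by apply: continuousB => //; exact: cst_continuous.
  by apply: continuous_ln; rewrite !scale1r divr_gt0 // ?subr_gt0 // ltr_wpDr.
have /cvgrPdist_lt/(_ e e0) h := cont.
have nn : \forall u \near (1 : R), (unit_disk R (u *: z) /\ unit_disk R (u *: w)) /\
    `|ln ((1 + pT ((1 : R) *: z) ((1 : R) *: w)) / (1 - pT ((1 : R) *: z) ((1 : R) *: w))) -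
      ln ((1 + pT (u *: z) (u *: w)) / (1 - pT (u *: z) (u *: w)))| < e.
  by apply: filterS2 (filterI (nD z hz) (nD w hw)) h.
have /nbhs_normP[d d0 hd] := nn.
pose u := 1 + d / (d + 1) / 2.
have d10 : 0 < d + 1 by rewrite addr_gt0.
have q0 : 0 < d / (d + 1) by rewrite divr_gt0.
have q1 : d / (d + 1) <= d by rewrite ler_pdivrMr // ler_peMr ?ltW //; lra.
have u1 : 1 < u by rewrite /u; lra.
have u0 : 0 < u by lra.
exists u^-1; first by rewrite invr_gt0 u0 invf_lt1.
rewrite invrK; have /= := hd u; rewrite {1}/u addrC addKr gtr0_norm ?divr_gt0 // => H.
have [[Dz Dw] l] := H ltac:(lra).
split=> //; rewrite !poincareE //; move: l; rewrite !scale1r ltr_distlC => /andP[_].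
by [].
Qed.

Lemma poincare_small (e : R) : 0 < e -> exists2 w, unit_disk R w /\ w != 0 & poincare 0 w < e.
Proof.
move=> e0.
have D0 : unit_disk R 0 by apply/unit_diskE; rewrite !mxE expr0n addr0 ltr01.
have p00 : poincare 0 0 = 0 :> R.
  rewrite poincareE // /pT /pP !mxE subrr expr0n addr0 mul0r sqrtr0 addr0 subr0 divr1.
  exact: ln1.
pose v : 'rV[R]_(1 + 1) := delta_mx 0 i0.
have cu : continuous (fun u : R => u *: v) by exact: scalel_continuous.
have vu u : (u *: v) 0 i0 = u /\ (u *: v) 0 i1 = 0.
  by rewrite !mxE !eqxx /= mulr1 mulr0.
pose u := (1 - expR (- e)) / (1 + expR (- e)) / 2.
have E0 := expR_gt0 (- e); have E1 : expR (- e) < 1 by rewrite expR_lt1 oppr_lt0.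
have d0 : 0 < 1 + expR (- e) by rewrite addr_gt0.
have u0 : 0 < u by rewrite !divr_gt0 // subr_gt0.
have u1 : u < (1 - expR (- e)) / (1 + expR (- e)).
  by rewrite /u ltr_pdivrMr // ltr_pMr ?divr_gt0 ?subr_gt0 //; lra.
have u2 : u < 1 by apply: lt_trans u1 _; rewrite ltr_pdivrMr //; lra.
have Du : unit_disk R (u *: v).
  apply/unit_diskE; rewrite (vu u).1 (vu u).2 expr0n addr0.
  by rewrite expr_lt1 // ltW.
exists (u *: v).
  split=> //; apply/eqP => /(congr1 (fun x : 'rV[R]_(1 + 1) => x 0 i0)); rewrite (vu u).1 mxE => h.
  by rewrite h ltxx in u0.
rewrite poincareE // /pT /pP /pQ (vu u).1 (vu u).2 !mxE !mul0r !sub0r oppr0 expr0n !addr0 subr0 expr1n divr1.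
rewrite sqrrN sqrtr_sqr gtr0_norm // -[ltRHS]expRK ltr_ln ?posrE ?expR_gt0 ?divr_gt0 ?subr_gt0 ?addr_gt0 //.
rewrite ltr_pdivrMr ?subr_gt0 //.
move: u1; rewrite ltr_pdivlMr // => h.
have ee : expR e * expR (- e) = 1 by rewrite -expRD subrr expR0.
rewrite -(ltr_pM2r E0) mulrAC ee mul1r; lra.
Qed.

End Poincare.

(** * Chains of disks *)

Section Chains.
Variables (R : realType) (n : nat) (M : manifold R n).
Implicit Types (J : complex_structure M) (p q : M) (t e : R).

Inductive chain J : R -> M -> M -> Prop :=
| chain_nil p : chain J 0 p p
| chain_cons f z w t q : holomorphic_disk J f -> unit_disk R z -> unit_disk R w ->
    chain J t (f w) q -> chain J (poincare z w + t) (f z) q.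

Lemma chain_ge0 J t p q : chain J t p q -> 0 <= t.
Proof. by elim=> // f z w t' q' _ hz hw _ IH; rewrite addr_ge0 // poincare_ge0. Qed.

Lemma chain_cat J t t' p q r : chain J t p q -> chain J t' q r -> chain J (t + t') p r.
Proof.
elim=> [p' h|f z w s q' hf hz hw _ IH h]; first by rewrite add0r.
by rewrite -addrA; apply: chain_cons => //; exact: IH.
Qed.

Lemma chain1 J f z w : holomorphic_disk J f -> unit_disk R z -> unit_disk R w ->
  chain J (poincare z w) (f z) (f w).
Proof. by move=> hf hz hw; rewrite -[poincare z w]addr0; apply: chain_cons => //; exact: chain_nil. Qed.

Lemma chain_sym J t p q : chain J t p q -> chain J t q p.
Proof.
elim=> [p'|f z w s q' hf hz hw _ IH]; first exact: chain_nil.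
by rewrite addrC; apply: chain_cat IH _; rewrite poincare_sym //; exact: chain1.
Qed.

Definition short e J : Prop := forall p q, exists2 t, t < e & chain J t p q.

(** The infimum of the chain lengths, capped at e, is a disk-decreasing pseudometric, so it is
    bounded by the Kobayashi pseudometric and vanishes. The cap gives a value to pairs that no chain
    is known to join. *)
Lemma kobayashi_short J e : 0 < e -> kobayashi_vanishes J -> short e J.
Proof.
move=> e0 kv p q; pose T p q := [set t | chain J t p q \/ t = e].
pose d p q : R := inf (T p q).
have lb p' q' : lbound (T p' q') 0 by move=> t [/chain_ge0//|->]; exact: ltW.
have hl p' q' : has_inf (T p' q') by split; [exists e; right|exists 0; exact: lb].
have dle p' q' t : chain J t p' q' -> d p' q' <= t.
  by move=> h; apply: ge_inf; [exact: (hl p' q').2|left].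
have dle' p' q' : d p' q' <= e by apply: ge_inf; [exact: (hl p' q').2|right].
have d0 p' q' : 0 <= d p' q' by apply: lb_le_inf; [exact: (hl p' q').1|exact: lb].
have near p' q' eta : 0 < eta -> exists2 t, T p' q' t & t < d p' q' + eta.
  by move=> h; exact: inf_adherent.
have pm : pseudometric d.
  split=> //.
  - by move=> x; apply/le_anti; rewrite d0 andbT; apply: dle; exact: chain_nil.
  - move=> x y; rewrite /d; congr inf; apply/seteqP.
    by split=> t [/chain_sym|]; [left|right|left|right].
  move=> x y z; apply/ler_addgt0Pr => eta eta0.
  have eta2 : 0 < eta / 2 by rewrite divr_gt0.
  have [t1 T1 h1] := near x y _ eta2; have [t2 T2 h2] := near y z _ eta2.
  have t10 := lb _ _ _ T1; have t20 := lb _ _ _ T2.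
  have dt : d x z <= t1 + t2.
    case: T1 t10 h1 => [c1|-> _ _]; last first.
      by apply: le_trans (dle' _ _) _; rewrite lerDl.
    case: T2 t20 h2 => [c2|-> _ _]; last first.
      by move=> t10 _; apply: le_trans (dle' _ _) _; rewrite lerDr.
    by move=> _ _ _ _; apply: dle; exact: chain_cat c1 c2.
  by lra.
have dd : disk_decreasing J d by move=> f hf z w hz hw; apply: dle; exact: chain1.
have dz : d p q <= 0.
  have : ((d p q)%:E <= kobayashi J p q)%E by apply: ereal_sup_ubound; exists d.
  by rewrite kv lee_fin.
have e0' : 0 < e by [].
have [t Tt ht] := near p q e e0; have {}ht : t < e by lra.
by case: Tt ht => [c ht|-> ]; [exists t|rewrite ltxx].
Qed.

(** By the triangle inequality a disk-decreasing pseudometric is at most the length of any chain;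
    the zero pseudometric makes the supremum exactly 0. *)
Lemma short_kobayashi J : (forall e, 0 < e -> short e J) -> kobayashi_vanishes J.
Proof.
move=> sh p q; rewrite /kobayashi.
have z d : pseudometric d -> disk_decreasing J d -> d p q = 0.
  move=> pm dd; apply/le_anti; rewrite (pm_ge0 pm) andbT; apply/ler_addgt0Pr => e e0.
  have [t te c] := sh e e0 p q; rewrite add0r; apply: le_trans (ltW te).
  elim: c => [x|f z w s y hf hz hw _ IH]; first by rewrite (pm_refl pm).
  by apply: le_trans (pm_triangle pm _ (f w) _) _; apply: lerD => //; exact: dd.
have -> : [set (d p q)%:E | d in [set d : M -> M -> R | pseudometric d /\ disk_decreasing J d]] = [set 0%:E].
  apply/seteqP; split=> [_ [d [pm dd] <-]|_ ->]; first by rewrite z.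
  exists (fun _ _ => 0) => //; split; first by split=> // *; rewrite addr0.
  by move=> f _ v w hv hw; exact: poincare_ge0.
exact: ereal_sup1.
Qed.

(** Both ends p and q are prescribed, so that consecutive perturbed disks fit together into a chain;
    this requires distinct z and w. *)
Definition disk_extends (J : complex_structure M) (F : set_system (complex_structure M)) : Prop :=
  forall f z w eta, holomorphic_disk J f -> unit_disk R z -> unit_disk R w -> z != w -> 0 < eta ->
  exists A B : set M, [/\ nbhs (f z) A, nbhs (f w) B &
    \forall J' \near F, forall p q, A p -> B q -> exists g z' w',
      [/\ holomorphic_disk J' g, unit_disk R z' /\ unit_disk R w', g z' = p, g w' = q &
          poincare z' w' < poincare z w + eta]].

Lemma cst_disk J p : holomorphic_disk J (fun=> p).
Proof.
apply: holomorphic_diskP.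
  split=> [q _|c ac i]; first exact: cst_continuous.
  exact: Cn_cst.
move=> z Dz; have [c ac cp] := atlas_cover p; exists c => // j.
rewrite !pd_cst big1 // => l _; by rewrite pd_cst mul0r.
Qed.

(** Induction along the chain. An empty chain, or a link with z = w, is treated as a constant disk
    marked at 0 and at a second point very close to 0, so that [disk_extends] applies to it. *)
Lemma chain_extends J (F : set_system (complex_structure M)) : Filter F -> disk_extends J F ->
  forall t p q, chain J t p q -> forall eta, 0 < eta ->
  exists A B : set M, [/\ nbhs p A, nbhs q B &
    \forall J' \near F, forall p' q', A p' -> B q' -> exists2 t', t' < t + eta & chain J' t' p' q'].
Proof.
move=> FF ext.
have base p eta : 0 < eta -> exists A B : set M, [/\ nbhs p A, nbhs p B &
    \forall J' \near F, forall p' q', A p' -> B q' -> exists2 t', t' < eta & chain J' t' p' q'].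
  move=> eta0; have eta2 : 0 < eta / 2 by rewrite divr_gt0.
  have [w [Dw w0] pw] := poincare_small eta2.
  have D0 : unit_disk R 0 by apply/unit_diskE; rewrite !mxE expr0n addr0 ltr01.
  have w0' : 0 != w by rewrite eq_sym.
  have [A [B [nA nB h]]] := ext _ _ _ _ (cst_disk J p) D0 Dw w0' eta2.
  exists A, B; split=> //; apply: filterS h => J' h p' q' Ap Bq.
  have [g [z' [w' [hg [Dz' Dw'] <- <- pl]]]] := h p' q' Ap Bq.
  by exists (poincare z' w'); [lra|exact: chain1].
move=> t p q; elim=> [p' eta eta0|f z w s q' hf hz hw _ IH eta eta0].
  by have [A [B [nA nB h]]] := base p' eta eta0; exists A, B; split=> //; rewrite add0r.
have eta2 : 0 < eta / 2 by rewrite divr_gt0.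
have [B1 [B2 [nB1 nB2 h2]]] := IH _ eta2.
have [A [A2 [nA nA2 h1]]] : exists A A2 : set M, [/\ nbhs (f z) A, nbhs (f w) A2 &
   \forall J' \near F, forall p' q', A p' -> A2 q' -> exists2 t', t' < poincare z w + eta / 2 & chain J' t' p' q'].
  have [zw|zw] := eqVneq z w.
    have [A [B [nA nB h]]] := base (f z) _ eta2; exists A, B; split=> //; first by rewrite -zw.
    apply: filterS h => J' h p' q'' Ap Bq; have [t' lt c] := h p' q'' Ap Bq; exists t' => //.
    by have := poincare_ge0 hz hw; lra.
  have [A [B [nA nB h]]] := ext _ _ _ _ hf hz hw zw eta2; exists A, B; split=> //.
  apply: filterS h => J' h p' q'' Ap Bq.
  have [g [z' [w' [hg [Dz' Dw'] <- <- pl]]]] := h p' q'' Ap Bq.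
  by exists (poincare z' w') => //; exact: chain1.
exists A, B2; split=> //; apply: filterS2 h1 h2 => J' h1 h2 p' q'' Ap Bq.
have [t1 l1 c1] := h1 p' (f w) Ap (nbhs_singleton nA2).
have [t2 l2 c2] := h2 (f w) q'' (nbhs_singleton nB1) Bq.
by exists (t1 + t2); [lra|exact: chain_cat c1 c2].
Qed.

(** Chains persist for all ends in a neighbourhood of each pair, and M x M is compact. *)
Lemma short_near J (F : set_system (complex_structure M)) e : Filter F -> disk_extends J F -> short e J ->
  \forall J' \near F, short e J'.
Proof.
move=> FF ext sh.
have cMM : compact ([set: M] `*` [set: M]) by apply: compact_setX; exact: manifold_compact.
have /compact_near_coveringP/(_ _ F (fun J' (x : M * M) => exists2 t, t < e & chain J' t x.1 x.2)) := cMM.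
move=> /(_ FF) H; apply: filterS (H _).
  by move=> J' h p q; exact: (h (p, q)).
move=> [p q] _; have [t te c] := sh p q.
have eta0 : 0 < e - t by rewrite subr_gt0.
have [A [B [nA nB h]]] := chain_extends FF ext c eta0.
exists (A `*` B, [set J' | forall p' q', A p' -> B q' -> exists2 t', t' < t + (e - t) & chain J' t' p' q']).
  by split=> //=; exists (A, B).
move=> [[p' q'] J'] [[/= Ap Bq] h']; have [t' lt ct] := h' p' q' Ap Bq.
by exists t' => //; rewrite addrC subrK in lt.
Qed.

End Chains.

(** * Auxiliary facts on indices, matrices and families *)

Lemma sidx_eq (R : realType) N n (k k' : 'I_N) (i i' : 'I_(n + n)) :
  (sidx k i == sidx k' i') = (k == k') && (i == i').
Proof.
apply/eqP/andP => [e|[/eqP-> /eqP->] //]; apply/andP; apply: contraT => /negbTE ne.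
have h := @packS_sidx R N n (fun j a => ((j == k') && (a == i'))%:R) k i.
by move: h; rewrite e packS_sidx !eqxx ne => /eqP; rewrite oner_eq0.
Qed.

Lemma Cn_pd (R : realType) k n (U : set 'rV[R]_k) f i : Cn n.+1 U f -> Cn n U (pd i f).
Proof. by case=> _; apply. Qed.

Lemma derive_line (R : realType) (V V' : normedModType R) (f : V -> R) (f' : V' -> R) x v x' v' :
  (forall h : R, f (h *: v + x) = f' (h *: v' + x')) -> 'D_v f x = 'D_v' f' x'.
Proof.
move=> hf; have := hf 0; rewrite !scale0r !add0r => e0.
have e : (fun h : R => h^-1 *: ((f \o shift x) (h *: v) - f x)) =
         (fun h : R => h^-1 *: ((f' \o shift x') (h *: v') - f' x')).
  by apply/funext => h /=; rewrite hf e0.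
by rewrite /derive e.
Qed.

Lemma conj_sum (R : comUnitRingType) a (I : finType) (A T : 'M[R]_a) (c : I -> R) (B : I -> 'M[R]_a) e :
  A *m T = 1%:M ->
  A *m (\sum_i c i *: B i + e *: 1%:M) *m T = \sum_i c i *: (A *m B i *m T) + e *: 1%:M.
Proof.
move=> AT; rewrite mulmxDr mulmxDl -scalemxAr mulmx1 -scalemxAl AT; congr (_ + _).
rewrite mulmx_sumr mulmx_suml; apply: eq_bigr => i _.
by rewrite -scalemxAr -scalemxAl.
Qed.

Lemma coef_conj (R : comUnitRingType) a (t : 'rV[R]_a) (T A B B' : 'M[R]_a) :
  T *m A = 1%:M -> B' = A *m B *m T -> B \in unitmx -> B' \in unitmx ->
  t *m T *m invmx B' = t *m invmx B *m T.
Proof.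
move=> TA eB uB uB'; apply: (can_inj (mulmxK uB')); rewrite mulmxKV // eB.
by rewrite -!mulmxA (mulmxA T) TA mul1mx (mulmxA (invmx _)) mulVmx // mul1mx.
Qed.

Lemma det_unitmx (F : fieldType) a (A : 'M[F]_a) : \det A != 0 -> A \in unitmx.
Proof. by rewrite unitmxE unitfE. Qed.

Lemma nul_le (R : realType) (X : Type) (F : set_system X) k a b (W : set 'rV[R]_k) h : (a <= b)%N ->
  nul F b W h -> nul F a W h.
Proof.
by move=> /subnKC <-; elim: (b - a)%N => [|d IH]; rewrite ?addn0 // addnS => /nulW/IH.
Qed.

Lemma nul_sub (R : realType) (X : Type) (F : set_system X) k r (V W : set 'rV[R]_k) h : V `<=` W ->
  nul F r W h -> nul F r V h.
Proof.
move=> VW; have uV h' : unif0 F W h' -> unif0 F V h'.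
  by move=> u C e cC CV; apply: u => //; exact: subset_trans CV VW.
elim: r h => [|r IH] h [c u d].
  by split; [move=> x; exact: Cn_sub VW (c x)|exact: uV|].
by split; [move=> x; exact: Cn_sub VW (c x)|exact: uV|move=> i; exact: IH (d i)].
Qed.

Lemma fin_bound (R : realType) (I : finType) (P : I -> R -> Prop) : (forall i b b', P i b -> b <= b' -> P i b') ->
  (forall i, exists2 b, 0 < b & P i b) -> exists2 b, 0 < b & forall i, P i b.
Proof.
move=> mono h; have h' i : exists b, 0 < b /\ P i b by have [b b0 pb] := h i; exists b.
have [f hf] := boolp.choice h'.
have f0 i : 0 <= f i by apply: ltW; exact: (hf i).1.
exists (1 + \sum_i f i); first by rewrite ltr_pwDl // sumr_ge0.
move=> i; apply: mono (hf i).2 _; rewrite (bigD1 i) //= addrCA lerDl.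
by rewrite addr_ge0 // sumr_ge0.
Qed.

Lemma is_derive_line_eq (R : realType) (V V' : normedModType R) (f : V -> R) (f' : V' -> R) x v x' v' d :
  (forall h : R, f (h *: v + x) = f' (h *: v' + x')) -> is_derive x' v' f' d -> is_derive x v f d.
Proof.
move=> hf [df' vf']; have := hf 0; rewrite !scale0r !add0r => e0.
have e : (fun h : R => h^-1 *: ((f \o shift x) (h *: v) - f x)) =
         (fun h : R => h^-1 *: ((f' \o shift x') (h *: v') - f' x')).
  by apply/funext => h /=; rewrite hf e0.
by split; [rewrite /derivable e; exact: df'|rewrite (derive_line hf)].
Qed.

(** * The spray around a disk and its Cauchy-Riemann defect *)

Section Spray.
Variables (R : realType) (n : nat) (M : manifold R n) (J : complex_structure M).
Notation i0 := (lshift 1 (0 : 'I_1) : 'I_(1 + 1)).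
Notation i1 := (rshift 1 (0 : 'I_1) : 'I_(1 + 1)).
Variables (N : nat) (Om : set 'rV[R]_(1 + 1)) (g : 'rV[R]_(1 + 1) -> M).
Variables (ch : 'I_N -> chart R M (n + n)) (th : 'I_N -> 'rV[R]_(1 + 1) -> R).
Variables (L : 'I_N -> set 'rV[R]_(1 + 1)) (t0 : R).
Hypothesis oOm : open Om.
Hypothesis cg : CnM 8 Om g.
Hypothesis crg : forall c z, atlas c -> Om z -> chart_dom c (g z) -> crat J g c z.
Hypothesis ach : forall k, atlas (ch k).
Hypothesis chJ : forall k x, chart_codom (ch k) x -> sval J (ch k) x = std_J R n.
Hypothesis cth : forall k, Cn 8 setT (th k).
Hypothesis clL : forall k, closed (L k).
Hypothesis LOm : forall k, L k `<=` Om.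
Hypothesis Lch : forall k z, L k z -> chart_dom (ch k) (g z).
Hypothesis thL : forall k z, ~ L k z -> th k z = 0.
Hypothesis t00 : 0 < t0.
Notation m := (N * n)%N.
Notation K := (1 + 1 + (m + m))%N.
Implicit Types (q : 'rV[R]_K) (j k : 'I_N) (s : seq 'I_N) (i l : 'I_(n + n)) (p : 'I_(m + m)).

Definition zeta q : 'rV[R]_(1 + 1) := lsubmx q.
Definition blk k q : 'rV[R]_(n + n) := \row_i q 0 (iS (sidx k i)).
Definition vv k q : 'rV[R]_(n + n) := th k (zeta q) *: blk k q.
Definition away k : set 'rV[R]_K := [set q | ~ L k (zeta q)].

(** The disk g is moved in one chart [ch k] after another, by th k times the k-th block of
    parameters. Over the zero section the spray is g. *)
Fixpoint spr s : 'rV[R]_K -> M :=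
  if s is k :: s' then cstep (spr s') (ch k) (vv k) else g \o zeta.
Fixpoint spW s : set 'rV[R]_K :=
  if s is k :: s' then wstep (spW s') (away k) (spr s') (ch k) (vv k) else zeta @^-1` Om.

Lemma zeta_pt x y (v : 'rV[R]_(m + m)) : zeta (pt x y v) = row_mx x%:M y%:M.
Proof. exact: row_mxKl. Qed.

Lemma zetaE q a : zeta q 0 a = q 0 (lshift (m + m) a).
Proof. by rewrite mxE. Qed.

Lemma zeta_cont : continuous zeta.
Proof.
move=> q; apply: rV_cont => a.
rewrite (_ : (fun q => zeta q 0 a) = fun q => q 0 (lshift (m + m) a)); first exact: coord_continuous.
by apply/funext => q'; rewrite zetaE.
Qed.

Lemma Cn_zeta r (W : set 'rV[R]_K) (f : 'rV[R]_(1 + 1) -> R) : open W -> Cn r setT f -> Cn r W (fun q => f (zeta q)).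
Proof.
move=> oW cf; apply: (Cn_comp oW _ cf) => // a.
by apply: (Cn_ext oW _ (Cn_coord r W (lshift (m + m) a))) => q _; rewrite zetaE.
Qed.

Lemma open_away k : open (away k).
Proof.
have -> : away k = setT `&` zeta @^-1` (~` L k) by apply/seteqP; split=> [q|q []].
apply: open_preimage_on; [exact: openT|exact: closed_openC|by move=> q _; exact: zeta_cont].
Qed.

Lemma vv_away k q : away k q -> vv k q = 0.
Proof. by move=> /thL h; rewrite /vv h scale0r. Qed.

Lemma Cn_vv k (W : set 'rV[R]_K) i : open W -> Cn 8 W (fun q => vv k q 0 i).
Proof.
move=> oW; apply: (Cn_ext oW (f := fun q => th k (zeta q) * q 0 (iS (sidx k i)))).
  by move=> q _; rewrite !mxE.
by apply: Cn_mul => //; [exact: Cn_zeta|exact: Cn_coord].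
Qed.

Lemma spr_reg s : open (spW s) /\ CnM 8 (spW s) (spr s).
Proof.
elim: s => [|k s [oW cW]] /=.
  have oz : open (zeta @^-1` Om).
    rewrite (_ : _ @^-1` _ = setT `&` zeta @^-1` Om); last by rewrite setTI.
    by apply: open_preimage_on; [exact: openT| |move=> q _; exact: zeta_cont].
  split=> //; apply: (CnM_comp oz oOm cg) => // a.
  by apply: (Cn_ext oz _ (Cn_coord 8 _ (lshift (m + m) a))) => q _; rewrite zetaE.
have oA : open (away k) by exact: open_away.
split; first exact: (open_wstep oW oA (ach k) cW (fun i => Cn_vv k i oW)).
exact: (CnM_step oW oA (ach k) cW (fun i => Cn_vv k i oW) (@vv_away k)).
Qed.

Lemma cstep0 (f : 'rV[R]_K -> M) k q : vv k q = 0 -> cstep f (ch k) (vv k) q = f q.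
Proof. by move=> v0; rewrite /cstep v0; case: asboolP => // cq; rewrite addr0 coordK. Qed.

Lemma spr_val0 s q : (forall j, j \in s -> blk j q = 0) -> spr s q = g (zeta q).
Proof.
elim: s => [|k s IH] //= h; rewrite cstep0.
  by apply: IH => j js; apply: h; rewrite inE js orbT.
by rewrite /vv h ?inE ?eqxx // scaler0.
Qed.

Lemma spW_val0 s q : Om (zeta q) -> (forall j, j \in s -> blk j q = 0) -> spW s q.
Proof.
move=> oq; elim: s => [|k s IH] //= h.
have h' j : j \in s -> blk j q = 0 by move=> js; apply: h; rewrite inE js orbT.
have [Lq|nLq] := pselect (L k (zeta q)); last by left; split; [exact: IH|].
right; split.
  by split; [exact: IH|rewrite /= spr_val0 //; exact: Lch].
rewrite spr_val0 // /vv h ?inE ?eqxx // scaler0 addr0.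
by apply: coord_codom; exact: Lch.
Qed.

Lemma spr_one s q k : uniq s -> k \in s -> (forall j, j != k -> blk j q = 0) ->
  spr s q = cstep (g \o zeta) (ch k) (vv k) q.
Proof.
move=> us ks h; elim: s us ks => [|j s IH] //= /andP[js us]; rewrite inE.
have [ekj|jk] := eqVneq k j => /= ks.
  rewrite -ekj /cstep spr_val0 // => j' j's; apply: h; apply/eqP => e.
  by move: js; rewrite -ekj -e j's.
rewrite cstep0; first exact: IH.
by rewrite /vv h ?scaler0 // eq_sym.
Qed.

Definition Phi : 'rV[R]_K -> M := spr (enum 'I_N).
Definition W0 : set 'rV[R]_K := spW (enum 'I_N).

Lemma open_W0 : open W0. Proof. exact: (spr_reg _).1. Qed.
Lemma CnM_Phi : CnM 8 W0 Phi. Proof. exact: (spr_reg _).2. Qed.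

Definition VV j : set 'rV[R]_K := W0 `&` Phi @^-1` chart_dom (ch j).
Lemma open_VV j : open (VV j). Proof. exact: CnM_open open_W0 CnM_Phi (ach j). Qed.

Definition Fc j l q : R := coord (ch j) (Phi q) 0 l.
Lemma Cn_Fc j l : Cn 8 (VV j) (Fc j l). Proof. exact: CnM_Phi.2 (ach j) l. Qed.

Definition TM j k q : 'M[R]_(n + n) := trM (ch j) (ch k) (Phi q).
Definition SM j k q : 'M[R]_(n + n) := \matrix_(i, l) pd (iS (sidx k i)) (Fc j l) q.
Definition Theta z : R := \sum_k th k z ^+ 2.
(** A tangent vector in the chart j is read in each chart k, weighted by th k and fed to the
    derivative of the spray in the k-th block. On the zero section the sum is Theta times the
    identity, so it gives a right inverse of the derivative nearby. The last term keeps the matrix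
    invertible where Theta is small and disappears where Theta >= t0. *)
Definition NM j q : 'M[R]_(n + n) :=
  \sum_k th k (zeta q) *: (TM j k q *m SM j k q) + pospow 8 (t0 - Theta (zeta q)) *: 1%:M.

(** Each chart that contributes to [NM] contains the point of the spray. *)
Definition W1 : set 'rV[R]_K := [set q | W0 q /\ forall k, away k q \/ chart_dom (ch k) (Phi q)].
Definition W2 j : set 'rV[R]_K := W1 `&` VV j.
Definition DD j : set 'rV[R]_K := [set q | W2 j q /\ \det (NM j q) != 0].

Lemma open_W1 : open W1.
Proof.
rewrite openE => q [W0q h]; apply: filterI; first by apply: open_nbhs_nbhs; split=> //; exact: open_W0.
apply: (filter_forall (nbhs_filter q)) => k; case: (h k) => hk.
  have : nbhs q (away k) by apply: open_nbhs_nbhs; split=> //; exact: open_away.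
  by apply: filterS => z; left.
have : nbhs q (VV k) by apply: open_nbhs_nbhs; split=> //; exact: open_VV.
by apply: filterS => z [_]; right.
Qed.

Lemma open_W2 j : open (W2 j). Proof. by apply: openI; [exact: open_W1|exact: open_VV]. Qed.

Lemma Cn_Theta : Cn 8 setT Theta.
Proof.
apply: Cn_sum => [|k _]; first exact: openT.
apply: (Cn_ext openT (f := fun z => th k z * th k z)) => [z _|]; first by rewrite expr2.
by apply: Cn_mul => //; exact: openT.
Qed.

Lemma Cn_NM j i l : Cn 7 (W2 j) (fun q => NM j q i l).
Proof.
have oW : open (W2 j) by exact: open_W2.
have t1 k : Cn 7 (W2 j) (fun q => th k (zeta q) * (TM j k q *m SM j k q) i l).
  have -> : W2 j = (W2 j `&` away k) `|` (W2 j `&` VV k).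
    apply/seteqP; split=> [q Wq|q [] []//]; have [[W0q /(_ k) h] Vq] := Wq.
    by case: h => h; [left|right].
  have oA : open (W2 j `&` away k) by apply: openI => //; exact: open_away.
  have oV : open (W2 j `&` VV k) by apply: openI => //; exact: open_VV.
  apply: Cn_glue => // [q [_ /thL ->]|]; first by rewrite mul0r.
  apply: Cn_mul => //; first by apply: Cn_zeta => //; exact: (CnW (cth k)).
  apply: (Cnm_mul oV) => a b.
    apply: (Cn_ext oV (f := fun q => pd a (fun x => rep (ch j) id (ch k) x 0 b) (coord (ch j) (Phi q)))).
      move=> q [[_ [_ jq]] [_ kq]]; rewrite /TM /trM jacobianE // => b'.
      exact: trans_diff.
    have cT := Cn_pd a (@trans_Cn R n M (ch j) (ch k) 8 b (ach j) (ach k)).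
    apply: (Cn_comp oV _ cT) => [q [[_ [_ jq]] [_ kq]]|b']; first by exists (Phi q).
    by apply: Cn_sub (CnW (Cn_Fc j b')) => q [[_ Vq] _].
  apply: (Cn_ext oV (f := pd (iS (sidx k a)) (Fc j b))) => [q _|]; first by rewrite mxE.
  have c := Cn_pd (iS (sidx k a)) (@Cn_Fc j b).
  by apply: Cn_sub c => q [[_ Vq] _].
apply: (Cn_ext oW (f := fun q => \sum_k th k (zeta q) * (TM j k q *m SM j k q) i l
   + pospow 8 (t0 - Theta (zeta q)) * (1%:M : 'M[R]_(n + n)) i l)).
  move=> q _; rewrite [RHS]mxE summxE [X in _ = _ + X]mxE; congr (_ + _).
  by apply: eq_bigr => k _; rewrite [RHS]mxE.
apply: Cn_add => //; first by apply: Cn_sum.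
apply: Cn_mul => //; last exact: Cn_cst.
apply: (@Cn_pospow R K 7 0) => //; apply: Cn_sub2 => //; first exact: Cn_cst.
by apply: Cn_zeta => //; exact: CnW Cn_Theta.
Qed.

Lemma open_DD j : open (DD j).
Proof.
have oW : open (W2 j) by exact: open_W2.
have -> : DD j = W2 j `&` (fun q => \det (NM j q)) @^-1` [set x | x != 0].
  by apply/seteqP; split=> q [].
apply: open_preimage_on; [exact: open_W2|exact: open_neq|move=> q Wq].
by apply: Cn_continuous (Cn_det oW (fun i l => Cn_NM j i l)) _ Wq.
Qed.

Lemma Cn_invNM j : Cnm 7 (DD j) (fun q => invmx (NM j q)).
Proof.
apply: Cnm_inv; first exact: open_DD.
  by move=> i l; apply: Cn_sub (Cn_NM j i l) => q [].
by move=> q [_ d]; exact: det_unitmx.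
Qed.

Definition JJ (J' : complex_structure M) j q : 'M[R]_(n + n) := sval J' (ch j) (coord (ch j) (Phi q)).
(** For u = Phi(x, y, S), the defect u_x + u_y J' is [tau0], plus the sum of S_y times [tauS], plus
    the derivative of Phi in v applied to S_x + i S_y. [tau0] is the defect for constant v, and
    [tauS] the failure of Phi to be complex linear in v. *)
Definition tau0 J' j q : 'rV[R]_(n + n) :=
  \row_l (pd (ix m) (Fc j l) q + \sum_l' pd (iy m) (Fc j l') q * JJ J' j q l' l).
Definition tauS J' j p q : 'rV[R]_(n + n) :=
  \row_l (\sum_l' pd (iS p) (Fc j l') q * JJ J' j q l' l - jco (fun p => pd (iS p) (Fc j l) q) p).
(** The j-th block of the right inverse applied to Y; the factor th j lets it extend by zero. *)
Definition coef j (Y : 'rV[R]_K -> 'rV[R]_(n + n)) i q : R := th j (zeta q) * (Y q *m invmx (NM j q)) 0 i.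
Definition aG J' q j i : R := coef j (tau0 J' j) i q.
Definition bG J' p q j i : R := coef j (tauS J' j p) i q.
Definition aa J' p q : R := packS (aG J' q) p.
Definition bb J' p p' q : R := packS (bG J' p q) p'.

Definition WW j : set 'rV[R]_K := away j `|` DD j.
Lemma open_WW j : open (WW j). Proof. by apply: openU; [exact: open_away|exact: open_DD]. Qed.

Lemma coef_away j Y i q : away j q -> coef j Y i q = 0.
Proof. by move=> /thL h; rewrite /coef h mul0r. Qed.

Lemma coefE j Y i q : coef j Y i q = \sum_l th j (zeta q) * invmx (NM j q) l i * Y q 0 l.
Proof. by rewrite /coef mxE mulr_sumr; apply: eq_bigr => l _; ring. Qed.

Lemma Cn_w j i l : Cn 7 (DD j) (fun q => th j (zeta q) * invmx (NM j q) l i).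
Proof.
apply: Cn_mul; [exact: open_DD| |exact: Cn_invNM].
by apply: Cn_zeta; [exact: open_DD|exact: CnW (cth j)].
Qed.

Lemma DD_VV j q : DD j q -> VV j q. Proof. by case=> -[]. Qed.

Section Families.
Variable F : set_system (complex_structure M).
Context {FF : Filter F}.
Hypothesis nulJ : forall c r i l, atlas c ->
  nul F r (chart_codom c) (fun J' x => sval J' c x i l - sval J c x i l).

Lemma Cn_JJ J' j i l : Cn 7 (DD j) (fun q => JJ J' j q i l).
Proof.
have oD : open (DD j) by exact: open_DD.
have sm := cs_smooth (svalP J') (ach j).
have c := (smooth_on_entries _ (codom_open (ach j))).1 sm i l 7.
apply: (Cn_comp oD _ c) => [q Dq|l']; first by have [_ jq] := DD_VV Dq; exact: coord_codom.
by apply: Cn_sub (CnW (@Cn_Fc j l')) => q Dq; exact: DD_VV Dq.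
Qed.

Lemma nul_JJ j i l : nul F 7 (DD j) (fun J' q => JJ J' j q i l - JJ J j q i l).
Proof.
have oD : open (DD j) by exact: open_DD.
apply: (nul_comp oD _ _ (@nulJ (ch j) 7 i l (ach j))) => [q Dq|l'].
  by have [_ jq] := DD_VV Dq; exact: coord_codom.
by apply: Cn_sub (CnW (@Cn_Fc j l')) => q Dq; exact: DD_VV Dq.
Qed.

Lemma Cn_pdFc j d l : Cn 7 (DD j) (pd d (Fc j l)).
Proof. by have c := Cn_pd d (@Cn_Fc j l); apply: Cn_sub c => q Dq; exact: DD_VV Dq. Qed.

(** The right inverse does not involve J', so the coefficients are linear in Y with fixed weights
    and inherit its convergence. *)
Lemma coef_fam j i (Y : complex_structure M -> 'rV[R]_K -> 'rV[R]_(n + n)) :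
  (forall J' l, Cn 7 (DD j) (fun q => Y J' q 0 l)) ->
  (forall l, nul F 7 (DD j) (fun J' q => Y J' q 0 l - Y J q 0 l)) ->
  (forall J', Cn 7 (WW j) (coef j (Y J') i)) /\
  nul F 7 (WW j) (fun J' q => coef j (Y J') i q - coef j (Y J) i q).
Proof.
move=> cY nY; have oD : open (DD j) by exact: open_DD.
split.
  move=> J'; apply: Cn_glue => //; [exact: open_away|by move=> q; exact: coef_away|].
  apply: (Cn_ext oD (f := fun q => \sum_l th j (zeta q) * invmx (NM j q) l i * Y J' q 0 l)).
    by move=> q _; rewrite coefE.
  by apply: Cn_sum => // l _; exact: (Cn_mul oD (@Cn_w j i l) (cY J' l)).
have oA : open (away j) by exact: open_away.
apply: (nul_glue oA oD); first by move=> J' q Aq; rewrite !coef_away // subrr.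
have h : nul F 7 (DD j) (fun J' q => \sum_l (th j (zeta q) * invmx (NM j q) l i) * (Y J' q 0 l - Y J q 0 l)).
  by apply: (nul_sum oD) => l; exact: (nul_mul oD (@Cn_w j i l) (nY l)).
apply: (nul_ext oD _ h) => J' q _; rewrite !coefE -sumrB.
by apply: eq_bigr => l _; rewrite mulrBr.
Qed.

Lemma jco_Cn j l p : Cn 7 (DD j) (fun q => jco (fun p => pd (iS p) (Fc j l) q) p).
Proof.
rewrite /jco; case: fintype.split => b; first exact: Cn_pdFc.
by apply: Cn_opp; [exact: open_DD|exact: Cn_pdFc].
Qed.

Lemma tau0_fam j i : (forall J', Cn 7 (WW j) (coef j (tau0 J' j) i)) /\
  nul F 7 (WW j) (fun J' q => coef j (tau0 J' j) i q - coef j (tau0 J j) i q).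
Proof.
have oD : open (DD j) by exact: open_DD.
apply: (@coef_fam j i (fun J' => tau0 J' j)) => [J' l|l].
  apply: (Cn_ext oD (f := fun q => pd (ix m) (Fc j l) q + \sum_l' pd (iy m) (Fc j l') q * JJ J' j q l' l)).
    by move=> q _; rewrite mxE.
  apply: Cn_add => //; first exact: Cn_pdFc.
  by apply: Cn_sum => // l' _; exact: (Cn_mul oD (@Cn_pdFc j _ l') (@Cn_JJ J' j l' l)).
have h : nul F 7 (DD j) (fun J' q => \sum_l' pd (iy m) (Fc j l') q * (JJ J' j q l' l - JJ J j q l' l)).
  by apply: (nul_sum oD) => l'; exact: (nul_mul oD (@Cn_pdFc j _ l') (nul_JJ j l' l)).
apply: (nul_ext oD _ h) => J' q _; rewrite !mxE opprD addrACA subrr add0r -sumrB.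
by apply: eq_bigr => l' _; rewrite mulrBr.
Qed.

Lemma tauS_fam j p i : (forall J', Cn 7 (WW j) (coef j (tauS J' j p) i)) /\
  nul F 7 (WW j) (fun J' q => coef j (tauS J' j p) i q - coef j (tauS J j p) i q).
Proof.
have oD : open (DD j) by exact: open_DD.
apply: (@coef_fam j i (fun J' => tauS J' j p)) => [J' l|l].
  apply: (Cn_ext oD (f := fun q => \sum_l' pd (iS p) (Fc j l') q * JJ J' j q l' l
      - jco (fun p => pd (iS p) (Fc j l) q) p)).
    by move=> q _; rewrite mxE.
  apply: Cn_sub2 => //; last exact: jco_Cn.
  by apply: Cn_sum => // l' _; exact: (Cn_mul oD (@Cn_pdFc j _ l') (@Cn_JJ J' j l' l)).
have h : nul F 7 (DD j) (fun J' q => \sum_l' pd (iS p) (Fc j l') q * (JJ J' j q l' l - JJ J j q l' l)).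
  by apply: (nul_sum oD) => l'; exact: (nul_mul oD (@Cn_pdFc j _ l') (nul_JJ j l' l)).
apply: (nul_ext oD _ h) => J' q _; rewrite !mxE opprB addrA subrK -sumrB.
by apply: eq_bigr => l' _; rewrite mulrBr.
Qed.

End Families.

Section ZeroSection.
Variables x y : R.
Let z : 'rV[R]_(1 + 1) := row_mx x%:M y%:M.
Let q0 : 'rV[R]_K := pt x y 0.

Lemma blk_dx (h : R) (d : 'I_K) k : (forall i, (iS (sidx k i) == d) = false) -> blk k (h *: delta_mx 0 d + q0) = 0.
Proof.
move=> hd; apply/rowP => i; rewrite [LHS]mxE [LHS]mxE [X in X + _]mxE [X in _ * X + _]mxE eqxx hd mulr0 add0r.
by rewrite pt_s mxE mxE.
Qed.

Lemma q0_blk k : blk k q0 = 0.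
Proof. by apply/rowP => i; rewrite [LHS]mxE pt_s !mxE. Qed.

Lemma Phi_q0 : Phi q0 = g z.
Proof. by rewrite /Phi spr_val0 ?zeta_pt // => k _; exact: q0_blk. Qed.

Lemma W0_q0 : Om z -> W0 q0.
Proof. by move=> Oz; apply: spW_val0; rewrite ?zeta_pt // => k _; exact: q0_blk. Qed.

Lemma pd_zeta (a : 'I_(1 + 1)) j l :
  pd (lshift (m + m) a) (Fc j l) q0 = pd a (fun z => coord (ch j) (g z) 0 l) z.
Proof.
apply: derive_line => h.
rewrite /Fc /Phi spr_val0; last by move=> k _; apply: blk_dx => i; rewrite eq_rlshift.
congr (coord _ (g _) 0 l); apply/rowP => b; rewrite zetaE [LHS]mxE [RHS]mxE; congr (_ + _); last by rewrite -zetaE zeta_pt.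
by rewrite [LHS]mxE [RHS]mxE; congr (_ * _); rewrite !mxE !eqxx /= eq_lshift.
Qed.

Lemma th_dom k : th k z != 0 -> Om z /\ chart_dom (ch k) (g z).
Proof.
move=> tz; have Lz : L k z.
  by apply: contrapT => nL; move: tz; rewrite thL // eqxx.
by split; [exact: LOm Lz|exact: Lch].
Qed.

(** Along this line only the k-th move acts, so the derivative is th k times a row of the transition
    matrix. *)
Lemma pd_S k i j l : chart_dom (ch j) (g z) ->
  pd (iS (sidx k i)) (Fc j l) q0 = th k z * trM (ch k) (ch j) (g z) i l.
Proof.
move=> jz.
have val (h : R) : Phi (h *: delta_mx 0 (iS (sidx k i)) + q0) =
    cstep (fun=> g z) (ch k) (fun=> (h * th k z) *: delta_mx 0 i) q0.
  have zq : zeta (h *: delta_mx 0 (iS (sidx k i)) + q0) = z.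
    apply/rowP => b; rewrite zetaE [LHS]mxE [X in X + _]mxE [X in _ * X + _]mxE eqxx /iS eq_lrshift mulr0 add0r.
    by rewrite -zetaE zeta_pt.
  rewrite /Phi (@spr_one _ _ k) ?enum_uniq ?mem_enum //.
    rewrite /cstep /= zq (_ : vv k _ = (h * th k z) *: delta_mx 0 i) //.
    apply/rowP => b; rewrite /vv zq [LHS]mxE [X in _ * X]mxE [X in _ * X]mxE [X in _ * (X + _)]mxE [X in _ * (_ * X + _)]mxE.
    rewrite eqxx /= pt_s !mxE addr0 eqxx /=.
    have -> : (iS (sidx k b) == iS (sidx k i)) = (b == i).
      by rewrite /iS eq_rshift (sidx_eq R) eqxx.
    by ring.
  move=> j' jk; apply: blk_dx => b.
  by rewrite /iS eq_rshift (sidx_eq R) (negbTE jk).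
have [/eqP th0|thn] := boolP (th k z == 0).
  rewrite th0 mul0r -(derive_cst (coord (ch j) (g z) 0 l) (0 : 'rV[R]_1) 0); apply: derive_line => h.
  rewrite /Fc val th0 mulr0 scale0r /cstep.
  by case: asboolP => cz; rewrite ?addr0 ?coordK.
have [Oz kz] := th_dom thn.
pose T x := rep (ch k) id (ch j) x 0 l.
have dT : differentiable T (coord (ch k) (g z)) by exact: trans_diff.
have -> : pd (iS (sidx k i)) (Fc j l) q0 = 'D_(th k z *: delta_mx 0 i) T (coord (ch k) (g z)).
  apply: derive_line => h.
  rewrite /Fc val /cstep asboolT // /T /rep addrC; congr (coord _ (param _ (_ + _)) 0 l).
  by rewrite scalerA.
rewrite deriveE // linearZ /= -deriveE //; congr (_ * _).
rewrite /trM jacobianE // => l'; exact: trans_diff.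
Qed.

(** Over the zero section the spray is the J-holomorphic disk g. *)
Lemma tau0_zero j : th j z != 0 -> tau0 J j q0 = 0.
Proof.
move=> tz; have [Oz jz] := th_dom tz; apply/rowP => l; rewrite [LHS]mxE [RHS]mxE.
rewrite (pd_zeta i0 j l).
have h := crg (ach j) Oz jz; have sq := cs_square (svalP J) (ach j) (coord_codom jz).
have -> : \sum_l' pd (iy m) (Fc j l') q0 * JJ J j q0 l' l =
   \sum_l' (\sum_k pd i0 (fun z => coord (ch j) (g z) 0 k) z * sval J (ch j) (coord (ch j) (g z)) k l') *
     sval J (ch j) (coord (ch j) (g z)) l' l.
  by apply: eq_bigr => l' _; rewrite (pd_zeta i1 j l') h /JJ Phi_q0.
under eq_bigr => l' _ do rewrite mulr_suml.
rewrite exchange_big /=.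
have -> : \sum_k \sum_l' pd i0 (fun z => coord (ch j) (g z) 0 k) z * sval J (ch j) (coord (ch j) (g z)) k l' *
     sval J (ch j) (coord (ch j) (g z)) l' l =
   \sum_k pd i0 (fun z => coord (ch j) (g z) 0 k) z *
    (sval J (ch j) (coord (ch j) (g z)) *m sval J (ch j) (coord (ch j) (g z))) k l.
  apply: eq_bigr => k _; rewrite [X in _ * X]mxE mulr_sumr; apply: eq_bigr => l' _; by rewrite mulrA.
rewrite sq (bigD1 l) //= big1 ?addr0 => [|k kl].
  by rewrite !mxE eqxx mulrN mulr1 subrr.
by rewrite !mxE (negbTE kl) oppr0 mulr0.
Qed.

(** The charts of the spray are holomorphic for J and transition matrices intertwine J, so the
    derivative in v is complex linear there. *)
Lemma tauS_zero j p : th j z != 0 -> tauS J j p q0 = 0.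
Proof.
move=> tz; have [Oz jz] := th_dom tz; apply/rowP => l; rewrite [LHS]mxE [RHS]mxE.
move: p; apply: sidx_case => k i; rewrite jco_sidx.
have [/eqP th0|thn] := boolP (th k z == 0).
  rewrite big1 => [|l' _]; last by rewrite pd_S // th0 !mul0r.
  by rewrite big1 ?subrr // => l' _; rewrite pd_S // th0 mul0r mulr0.
have [_ kz] := th_dom thn.
have te := trM_tensor J (ach k) (ach j) kz jz.
rewrite (chJ (coord_codom kz)) in te.
have e := congr1 (fun A : 'M[R]_(n + n, n + n) => (A : 'M[R]_(n + n)) i l) te.
rewrite [in LHS]mxE [in RHS]mxE in e.
transitivity (th k z * (\sum_l' trM (ch k) (ch j) (g z) i l' * sval J (ch j) (coord (ch j) (g z)) l' l) -
   th k z * (\sum_l' std_J R n i l' * trM (ch k) (ch j) (g z) l' l)).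
  rewrite !mulr_sumr; congr (_ - _); apply: eq_bigr => l' _; rewrite pd_S //.
    by rewrite /JJ Phi_q0 mulrA.
  by rewrite mulrCA.
by rewrite e subrr.
Qed.

Lemma DD_q0 j : L j z -> DD j q0.
Proof.
move=> Lz; have Oz := LOm Lz; have jz := Lch Lz.
have W1q : W1 q0.
  split=> [|k]; first exact: W0_q0.
  have [Lk|nLk] := pselect (L k z); [right|by left; rewrite /away /= zeta_pt].
  by rewrite Phi_q0; exact: Lch.
split; first by split=> //; split; [exact: W0_q0|rewrite /= Phi_q0].
have zq : zeta q0 = z by exact: zeta_pt.
have -> : NM j q0 = (Theta z + pospow 8 (t0 - Theta z))%:M.
  rewrite /NM zq -[RHS]scalemx1 scalerDl; congr (_ + _).
  rewrite /Theta scaler_suml; apply: eq_bigr => k _.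
  have [/eqP th0|thn] := boolP (th k z == 0); first by rewrite th0 expr0n !scale0r.
  have [_ kz] := th_dom thn.
  have -> : SM j k q0 = th k z *: trM (ch k) (ch j) (g z).
    by apply/matrixP => i l; rewrite [LHS]mxE [RHS]mxE pd_S.
  rewrite -scalemxAr scalerA -expr2 /TM Phi_q0 -trM_comp ?ach // trM_id ?ach //.
rewrite det_scalar expf_neq0 // gt_eqF //.
have T0 : 0 <= Theta z by apply: sumr_ge0 => k _; exact: sqr_ge0.
have [h|h] := leP (Theta z) 0; last by rewrite ltr_pwDl // pospow_ge0.
by rewrite ltr_wpDl // pospow_gt0 // subr_gt0; apply: le_lt_trans h t00.
Qed.

Lemma WW_q0 j : WW j q0.
Proof.
have [Lz|nLz] := pselect (L j z); first by right; exact: DD_q0.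
by left; rewrite /away /= zeta_pt.
Qed.

Lemma aa_zero p : aa J p q0 = 0.
Proof.
move: p; apply: sidx_case => k i; rewrite /aa packS_sidx /aG /coef zeta_pt.
have [/eqP th0|thn] := boolP (th k z == 0); first by rewrite th0 mul0r.
by rewrite tau0_zero // mul0mx mxE mulr0.
Qed.

Lemma bb_zero p p' : bb J p p' q0 = 0.
Proof.
move: p'; apply: sidx_case => k i; rewrite /bb packS_sidx /bG /coef zeta_pt.
have [/eqP th0|thn] := boolP (th k z == 0); first by rewrite th0 mul0r.
by rewrite tauS_zero // mul0mx mxE mulr0.
Qed.

End ZeroSection.

Section ChartChange.
Variables (J' : complex_structure M) (q : 'rV[R]_K) (k j : 'I_N).
Hypotheses (Wq : W0 q) (kq : chart_dom (ch k) (Phi q)) (jq : chart_dom (ch j) (Phi q)).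
Let T := TM k j q.

Lemma dF_change d l : pd d (Fc j l) q = \sum_l' pd d (Fc k l') q * T l' l.
Proof.
have oV : open (VV k) by exact: open_VV.
have -> : pd d (Fc j l) q = pd d (fun q => rep (ch k) id (ch j) (coord (ch k) (Phi q)) 0 l) q.
  apply: pd_near; have : nbhs q (VV k) by apply: open_nbhs_nbhs.
  by apply: filterS => z [_ kz]; rewrite /Fc /rep coordK.
rewrite (@pd_comp R _ _ (fun x => rep (ch k) id (ch j) x 0 l)).
- apply: eq_bigr => l' _; rewrite mulrC; congr (_ * _).
  by rewrite /T /TM /trM jacobianE // => b; exact: trans_diff.
- exact: trans_diff.
by move=> b; have [c _] := Cn_Fc k b; apply: c.
Qed.

Lemma tau0_change : tau0 J' j q = tau0 J' k q *m T.
Proof.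
have te := trM_tensor J' (ach k) (ach j) kq jq.
pose DX k := \row_l pd (ix m) (Fc k l) q; pose DY k := \row_l pd (iy m) (Fc k l) q.
have E c : tau0 J' c q = DX c + DY c *m JJ J' c q.
  apply/rowP => l; rewrite [LHS]mxE [RHS]mxE [X in _ = X + _]mxE [X in _ = _ + X]mxE; congr (_ + _).
  by apply: eq_bigr => l' _; rewrite [X in _ = X * _]mxE.
have eX : DX j = DX k *m T.
  apply/rowP => l; rewrite [LHS]mxE [RHS]mxE dF_change; apply: eq_bigr => l' _.
  by rewrite [X in _ = X * _]mxE.
have eY : DY j = DY k *m T.
  apply/rowP => l; rewrite [LHS]mxE [RHS]mxE dF_change; apply: eq_bigr => l' _.
  by rewrite [X in _ = X * _]mxE.
by rewrite !E eX eY mulmxDl -!mulmxA; congr (_ + _ *m _); symmetry; exact: te.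
Qed.

Lemma jco_sum (G : 'I_(m + m) -> 'I_(n + n) -> R) (w : 'I_(n + n) -> R) p :
  jco (fun p => \sum_l G p l * w l) p = \sum_l jco (fun p => G p l) p * w l.
Proof.
rewrite /jco; case: fintype.split => b //.
by rewrite -sumrN; apply: eq_bigr => l _; rewrite mulNr.
Qed.

Lemma jco_ext (G H : 'I_(m + m) -> R) p : G =1 H -> jco G p = jco H p.
Proof. by move=> /funext ->. Qed.

Lemma tauS_change p : tauS J' j p q = tauS J' k p q *m T.
Proof.
have te := trM_tensor J' (ach k) (ach j) kq jq.
pose DS k := \row_l pd (iS p) (Fc k l) q.
pose DJ k : 'rV[R]_(n + n) := \row_l jco (fun p => pd (iS p) (Fc k l) q) p.
have E c : tauS J' c p q = DS c *m JJ J' c q - DJ c.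
  apply/rowP => l; rewrite [LHS]mxE [RHS]mxE [X in _ = X + _]mxE [X in _ = _ + X]mxE [X in _ = _ - X]mxE; congr (_ - _).
  by apply: eq_bigr => l' _; rewrite [X in _ = X * _]mxE.
have eS : DS j = DS k *m T.
  apply/rowP => l; rewrite [LHS]mxE [RHS]mxE dF_change; apply: eq_bigr => l' _.
  by rewrite [X in _ = X * _]mxE.
have eJ : DJ j = DJ k *m T.
  apply/rowP => l; rewrite [LHS]mxE [RHS]mxE.
  rewrite (jco_ext _ (fun p => dF_change (iS p) l)) jco_sum; apply: eq_bigr => l' _.
  by rewrite [X in _ = X * _]mxE.
by rewrite !E eS eJ mulmxBl -!mulmxA; congr (_ *m _ - _); symmetry; exact: te.
Qed.

Lemma SM_change r : SM j r q = SM k r q *m T.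
Proof.
apply/matrixP => i l; rewrite [LHS]mxE [RHS]mxE dF_change; apply: eq_bigr => l' _.
by rewrite [X in _ = X * _]mxE.
Qed.

Hypothesis W1q : W1 q.

Lemma TT : T *m TM j k q = 1%:M.
Proof. by rewrite /T /TM -trM_comp ?ach // trM_id ?ach. Qed.

Lemma NM_change : NM j q = TM j k q *m NM k q *m T.
Proof.
have TT' := mulmx1C TT.
rewrite [X in _ *m X *m _]/NM (conj_sum _ _ _ TT') /NM; congr (_ + _); apply: eq_bigr => r _.
have [/eqP th0|thn] := boolP (th r (zeta q) == 0); first by rewrite th0 !scale0r.
congr (_ *: _); have [_ /(_ r)[/thL e|rq]] := W1q; first by rewrite e eqxx in thn.
have e : TM j r q = TM j k q *m TM k r q by apply: trM_comp.
by rewrite SM_change e; move: (TM j k q) (TM k r q) (SM k r q) (T) => A B C D; rewrite !mulmxA.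
Qed.

(** [NM] is conjugated by the transition matrix, so its inverse defines one endomorphism of the
    tangent space, whatever the chart. *)
Lemma coef_change (t : 'rV[R]_(n + n)) : \det (NM k q) != 0 -> \det (NM j q) != 0 ->
  t *m T *m invmx (NM j q) = t *m invmx (NM k q) *m T.
Proof.
move=> dk dj; have uk := det_unitmx dk.
have uj := det_unitmx dj.
exact: coef_conj TT NM_change uk uj.
Qed.

End ChartChange.

(* The coefficients are built so that A = aa + Sy bb is the preimage under the
   derivative of the spray of the Cauchy-Riemann defect. *)
Lemma spray_cr (J' : complex_structure M) q (Sy : 'I_(m + m) -> R) k :
  (forall j, WW j q) -> th k (zeta q) != 0 -> t0 <= Theta (zeta q) ->
  forall l, pd (ix m) (Fc k l) q + \sum_p - (jrow Sy p + aa J' p q + \sum_p' Sy p' * bb J' p' p q) * pd (iS p) (Fc k l) q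
   + \sum_l' (pd (iy m) (Fc k l') q + \sum_p Sy p * pd (iS p) (Fc k l') q) * JJ J' k q l' l = 0.
Proof.
move=> Wq thk tT l.
have Dj j : th j (zeta q) != 0 -> DD j q.
  by move=> h; case: (Wq j) => // /thL e; rewrite e eqxx in h.
have [[W1q [W0q kq]] dk] := Dj k thk.
pose t c := tau0 J' c q + \sum_p Sy p *: tauS J' c p q.
pose A j := th j (zeta q) *: (t j *m invmx (NM j q)).
have AE j i : aa J' (sidx j i) q + \sum_p' Sy p' * bb J' p' (sidx j i) q = A j 0 i.
  rewrite /aa packS_sidx /A [RHS]mxE /t mulmxDl [X in _ = _ * X]mxE mulrDr; congr (_ + _).
  rewrite mulmx_suml summxE mulr_sumr; apply: eq_bigr => p _.
  by rewrite /bb packS_sidx -scalemxAl [X in _ = _ * X]mxE mulrCA.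
have key : \sum_j A j *m SM k j q = t k.
  have e j : A j *m SM k j q = t k *m invmx (NM k q) *m (th j (zeta q) *: (TM k j q *m SM k j q)).
    rewrite /A -[LHS]scalemxAl -[RHS]scalemxAr.
    have [/eqP th0|thn] := boolP (th j (zeta q) == 0); first by rewrite th0 !scale0r.
    congr (_ *: _); have [[_ [_ jq]] dj] := Dj j thn.
    have -> : t j = t k *m TM k j q.
      rewrite /t mulmxDl (tau0_change J' W0q kq jq) mulmx_suml; congr (_ + _).
      by apply: eq_bigr => p _; rewrite (tauS_change J' W0q kq jq) -scalemxAl.
    by rewrite (coef_change W0q kq jq W1q _ dk dj) !mulmxA.
  rewrite (eq_bigr _ (fun j _ => e j)) -mulmx_sumr.
  (* Here Theta >= t0 removes the cut-off term of [NM]. *)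
  have -> : \sum_j th j (zeta q) *: (TM k j q *m SM k j q) = NM k q.
    by rewrite /NM pospow_eq0 ?scale0r ?addr0 // subr_le0.
  rewrite mulmxKV //; exact: det_unitmx.
have tl : t k 0 l = \sum_j \sum_i A j 0 i * pd (iS (sidx j i)) (Fc k l) q.
  rewrite -key summxE; apply: eq_bigr => j _; rewrite [LHS]mxE.
  by apply: eq_bigr => i _; rewrite [X in _ * X]mxE.
have s1 : \sum_p (aa J' p q + \sum_p' Sy p' * bb J' p' p q) * pd (iS p) (Fc k l) q = t k 0 l.
  rewrite sum_sidx tl; apply: eq_bigr => j _; apply: eq_bigr => i _.
  by rewrite AE.
have s2 : \sum_p jrow Sy p * pd (iS p) (Fc k l) q = \sum_p Sy p * jco (fun p => pd (iS p) (Fc k l) q) p.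
  rewrite !big_split_ord /= addrC; congr (_ + _); apply: eq_bigr => b _.
    by rewrite /jrow /jco split_rshift split_lshift.
  by rewrite /jrow /jco split_rshift split_lshift mulNr mulrN.
have s3 : t k 0 l = pd (ix m) (Fc k l) q + \sum_l' pd (iy m) (Fc k l') q * JJ J' k q l' l +
    \sum_p Sy p * (\sum_l' pd (iS p) (Fc k l') q * JJ J' k q l' l - jco (fun p => pd (iS p) (Fc k l) q) p).
  rewrite /t [LHS]mxE [X in X + _]mxE summxE; congr (_ + _); apply: eq_bigr => p _.
  by rewrite [LHS]mxE [X in _ * X]mxE.
under eq_bigr => p _ do rewrite mulNr -addrA mulrDl.
rewrite sumrN big_split /= s1 s2 s3.
under [X in _ + X]eq_bigr => l' _ do rewrite mulrDl mulr_suml.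
rewrite [X in _ + X]big_split /= [X in _ + (_ + X)]exchange_big /=.
under [X in _ - (_ + (_ + X))]eq_bigr => p _ do rewrite mulrBr mulr_sumr.
rewrite sumrB.
under [X in _ + (_ + X)]eq_bigr => p _ do (under eq_bigr => l' _ do rewrite -mulrA).
ring.
Qed.

Lemma z_row (z : 'rV[R]_(1 + 1)) : z = row_mx (z 0 i0)%:M (z 0 i1)%:M.
Proof. by apply/rowP; apply: ord2_case; rewrite ?row_mxEl ?row_mxEr mxE eqxx mulr1n. Qed.

Section Deform.
Variable F : set_system (complex_structure M).
Context {FF : Filter F}.
Hypothesis nulJ : forall c r i l, atlas c ->
  nul F r (chart_codom c) (fun J' x => sval J' c x i l - sval J c x i l).
Hypothesis hbox : forall z, Om z -> `|z 0 i0| <= 1 /\ 8^-1 <= z 0 i1 <= 1 - 8^-1.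

Definition WA : set 'rV[R]_K := [set q | forall j, WW j q].

Lemma open_WA : open WA.
Proof.
rewrite openE => q h.
have : \forall q' \near q, forall j, WW j q'; last by [].
apply: (filter_forall (nbhs_filter q)) => j.
by apply: open_nbhs_nbhs; split; [exact: open_WW|exact: h].
Qed.

Lemma away_WA q : ~ Om (zeta q) -> WA q.
Proof. by move=> nO j; left => Lz; apply: nO; exact: LOm Lz. Qed.

Lemma off_Om q : off_box q -> ~ Om (zeta q).
Proof.
have e0 : zeta q 0 i0 = q 0 (ix m) by exact: zetaE.
have e1 : zeta q 0 i1 = q 0 (iy m) by exact: zetaE.
move=> ob /hbox; rewrite e0 e1 => -[h1 /andP[h2 h3]].
by case: ob; rewrite ltNge ?h1 ?h2 ?h3.
Qed.

Lemma aa_fam p : (forall J', Cn 7 WA (aa J' p)) /\ nul F 7 WA (fun J' q => aa J' p q - aa J p q).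
Proof.
move: p; apply: sidx_case => k i; have [c u] := tau0_fam nulJ k i.
have sub : WA `<=` WW k by move=> q; apply.
have e J' : aa J' (sidx k i) = coef k (tau0 J' k) i by apply/funext => q; rewrite /aa packS_sidx.
split=> [J'|]; first by rewrite e; exact: Cn_sub sub (c J').
rewrite (_ : (fun J' q => _) = fun J' q => coef k (tau0 J' k) i q - coef k (tau0 J k) i q).
  exact: nul_sub sub u.
by apply/funext => J'; rewrite !e.
Qed.

Lemma bb_fam p p' : (forall J', Cn 7 WA (bb J' p p')) /\ nul F 7 WA (fun J' q => bb J' p p' q - bb J p p' q).
Proof.
move: p'; apply: sidx_case => k i; have [c u] := tauS_fam nulJ k p i.
have sub : WA `<=` WW k by move=> q; apply.
have e J' : bb J' p (sidx k i) = coef k (tauS J' k p) i by apply/funext => q; rewrite /bb packS_sidx.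
split=> [J'|]; first by rewrite e; exact: Cn_sub sub (c J').
rewrite (_ : (fun J' q => _) = fun J' q => coef k (tauS J' k p) i q - coef k (tauS J k p) i q).
  exact: nul_sub sub u.
by apply/funext => J'; rewrite !e.
Qed.

Lemma aa_van J' p : van (aa J' p).
Proof.
move=> q /off_Om nO; move: p; apply: sidx_case => k i; rewrite /aa packS_sidx.
by apply: coef_away => Lz; apply: nO; exact: LOm Lz.
Qed.

Lemma bb_van J' p p' : van (bb J' p p').
Proof.
move=> q /off_Om nO; move: p'; apply: sidx_case => k i; rewrite /bb packS_sidx.
by apply: coef_away => Lz; apply: nO; exact: LOm Lz.
Qed.

Definition box : set 'rV[R]_(1 + 1) := [set z | `|z 0 i0| <= 1 /\ 8^-1 <= z 0 i1 <= 1 - 8^-1].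
Let boxA (i : 'I_(1 + 1)) : set R := if i == i0 then [set` `[-1, 1]] else [set` `[8^-1, 1 - 8^-1]].

Lemma boxAP z : box z <-> forall a, boxA a (z 0 a).
Proof.
have i10 : (i1 == i0) = false by [].
split=> [[h1 h2]|h].
  by apply: ord2_case; rewrite /boxA ?eqxx ?i10 /= in_itv /= ?h2 // -ler_norml.
by split; [have := h i0|have := h i1]; rewrite /boxA ?eqxx ?i10 /= in_itv /= // -ler_norml.
Qed.

Lemma boxA_compact a : compact (boxA a).
Proof. by rewrite /boxA; case: ifP => _; exact: segment_compact. Qed.

Lemma box_compact : compact box.
Proof.
have -> : box = [set v | forall a, boxA a (v ord0 a)].
  by apply/seteqP; split=> z /boxAP.
exact: (rV_compact boxA_compact).
Qed.

Definition tubeC (rho : R) : set 'rV[R]_K := [set q | box (zeta q) /\ forall p, `|q 0 (iS p)| <= rho].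

Lemma tubeC_compact rho : compact (tubeC rho).
Proof.
pose A (j : 'I_K) : set R := match fintype.split j with inl a => boxA a | inr _ => [set` `[- rho, rho]] end.
have -> : tubeC rho = [set v | forall a, A a (v ord0 a)].
  apply/seteqP; split=> q.
    move=> [/boxAP h1 h2]; apply: ordD_case => j; rewrite /A ?split_lshift ?split_rshift.
      by have := h1 j; rewrite zetaE.
    by have := h2 j; rewrite ler_norml /= in_itv.
  move=> h; split.
    by apply/boxAP => j; have := h (lshift _ j); rewrite /A split_lshift zetaE.
  by move=> p; have := h (iS p); rewrite /A split_rshift /= in_itv /= -ler_norml.
apply: (@rV_compact R _ A) => j; rewrite /A; case: fintype.split => a; first exact: boxA_compact.
exact: segment_compact.
Qed.

(** The zero section over the compact box lies in the open set [WA], which gives a uniform radius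
    there; outside the box all cut-offs vanish. *)
Lemma tube : exists2 rho : R, 0 < rho & forall q, (forall p, `|q 0 (iS p)| <= rho) -> WA q.
Proof.
have /compact_near_coveringP nc := box_compact.
have h : \forall s \near (0 : 'rV[R]_(m + m)), box `<=` (fun z => WA (row_mx z s)).
  have := nc _ (nbhs (0 : 'rV[R]_(m + m))) (fun (w : 'rV[R]_(m + m)) z => WA (row_mx z w)) _.
  move=> /(_ _) H; apply: H => z bz.
  have w : WA (row_mx z 0) by move=> j; rewrite (z_row z); exact: WW_q0.
  have : nbhs (row_mx z 0 : 'rV[R]_K) WA by apply: open_nbhs_nbhs; split=> //; exact: open_WA.
  move=> /nbhs_normP[e e0 he].
  have N1 : \forall z' \near z, `|z' - z| < e by apply/nbhs_normP; exists e.
  have N2 : \forall w' \near (0 : 'rV[R]_(m + m)), `|w' - 0| < e by apply/nbhs_normP; exists e.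
  exists ([set z' | `|z' - z| < e], [set w : 'rV[R]_(m + m) | `|w - 0| < e]) => /=.
    by split; [exact: N1|exact: N2].
  move=> [z' s] [/= hz hs]; apply: he.
  apply: mx_norm_lt => // i; apply: ordD_case => j; rewrite opp_row_mx add_row_mx ?row_mxEl ?row_mxEr.
    exact: le_lt_trans (mx_entry_norm _ _ _) hz.
  exact: le_lt_trans (mx_entry_norm _ _ _) hs.
move: h => /nbhs_normP[d d0 hd]; exists (d / 2); first by rewrite divr_gt0.
move=> q hq; have [bz|nb] := pselect (box (zeta q)); last first.
  by apply: away_WA => /hbox.
rewrite -(hsubmxK q); apply: hd bz; rewrite subr0.
apply: (@le_lt_trans _ _ (d / 2)); last by move: (d0); lra.
apply: mx_norm_le => [|i p]; first by rewrite divr_ge0 // ltW.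
by rewrite mxE (ord1 i); exact: hq.
Qed.

Lemma coef_bounds rho : tubeC rho `<=` WA -> exists2 be, 0 < be &
  (forall p, \forall J' \near F, Cb 4 be (tubeC rho) (aa J' p)) /\
  (forall p p', \forall J' \near F, Cb 3 be (tubeC rho) (bb J' p p')).
Proof.
move=> CW; have oA : open WA by exact: open_WA.
have cC := @tubeC_compact rho.
have [b1 b10 h1] : exists2 b, 0 < b & forall p, \forall J' \near F, Cb 4 b (tubeC rho) (aa J' p).
  apply: fin_bound => [p b b' h bb'|p]; first by apply: filterS h => J'; exact: Cb_le.
  have [c u] := aa_fam p.
  have [b b0 hb] := nul_bound (F := F) oA cC CW (Cn_le (isT : (4 <= 7)%N) (c J)).
  exists b => //; apply: (hb (fun J' => aa J' p)) => [J'|]; first exact: Cn_le (c J').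
  exact: nul_le u.
have [b2 b20 h2] : exists2 b, 0 < b & forall pp : 'I_(m + m) * 'I_(m + m),
    \forall J' \near F, Cb 3 b (tubeC rho) (bb J' pp.1 pp.2).
  apply: fin_bound => [p b b' h bb'|p]; first by apply: filterS h => J'; exact: Cb_le.
  have [c u] := bb_fam p.1 p.2.
  have [b b0 hb] := nul_bound (F := F) oA cC CW (Cn_le (isT : (3 <= 7)%N) (c J)).
  exists b => //; apply: (hb (fun J' => bb J' p.1 p.2)) => [J'|]; first exact: Cn_le (c J').
  exact: nul_le u.
exists (b1 + b2); first by rewrite addr_gt0.
split=> [p|p p']; [apply: filterS (h1 p)|apply: filterS (h2 (p, p'))] => J'; apply: Cb_le.
  by rewrite lerDl ltW.
by rewrite lerDr ltW.
Qed.

Lemma active z : t0 <= Theta z -> exists k, th k z != 0.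
Proof.
move=> tT; apply: contrapT => h.
have T0 : Theta z = 0.
  rewrite /Theta big1 // => k _; apply/eqP; rewrite sqrf_eq0; apply/negPn/negP => tk.
  by apply: h; exists k.
by move: tT; rewrite T0 leNgt t00.
Qed.

(** With a single nonzero block the spray is one move, so the parameter that reaches p is
    explicit. *)
Lemma Phi_target k x y (p : M) (z := row_mx x%:M y%:M : 'rV[R]_(1 + 1)) :
  th k z != 0 -> chart_dom (ch k) p ->
  Phi (pt x y (\row_l packS (fun j i => if j == k then (coord (ch k) p - coord (ch k) (g z)) 0 i / th k z else 0) l)) = p.
Proof.
move=> tz kp; have [Oz kz] := th_dom tz.
rewrite /Phi (@spr_one _ _ k) ?enum_uniq ?mem_enum //; last first.
  move=> j jk; apply/rowP => i; rewrite [LHS]mxE pt_s mxE packS_sidx (negbTE jk).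
  by rewrite mxE.
rewrite cstep_move /= zeta_pt //.
have -> : vv k (pt x y (\row_l packS (fun j i => if j == k then (coord (ch k) p - coord (ch k) (g z)) 0 i / th k z else 0) l))
   = coord (ch k) p - coord (ch k) (g z).
  apply/rowP => i; rewrite /vv zeta_pt -/z [LHS]mxE [X in _ * X]mxE pt_s [X in _ * X]mxE packS_sidx eqxx.
  by rewrite mulrC divfK.
by rewrite addrC subrK coordK.
Qed.

Lemma nbhs_target k z e : chart_dom (ch k) (g z) -> 0 < e ->
  nbhs (g z) [set x : M | chart_dom (ch k) x /\ forall i, `|(coord (ch k) x - coord (ch k) (g z)) 0 i| < e].
Proof.
move=> kz e0; apply: filterI.
  by apply: open_nbhs_nbhs; split=> //; exact: chart_open.
have /cvgrPdist_lt/(_ _ e0) := coord_cont (ach k) kz.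
apply: filterS => p hp i; apply: le_lt_trans (mx_entry_norm _ _ _) _.
by rewrite distrC.
Qed.

Section Solution.
Variables (J' : complex_structure M) (rho : R) (O : set 'rV[R]_(1 + 1)).
Variables S Sy : 'I_(m + m) -> R -> R -> R.
Hypothesis tb : forall q, (forall p, `|q 0 (iS p)| <= rho) -> WA q.
Hypothesis oO : open O.
Hypothesis hT : forall z, O z -> t0 <= Theta z.
Hypothesis cS : forall l : 'I_(m + m), continuous (fun p : R * R => S l p.1 p.2) /\ continuous (fun p : R * R => Sy l p.1 p.2).
Hypothesis dSy : forall (l : 'I_(m + m)) (x y : R), is_derive y 1 (S l x) (Sy l x y).
Hypothesis dSx : forall (l : 'I_(m + m)) (x y : R), 0 < y < 1 -> is_derive x 1 (fun x => S l x y)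
    (- (jrow (fun a => Sy a x y) l + aa J' l (pt x y (\row_a S a x y)) +
        \sum_a Sy a x y * bb J' a l (pt x y (\row_a S a x y)))).
Hypothesis Srho : forall (l : 'I_(m + m)) (x y : R), `|x| <= 1 -> `|S l x y| < rho.

Definition lift (z : 'rV[R]_(1 + 1)) : 'rV[R]_K := pt (z 0 i0) (z 0 i1) (\row_p S p (z 0 i0) (z 0 i1)).
Let Ss p (z : 'rV[R]_(1 + 1)) : R := S p (z 0 i0) (z 0 i1).
Let SY p (z : 'rV[R]_(1 + 1)) : R := Sy p (z 0 i0) (z 0 i1).
Let SX p (z : 'rV[R]_(1 + 1)) : R :=
  - (jrow (fun a => SY a z) p + aa J' p (lift z) + \sum_a SY a z * bb J' a p (lift z)).

Lemma O_Om z : O z -> Om z.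
Proof.
move=> /hT/active[k]; rewrite (z_row z) => tk.
by have [] := th_dom tk.
Qed.

Lemma zeta_lift z : zeta (lift z) = z.
Proof. by rewrite /lift zeta_pt -z_row. Qed.

Lemma WA_lift z : O z -> WA (lift z).
Proof.
move=> /O_Om/hbox[h _]; apply: tb => p; rewrite pt_s mxE; apply: ltW; exact: Srho.
Qed.

Lemma cont_pair (f : R -> R -> R) : continuous (fun p : R * R => f p.1 p.2) ->
  Cn 0 O (fun z => f (z 0 i0) (z 0 i1)).
Proof.
move=> cf z _.
apply: (@continuous_comp _ _ _ (fun z : 'rV[R]_(1 + 1) => (z 0 i0, z 0 i1)) (fun p : R * R => f p.1 p.2)); last exact: cf.
have c0 : {for z, continuous (fun z : 'rV[R]_(1 + 1) => z 0 i0)} by exact: coord_continuous.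
have c1 : {for z, continuous (fun z : 'rV[R]_(1 + 1) => z 0 i1)} by exact: coord_continuous.
exact: cvg_pair c0 c1.
Qed.

Lemma lift_coord (P : ('rV[R]_(1 + 1) -> R) -> Prop) : P (fun z => z 0 i0) -> P (fun z => z 0 i1) ->
  (forall p, P (Ss p)) -> forall a, P (fun z => lift z 0 a).
Proof.
move=> h0 h1 h2; apply: idx_case => [||l].
- have -> : (fun z => lift z 0 (ix m)) = fun z : 'rV[R]_(1 + 1) => z 0 i0 by apply/funext => z; rewrite pt_x.
  by [].
- have -> : (fun z => lift z 0 (iy m)) = fun z : 'rV[R]_(1 + 1) => z 0 i1 by apply/funext => z; rewrite pt_y.
  by [].
- have -> : (fun z => lift z 0 (iS l)) = Ss l by apply/funext => z; rewrite pt_s mxE.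
  exact: h2.
Qed.

Lemma Cn0_SX p : Cn 0 O (SX p).
Proof.
have cY a : Cn 0 O (SY a) by apply: cont_pair; exact: (cS a).2.
have cl a : Cn 0 O (fun z => lift z 0 a).
  move: a; apply: lift_coord => [||l]; [exact: Cn_coord|exact: Cn_coord|].
  by apply: cont_pair; exact: (cS l).1.
have ca (l : 'I_(m + m)) : Cn 0 O (fun z => aa J' l (lift z)).
  apply: (Cn_comp oO WA_lift) => //; exact: Cn_le ((aa_fam l).1 J').
have cb (a l : 'I_(m + m)) : Cn 0 O (fun z => bb J' a l (lift z)).
  apply: (Cn_comp oO WA_lift) => //; exact: Cn_le ((bb_fam a l).1 J').
apply: Cn_opp => //; apply: Cn_add => //; first apply: Cn_add => //.
  rewrite /jrow; case: fintype.split => i //.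
  by apply: Cn_opp.
by apply: Cn_sum => // j _; exact: Cn_mul.
Qed.

Lemma deriv_S0 p z : O z -> is_derive z (delta_mx 0 i0) (Ss p) (SX p z).
Proof.
move=> Oz; have [_ h] := hbox (O_Om Oz).
apply: (@is_derive_line_eq R _ _ _ (fun x : R => S p x (z 0 i1)) _ _ (z 0 i0) (1 : R)); last first.
  by apply: dSx; move: h => /andP[h1 h2]; apply/andP; split; move: (h1) (h2); lra.
move=> h'; rewrite /Ss; congr (S p _ _).
  by rewrite [LHS]mxE [X in X + _]mxE [X in _ * X + _]mxE !eqxx.
by rewrite [LHS]mxE [X in X + _]mxE [X in _ * X + _]mxE eqxx mulr0 add0r.
Qed.

Lemma deriv_S1 p z : is_derive z (delta_mx 0 i1) (Ss p) (SY p z).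
Proof.
apply: (@is_derive_line_eq R _ _ _ (fun y : R => S p (z 0 i0) y) _ _ (z 0 i1) (1 : R)); last exact: dSy.
move=> h'; rewrite /Ss; congr (S p _ _).
  by rewrite [LHS]mxE [X in X + _]mxE [X in _ * X + _]mxE eqxx mulr0 add0r.
by rewrite [LHS]mxE [X in X + _]mxE [X in _ * X + _]mxE !eqxx.
Qed.

(** The derivative in x is continuous because the equation expresses it through S and S_y;
    continuous partial derivatives then give class C^1. *)
Lemma Cn1_S p : Cn 1 O (Ss p).
Proof.
have c a : Cn 0 O (pd a (Ss p)).
  move: a; apply: ord2_case.
    have e z : O z -> SX p z = pd i0 (Ss p) z.
      by move=> Oz; have h := deriv_S0 p Oz; rewrite /pd derive_val.
    by apply: (@Cn_ext R _ 0 O (SX p)); [exact: oO|exact: e|exact: Cn0_SX].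
  have cY : Cn 0 O (SY p) by apply: cont_pair; exact: (cS p).2.
  have e z : O z -> SY p z = pd i1 (Ss p) z.
    by move=> Oz; have h := deriv_S1 p z; rewrite /pd derive_val.
  exact: (@Cn_ext R _ 0 O _ _ oO e cY).
split=> //; apply: (differentiable_partials oO) => [z Oz|j z Oz]; last exact: c.
apply: ord2_case; [have h := deriv_S0 p Oz|have h := deriv_S1 p z]; exact: ex_derive.
Qed.

Lemma Cn1_lift a : Cn 1 O (fun z => lift z 0 a).
Proof. by move: a; apply: lift_coord; [exact: Cn_coord|exact: Cn_coord|exact: Cn1_S]. Qed.

Lemma W0_lift z k : O z -> th k z != 0 -> DD k (lift z).
Proof.
move=> Oz tk; case: (WA_lift Oz k) => //; rewrite /away /= zeta_lift => /thL e.
by rewrite e eqxx in tk.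
Qed.

Lemma solution_CnM : CnM 1 O (Phi \o lift).
Proof.
apply: (CnM_comp oO open_W0 (CnM_le (isT : (1 <= 8)%N) CnM_Phi)) => [z Oz|]; last exact: Cn1_lift.
have [k tk] := active (hT Oz).
by have [[_ [W0q _]] _] := W0_lift Oz tk.
Qed.

(** In a chart whose cut-off is nonzero at z the defect u_x + u_y J' vanishes by [spray_cr];
    multiplying by J' gives u_y = u_x J'. *)
Lemma solution_cr z : O z -> exists2 c, atlas c /\ chart_dom c ((Phi \o lift) z) & crat J' (Phi \o lift) c z.
Proof.
move=> Oz; have [k tk] := active (hT Oz); have [[W1q Vq] dq] := W0_lift Oz tk.
have [_ kq] := Vq; exists (ch k); first by split=> //; exact: ach.
pose q := lift z.
pose Jm : 'M[R]_(n + n) := JJ J' k q.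
have pdE a l : pd a (fun y => Fc k l (lift y)) z = \sum_b pd b (Fc k l) q * pd a (fun y => lift y 0 b) z.
  apply: pd_comp; first by have [d _] := @Cn_Fc k l; exact: d.
  by move=> b; have [d _] := Cn1_lift b; exact: d.
have vx a : pd a (fun y => lift y 0 (ix m)) z = pd a (fun y : 'rV[R]_(1 + 1) => y 0 i0) z.
  by congr (pd a _ z); apply/funext => y; rewrite pt_x.
have vy a : pd a (fun y => lift y 0 (iy m)) z = pd a (fun y : 'rV[R]_(1 + 1) => y 0 i1) z.
  by congr (pd a _ z); apply/funext => y; rewrite pt_y.
have vs a p : pd a (fun y => lift y 0 (iS p)) z = pd a (Ss p) z.
  by congr (pd a _ z); apply/funext => y; rewrite pt_s mxE.
have X l : pd i0 (fun y => Fc k l (lift y)) z = pd (ix m) (Fc k l) q + \sum_p SX p z * pd (iS p) (Fc k l) q.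
  rewrite pdE sum_idx vx vy !pd_coord /= mulr1 mulr0 addr0; congr (_ + _).
  apply: eq_bigr => p _; rewrite vs mulrC; congr (_ * _).
  by have h := deriv_S0 p Oz; rewrite /pd derive_val.
have Y l : pd i1 (fun y => Fc k l (lift y)) z = pd (iy m) (Fc k l) q + \sum_p SY p z * pd (iS p) (Fc k l) q.
  rewrite pdE sum_idx vx vy !pd_coord /= mulr1 mulr0 add0r; congr (_ + _).
  apply: eq_bigr => p _; rewrite vs mulrC; congr (_ * _).
  by have h := deriv_S1 p z; rewrite /pd derive_val.
pose XR : 'rV[R]_(n + n) := \row_l pd i0 (fun y => Fc k l (lift y)) z.
pose YR : 'rV[R]_(n + n) := \row_l pd i1 (fun y => Fc k l (lift y)) z.
have e : XR + YR *m Jm = 0.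
  apply/rowP => l; rewrite [LHS]mxE [X in X + _]mxE [X in _ + X]mxE [RHS]mxE X.
  have tz : th k (zeta q) != 0 by rewrite zeta_lift.
  have tT : t0 <= Theta (zeta q) by rewrite zeta_lift; exact: hT.
  rewrite -[RHS](@spray_cr J' q (fun p => SY p z) k (WA_lift Oz) tz tT l); congr (_ + _).
  by apply: eq_bigr => l' _; rewrite [X in X * _]mxE Y.
have sq : Jm *m Jm = - 1%:M := cs_square (svalP J') (ach k) (coord_codom kq).
have e' : YR = XR *m Jm.
  have -> : XR = - (YR *m Jm) by apply/eqP; rewrite -addr_eq0 e.
  by rewrite mulNmx -mulmxA sq mulmxN mulmx1 opprK.
move=> l; have := congr1 (fun A : 'rV[R]_(n + n) => A 0 l) e'; rewrite [in LHS]mxE [in RHS]mxE => el.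
rewrite [LHS]el; apply: eq_bigr => l' _; by rewrite [X in X * _]mxE.
Qed.

End Solution.

(** The radius rho and the bound be are found first, then del by [pde_solution]. For J' near J the
    coefficients are del-small on the zero section, and for p and q near the original ends the
    parameters of [Phi_target] are at most del; these become the prescribed values of S at the two
    points. *)
Lemma deform O y1 y2 : open O -> (forall z, O z -> t0 <= Theta z) ->
  0 < y1 < 1 -> 0 < y2 < 1 -> y1 != y2 ->
  O (row_mx 0%:M y1%:M) -> O (row_mx 0%:M y2%:M) ->
  exists A B : set M, [/\ nbhs (g (row_mx 0%:M y1%:M)) A, nbhs (g (row_mx 0%:M y2%:M)) B &
   \forall J' \near F, forall p q : M, A p -> B q -> exists u : 'rV[R]_(1 + 1) -> M,
     [/\ CnM 1 O u, forall z, O z -> exists2 c, atlas c /\ chart_dom c (u z) & crat J' u c z,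
       u (row_mx 0%:M y1%:M) = p & u (row_mx 0%:M y2%:M) = q]].
Proof.
move=> oO hT y1I y2I y12 O1 O2.
have [rho r0 tb] := tube.
have CW : tubeC rho `<=` WA by move=> q [_ h]; exact: tb.
have oA : open WA by exact: open_WA.
have [be be0 [h1 h2]] := coef_bounds CW.
have [del d0 pde] := @pde_solution R m be rho y1 y2 (ltW be0) r0 y1I y2I y12.
have [k1 tk1] := active (hT _ O1); have [k2 tk2] := active (hT _ O2).
have [_ kz1] := th_dom tk1; have [_ kz2] := th_dom tk2.
set e1 := row_mx 0%:M y1%:M in O1 tk1 kz1 *; set e2 := row_mx 0%:M y2%:M in O2 tk2 kz2 *.
have n1 : 0 < `|th k1 e1| by rewrite normr_gt0.
have n2 : 0 < `|th k2 e2| by rewrite normr_gt0.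
exists [set x : M | chart_dom (ch k1) x /\ forall i, `|(coord (ch k1) x - coord (ch k1) (g e1)) 0 i| < del * `|th k1 e1|].
exists [set x : M | chart_dom (ch k2) x /\ forall i, `|(coord (ch k2) x - coord (ch k2) (g e2)) 0 i| < del * `|th k2 e2|].
split; [by apply: nbhs_target => //; rewrite mulr_gt0|by apply: nbhs_target => //; rewrite mulr_gt0|].
pose U : set 'rV[R]_K := [set q | off_box q \/ forall p, `|q 0 (iS p)| < rho].
have UW : U `<=` WA.
  by move=> q [/off_Om|h]; [exact: away_WA|apply: tb => p; exact: ltW].
have UC q : U q -> off_box q \/ tubeC rho q.
  move=> [ob|h]; [by left|]; have [bz|nb] := pselect (box (zeta q)).
    by right; split=> // p; exact: ltW.
  left; apply: contrapT => nob; apply: nb.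
  have e0 : zeta q 0 i0 = q 0 (ix m) by exact: zetaE.
  have e1' : zeta q 0 i1 = q 0 (iy m) by exact: zetaE.
  rewrite /box /= e0 e1'; split; first by rewrite leNgt; apply/negP => hh; apply: nob; apply: Or31.
  by rewrite !leNgt; apply/andP; split; apply/negP => hh; apply: nob; [apply: Or32|apply: Or33].
have C0 x y : ~ @off_box R m (pt x y 0) -> tubeC rho (pt x y 0).
  move=> nob; have [] // := UC (pt x y 0) _; right => p.
  by rewrite pt_s mxE normr0.
have ga : \forall J' \near F, forall p, good U 4 be (aa J' p).
  apply: (filter_forall FF) => p; apply: filterS (h1 p) => J' hb; split; last exact: aa_van.
  apply: (Cb_van (ltW be0) UW UC) => //; last exact: aa_van.
  exact: Cn_le ((aa_fam p).1 J').
have gb : \forall J' \near F, forall p p', good U 3 be (bb J' p p').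
  apply: (filter_forall FF) => p; apply: (filter_forall FF) => p'; apply: filterS (h2 p p') => J' hb.
  split; last exact: bb_van.
  apply: (Cb_van (ltW be0) UW UC) => //; last exact: bb_van.
  exact: Cn_le ((bb_fam p p').1 J').
have cC := @tubeC_compact rho.
have za : \forall J' \near F, forall p, atzero del (aa J' p) /\ atzero del (pd (iy m) (aa J' p)).
  apply: (filter_forall FF) => p; have [c u] := aa_fam p; apply: filterI.
    apply: (nul_atzero oA cC CW C0 (Cn_le (isT : (2 <= 7)%N) (c J)) (fun x y => aa_zero x y p)) => //.
    - by move=> J'; exact: aa_van.
    - exact: nul_le u.
    - by move=> J'; exact: Cn_le (c J').
  apply: (nul_atzero oA cC CW C0 (Cn_le (isT : (2 <= 6)%N) (Cn_pd (iy m) (c J)))) => //.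
  - by apply: pd_iy_zero => x y; exact: aa_zero.
  - by move=> J'; apply: van_pd; exact: aa_van.
  - have u' := nul_pd (iy m) u; apply: nul_le (isT : (2 <= 6)%N) _.
    apply: (nul_ext oA _ u') => J' q Wq.
    by rewrite /pd deriveB //; [have [d _] := c J'|have [d _] := c J]; exact: diff_derivable (d _ Wq).
  - by move=> J'; exact: Cn_le (Cn_pd (iy m) (c J')).
have zb : \forall J' \near F, forall p p', atzero del (bb J' p p').
  apply: (filter_forall FF) => p; apply: (filter_forall FF) => p'; have [c u] := bb_fam p p'.
  apply: (nul_atzero oA cC CW C0 (Cn_le (isT : (2 <= 7)%N) (c J)) (fun x y => bb_zero x y p p')) => //.
  - by move=> J'; exact: bb_van.
  - exact: nul_le u.
  - by move=> J'; exact: Cn_le (c J').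
apply: filterS (filterI (filterI ga gb) (filterI za zb)) => J' [[gaJ gbJ] [zaJ zbJ]] p q [kp hp] [kq hq].
pose t1 := packS (fun j i => if j == k1 then (coord (ch k1) p - coord (ch k1) (g e1)) 0 i / th k1 e1 else 0).
pose t2 := packS (fun j i => if j == k2 then (coord (ch k2) q - coord (ch k2) (g e2)) 0 i / th k2 e2 else 0).
have ht (l : 'I_(m + m)) : `|t1 l| <= del /\ `|t2 l| <= del.
  move: l; apply: sidx_case => k i; rewrite /t1 /t2 !packS_sidx; split; case: ifP => _.
  - by rewrite normrM normfV ler_pdivrMr // ltW.
  - by rewrite normr0 ltW.
  - by rewrite normrM normfV ler_pdivrMr // ltW.
  - by rewrite normr0 ltW.
have Uoff : @off_box R m `<=` U by move=> x; left.
have Urho (x : 'rV[R]_K) : (forall l : 'I_(m + m), `|x 0 (iS l)| < rho) -> U x by right.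
have [S [Sy [cS dSy dSx Srho ends]]] := pde U (aa J') (bb J') t1 t2 Uoff Urho gaJ gbJ zaJ zbJ ht.
exists (Phi \o lift S); split.
- exact: (solution_CnM tb oO hT cS dSy dSx Srho).
- exact: (solution_cr tb oO hT cS dSy dSx Srho).
- rewrite /= /lift /e1 row_mxEl row_mxEr !mxE !eqxx !mulr1n.
  by rewrite -[RHS](Phi_target tk1 kp); congr (Phi (pt _ _ _)); apply/rowP => l; rewrite !mxE (ends l).1.
- rewrite /= /lift /e2 row_mxEl row_mxEr !mxE !eqxx !mulr1n.
  by rewrite -[RHS](Phi_target tk2 kq); congr (Phi (pt _ _ _)); apply/rowP => l; rewrite !mxE (ends l).2.
Qed.

End Deform.
End Spray.

(** * Invariance under biholomorphisms *)

Lemma conj_inv (R : comUnitRingType) a (A B G F : 'M[R]_a) :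
  G *m F = 1%:M -> B *m F = F *m A -> A *m G = G *m B.
Proof.
move=> GF e; have FG := mulmx1C GF.
by rewrite -[LHS]mul1mx -GF !mulmxA -(mulmxA G F A) -e mulmxA -(mulmxA (G *m B)) FG mulmx1.
Qed.

Section Invariance.
Variables (R : realType) (n : nat) (M : manifold R n).
Implicit Types (J : complex_structure M).

Lemma rep_dom_map_open (h : M -> M) c c' : smooth_map h -> atlas c -> atlas c' -> open (rep_dom c h c').
Proof.
move=> [ch _] ac ac'.
have -> : rep_dom c h c' = chart_codom c `&` (fun x => h (param c x)) @^-1` chart_dom c'.
  apply/seteqP; split=> x.
    by move=> [p [cp cp'] <-]; split; [exists p|rewrite /= coordK].
  by move=> [[p cp <-]]; rewrite /= coordK // => cp'; exists p.
apply: open_preimage_on; [exact: codom_open|exact: chart_open|].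
move=> x cx; apply: (@continuous_comp _ _ _ (param c) h); first exact: param_cont.
exact: ch.
Qed.

Lemma rep_map_Cn (h : M -> M) c c' k j : smooth_map h -> atlas c -> atlas c' ->
  Cn k (rep_dom c h c') (fun x => rep c h c' x 0 j).
Proof.
move=> sh ac ac'; have oh := rep_dom_map_open sh ac ac'.
by have := sh.2 c c' ac ac'; move=> /(smooth_on_entries _ oh); apply.
Qed.

Lemma holomorphic_disk_map J J' (h : M -> M) f : smooth_map h -> intertwines h (sval J) (sval J') ->
  holomorphic_disk J f -> holomorphic_disk J' (h \o f).
Proof.
move=> sh ih hf; have oD := @open_unit_disk R; have cf := holomorphic_disk_CnM 1 hf.
have loc z : unit_disk R z -> exists c c', [/\ atlas c, atlas c', chart_dom c (f z) & rep_dom c h c' (coord c (f z))].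
  move=> Dz; have [c ac cz] := atlas_cover (f z); have [c' ac' cz'] := atlas_cover (h (f z)).
  by exists c, c'; split=> //; exists (f z).
apply: holomorphic_diskP.
  apply: CnM_local => // z Dz; have [c [c' [ac ac' cz xd]]] := loc z Dz.
  have oF := CnM_open oD cf ac; have oT := rep_dom_map_open sh ac ac'.
  pose V := (unit_disk R `&` f @^-1` chart_dom c) `&` (fun z => coord c (f z)) @^-1` rep_dom c h c'.
  have oV : open V.
    apply: open_preimage_on => // q Fq; apply: rV_cont => i.
    exact: Cn_continuous (cf.2 c ac i) _ Fq.
  exists V, c'; split=> //.
    by move=> q [[_ cq] [p [cp cp'] e]]; rewrite /= -(coordK ac cq) -e coordK.
  move=> i; apply: (Cn_ext oV (f := fun z => rep c h c' (coord c (f z)) 0 i)).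
    by move=> q [[_ cq] _]; rewrite /rep coordK.
  apply: (Cn_comp oV _ (rep_map_Cn 1 i sh ac ac')); first by move=> q [].
  by move=> j; apply: Cn_sub (cf.2 c ac j) => q [].
move=> z Dz; have [c [c' [ac ac' cz xd]]] := loc z Dz.
have e : chart_dom c' (h (f z)).
  by move: xd => [p [cp cp'] e]; rewrite -(coordK ac cz) -e coordK.
exists c' => //.
apply: (@crat_map R n M J J' h _ f c c' z oD cf Dz ac cz (rep_dom_map_open sh ac ac') _ xd (ih c c' ac ac' _ xd)).
  by move=> j; exact: rep_map_Cn.
exact: (holomorphic_disk_crat hf ac Dz cz).
Qed.

Lemma short_map J J' e (h k : M -> M) : smooth_map h -> cancel k h -> intertwines h (sval J) (sval J') ->
  short e J -> short e J'.
Proof.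
move=> sh kh ih sJ p q; have [t te c] := sJ (k p) (k q); exists t => //.
rewrite -(kh p) -(kh q); elim: c => [x|f z w s y hf hz hw _ IH]; first exact: chain_nil.
by apply: (@chain_cons R n M J' (h \o f)) => //; exact: holomorphic_disk_map ih hf.
Qed.

Lemma intertwines_inv (I I' : chart_field M) (f g : M -> M) : smooth_map f -> smooth_map g ->
  cancel f g -> cancel g f -> intertwines f I I' -> intertwines g I' I.
Proof.
move=> sf sg fg gf h c c' ac ac' x xd.
have [p [cp cp'] ex] := xd; pose x' := coord c' (g p).
have xE : rep c g c' x = x' by rewrite /rep -ex coordK.
have xd' : rep_dom c' f c x' by exists (g p) => //; split=> //; rewrite /= gf.
have x'E : rep c' f c x' = x by rewrite /rep /x' coordK // gf.
have dg j : differentiable (fun y => rep c g c' y 0 j) x.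
  by have [t _] := rep_map_Cn 1 j sg ac ac'; exact: t.
have df j : differentiable (fun y => rep c' f c y 0 j) x'.
  by have [t _] := rep_map_Cn 1 j sf ac' ac; exact: t.
have GF : 'J (rep c g c') x *m 'J (rep c' f c) x' = 1%:M.
  rewrite -xE -jac_comp ?xE // -(jac_id x); apply: jac_near; last first.
    by move=> j; exact: differentiable_coord.
  have : nbhs x (rep_dom c g c').
    by apply: open_nbhs_nbhs; split=> //; exact: rep_dom_map_open.
  by apply: filterS => y [r [cr cr'] <-]; rewrite /rep /= (coordK ac cr) coordK // gf.
have e := h c' c ac' ac x' xd'; rewrite x'E in e; rewrite xE.
exact: conj_inv GF e.
Qed.

End Invariance.

From mathcomp Require Import finmap.

(** * Disks for nearby complex structures *)

Section Nearby.
Variables (R : realType) (n : nat) (M : manifold R n) (J : complex_structure M).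
Notation i0 := (lshift 1 (0 : 'I_1) : 'I_(1 + 1)).
Notation i1 := (rshift 1 (0 : 'I_1) : 'I_(1 + 1)).

Lemma subbase_open (U : set (complex_structure M)) : complex_structure_subbase U -> open U.
Proof.
move=> sU; exists [set U]; last by rewrite bigcup_set1.
move=> _ ->; exists [fset U]%fset; last by rewrite set_fset1 bigcap_set1.
by move=> V /fset1P ->; exact: mem_set.
Qed.

(** The subbasic neighbourhoods of J give uniform smallness on compact sets of each iterated partial
    derivative of J' - J. *)
Lemma nul_structure c r i l : atlas c ->
  nul (nbhs J) r (chart_codom c) (fun J' x => sval J' c x i l - sval J c x i l).
Proof.
move=> ac; have oW : open (chart_codom c) by exact: codom_open.
have sm (J' : complex_structure M) : smooth_on (chart_codom c) (sval J' c) := cs_smooth (svalP J') ac.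
pose D s (J' : complex_structure M) := iter_partial s (fun x => sval J' c x i l).
have cD s J' k : Cn k (chart_codom c) (D s J').
  elim: s k => [|a s IH] k; first exact: (smooth_on_entries _ oW).1 (sm J') i l k.
  exact: Cn_pd a (IH k.+1).
have uD s : unif0 (nbhs J) (chart_codom c) (fun J' x => D s J' x - D s J x).
  move=> K e cK KW e0.
  pose V := [set J' : complex_structure M | forall x, K x ->
    `|iter_partial s (sval J' c) x - iter_partial s (sval J c) x| < e].
  have oV : open V by apply: subbase_open; exists J, c, K, s, e; split.
  have VJ : V J by move=> x _; rewrite subrr normr0.
  have nV : nbhs J V by apply: open_nbhs_nbhs; split.
  apply: filterS nV => J' h x Kx.
  have E J1 : D s J1 x = iter_partial s (sval J1 c) x i l.
    exact: esym (iter_partial_entry s i l oW (sm J1) (KW x Kx)).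
  rewrite !E; apply: ltW; apply: le_lt_trans (h x Kx).
  have := mx_entry_norm (iter_partial s (sval J' c) x - iter_partial s (sval J c) x) i l.
  by rewrite [X in `|X| <= _]mxE [X in `|_ + X| <= _]mxE.
have gen k s : nul (nbhs J) k (chart_codom c) (fun J' x => D s J' x - D s J x).
  have cB J' k' : Cn k' (chart_codom c) (fun x => D s J' x - D s J x).
    exact: Cn_sub2 oW (cD s J' k') (cD s J k').
  elim: k s cB => [|k IH] s cB; first by split; [move=> J'; exact: cB|exact: uD|].
  split; [by move=> J'; exact: cB|exact: uD|move=> a].
  have cB' J' k' : Cn k' (chart_codom c) (fun x => D (a :: s) J' x - D (a :: s) J x).
    exact: Cn_sub2 oW (cD (a :: s) J' k') (cD (a :: s) J k').
  apply: (nul_ext oW _ (IH (a :: s) cB')) => J' x Wx.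
  rewrite /pd deriveB //; [have [d _] := cD s J' 1%N|have [d _] := cD s J 1%N]; exact: diff_derivable (d _ Wx).
exact: (gen r [::]).
Qed.

(** The complex affine map of slope a0 + i a1 and constant term b0 + i b1. *)
Definition caff (a0 a1 b0 b1 : R) (z : 'rV[R]_(1 + 1)) : 'rV[R]_(1 + 1) :=
  row_mx (b0 + (a0 * z 0 i0 + - a1 * z 0 i1))%:M (b1 + (a1 * z 0 i0 + a0 * z 0 i1))%:M.

Lemma caff0 a0 a1 b0 b1 z : caff a0 a1 b0 b1 z 0 i0 = b0 + (a0 * z 0 i0 + - a1 * z 0 i1).
Proof. by rewrite /caff row_mxEl mxE eqxx mulr1n. Qed.

Lemma caff1 a0 a1 b0 b1 z : caff a0 a1 b0 b1 z 0 i1 = b1 + (a1 * z 0 i0 + a0 * z 0 i1).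
Proof. by rewrite /caff row_mxEr mxE eqxx mulr1n. Qed.

Lemma pd_lin (b p q : R) a z :
  pd a (fun z : 'rV[R]_(1 + 1) => b + (p * z 0 i0 + q * z 0 i1)) z = p * (a == i0)%:R + q * (a == i1)%:R.
Proof.
pose c (i : 'I_(1 + 1)) := fun z : 'rV[R]_(1 + 1) => z 0 i.
have dc i : derivable (c i) z (delta_mx 0 a).
  apply: diff_derivable; have [d _] := @Cn_coord R _ 1 setT i; exact: d.
have e i : 'D_(delta_mx 0 a) (c i) z = (a == i)%:R := pd_coord a i z.
rewrite /pd (_ : (fun z => _) = cst b + (p *: c i0 + q *: c i1)) //.
have dz (t : R) i : derivable (t *: c i) z (delta_mx 0 a) by exact: derivableZ.
rewrite deriveD; [|exact: derivable_cst|exact: derivableD].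
by rewrite derive_cst add0r deriveD // !deriveZ // !e.
Qed.

Lemma Cn_caff k (U : set 'rV[R]_(1 + 1)) a0 a1 b0 b1 j : open U -> Cn k U (fun z => caff a0 a1 b0 b1 z 0 j).
Proof.
move=> oU; have lin (b p q : R) : Cn k U (fun z => b + (p * z 0 i0 + q * z 0 i1)).
  apply: Cn_add => //; first exact: Cn_cst.
  by apply: Cn_add => //; apply: Cn_mul => //; [exact: Cn_cst|exact: Cn_coord|exact: Cn_cst|exact: Cn_coord].
move: j; apply: ord2_case.
  by apply: (Cn_ext oU _ (lin b0 a0 (- a1))) => z _; rewrite caff0.
by apply: (Cn_ext oU _ (lin b1 a1 a0)) => z _; rewrite caff1.
Qed.

Lemma crat_caff (J' : complex_structure M) (V : set 'rV[R]_(1 + 1)) f c a0 a1 b0 b1 z (T := caff a0 a1 b0 b1) :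
  open V -> CnM 1 V f -> V (T z) -> atlas c -> chart_dom c (f (T z)) ->
  crat J' f c (T z) -> crat J' (f \o T) c z.
Proof.
move=> oV cf Vz ac cz h.
have i01 : (i0 == i1) = false by [].
have i10 : (i1 == i0) = false by [].
have dT b : differentiable (fun y => T y 0 b) z.
  by have [d _] := @Cn_caff 1 setT a0 a1 b0 b1 b openT; exact: d.
pose G a j := pd a (fun w => coord c (f w) 0 j) (T z).
have pdE a j : pd a (fun y => coord c (f (T y)) 0 j) z = \sum_b G b j * pd a (fun y => T y 0 b) z.
  apply: (@pd_comp R _ _ (fun w => coord c (f w) 0 j) T) => //.
  by have [d _] := cf.2 c ac j; exact: d.
have T0 : (fun y => T y 0 i0) = fun y => b0 + (a0 * y 0 i0 + - a1 * y 0 i1) by apply/funext => y; rewrite /T caff0.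
have T1 : (fun y => T y 0 i1) = fun y => b1 + (a1 * y 0 i0 + a0 * y 0 i1) by apply/funext => y; rewrite /T caff1.
have X j : pd i0 (fun y => coord c (f (T y)) 0 j) z = a0 * G i0 j + a1 * G i1 j.
  by rewrite pdE sum_ord2 T0 T1 !pd_lin !eqxx i01 !mulr1 !mulr0 !addr0; congr (_ + _); rewrite mulrC.
have Y j : pd i1 (fun y => coord c (f (T y)) 0 j) z = - a1 * G i0 j + a0 * G i1 j.
  by rewrite pdE sum_ord2 T0 T1 !pd_lin !eqxx i10 !mulr1 !mulr0 !add0r; congr (_ + _); rewrite mulrC.
pose XR : 'rV[R]_(n + n) := \row_l G i0 l; pose YR : 'rV[R]_(n + n) := \row_l G i1 l.
pose Jm : 'M[R]_(n + n) := sval J' c (coord c (f (T z))).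
have sq : Jm *m Jm = - 1%:M := cs_square (svalP J') ac (coord_codom cz).
have e : YR = XR *m Jm.
  apply/rowP => l; rewrite [LHS]mxE [RHS]mxE /G h; apply: eq_bigr => l' _.
  by rewrite [X in _ = X * _]mxE.
have e3 : YR *m Jm = - XR by rewrite e -mulmxA sq mulmxN mulmx1.
have e2 : - a1 *: XR + a0 *: YR = (a0 *: XR + a1 *: YR) *m Jm.
  by rewrite mulmxDl -!scalemxAl -e e3 scalerN scaleNr addrC.
have lin (p q : R) l : (p *: XR + q *: YR) 0 l = p * G i0 l + q * G i1 l.
  by rewrite /XR /YR !mxE.
move=> j; rewrite [LHS]Y -lin e2 [LHS]mxE; apply: eq_bigr => l _.
by rewrite lin -X.
Qed.

Definition sqd (a z : 'rV[R]_(1 + 1)) : R := (z 0 i0 - a 0 i0) ^+ 2 + (z 0 i1 - a 0 i1) ^+ 2.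

Lemma Cn_sqd k (U : set 'rV[R]_(1 + 1)) a : open U -> Cn k U (sqd a).
Proof.
move=> oU; have c i : Cn k U (fun z : 'rV[R]_(1 + 1) => (z 0 i - a 0 i) * (z 0 i - a 0 i)).
  by apply: Cn_mul => //; apply: Cn_sub2 => //; [exact: Cn_coord|exact: Cn_cst|exact: Cn_coord|exact: Cn_cst].
by apply: (Cn_ext oU _ (Cn_add oU (c i0) (c i1))) => z _; rewrite /sqd !expr2.
Qed.

Lemma open_lt_Cn (U : set 'rV[R]_(1 + 1)) f e : open U -> Cn 0 U f -> open (U `&` f @^-1` [set x | x < e]).
Proof. by move=> oU cf; apply: open_preimage_on => //; exact: open_lt. Qed.

Lemma closed_sqd a e : closed [set z | sqd a z <= e].
Proof.
have -> : [set z | sqd a z <= e] = ~` (setT `&` sqd a @^-1` [set x | e < x]).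
  apply/seteqP; split=> z /=; first by move=> h [_]; rewrite ltNge h.
  by move=> h; rewrite leNgt; apply/negP => h'; apply: h.
apply: open_closedC; apply: open_preimage_on; [exact: openT|exact: open_gt|].
by move=> z _; exact: (@Cn_sqd 0 setT a openT).
Qed.

Lemma sqd_norm a z e : 0 <= e -> sqd a z <= e ^+ 2 -> `|z - a| <= e.
Proof.
move=> e0 h; have sq (x y : R) : x ^+ 2 + y ^+ 2 <= e ^+ 2 -> `|x| <= e.
  move=> hx; rewrite -(@ler_pXn2r _ 2) ?nnegrE // real_normK ?num_real //.
  by apply: le_trans hx; rewrite lerDl sqr_ge0.
apply: mx_norm_le => // i; rewrite (ord1 i); apply: ord2_case; rewrite mxE [X in _ + X]mxE.
  exact: (sq _ (z 0 i1 - a 0 i1) h).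
by apply: (sq _ (z 0 i0 - a 0 i0)); rewrite [X in X <= _]addrC; exact: h.
Qed.

(** A finite subcover of K1 by round disks, each sent by g with its closure into one chart
    holomorphic for J; the cut-off of a disk is a power of the positive part of its squared radius
    minus the squared distance to its centre. *)
Lemma bump_cover (Om K1 : set 'rV[R]_(1 + 1)) (g : 'rV[R]_(1 + 1) -> M) : open Om -> CnM 8 Om g ->
  compact K1 -> K1 `<=` Om -> exists N (ch : 'I_N -> chart R M (n + n)) (th : 'I_N -> 'rV[R]_(1 + 1) -> R)
    (L : 'I_N -> set 'rV[R]_(1 + 1)),
  [/\ forall k, atlas (ch k), forall k x, chart_codom (ch k) x -> sval J (ch k) x = std_J R n,
      forall k, Cn 8 setT (th k) & forall k, closed (L k)] /\
  [/\ forall k, L k `<=` Om, forall k z, L k z -> chart_dom (ch k) (g z),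
      forall k z, ~ L k z -> th k z = 0 & forall z, K1 z -> exists k, th k z != 0].
Proof.
move=> oOm cg cK KO.
have loc z : exists ce : chart R M (n + n) * R, K1 z ->
    [/\ atlas ce.1, forall x, chart_codom ce.1 x -> sval J ce.1 x = std_J R n, 0 < ce.2 &
        forall z', `|z' - z| <= ce.2 -> Om z' /\ chart_dom ce.1 (g z')].
  have [Kz|nK] := pselect (K1 z); last by exists (Chart set0 (fun=> 0) (fun=> g z), 0).
  have [c [ac cz hc]] := cs_integrable (svalP J) (g z).
  have : nbhs z (Om `&` g @^-1` chart_dom c).
    by apply: open_nbhs_nbhs; split; [exact: CnM_open oOm cg ac|split=> //; exact: KO].
  move=> /nbhs_normP[d d0 hd]; exists (c, d / 2) => _; split=> //=; first by rewrite divr_gt0.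
  by move=> z' h; apply: hd; apply: le_lt_trans h _; move: (d0); lra.
have [ce hce] := boolp.choice loc.
rewrite compact_cover in cK.
have [] := cK _ K1 (fun z => [set z' | sqd z z' < (ce z).2 ^+ 2]).
- move=> z _; rewrite (_ : [set _ | _] = setT `&` sqd z @^-1` [set x | x < (ce z).2 ^+ 2]).
    by apply: open_lt_Cn; [exact: openT|exact: Cn_sqd openT].
  by rewrite setTI.
- move=> z Kz; exists z => //=; have [_ _ e0 _] := hce z Kz.
  by rewrite /sqd !subrr expr0n addr0 exprn_gt0.
move=> D' sD cov; pose s : seq 'rV[R]_(1 + 1) := enum_fset D'; pose zk (k : 'I_(size s)) := nth 0 s k.
have Kzk k : K1 (zk k).
  have : zk k \in D' by exact: (mem_nth 0 (ltn_ord k)).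
  by move=> /sD/set_mem.
exists (size s), (fun k => (ce (zk k)).1), (fun k z => pospow 9 ((ce (zk k)).2 ^+ 2 - sqd (zk k) z)),
  (fun k => [set z | sqd (zk k) z <= (ce (zk k)).2 ^+ 2]).
have inL k z : sqd (zk k) z <= (ce (zk k)).2 ^+ 2 -> Om z /\ chart_dom (ce (zk k)).1 (g z).
  by have [_ _ e0 h] := hce _ (Kzk k) => hz; apply: h; apply: sqd_norm => //; exact: ltW.
split; split.
- by move=> k; have [] := hce _ (Kzk k).
- by move=> k; have [] := hce _ (Kzk k).
- move=> k; apply: (@Cn_pospow R _ 8 0); first exact: openT.
  by apply: Cn_sub2; [exact: openT|exact: Cn_cst|exact: Cn_sqd openT].
- by move=> k; exact: closed_sqd.
- by move=> k z /inL[].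
- by move=> k z /inL[].
- by move=> k z /= /negP; rewrite -ltNge => h; apply: pospow_eq0; rewrite subr_le0 ltW.
move=> z /cov[i iD hi]; have ls : (index i s < size s)%N by rewrite index_mem.
exists (Ordinal ls); rewrite gt_eqF // pospow_gt0 // subr_gt0 /zk /= nth_index //.
Qed.

Lemma disk_extends_nbhs : disk_extends J (nbhs J).
Proof.
move=> f z w eta hf Dz Dw zw eta0.
have [r /andP[r0 r1] [Dz' Dw' hp]] := poincare_dilate Dz Dw eta0.
have oD := @open_unit_disk R.
have zw0 : 0 < sqd z w.
  rewrite lt_neqAle addr_ge0 ?sqr_ge0 // andbT eq_sym; apply/eqP => /eqP.
  rewrite paddr_eq0 ?sqr_ge0 // !sqrf_eq0 !subr_eq0 => /andP[/eqP h0 /eqP h1].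
  by move/eqP: zw; apply; apply/esym/rowP; apply: ord2_case.
pose d := Num.sqrt (sqd z w); have d0 : 0 < d by rewrite sqrtr_gt0.
have dn : d != 0 by rewrite gt_eqF.
have dd : d ^+ 2 = sqd z w by rewrite sqr_sqrtr // ltW.
pose c0 := (w 0 i0 - z 0 i0) / d; pose c1 := (w 0 i1 - z 0 i1) / d.
have c01 : c0 ^+ 2 + c1 ^+ 2 = 1.
  by rewrite !expr_div_n -mulrDl -/(sqd z w) -dd divff // expf_neq0.
have w0 : w 0 i0 = z 0 i0 + c0 * d by rewrite /c0 divfK // addrC subrK.
have w1 : w 0 i1 = z 0 i1 + c1 * d by rewrite /c1 divfK // addrC subrK.
clearbody c0 c1.
(* [phi] sends (0, 1/2) to z and the vertical direction to that of w - z. Its scale 8 brings the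
   preimage of the unit disk within 1/4 of (0, 1/2), well inside the box where the coefficients may
   be nonzero. [psi s] is the dilation by s followed by the inverse of [phi]. *)
pose phi := caff (8 * c1) (- (8 * c0)) (z 0 i0 - 4 * c0) (z 0 i1 - 4 * c1).
pose psi s := caff (s * c1 / 8) (s * c0 / 8) (- (c1 * z 0 i0 - c0 * z 0 i1) / 8)
  (2^-1 - (c0 * z 0 i0 + c1 * z 0 i1) / 8).
have phi_psi s v : phi (psi s v) = s *: v.
  apply/rowP; apply: ord2_case; rewrite [RHS]mxE /phi /psi ?caff0 ?caff1 ?caff0.
    transitivity (z 0 i0 + (c0 ^+ 2 + c1 ^+ 2) * (s * v 0 i0 - z 0 i0)); [by field|by rewrite c01; ring].
  transitivity (z 0 i1 + (c0 ^+ 2 + c1 ^+ 2) * (s * v 0 i1 - z 0 i1)); [by field|by rewrite c01; ring].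
have psi_phi y : psi 1 (phi y) = y.
  apply/rowP; apply: ord2_case; rewrite /phi /psi ?caff0 ?caff1 ?caff0.
    transitivity ((c0 ^+ 2 + c1 ^+ 2) * y 0 i0); [by field|by rewrite c01; ring].
  transitivity (2^-1 + (c0 ^+ 2 + c1 ^+ 2) * (y 0 i1 - 2^-1)); [by field|by rewrite c01; ring].
have sq_phi y : sqd z (phi y) = 64 * (y 0 i0 ^+ 2 + (y 0 i1 - 2^-1) ^+ 2).
  rewrite /sqd /phi caff0 caff1.
  transitivity (64 * ((c0 ^+ 2 + c1 ^+ 2) * (y 0 i0 ^+ 2 + (y 0 i1 - 2^-1) ^+ 2))); [by field|by rewrite c01 mul1r].
pose y2 := 2^-1 + d / 8.
pose e1 : 'rV[R]_(1 + 1) := row_mx 0%:M (2^-1)%:M; pose e2 : 'rV[R]_(1 + 1) := row_mx 0%:M y2%:M.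
have row0 (a b : R) : (row_mx a%:M b%:M : 'rV[R]_(1 + 1)) 0 i0 = a by rewrite row_mxEl mxE eqxx mulr1n.
have row1 (a b : R) : (row_mx a%:M b%:M : 'rV[R]_(1 + 1)) 0 i1 = b by rewrite row_mxEr mxE eqxx mulr1n.
have rn : r != 0 by rewrite gt_eqF.
have psi_z : psi r (r^-1 *: z) = e1.
  apply/rowP; apply: ord2_case; rewrite /psi /e1 ?caff0 ?caff1 ?row0 ?row1 ![(_ *: z) _ _]mxE; by field.
have psi_w : psi r (r^-1 *: w) = e2.
  apply/rowP; apply: ord2_case; rewrite /psi /e2 ?caff0 ?caff1 ?row0 ?row1 ![(_ *: w) _ _]mxE w0 w1.
    by field.
  transitivity (2^-1 + (c0 ^+ 2 + c1 ^+ 2) * d / 8); [by field|by rewrite c01 mul1r].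
have phi_z : phi e1 = z by rewrite -psi_z phi_psi scalerA divff // scale1r.
have phi_w : phi e2 = w by rewrite -psi_w phi_psi scalerA divff // scale1r.
pose Om : set 'rV[R]_(1 + 1) := [set y | unit_disk R (phi y)].
have Cphi k j U : open U -> Cn k U (fun y => phi y 0 j) by exact: Cn_caff.
have cphi y : {for y, continuous phi}.
  by apply: rV_cont => j; exact: (Cphi 0 j setT openT).
have oOm : open Om.
  rewrite (_ : Om = setT `&` phi @^-1` unit_disk R); last by rewrite setTI.
  by apply: open_preimage_on => //; exact: openT.
have hbox y : Om y -> `|y 0 i0| <= 1 /\ 8^-1 <= y 0 i1 <= 1 - 8^-1.
  move=> /unit_diskE hy; move/unit_diskE: Dz => hz.
  have h4 : sqd z (phi y) < 4.
    rewrite /sqd; move: (phi y 0 i0) (phi y 0 i1) (z 0 i0) (z 0 i1) hy hz => a b a' b' hy hz.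
    have := sqr_ge0 (a + a'); have := sqr_ge0 (b + b'); move: hy hz; rewrite !expr2; nra.
  have small (x : R) : x ^+ 2 < 16^-1 -> - 4^-1 < x < 4^-1 by rewrite expr2 => hx; apply/andP; split; nra.
  have a0 := sqr_ge0 (y 0 i0); have b0 := sqr_ge0 (y 0 i1 - 2^-1).
  rewrite sq_phi in h4.
  have /small/andP[x1 x2] : y 0 i0 ^+ 2 < 16^-1 by move: h4 a0 b0; move: (y 0 i0 ^+ 2) ((y 0 i1 - 2^-1) ^+ 2) => A B; lra.
  have /small/andP[x3 x4] : (y 0 i1 - 2^-1) ^+ 2 < 16^-1 by move: h4 a0 b0; move: (y 0 i0 ^+ 2) ((y 0 i1 - 2^-1) ^+ 2) => A B; lra.
  split; first by rewrite ler_norml; apply/andP; split; move: x1 x2; lra.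
  by apply/andP; split; move: x3 x4; lra.
pose g := f \o phi.
have cf k := holomorphic_disk_CnM k hf.
have cg : CnM 8 Om g by apply: (CnM_comp oOm oD (cf 8%N)) => // j; exact: Cphi.
have crg c y : atlas c -> Om y -> chart_dom c (g y) -> crat J g c y.
  move=> ac Oy cy; apply: (crat_caff oD (cf 1%N) Oy ac cy).
  exact: holomorphic_disk_crat hf ac Oy cy.
pose Kd : set 'rV[R]_(1 + 1) := [set v | sqd 0 v <= r ^+ 2].
have nsq (v : 'rV[R]_(1 + 1)) : sqd 0 v = v 0 i0 ^+ 2 + v 0 i1 ^+ 2 by rewrite /sqd !mxE !subr0.
have cKd : compact Kd.
  apply: (@subclosed_compact _ _ [set v : 'rV[R]_(1 + 1) | forall a, [set` `[- r, r]] (v ord0 a)]).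
  - exact: closed_sqd.
  - by apply: (@rV_compact R _ (fun=> [set` `[- r, r]])) => a; exact: segment_compact.
  - move=> v hv a; rewrite /= in_itv /= -ler_norml.
    have := sqd_norm (ltW r0) hv; rewrite subr0; apply: le_trans; exact: mx_entry_norm.
have cpsi : continuous (psi 1).
  by move=> v; apply: rV_cont => j; exact: (@Cn_caff 0 setT _ _ _ _ j openT).
pose K1 := psi 1 @` Kd.
have cK1 : compact K1 by apply: continuous_compact => //; exact: continuous_subspaceT.
have r21 : r ^+ 2 < 1 by rewrite expr2; move: (r0) (r1); nra.
have KO : K1 `<=` Om.
  move=> _ [v hv <-]; rewrite /Om /= phi_psi scale1r; apply/unit_diskE.
  by rewrite -nsq; exact: le_lt_trans hv r21.
have [N [ch [th [L [[ach chJ cth clL] [LOm Lch thL pos]]]]]] := bump_cover oOm cg cK1 KO.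
have cT : Cn 8 setT (Theta th) by exact: Cn_Theta.
pose W := setT `&` Theta th @^-1` [set x | x != 0].
have oW : open W.
  apply: open_preimage_on; [exact: openT|exact: open_neq|].
  by move=> y _; exact: (Cn_continuous cT).
have KW : K1 `<=` W.
  move=> y /pos[k hk]; split=> //=; rewrite gt_eqF // /Theta (bigD1 k) //= ltr_pwDl ?exprn_even_gt0 //.
  by apply: sumr_ge0 => k' _; exact: sqr_ge0.
have [B B0 hB] := compact_bound cK1 KW (Cn_inv oW (fun x h => h.2) (Cn_sub (fun y _ => I) (Cn_le (isT : (0 <= 8)%N) cT))).
have t00 : 0 < B^-1 by rewrite invr_gt0.
(* The preimage of the disk of radius r: there Theta is bounded below, and [psi r] maps the unit
   disk into it, taking z / r and w / r to the two interpolation points. *)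
pose O : set 'rV[R]_(1 + 1) := [set y | sqd 0 (phi y) < r ^+ 2].
have oO : open O.
  rewrite (_ : O = setT `&` (fun y => sqd 0 (phi y)) @^-1` [set x | x < r ^+ 2]); last by rewrite setTI.
  apply: open_lt_Cn; first exact: openT.
  have cs : Cn 0 setT (sqd 0) by exact: Cn_sqd openT.
  exact: (@Cn_comp R _ _ 0 setT setT (sqd 0) phi openT (fun _ _ => I) cs (fun j => Cphi 0%N j setT openT)).
have hT y : O y -> B^-1 <= Theta th y.
  move=> Oy; have Ky : K1 y by exists (phi y) => //; exact: ltW.
  have [_ Tn] := KW y Ky.
  have T0 : 0 <= Theta th y by apply: sumr_ge0 => k _; exact: sqr_ge0.
  have Tp : 0 < Theta th y by rewrite lt_neqAle eq_sym Tn.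
  have := hB y Ky; rewrite ger0_norm ?invr_ge0 // => h.
  by rewrite -(invrK (Theta th y)) lef_pV2 // posrE invr_gt0.
have DO v : unit_disk R v -> O (psi r v).
  move=> /unit_diskE hv; rewrite /O /= phi_psi nsq !mxE !exprMn -mulrDr.
  by rewrite gtr_pMr // exprn_gt0.
have O1 : O e1 by rewrite -psi_z; exact: DO.
have O2 : O e2 by rewrite -psi_w; exact: DO.
have Oe2 : Om e2 by rewrite /Om /= phi_w.
have y12 : (2^-1 : R) != y2 by rewrite /y2 -subr_eq0 opprD addrA subrr add0r oppr_eq0 mulf_neq0 // invr_neq0.
have y1I : 0 < (2^-1 : R) < 1 by apply/andP; split; lra.
have y2I : 0 < y2 < 1.
  by have [_] := hbox e2 Oe2; rewrite /e2 row1 => /andP[h1 h2]; apply/andP; split; move: h1 h2; lra.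
have [A [A' [nA nA' H]]] := deform oOm cg crg ach chJ cth clL LOm Lch thL t00
  nul_structure hbox oO hT y1I y2I y12 O1 O2.
exists A, A'; split.
- by move: nA; rewrite /g /= -/e1 phi_z.
- by move: nA'; rewrite /g /= -/e2 phi_w.
apply: filterS H => J' H p q Ap Aq; have [u [cu cru u1 u2]] := H p q Ap Aq.
exists (u \o psi r), (r^-1 *: z), (r^-1 *: w); split=> //.
- apply: holomorphic_diskP.
    by apply: (CnM_comp oD oO cu) => // j; exact: Cn_caff.
  move=> v Dv; have [c [ac cc] h] := cru _ (DO v Dv); exists c => //.
  exact: (crat_caff oO cu (DO v Dv) ac cc h).
- by rewrite /= psi_z.
- by rewrite /= psi_w.
Qed.

End Nearby.

Theorem theorem2p1 (R : realType) (n : nat) (M : manifold R n)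
    (I0 : complex_structure M) (I : Comp I0) :
  kobayashi_vanishes I0 ->
  ergodic I ->
  same_deformation_class (base I0) I ->
  kobayashi_vanishes (set_val I).
Proof.
move=> kv erg _; apply: short_kobayashi => e e0.
(* For fixed e this set is open and contains I0; it remains to transport it along the orbit of I. *)
pose V := [set J : Comp I0 | short e (set_val J)].
have oV : open V.
  rewrite openE => J VJ.
  have h := short_near (@nbhs_filter _ (set_val J)) (@disk_extends_nbhs _ _ _ (set_val J)) VJ.
  have c : continuous (@set_val _ (Comp I0)) by exact: initial_continuous.
  exact: (c J _ h).
have inv (J J' : Comp I0) f : moved_to f J J' -> V J -> V J'.
  move=> mv VJ; have [sf [g [fg gf sg]] _] := svalP f.
  exact: (short_map sf gf mv VJ).
pose W : set (Teich I0) := [set A | exists2 J, V J & A = to_Teich J].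
(* Invariance makes V a union of Diff0-orbits, so its image in the quotient is open. *)
have pre : @to_Teich R n M I0 @^-1` W = V.
  apply/seteqP; split=> J; last by exists J.
  move=> [J1 VJ1 e1].
  have : sval (to_Teich J) J.
    exists (diffeo_id M); first exact: connected_component_refl.
    by move=> c c' ac ac' x xd; exact: (cs_tensor (svalP (set_val J)) ac ac' xd).
  rewrite (_ : to_Teich J = to_Teich J1) // => -[f _ mv]; exact: inv mv VJ1.
have oW : open W by change (open (@to_Teich R n M I0 @^-1` W)); rewrite pre.
have W0 : W !=set0.
  by exists (to_Teich (base I0)); exists (base I0) => //; exact: kobayashi_short.
have [A [[J VJ eA] [I' [f mv] eA']]] := erg W W0 oW.
have VI' : V I' by rewrite -pre /=; exists J => //; rewrite eA'.
have [sf [g [fg gf sg]] _] := svalP f.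
(* Density yields a short structure I' in the orbit of I; the inverse diffeomorphism takes I' back
   to I. *)
have mv' := intertwines_inv sf sg fg gf mv.
exact: (short_map sg fg mv' VI').
Qed.
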